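(* Let $A,B,b,(u_n),(\gamma_n),x_0,(x_n)$, the mean operators $\mathcal A,\mathcal B$, the set $\mathcal Z=Z(\mathcal A+\mathcal B)$ and the interpolated process $x(t)$ be as introduced in the context. Assume the following. 1. The monotone operator $\mathcal A$ is maximal. 2. There exist an integer $p\ge 1$ and a point $x_\star\in\mathcal Z$ such that $\mathcal R_{2p}(x_\star)\neq\emptyset$. 3. For any compact set $K\subset\mathbb R^N$, there exists $\varepsilon\in\,]0,1]$ such that $$\sup_{x\in K\cap\mathcal D}\int\|A_0(\xi,x)\|^{1+\varepsilon}\,\mu(d\xi)<\infty ,$$ and moreover there exists $y_0\in\mathcal D$ such that $\int\|A_0(\xi,y_0)\|^{1+1/\varepsilon}\,\mu(d\xi)<\infty$. 4. There exists $C>0$ such that for all $x\in\mathbb R^N$, $\int d(\xi,x)^2\,\mu(d\xi)\ge C\,\boldsymbol d(x)^2$; furthermore $\gamma_{n+1}/\gamma_n\to 1$. 5. There exists $C>0$ such that for any $x\in\mathbb R^N$ and any $\gamma>0$, $$\frac1{\gamma^4}\int\|J_\gamma(\xi,x)-\Pi(\xi,x)\|^4\,\mu(d\xi)\le C(1+\|x\|^{2p}),$$ where $p$ is the integer of item 2. 6. There exists $M:\Xi\to\mathbb R_+$ such that $M^{2p}$ is $\mu$-integrable and $\|b(\xi,x)\|\le M(\xi)(1+\|x\|)$ for all $x\in\mathbb R^N$. Moreover, there exists $C>0$ such that $\int\|b(\xi,x)\|^4\,\mu(d\xi)\le C(1+\|x\|^{2p})$ for all $x\in\mathbb R^N$.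 Then the monotone operator $\mathcal A+\mathcal B$ is maximal. Moreover, with probability one, the continuous time process $x(t)$ is bounded and is an asymptotic pseudotrajectory of the differential inclusion $\dot z(t)\in-(\mathcal A+\mathcal B)(z(t))$, that is, for every $T>0$, $$\sup_{s\in[0,T]}\big\|x(t+s)-\Phi\big(\mathrm{proj}_{\mathrm{cl}(\mathcal D)}(x(t)),s\big)\big\|\xrightarrow[t\to\infty]{}0,$$ where $\Phi$ is the semiflow on $\mathrm{cl}(\mathcal D)$ associated with this differential inclusion.
   Context: Operators. A set-valued operator $\mathsf A:\mathbb R^N\rightrightarrows\mathbb R^N$ is monotone if $\langle y-y',x-x'\rangle\ge0$ for all $(x,y),(x',y')$ in its graph $\mathrm{gr}(\mathsf A)$; a non-empty monotone operator is maximal if its graph is maximal for inclusion among graphs of monotone operators. $\mathcal M$ is the set of maximal monotone operators on $\mathbb R^N$; $\mathrm{dom}(\mathsf A)=\{x:\mathsf A(x)\ne\emptyset\}$; $Z(\mathsf A)=\{x:0\in\mathsf A(x)\}$; $\mathrm{cl}$ is closure. Set-valued integrals. $(\Xi,\mathcal T,\mu)$ is a probability space with $\mathcal T$ $\mu$-complete. A closed-set-valued function $F$ on $\Xi$ is measurable if $\{\xi:F(\xi)\cap H\ne\emptyset\}\in\mathcal T$ for every Borel set $H$. For $1\le q<\infty$, $\mathcal S^q_F$ is the set of $\varphi\in\mathcal L^q(\Xi,\mathcal T,\mu;\mathbb R^N)$ with $\varphi(\xi)\in F(\xi)$ $\mu$-a.e.; $F$ is integrable if $\mathcal S^1_F\ne\emptyset$;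 its Aumann integral is $\int F\,d\mu=\{\int\varphi\,d\mu:\varphi\in\mathcal S^1_F\}$. Random operator $A$. $A:\Xi\to\mathcal M$ is such that $\xi\mapsto\mathrm{gr}(A(\xi,\cdot))$ is measurable; $A(\xi,x)$ is the image of $x$ under $A(\xi,\cdot)$. $D(\xi)=\mathrm{dom}(A(\xi,\cdot))$; for $x\in D(\xi)$, $A_0(\xi,x)$ is the element of least norm of $A(\xi,x)$; $J_\gamma(\xi,x)=(I+\gamma A(\xi,\cdot))^{-1}(x)$ for $\gamma>0$. $\Pi(\xi,\cdot)$ is the projection onto $\mathrm{cl}(D(\xi))$, and $d(\xi,\cdot)$ the distance function to $D(\xi)$. $\mathcal D=\{x\in\mathbb R^N:\mu(\{\xi:x\in D(\xi)\})=1\}$ is assumed non-empty, $\boldsymbol d(\cdot)$ is the distance function to $\mathcal D$, and $A(\cdot,x)$ is assumed integrable for each $x\in\mathcal D$. The monotone operator $\mathcal A$ has domain $\mathcal D$ and $\mathcal A(x)=\int A(\xi,x)\,\mu(d\xi)$ (Aumann integral) for $x\in\mathcal D$. Random operator $B$. $B:\Xi\to\mathcal M$ is such that $\xi\mapsto\mathrm{gr}(B(\xi,\cdot))$ is measurable, $\mathrm{dom}(B(\xi,\cdot))=\mathbb R^N$ for almost every $\xi$, and $B(\cdot,x)$ is integrable for every $x\in\mathbb R^N$; $\mathcal B(x)=\int B(\xi,x)\,\mu(d\xi)$ (Aumann integral). The map $b:\Xi\times\mathbb R^N\to\mathbb R^N$ is $\mathcal T\otimes\mathcal B(\mathbb R^N)$-measurable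 (product of $\mathcal T$ with the Borel field) with $b(\cdot,x)\in\mathcal S^1_{B(\cdot,x)}$ for every $x$. $\mathcal Z=Z(\mathcal A+\mathcal B)$, and for $x_\star\in\mathcal Z$ and $q\geq 1$, $$\mathcal R_{q}(x_\star)=\Big\{(\varphi,\psi)\in\mathcal S^{q}_{A(\cdot,x_\star)}\times\mathcal S^{q}_{B(\cdot,x_\star)}:\int\varphi\,d\mu+\int\psi\,d\mu=0\Big\}.$$ Algorithm. $(u_n)_{n\ge1}$ is an iid sequence of random variables on a probability space $(\Omega,\mathcal F,\mathbb P)$ with values in $(\Xi,\mathcal T)$ and distribution $\mu$. $(\gamma_n)_{n\ge1}$ is a positive sequence in $\ell^2\setminus\ell^1$. Given an arbitrary $x_0\in\mathbb R^N$, $$x_{n+1}=J_{\gamma_{n+1}}\big(u_{n+1},\,x_n-\gamma_{n+1}b(u_{n+1},x_n)\big),\qquad n\ge0.$$ With $\tau_0=0$ and $\tau_n=\sum_{k=1}^n\gamma_k$, the interpolated process is $x(t)=x_n+\frac{x_{n+1}-x_n}{\gamma_{n+1}}(t-\tau_n)$ for $t\in[\tau_n,\tau_{n+1}[$. Semiflow. If $\mathsf A\in\mathcal M$, for each $z_0\in\mathrm{dom}(\mathsf A)$ there is a unique absolutely continuous $z:\mathbb R_+\to\mathbb R^N$ with $z(0)=z_0$ and $\dot z(t)\in-\mathsf A(z(t))$ for a.e. $t\ge 0$. The map $(z_0,t)\mapsto z(t)$ is non-expansive in $z_0$ and extends by continuity to a map $\mathrm{cl}(\mathrm{dom}(\mathsf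 A))\times\mathbb R_+\to\mathrm{cl}(\mathrm{dom}(\mathsf A))$, called the semiflow of the differential inclusion. $\Phi$ denotes the semiflow for $\mathsf A=\mathcal A+\mathcal B$ (whose domain is $\mathcal D$). *)

(* Defs.v *)
From HB Require Import structures.
From mathcomp Require Import all_boot all_order all_algebra.
From mathcomp Require Import all_classical all_reals all_analysis.

Set Implicit Arguments.
Unset Strict Implicit.
Unset Printing Implicit Defensive.

Import Order.TTheory GRing.Theory Num.Theory.
Import numFieldNormedType.Exports.

Local Open Scope classical_set_scope.
Local Open Scope ring_scope.

(* The library's norm on ['rV[R]_N] is the sup norm: it only supplies the
   topology (hence the Borel sets, closures, compacts and derivatives).  All
   norms and distances in the statement are the Euclidean ones below. *)
Section Euclidean.
Variables (R : realType) (N : nat).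
Implicit Types (x y : 'rV[R]_N) (C : set 'rV[R]_N).

Definition dotv x y : R := \sum_(i < N) x 0 i * y 0 i.

Definition enorm x : R := Num.sqrt (dotv x x).

Definition dist_to C x : R := inf [set enorm (x - y) | y in C].

(* Nearest point; meaningful for nonempty closed convex [C]. *)
Definition proj_on C x : 'rV[R]_N :=
  xget 0 [set y | C y /\ forall z, C z -> enorm (x - y) <= enorm (x - z)].

End Euclidean.

Notation borelV R N := (g_sigma_algebraType (@open 'rV[R]_N)).

Section Operators.
Variables (R : realType) (N : nat).
Local Notation V := 'rV[R]_N.

Definition operator : Type := V -> set V.

Implicit Types T S : operator.

Definition graph T : set (V * V) := [set q | T q.1 q.2].

Definition dom T : set V := [set x | T x !=set0].

Definition zeros T : set V := [set x | T x 0].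

Definition op_add T S : operator :=
  fun x => [set y + z | y in T x & z in S x].

Definition monotone_op T : Prop :=
  forall x y x' y', T x y -> T x' y' -> 0 <= dotv (y - y') (x - x').

Definition maximal_monotone T : Prop :=
  [/\ graph T !=set0,
      monotone_op T &
      forall S, monotone_op S -> graph T `<=` graph S -> graph S = graph T].

(* [(I + g T)^-1 x]: the [y] such that [x] belongs to [y + g T(y)]. *)
Definition resolvent (g : R) T (x : V) : V :=
  xget 0 [set y | exists2 a, T y a & x = y + g *: a].

Definition least_norm_value T (x : V) : V :=
  xget 0 [set y | T x y /\ forall z, T x z -> enorm y <= enorm z].

(* Absolute continuity on R_+ is understood on every segment [0, t]. *)
Definition abs_continuous (z : R -> V) : Prop :=
  forall t, 0 <= t -> forall e, 0 < e -> exists2 dlt, 0 < dlt &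
    forall (n : nat) (a b : 'I_n -> R),
      (forall i, [/\ 0 <= a i, a i <= b i & b i <= t]) ->
      (forall i j, i != j -> b i <= a j \/ b j <= a i) ->
      \sum_i (b i - a i) < dlt ->
      \sum_i enorm (z (b i) - z (a i)) < e.

Definition is_solution T (z0 : V) (z : R -> V) : Prop :=
  [/\ z 0 = z0,
      abs_continuous z &
      {ae (@lebesgue_measure R), forall t, 0 <= t ->
         derivable z t 1 /\ T (z t) (- 'D_1 z t)}].

(* The joint continuity determines [Phi] on [closure (dom T)] times R_+;
   outside of that set its values are irrelevant. *)
Definition is_semiflow T (Phi : V -> R -> V) : Prop :=
  [/\ forall z0, dom T z0 -> is_solution T z0 (Phi z0),
      forall z0 t, closure (dom T) z0 -> 0 <= t ->
        closure (dom T) (Phi z0 t) &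
      {within closure (dom T) `*` [set t : R | 0 <= t],
         continuous (fun q : V * R => Phi q.1 q.2)}].

Definition semiflow T : V -> R -> V :=
  xget ((fun z0 _ => z0) : V -> R -> V) [set Phi | is_semiflow T Phi].

End Operators.

Section SetValuedIntegrals.
Variables (R : realType) (N : nat).
Variables (d : measure_display) (Xi : measurableType d).
Variable mu : probability Xi R.
Local Notation V := 'rV[R]_N.

Definition sv_measurable (T : topologicalType) (F : Xi -> set T) : Prop :=
  forall H : set T, <<s open >> H ->
    measurable [set xi | F xi `&` H !=set0].

Definition selections (q : R) (F : Xi -> set V) : set (Xi -> V) :=
  [set phi | [/\ measurable_fun [set: Xi] (phi : Xi -> borelV R N),
       (\int[mu]_xi ((enorm (phi xi)) `^ q)%:E < +oo)%E &
       {ae mu, forall xi, F xi (phi xi)}]].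

Definition sv_integrable (F : Xi -> set V) : Prop := selections 1 F !=set0.

Definition vintegral (phi : Xi -> V) : V :=
  \row_i (\int[mu]_xi (phi xi 0 i))%R.

Definition aumann (F : Xi -> set V) : set V :=
  [set vintegral phi | phi in selections 1 F].

Definition random_operator (A : Xi -> operator R N) : Prop :=
  (forall xi, maximal_monotone (A xi)) /\
  sv_measurable (fun xi => graph (A xi)).

Variables A B : Xi -> operator R N.

Definition essential_dom : set V :=
  [set x | mu [set xi | dom (A xi) x] = 1%E].

Definition mean_op_on (D : set V) : operator R N :=
  fun x => [set y | D x /\ aumann (fun xi => A xi x) y].

Definition representations (q : R) (x : V) : set ((Xi -> V) * (Xi -> V)) :=
  [set f | [/\ selections q (fun xi => A xi x) f.1,
               selections q (fun xi => B xi x) f.2 &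
               vintegral f.1 + vintegral f.2 = 0]].

End SetValuedIntegrals.

Section Algorithm.
Variables (R : realType) (N : nat).
Variables (d : measure_display) (Xi : measurableType d).
Variable mu : probability Xi R.
Variables (d' : measure_display) (Omega : measurableType d').
Variable P : probability Omega R.
Local Notation V := 'rV[R]_N.

Definition independent_seq (u : nat -> Omega -> Xi) : Prop :=
  forall (s : seq nat) (E : nat -> set Xi), uniq s ->
    (forall i, measurable (E i)) ->
    P (\big[setI/setT]_(i <- s) (u i @^-1` E i)) =
    (\prod_(i <- s) P (u i @^-1` E i))%E.

Definition iid_seq (u : nat -> Omega -> Xi) : Prop :=
  [/\ forall n, measurable_fun [set: Omega] (u n),
      forall n S, measurable S -> pushforward P (u n) S = mu S &
      independent_seq u].

(* The sequences [u] and [gam] are only used from index 1 on. *)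
Fixpoint iterates (A : Xi -> operator R N) (b : Xi -> V -> V)
    (gam : nat -> R) (u : nat -> Xi) (x0 : V) (n : nat) : V :=
  if n is m.+1 then
    let x := iterates A b gam u x0 m in
    resolvent (gam m.+1) (A (u m.+1)) (x - gam m.+1 *: b (u m.+1) x)
  else x0.

Definition tau (gam : nat -> R) (n : nat) : R :=
  \sum_(1 <= k < n.+1) gam k.

Definition interpolation (gam : nat -> R) (x : nat -> V) (t : R) : V :=
  let n := xget 0%N [set n | tau gam n <= t < tau gam n.+1] in
  x n + (t - tau gam n) *: ((gam n.+1)^-1 *: (x n.+1 - x n)).

Definition bounded_process (x : R -> V) : Prop :=
  exists c : R, forall t, 0 <= t -> enorm (x t) <= c.

Definition asymptotic_pseudotrajectory (Phi : V -> R -> V) (D : set V)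
    (x : R -> V) : Prop :=
  forall T : R, 0 < T ->
    ereal_sup [set (enorm (x (t + s) - Phi (proj_on (closure D) (x t)) s))%:E
               | s in [set s | 0 <= s <= T]] @[t --> +oo%R] --> 0%E.

End Algorithm.

(* Main.v *)
(* Maximality of the sum is surjectivity of [I + calA + calB]: replace [B] by its
   Yosida approximations, solve, show that the solutions are Cauchy, and
   pass to the limit in the approximations by convex combinations (Mazur), under
   the integrable bound [1 + M ^ (2 p)].

   Boundedness is a Fejer inequality with respect to [xstar], made pathwise by a
   Robbins-Siegmund argument and by the convergence of square integrable
   martingales.  The same tools, applied to the fourth and second powers of the
   distance [d] to [calD], give
     [\sum_(n <= k < m) d (x k) ^ 2 / gam k.+1 <= C (tau m - tau n) + o(1)],
   which controls the steps although the resolvents move the iterates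
   by more than a multiple of [gam] outside of the domain.

   For [v \in (calA + calB) y], monotonicity then bounds the increments of
   [|x - y| ^ 2] by [2 (tau m - tau n) <v, y - x n>], up to a quadratic
   error; an integrable selection of [A(., y)] is truncated at a level [K], and on
   its tail the uniform integrability of [A_0] provided by the moments of
   order [1 + eps] is used.  These inequalities characterise the solutions of the
   inclusion, so every limit of shifted paths is one, and monotonicity makes
   the solution unique. *)

Require Import Defs.
From HB Require Import structures.
From mathcomp Require Import all_boot all_order all_algebra.
From mathcomp Require Import all_classical all_reals all_analysis.
From mathcomp Require Import measurable_realfun.
From mathcomp Require Import ring lra.

Set Implicit Arguments.
Unset Strict Implicit.
Unset Printing Implicit Defensive.

Import Order.TTheory GRing.Theory Num.Theory.
Import numFieldNormedType.Exports.

Local Open Scope classical_set_scope.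
Local Open Scope ring_scope.

(** * Euclidean structure *)

(** A resolvent moves a point of its operator's domain by [O(g)] only, but the iterates need not lie
    in [calD]. A move is therefore measured from a point [pi k] of [calD] at distance at most
    [d (x k) + g k] from [x k]; the price, a multiple of [d (x k)], is paid by the bound on the sums
    of [d ^ 2 / g]. Solutions are handled through the inequality on [|z - y| ^ 2] for [(y, v)] in
    the graph (integral solutions in the sense of Benilan): it is stable under pointwise limits,
    involves no derivative, and gives back the inclusion wherever the limit is differentiable.
    Compactness of paths comes from ultrafilters, and weak limits are replaced by convex
    combinations converging almost everywhere. Conditional expectations never appear: the
    independence of [u n] from its past becomes a Fubini identity on the product of the past with
    [Xi], and stopping times become predictable 0-1 factors. Since [semiflow] is a choice among the
    maps satisfying a specification, existence and uniqueness of the flow have to be established as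
    well, from Minty's theorem on. *)

Definition sqn (R : realType) (N : nat) (x : 'rV[R]_N) : R := dotv x x.

Section EuclideanAlgebra.
Variables (R : realType) (N : nat).
Implicit Types (x y z : 'rV[R]_N) (c : R).

Lemma dotvC x y : dotv x y = dotv y x.
Proof. by apply: eq_bigr => i _; rewrite mulrC. Qed.

Lemma dotvDl x y z : dotv (x + y) z = dotv x z + dotv y z.
Proof.
by rewrite /dotv -big_split; apply: eq_bigr => i _; rewrite mxE mulrDl.
Qed.

Lemma dotvDr x y z : dotv z (x + y) = dotv z x + dotv z y.
Proof. by rewrite dotvC dotvDl !(dotvC z). Qed.

Lemma dotvZl c x y : dotv (c *: x) y = c * dotv x y.
Proof. by rewrite /dotv mulr_sumr; apply: eq_bigr => i _; rewrite mxE mulrA. Qed.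

Lemma dotvZr c x y : dotv x (c *: y) = c * dotv x y.
Proof. by rewrite dotvC dotvZl dotvC. Qed.

Lemma dotvNl x y : dotv (- x) y = - dotv x y.
Proof. by rewrite -scaleN1r dotvZl mulN1r. Qed.

Lemma dotvNr x y : dotv x (- y) = - dotv x y.
Proof. by rewrite dotvC dotvNl dotvC. Qed.

Lemma dot0v x : dotv 0 x = 0.
Proof. by rewrite -(scale0r (0 : 'rV_N)) dotvZl mul0r. Qed.

Lemma dotv0 x : dotv x 0 = 0.
Proof. by rewrite dotvC dot0v. Qed.

Definition dotE := (dotvDl, dotvDr, dotvNl, dotvNr, dotvZl, dotvZr, dot0v, dotv0).

Lemma dotv_suml (I : Type) (s : seq I) (P : pred I) (f : I -> 'rV[R]_N) y :
  dotv (\sum_(i <- s | P i) f i) y = \sum_(i <- s | P i) dotv (f i) y.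
Proof.
apply: (big_morph (fun x => dotv x y)) => [u v|]; [exact: dotvDl|exact: dot0v].
Qed.

Lemma sqn_ge0 x : 0 <= sqn x.
Proof. by apply: sumr_ge0 => i _; rewrite -expr2 sqr_ge0. Qed.

Lemma sqn_eq0 x : sqn x = 0 -> x = 0.
Proof.
move/eqP; rewrite /sqn /dotv psumr_eq0; last first.
  by move=> i _; rewrite -expr2 sqr_ge0.
move=> /allP x0; apply/rowP => i; rewrite mxE.
by have := x0 i (mem_index_enum _); rewrite -expr2 sqrf_eq0 => /eqP.
Qed.

Lemma sqn0 : sqn (0 : 'rV[R]_N) = 0.
Proof. exact: dot0v. Qed.

Lemma sqnN x : sqn (- x) = sqn x.
Proof. by rewrite /sqn !dotE opprK. Qed.

Lemma sqnB x y : sqn (x - y) = sqn (y - x).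
Proof. by rewrite -sqnN opprB. Qed.

Lemma sqnZ c x : sqn (c *: x) = c ^+ 2 * sqn x.
Proof. by rewrite /sqn !dotE mulrA expr2. Qed.

Lemma enorm_ge0 x : 0 <= enorm x.
Proof. exact: sqrtr_ge0. Qed.

Lemma enormK x : enorm x ^+ 2 = sqn x.
Proof. by rewrite sqr_sqrtr ?sqn_ge0. Qed.

Lemma enorm0 : enorm (0 : 'rV[R]_N) = 0.
Proof. by rewrite /enorm dot0v sqrtr0. Qed.

Lemma enorm_eq0 x : enorm x = 0 -> x = 0.
Proof. by move=> x0; apply: sqn_eq0; rewrite -enormK x0 expr0n. Qed.

Lemma enormN x : enorm (- x) = enorm x.
Proof. by rewrite /enorm -/(sqn _) sqnN. Qed.

Lemma enormB x y : enorm (x - y) = enorm (y - x).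
Proof. by rewrite -enormN opprB. Qed.

Lemma enormZ c x : enorm (c *: x) = `|c| * enorm x.
Proof. by rewrite /enorm -/(sqn _) sqnZ sqrtrM ?sqr_ge0// sqrtr_sqr. Qed.

(* The discriminant of [sqn (x + t y)]. *)
Lemma dotv_sqr_le x y : dotv x y ^+ 2 <= sqn x * sqn y.
Proof.
have [y0|y0] := eqVneq (sqn y) 0.
  by rewrite y0 (sqn_eq0 y0) dotv0 expr0n mulr0.
have ygt0 : 0 < sqn y by rewrite lt0r y0 sqn_ge0.
have := sqn_ge0 (sqn y *: x - dotv x y *: y).
rewrite {1}/sqn !dotE -!/(sqn _) (dotvC y x) => h.
rewrite -(ler_pM2l ygt0); nra.
Qed.

Lemma dotv_le x y : dotv x y <= enorm x * enorm y.
Proof.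
apply: le_trans (ler_norm _) _; rewrite -sqrtr_sqr /enorm -sqrtrM ?sqn_ge0//.
by rewrite ler_wsqrtr// dotv_sqr_le.
Qed.

Lemma dotv_normle x y : `|dotv x y| <= enorm x * enorm y.
Proof.
rewrite ler_norml dotv_le andbT lerNl -dotvNl -(enormN x).
exact: dotv_le.
Qed.

Lemma enormD x y : enorm (x + y) <= enorm x + enorm y.
Proof.
rewrite -(@ler_pXn2r _ 2)// ?nnegrE ?addr_ge0 ?enorm_ge0//.
rewrite enormK /sqn !dotE -!/(sqn _) -!enormK (dotvC y x).
have := dotv_le x y; nra.
Qed.

Lemma enormD3 x y z : enorm (x - y) <= enorm (x - z) + enorm (z - y).
Proof.
by have := enormD (x - z) (z - y); rewrite addrA subrK.
Qed.

Lemma enorm_sub_ge x y : enorm x <= enorm (x - y) + enorm y.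
Proof. by rewrite -{1}(subrK y x) enormD. Qed.

Lemma enorm_distB x y : `|enorm x - enorm y| <= enorm (x - y).
Proof.
rewrite ler_norml; apply/andP; split; last first.
  by rewrite lerBlDr enorm_sub_ge.
by rewrite lerNl opprB lerBlDr enormB enorm_sub_ge.
Qed.

Lemma enorm_sum (I : Type) (s : seq I) (P : pred I) (f : I -> 'rV[R]_N) :
  enorm (\sum_(i <- s | P i) f i) <= \sum_(i <- s | P i) enorm (f i).
Proof.
elim/big_ind2 : _ => [|u r v r' h h'|//]; first by rewrite enorm0.
by apply: le_trans (enormD _ _) _; rewrite lerD.
Qed.

Lemma sqn_le x c : 0 <= c -> (sqn x <= c ^+ 2) = (enorm x <= c).
Proof. by move=> c0; rewrite -enormK ler_pXn2r ?nnegrE ?enorm_ge0. Qed.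

Lemma ler_enorm_sqn x y : (enorm x <= enorm y) = (sqn x <= sqn y).
Proof. by rewrite -(enormK y) sqn_le ?enorm_ge0. Qed.

Lemma sqnD_le x y : sqn (x + y) <= 2 * sqn x + 2 * sqn y.
Proof.
have := sqn_ge0 (x - y); rewrite /sqn !dotE (dotvC y x) => h.
lra.
Qed.

Lemma young x y : 2 * dotv x y <= sqn x + sqn y.
Proof. have := sqn_ge0 (x - y); rewrite /sqn !dotE (dotvC y x); lra. Qed.

Lemma enorm_coord x i : `|x 0 i| <= enorm x.
Proof.
rewrite -sqrtr_sqr /enorm ler_wsqrtr// /dotv (bigD1 i)//= expr2 lerDl.
by apply: sumr_ge0 => j _; rewrite -expr2 sqr_ge0.
Qed.

Lemma enorm_le_sum x : enorm x <= \sum_i `|x 0 i|.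
Proof.
have s0 : 0 <= \sum_i `|x 0 i| by apply: sumr_ge0.
rewrite -sqn_le// expr2 mulr_suml; apply: ler_sum => i _.
apply: le_trans (ler_norm _) _; rewrite normrM ler_wpM2l//.
by rewrite (bigD1 i)//= lerDl; apply: sumr_ge0.
Qed.

End EuclideanAlgebra.

(** * The Euclidean norm and the topology of the space *)

Section EuclideanTopology.
Variables (R : realType) (N : nat).
Local Notation V := 'rV[R]_N.
Implicit Types (x y z : V) (c : R).

Lemma normr_le_enorm x : `|x| <= enorm x.
Proof.
rewrite [leLHS]/Num.Def.normr/= mx_normrE; apply/bigmax_leP; split => [|[i j] _].
  exact: enorm_ge0.
by rewrite /= (ord1 i) enorm_coord.
Qed.

Lemma coord_le_normr x i : `|x 0 i| <= `|x|.
Proof.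
rewrite [leRHS]/Num.Def.normr/= mx_normrE; apply/bigmax_geP; right.
by exists (0, i).
Qed.

Lemma enorm_le_normr x : enorm x <= N%:R * `|x|.
Proof.
apply: le_trans (enorm_le_sum _) _.
apply: (@le_trans _ _ (\sum_(i < N) `|x|)).
  by apply: ler_sum => i _; exact: coord_le_normr.
by rewrite sumr_const card_ord mulr_natl.
Qed.

Lemma enorm_continuous : continuous (@enorm R N).
Proof.
move=> x; apply/(@cvgrPdist_le _ _ _ (nbhs x) (nbhs_filter x)) => e e0.
have d0 : 0 < e / (N%:R + 1) by rewrite divr_gt0// ltr_wpDl.
apply: filterS (nbhsx_ballx x _ d0) => y; rewrite -ball_normE /ball_/= => h.
apply: le_trans (enorm_distB _ _) _.
apply: le_trans (enorm_le_normr _) _.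
move: h; rewrite ltr_pdivlMr ?ltr_wpDl// => /ltW; apply: le_trans.
by rewrite mulrC ler_wpM2l// lerDl.
Qed.

(** Equivalence with the sup norm; limits of vectors are checked below through the Euclidean
    norm. *)
Lemma cvg_enormP (T : Type) (F : set_system T) {FF : Filter F} (f : T -> V) x :
  (f t @[t --> F] --> x) <-> (forall e, 0 < e -> \forall t \near F, enorm (f t - x) <= e).
Proof.
split=> [fx e e0|h].
  have : enorm (f t - x) @[t --> F] --> enorm (x - x).
    by apply: continuous_cvg; [exact: enorm_continuous|apply: cvgB => //; exact: cvg_cst].
  rewrite subrr enorm0 => /cvgr0Pnorm_le /(_ e e0).
  by apply: filterS => t; rewrite ger0_norm ?enorm_ge0.
apply/cvgrPdist_le => e e0; have := h e e0; apply: filterS => t.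
by rewrite -normrN opprB => /(le_trans (normr_le_enorm _)).
Qed.

Lemma near_enorm x (e : R) : 0 < e -> \forall y \near x, enorm (y - x) <= e.
Proof.
move=> e0; have [h _] := @cvg_enormP V (nbhs x) (nbhs_filter x) id x.
exact: h.
Qed.

Lemma cvg_dotv (T : Type) (F : set_system T) {FF : Filter F} (f g : T -> V) x y :
  f t @[t --> F] --> x -> g t @[t --> F] --> y ->
  dotv (f t) (g t) @[t --> F] --> dotv x y.
Proof.
move=> fx gy; apply: (@cvg_big _ _ _ _ _ _ _ _ _ _ _) => [|i _].
  exact: add_continuous.
have cc (h : T -> V) z : h t @[t --> F] --> z -> h t 0 i @[t --> F] --> z 0 i.
  by move=> hz; apply: (cvg_comp h (fun u : V => u 0 i) hz); exact: coord_continuous.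
by apply: cvgM; exact: cc.
Qed.

Lemma closure_enormP (C : set V) x :
  closure C x <-> (forall e, 0 < e -> exists2 y, C y & enorm (x - y) <= e).
Proof.
split=> [Cx e e0|h].
  have := near_enorm x e0.
  by move=> /Cx[y [Cy yx]]; exists y => //; rewrite enormB.
move=> U /nbhs_ballP[e /= e0 eU]; have [y Cy yx] := h (e / 2) ltac:(by rewrite divr_gt0).
exists y; split => //; apply: eU; rewrite -ball_normE /ball_/=.
apply: le_lt_trans (normr_le_enorm _) _; apply: le_lt_trans yx _.
by rewrite ltr_pdivrMr// ltr_pMr// ltr1n.
Qed.

Lemma enorm_cauchy_cvg (f : nat -> V) :
  (forall e, 0 < e -> exists n0, forall n m, (n0 <= n)%N -> (n <= m)%N ->
     enorm (f m - f n) <= e) ->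
  exists x, f n @[n --> \oo] --> x.
Proof.
move=> fC; suff : cvgn f by move=> /cvg_ex.
apply/cauchy_cvgP; apply: cauchy_exP => _/posnumP[e].
have e2 : 0 < e%:num / 2 by [].
have [n0 h] := fC _ e2; exists (f n0); exists n0 => // m /= nm.
rewrite -ball_normE /ball_/= -normrN opprB.
apply: le_lt_trans (normr_le_enorm _) _; apply: le_lt_trans (h _ _ (leqnn _) nm) _.
by rewrite ltr_pdivrMr// ltr_pMr// ltr1n.
Qed.

End EuclideanTopology.

(** First-order optimality: this reads off a variational inequality at a minimiser after division by
    [t]. *)
Lemma ge0_of_small (R : realType) (A B : R) :
  (forall t, 0 < t -> t <= 1 -> 0 <= A + t * B) -> 0 <= A.
Proof.
move=> h; apply/ler_addgt0Pr => e e0.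
have B0 : 0 < `|B| + 1 by rewrite ltr_wpDl.
have t0 : 0 < Num.min 1 (e / (`|B| + 1)) by rewrite lt_min ltr01 divr_gt0.
have := h _ t0; rewrite ge_min lexx => /(_ isT) /le_trans; apply.
rewrite lerD2l; apply: le_trans (ler_norm _) _.
rewrite normrM gtr0_norm//.
apply: (@le_trans _ _ (e / (`|B| + 1) * `|B|)).
  by rewrite ler_wpM2r// ge_min lexx orbT.
by rewrite mulrAC ler_pdivrMr// ler_pM2l// lerDl.
Qed.

Lemma cvg_ge0 (R : realType) (T : Type) (F : set_system T) {FF : ProperFilter F}
    (f : T -> R) l :
  (\forall t \near F, 0 <= f t) -> f t @[t --> F] --> l -> 0 <= l.
Proof.
move=> f0 fl; rewrite -(cvg_lim (@Rhausdorff R) fl); apply: limr_ge => //.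
by apply/cvg_ex; exists l.
Qed.

Lemma natSinv_small (R : realType) (e : R) : 0 < e ->
  exists n0, forall n, (n0 <= n)%N -> n.+1%:R^-1 <= e.
Proof.
move=> e0; have [n0 _ h] := near_infty_natSinv_lt (PosNum e0).
by exists n0 => n /h /ltW.
Qed.

Lemma cvg_natSinv (R : realType) : n.+1%:R^-1 @[n --> \oo] --> (0 : R).
Proof. exact: cvg_harmonic. Qed.

Lemma cvg_sqn (R : realType) N (T : Type) (F : set_system T) {FF : Filter F}
    (f : T -> 'rV[R]_N) x :
  f t @[t --> F] --> x -> sqn (f t) @[t --> F] --> sqn x.
Proof. by move=> fx; exact: cvg_dotv. Qed.

Section Minty.
Variables (R : realType) (N : nat).
Local Notation V := 'rV[R]_N.
Implicit Types (T : operator R N) (x y a c : V) (p : R).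

(** * Maximal monotone operators *)

(** The convex hull of the triples [(a, c, <c, a>)] over the graph. The third coordinate is kept
    because the pairing of averages is not the average of the pairings. Its lower envelope in [p] is
    a convex function whose conjugate is, up to a swap of the variables, the Fitzpatrick function of
    [T]. *)
Inductive mhull T : V -> V -> R -> Prop :=
| mhull_base a c : T a c -> mhull T a c (dotv c a)
| mhull_mix t a c p a' c' p' : 0 <= t -> t <= 1 ->
    mhull T a c p -> mhull T a' c' p' ->
    mhull T (t *: a + (1 - t) *: a') (t *: c + (1 - t) *: c')
      (t * p + (1 - t) * p').

(* The left-hand side is affine in each of the two hull points. *)
Lemma mhull_monotone T a c p a' c' p' : monotone_op T ->
  mhull T a c p -> mhull T a' c' p' ->
  0 <= p + p' - dotv c a' - dotv c' a.
Proof.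
move=> mT h; elim: h a' c' p' => {a c p} [a c Tac|t a c p b d q t0 t1 _ IH1 _ IH2].
  move=> a' c' p'; elim => {a' c' p'} [a' c' Tac'|t a1 c1 p1 a2 c2 p2 t0 t1 _ IH1 _ IH2].
    have := mT _ _ _ _ Tac Tac'; rewrite !dotE; lra.
  by rewrite !dotE; nra.
by move=> a' c' p' h; have := IH1 _ _ _ h; have := IH2 _ _ _ h; rewrite !dotE; nra.
Qed.

Let half : R := 2^-1.
Let f a c p : R := sqn (half *: (a - c)) + p.

(** A hull point against itself gives [p >= <c, a>], and
    [|(a - c)/2|^2 + <c, a> = |(a + c)/2|^2]. *)
Let f_ge0 T a c p : monotone_op T -> mhull T a c p -> 0 <= f a c p.
Proof.
move=> mT h; have := mhull_monotone mT h h.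
have := sqn_ge0 (half *: (a + c)); rewrite /f /sqn !dotE /half (dotvC c a).
lra.
Qed.

(* The minimiser of [|y|^2 + p] over the hull of the points
   [((a - c)/2, <c, a>)]; the variational inequality at the minimiser is the
   conclusion because the minimum is nonnegative. *)
Lemma minty0 T : monotone_op T -> graph T !=set0 ->
  exists y, forall a c, T a c -> 0 <= dotv (c + y) (a - y).
Proof.
move=> mT [[a0 c0] /= T0].
pose E := [set r | exists a c p, mhull T a c p /\ r = f a c p].
have Elb : lbound E 0 by move=> _ [a [c [p [h ->]]]]; exact: f_ge0 h.
have infE : has_inf E.
  by split; [exists (f a0 c0 (dotv c0 a0)), a0, c0, (dotv c0 a0); split => //; exact: mhull_base|exists 0].
have inf0 : 0 <= inf E by apply: lb_le_inf => //; case: infE.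
have pick n : { q : V * V * R | mhull T q.1.1 q.1.2 q.2 /\
                 f q.1.1 q.1.2 q.2 <= inf E + n.+1%:R^-1 }.
  apply: cid.
  have /(inf_adherent (E := E)) /(_ infE) : 0 < n.+1%:R^-1 :> R by rewrite invr_gt0.
  by move=> [_ [a [c [p [h ->]]]] /ltW lt]; exists ((a, c), p).
pose y n : V := half *: ((sval (pick n)).1.1 - (sval (pick n)).1.2).
pose p n : R := (sval (pick n)).2.
have yp n : sqn (y n) + p n <= inf E + n.+1%:R^-1 by have [_] := svalP (pick n).
have Einf a c q : mhull T a c q -> inf E <= f a c q.
  by move=> h; apply: ge_inf; [exists 0|exists a, c, q].
(* Parallelogram identity at the midpoint of two almost minimisers, which is again in the hull: the
   sequence is Cauchy even though the hull need not be closed. *)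
have dy n k : sqn (y k - y n) <= 2 * n.+1%:R^-1 + 2 * k.+1%:R^-1.
  have [hn _] := svalP (pick n); have [hk _] := svalP (pick k).
  have h01 : 0 <= half <= 1 by rewrite /half; lra.
  have /andP[h0 h1] := h01.
  have /Einf := mhull_mix h0 h1 hn hk.
  move: (yp n) (yp k); rewrite /f /y /p /sqn !dotE.
  move: (sval (pick n)) (sval (pick k)) => [[a c] q] [[a' c'] q'] /=.
  rewrite (dotvC c a) (dotvC c' a') (dotvC c' a) (dotvC c a') (dotvC c' c) (dotvC a' a) /half.
  by move: (n.+1%:R^-1) (k.+1%:R^-1) (inf E) => ? ? ?; lra.
have [y1 yy1] : exists y1, y n @[n --> \oo] --> y1.
  apply: enorm_cauchy_cvg => e e0.
  have [n0 hn0] : exists n0 : nat, 4 * n0.+1%:R^-1 <= e ^+ 2.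
    have e20 : 0 < e ^+ 2 / 4 by rewrite divr_gt0 ?exprn_gt0.
    have [n0 /(_ _ (leqnn _))] := natSinv_small e20.
    by exists n0; rewrite mulrC -ler_pdivlMr.
  exists n0 => n m nn nm; rewrite -(sqn_le _ (ltW e0)); apply: le_trans (dy _ _) _.
  apply: le_trans hn0.
  have inv k : (n0 <= k)%N -> k.+1%:R^-1 <= n0.+1%:R^-1 :> R.
    by move=> ?; rewrite lef_pV2 ?posrE// ler_nat ltnS.
  move: (inv _ nn) (inv _ (leq_trans nn nm)).
  by move: (n.+1%:R^-1) (m.+1%:R^-1) (n0.+1%:R^-1) => ? ? ?; lra.
exists y1 => a c Tac.
set y' := half *: (a - c).
suff : 0 <= 2 * dotv y1 y' - sqn y1 + dotv c a.
  by rewrite /y' /sqn !dotE /half (dotvC y1 a) (dotvC y1 c); lra.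
(* Up to the error [1 / n.+1], minimality in the direction of the triple of [(a, c)] gives
   [2 <y1, y' - y1> + <c, a> - p >= 0], while [- p <= |y1|^2] because the infimum is nonnegative. *)
apply: (@ge0_of_small _ _ (sqn (y' - y1))) => t t0 t1.
rewrite -(pmulr_rge0 _ t0).
pose u n := t * (2 * dotv (y n) y' - sqn (y n) + dotv c a + t * sqn (y' - y n)) + n.+1%:R^-1.
apply: (@cvg_ge0 _ _ \oo _ u).
  near=> n; rewrite /u.
  have [hn _] := svalP (pick n).
  have t01 : 0 <= 1 - t by rewrite subr_ge0.
  have t11 : 1 - t <= 1 by lra.
  have := mhull_mix t01 t11 hn (mhull_base Tac).
  move/Einf; move: (yp n); rewrite /f (_ : half *: _ = (1 - t) *: y n + (1 - (1 - t)) *: y'); last first.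
    by rewrite /y /y'; apply/rowP => i; rewrite !mxE; ring.
  rewrite -/(p n); move: inf0 => i0 h1 h2.
  have : p n + sqn (y n) <= inf E + n.+1%:R^-1 by rewrite addrC.
  have p0 : inf E <= f (sval (pick n)).1.1 (sval (pick n)).1.2 (p n) by exact: Einf.
  have {p0} p0 : 0 <= sqn (y n) + p n by exact: le_trans p0.
  move: h1 h2 p0 i0; move: (y n) (y') (dotv c a) (p n) (inf E) (n.+1%:R^-1) => yn y'' D P I M.
  rewrite /sqn !dotE (dotvC y'' yn) -!/(sqn _).
  move: (sqn yn) (sqn y'') (dotv yn y'') => A B C.
  by nra.
rewrite -[X in _ --> X]addr0; apply: cvgD; last first.
  exact: cvg_natSinv.
apply: cvgMr; apply: cvgD.
  apply: cvgD; last exact: cvg_cst.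
  apply: cvgB; last exact: cvg_sqn.
  by apply: cvgMr; apply: cvg_dotv => //; exact: cvg_cst.
by apply: cvgMr; apply: cvg_sqn; apply: cvgB => //; exact: cvg_cst.
Unshelve. all: by end_near. Qed.

(** The pair [(y, x - y)] is monotonically related to the graph: under maximality it belongs to it,
    which is the surjectivity of [I + T]. The proof translates the values of [T] by [- x]. *)
Lemma minty T x : monotone_op T -> graph T !=set0 ->
  exists y, forall a c, T a c -> 0 <= dotv (c + y - x) (a - y).
Proof.
move=> mT [[a0 c0] /= T0].
have [||y hy] := @minty0 (fun a c => T a (c + x)).
- by move=> a c a' c' h h'; have := mT _ _ _ _ h h'; rewrite opprD addrACA subrr addr0.
- by exists (a0, c0 - x); rewrite /graph/= subrK.
exists y => a c Tac; have := hy a (c - x); rewrite subrK addrAC => /(_ Tac).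
by rewrite addrAC.
Qed.

(* Resolvents and Yosida approximations *)
End Minty.

Definition yosida (R : realType) N (g : R) (T : operator R N) (x : 'rV[R]_N) :=
  g^-1 *: (x - resolvent g T x).

Section Resolvents.
Variables (R : realType) (N : nat) (T : operator R N).
Local Notation V := 'rV[R]_N.
Implicit Types (x y a c : V) (g h : R).
Hypothesis maxT : maximal_monotone T.

Lemma maximal_op_monotone : monotone_op T.
Proof. by case: maxT. Qed.

Lemma maximal_dom_neq0 : dom T !=set0.
Proof. by case: maxT => -[[a c] /= Tac] _ _; exists a, c. Qed.

(** Adding [(x, y)] to the graph keeps it monotone, so maximality absorbs the new point. *)
Lemma maximal_in x y : (forall a c, T a c -> 0 <= dotv (c - y) (a - x)) -> T x y.
Proof.
move=> h; case: maxT => _ mT maxi.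
pose S : operator R N := fun a c => T a c \/ (a = x /\ c = y).
have mS : monotone_op S.
  move=> a c a' c' [Tac|[-> ->]] [Tac'|[-> ->]].
  - exact: mT Tac Tac'.
  - exact: h Tac.
  - by rewrite -opprB -(opprB a') dotvNl dotvNr opprK; exact: h.
  - by rewrite subrr dot0v.
have : graph S (x, y) by right.
rewrite (maxi S mS)//; by case => a c Tac; left.
Qed.

Lemma maximal_closed (I : Type) (F : set_system I) {FF : ProperFilter F}
    (f k : I -> V) x y :
  (\forall i \near F, T (f i) (k i)) ->
  f i @[i --> F] --> x -> k i @[i --> F] --> y -> T x y.
Proof.
move=> fk fx ky; apply: maximal_in => a c Tac.
apply: (@cvg_ge0 _ _ F _ (fun i => dotv (c - k i) (a - f i))).
  by apply: filterS fk => i; exact: maximal_op_monotone.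
by apply: cvg_dotv; apply: cvgB => //; exact: cvg_cst.
Qed.

Section FixedStep.
Variable g : R.
Hypothesis g0 : 0 < g.

(** Minty's theorem for [g T]: it shows that [resolvent] picks a genuine solution and not the
    default value of [xget]. *)
Lemma yosida_in x : T (resolvent g T x) (yosida g T x).
Proof.
have gV0 : 0 <= g^-1 by rewrite invr_ge0 ltW.
suff [y Ty] : exists y, T y (g^-1 *: (x - y)).
  have : [set y | exists2 a, T y a & x = y + g *: a] y.
    by exists (g^-1 *: (x - y)) => //; rewrite scalerA divff ?gt_eqF// scale1r addrC subrK.
  move=> /(ex_intro _ y) /(xgetPex 0) [a Ta].
  rewrite -/(resolvent g T x) /yosida => {2}->.
  by rewrite addrAC subrr add0r scalerA mulVf ?gt_eqF// scale1r.
have [||y hy] := @minty _ _ (fun a c => T a (g^-1 *: c)) x.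
- move=> a c a' c' h h'; have := maximal_op_monotone h h'.
  by rewrite -scalerBr dotvZl pmulr_rge0 ?invr_gt0.
- case: maxT => -[[a c] /= Tac] _ _; exists (a, g *: c) => /=.
  by rewrite /graph/= scalerA mulVf ?gt_eqF// scale1r.
exists y; apply: maximal_in => a c Tac.
have := hy a (g *: c); rewrite scalerA mulVf ?gt_eqF// scale1r => /(_ Tac) h.
have -> : c - g^-1 *: (x - y) = g^-1 *: (g *: c + y - x).
  by apply/rowP => i; rewrite !mxE; field; rewrite gt_eqF.
by rewrite dotvZl mulr_ge0.
Qed.

Lemma resolventE x : x = resolvent g T x + g *: yosida g T x.
Proof. by rewrite /yosida scalerA divff ?gt_eqF// scale1r addrC subrK. Qed.

Lemma resolvent_sub x : x - resolvent g T x = g *: yosida g T x.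
Proof. by rewrite {1}(resolventE x) addrAC subrr add0r. Qed.

Lemma resolvent_in_dom x : dom T (resolvent g T x).
Proof. by exists (yosida g T x); exact: yosida_in. Qed.

Lemma resolvent_uniq x y : T y (g^-1 *: (x - y)) -> resolvent g T x = y.
Proof.
move=> Ty; have := maximal_op_monotone (yosida_in x) Ty.
have -> : yosida g T x - g^-1 *: (x - y) = - (g^-1 *: (resolvent g T x - y)).
  by rewrite /yosida; apply/rowP => i; rewrite !mxE; ring.
rewrite dotvNl dotvZl oppr_ge0 pmulr_rle0 ?invr_gt0// => h.
apply/eqP; rewrite -subr_eq0; apply/eqP; apply: sqn_eq0.
by apply/eqP; rewrite eq_le sqn_ge0 andbT; exact: h.
Qed.

Lemma resolvent_firm x y :
  sqn (resolvent g T x - resolvent g T y) <=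
  dotv (x - y) (resolvent g T x - resolvent g T y).
Proof.
have := maximal_op_monotone (yosida_in x) (yosida_in y).
rewrite /yosida -scalerBr dotvZl pmulr_rge0 ?invr_gt0// /sqn !dotE.
lra.
Qed.

Lemma resolvent_nonexp x y :
  enorm (resolvent g T x - resolvent g T y) <= enorm (x - y).
Proof.
set u := (X in enorm X <= _).
have := le_trans (resolvent_firm x y) (dotv_le _ _).
rewrite -/u -enormK expr2.
have [->|u0] := eqVneq (enorm u) 0; first by rewrite enorm_ge0.
by rewrite ler_pM2r// lt0r u0 enorm_ge0.
Qed.

Lemma yosida_monotone x y :
  0 <= dotv (yosida g T x - yosida g T y) (x - y).
Proof.
have := maximal_op_monotone (yosida_in x) (yosida_in y).
have := sqn_ge0 (yosida g T x - yosida g T y).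
have -> : x - y = (resolvent g T x - resolvent g T y) +
                  g *: (yosida g T x - yosida g T y).
  rewrite {1}(resolventE x) {1}(resolventE y).
  by apply/rowP => i; rewrite !mxE; ring.
by move=> h1 h2; rewrite dotvDr dotvZr addr_ge0// mulr_ge0// ltW.
Qed.

Lemma yosida_lipschitz x y :
  enorm (yosida g T x - yosida g T y) <= g^-1 * enorm (x - y).
Proof.
set u := (X in enorm X <= _).
have := maximal_op_monotone (yosida_in x) (yosida_in y).
have -> : (resolvent g T x - resolvent g T y) = (x - y) - g *: u.
  rewrite /u {2}(resolventE x) {2}(resolventE y).
  by apply/rowP => i; rewrite !mxE; ring.
rewrite -/u dotvDr dotvNr dotvZr subr_ge0 -/(sqn u) -enormK => h.
have := le_trans h (dotv_le _ _); rewrite ler_pdivlMl// expr2 mulrA.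
have [->|u0] := eqVneq (enorm u) 0; first by move=> _; rewrite mulr0 enorm_ge0.
by rewrite (mulrC (enorm u)) ler_pM2r// lt0r u0 enorm_ge0.
Qed.

Lemma yosida_le x a : T x a -> enorm (yosida g T x) <= enorm a.
Proof.
move=> Txa; have := maximal_op_monotone Txa (yosida_in x).
rewrite resolvent_sub dotvZr pmulr_rge0// dotvDl dotvNl subr_ge0 -/(sqn _) -enormK.
move=> /le_trans /(_ (dotv_le _ _)); rewrite expr2.
have [->|u0] := eqVneq (enorm (yosida g T x)) 0; first by rewrite enorm_ge0.
by rewrite ler_pM2r// lt0r u0 enorm_ge0.
Qed.

Lemma resolvent_dist x a : T x a -> enorm (resolvent g T x - x) <= g * enorm a.
Proof.
move=> Txa; rewrite enormB resolvent_sub enormZ gtr0_norm// ler_pM2l//.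
exact: yosida_le.
Qed.

Lemma resolvent_bound x y a : T y a ->
  enorm (resolvent g T x - y) <= enorm (x - y) + g * enorm a.
Proof.
move=> Tya; apply: le_trans (enormD3 _ _ (resolvent g T y)) _.
by rewrite lerD ?resolvent_nonexp ?resolvent_dist.
Qed.

End FixedStep.

(** With [u], [v] the Yosida values at [h] and [g], the resolvents differ by
    [(g - h) v - h (u - v)], so monotonicity forces [<u - v, v> >= 0]. Norms therefore increase as
    the step decreases, and any bound on them makes the values Cauchy. *)
Lemma yosida_increments x g h : 0 < h -> h <= g ->
  sqn (yosida h T x - yosida g T x) <= sqn (yosida h T x) - sqn (yosida g T x).
Proof.
move=> h0; rewrite le_eqVlt => /predU1P[->|hg]; first by rewrite !subrr sqn0.
have g0 := lt_trans h0 hg.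
have := maximal_op_monotone (yosida_in h0 x) (yosida_in g0 x).
have -> : resolvent h T x - resolvent g T x = g *: yosida g T x - h *: yosida h T x.
  by rewrite -!resolvent_sub//; apply/rowP => i; rewrite !mxE; ring.
move: (yosida h T x) (yosida g T x) => u v.
rewrite /sqn !dotE (dotvC v u) => k.
have := sqn_ge0 (u - v); rewrite /sqn !dotE (dotvC v u) => k2.
have : 0 <= h * (dotv u u - dotv u v - (dotv u v - dotv v v)).
  by rewrite (mulr_ge0 (ltW h0))//; lra.
move=> k3; have {k k3} : 0 <= (g - h) * (dotv u v - dotv v v) by nra.
by rewrite pmulr_rge0 ?subr_gt0//; lra.
Qed.

(** The squared norms increase and stay below that of every element of [T x], so the values
    converge; the graph being closed, the limit is the element of least norm. The measurability of
    this least norm is obtained from here. *)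
Lemma yosida_cvg x : dom T x -> exists y, [/\ T x y,
  forall z, T x z -> enorm y <= enorm z &
  yosida n.+1%:R^-1 T x @[n --> \oo] --> y].
Proof.
move=> [a Ta]; pose Y n := yosida n.+1%:R^-1 T x.
have s0 n : 0 < n.+1%:R^-1 :> R by rewrite invr_gt0.
have sle n m : (n <= m)%N -> m.+1%:R^-1 <= n.+1%:R^-1 :> R.
  by move=> nm; rewrite lef_pV2 ?posrE// ler_nat.
have Yinc n m : (n <= m)%N -> sqn (Y m - Y n) <= sqn (Y m) - sqn (Y n).
  by move=> nm; exact: yosida_increments (s0 m) (sle _ _ nm).
have Yle n z : T x z -> enorm (Y n) <= enorm z by exact: yosida_le.
have cv : cvgn (fun n => sqn (Y n)).
  apply: nondecreasing_is_cvgn.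
    by move=> n m nm; have := le_trans (sqn_ge0 _) (Yinc _ _ nm); rewrite subr_ge0.
  by exists (sqn a) => _ [n _ <-]; rewrite -ler_enorm_sqn; exact: Yle.
have [y Yy] : exists y, Y n @[n --> \oo] --> y.
  apply: enorm_cauchy_cvg => e e0.
  have e2 : 0 < e ^+ 2 / 2 by rewrite divr_gt0 ?exprn_gt0.
  move/cvg_ex: cv => [l /cvgrPdist_le /(_ _ e2)] [n0 _ hn0].
  exists n0 => n m nn nm; rewrite -(sqn_le _ (ltW e0)).
  apply: le_trans (Yinc _ _ nm) _.
  have := hn0 n nn; have := hn0 m (leq_trans nn nm) => /=.
  by rewrite !ler_norml => /andP[h1 h2] /andP[h3 h4]; lra.
exists y; split => //.
- apply: (@maximal_closed _ \oo _ (fun n => resolvent n.+1%:R^-1 T x) Y) => //.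
    by near=> n; exact: yosida_in.
  apply/cvg_enormP => e e0.
  have e1 : 0 < e / (enorm a + 1) by rewrite divr_gt0// ltr_wpDl ?enorm_ge0.
  have [n0 hn0] := natSinv_small e1; exists n0 => // n /= nn.
  apply: le_trans (resolvent_dist (s0 n) Ta) _.
  apply: (@le_trans _ _ (n.+1%:R^-1 * (enorm a + 1))).
    by rewrite ler_wpM2l ?lerDl// ltW.
  by rewrite -ler_pdivlMr ?hn0// ltr_wpDl ?enorm_ge0.
- move=> z Tz.
  have Yy' := cvg_comp _ _ Yy (@enorm_continuous R N y).
  rewrite -subr_ge0; apply: (@cvg_ge0 _ _ \oo _ (fun n => enorm z - enorm (Y n))).
    by near=> n; rewrite subr_ge0; exact: Yle.
  by apply: cvgB => //; exact: cvg_cst.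
Unshelve. all: by end_near. Qed.

Lemma least_norm_valueP x : dom T x -> T x (least_norm_value T x) /\
  forall z, T x z -> enorm (least_norm_value T x) <= enorm z.
Proof.
move=> /yosida_cvg [y [Ty ymin _]].
have h : [set v | T x v /\ forall z, T x z -> enorm v <= enorm z] y by [].
exact: (xgetPex 0 (ex_intro _ y h)).
Qed.

Lemma least_norm_value_cvg x : dom T x ->
  enorm (yosida n.+1%:R^-1 T x) @[n --> \oo] --> enorm (least_norm_value T x).
Proof.
move=> dx; have [y [Ty ymin Yy]] := yosida_cvg dx.
have [Tl lmin] := least_norm_valueP dx.
have -> : enorm (least_norm_value T x) = enorm y by apply/le_anti; rewrite lmin ?ymin.
exact: cvg_comp _ _ Yy (@enorm_continuous R N y).
Qed.

(** Minty's theorem for [T + L] only yields a [y] monotonically related to the graph. Testing it at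
    the point [z] of a backward step of length [1 / (k + 1)] gives
    [(k + 1) |y - z|^2 <= k |y - z|^2], hence [z = y]. *)
Lemma maximal_add_lipschitz_surj (L : V -> V) k w : 0 <= k ->
  (forall x y, 0 <= dotv (L x - L y) (x - y)) ->
  (forall x y, enorm (L x - L y) <= k * enorm (x - y)) ->
  exists x a, T x a /\ w = x + a + L x.
Proof.
move=> k0 Lm Llip.
have [||y hy] := @minty _ _ (fun a c => exists2 c', T a c' & c = c' + L a) w.
- move=> a _ a' _ [c Tc ->] [c' Tc' ->].
  rewrite opprD addrACA dotvDl addr_ge0//; exact: maximal_op_monotone Tc Tc'.
- case: maxT => -[[a c] /= Tac] _ _; exists (a, c + L a) => /=.
  by exists c.
pose v := w - y; pose t : R := (k + 1)^-1.
have t0 : 0 < t by rewrite invr_gt0 ltr_wpDl.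
pose z := resolvent t T (y + t *: (v - L y)).
have Tz := yosida_in t0 (y + t *: (v - L y)).
have := hy z _ (ex_intro2 _ _ _ Tz erefl).
have -> : yosida t T (y + t *: (v - L y)) + L z + y - w =
    t^-1 *: (y - z) + (L z - L y).
  rewrite /yosida -/z /v; move: (z) (L z) (L y) (t) (lt0r_neq0 t0) => z' Lz Ly s sn0.
  by apply/rowP => i; rewrite !mxE; field.
rewrite -(opprB y z) dotvNr oppr_ge0 dotvDl dotvZl -/(sqn _) -enormK /t invrK => h.
have h2 : - (k * enorm (y - z) ^+ 2) <= dotv (L z - L y) (y - z).
  rewrite -(opprB z y) dotvNr lerN2 enormN; apply: le_trans (dotv_le _ _) _.
  by rewrite expr2 mulrA ler_wpM2r ?enorm_ge0.
have yz : y - z = 0.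
  apply: enorm_eq0; apply/eqP; rewrite -sqrf_eq0 eq_le sqr_ge0 andbT; nra.
have {yz} yz : z = y by apply/eqP; rewrite eq_sym -subr_eq0 yz.
exists y, (v - L y); split.
  move: Tz; rewrite -/z yz /yosida -/z yz addrAC subrr add0r.
  by rewrite scalerA mulVf ?gt_eqF// scale1r.
by rewrite /v -addrA subrK addrC subrK.
Qed.

End Resolvents.

(** * Distances and projections *)

Section Distance.
Variables (R : realType) (N : nat).
Local Notation V := 'rV[R]_N.
Implicit Types (C : set V) (x y z : V).

Let dist_has_inf C x : C !=set0 -> has_inf [set enorm (x - y) | y in C].
Proof.
move=> [y Cy]; split; first by exists (enorm (x - y)), y.
by exists 0 => _ [z _ <-]; exact: enorm_ge0.
Qed.

Lemma dist_to_le C x y : C y -> dist_to C x <= enorm (x - y).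
Proof.
move=> Cy; apply: ge_inf; last by exists y.
by case: (dist_has_inf x (ex_intro _ y Cy)).
Qed.

Lemma dist_to_ge0 C x : C !=set0 -> 0 <= dist_to C x.
Proof.
move=> C0; apply: lb_le_inf; first by case: (dist_has_inf x C0).
by move=> _ [z _ <-]; exact: enorm_ge0.
Qed.

Lemma dist_to_near C x e : C !=set0 -> 0 < e ->
  exists2 y, C y & enorm (x - y) <= dist_to C x + e.
Proof.
move=> C0 e0; have [_ [y Cy <-] /ltW h] := inf_adherent e0 (dist_has_inf x C0).
by exists y.
Qed.

Lemma dist_to_lipschitz C x y : C !=set0 ->
  dist_to C x <= dist_to C y + enorm (x - y).
Proof.
move=> C0; apply/ler_addgt0Pr => e e0; have [z Cz zy] := dist_to_near y C0 e0.
apply: le_trans (dist_to_le _ Cz) _; apply: le_trans (enormD3 _ _ y) _.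
rewrite addrC; apply: le_trans (lerD zy (lexx _)) _; lra.
Qed.

Lemma dist_to_continuous C : C !=set0 -> continuous (dist_to C).
Proof.
move=> C0 x; apply/(@cvgrPdist_le _ _ _ (nbhs x) (nbhs_filter x)) => e e0.
apply: filterS (near_enorm x e0) => y /= yx.
rewrite ler_norml lerNl opprB !lerBlDl.
have h1 := dist_to_lipschitz x y C0; have h2 := dist_to_lipschitz y x C0.
rewrite enormB in yx; rewrite enormB in h2.
by apply/andP; split; [apply: le_trans h2 _|apply: le_trans h1 _]; rewrite lerD.
Qed.

Definition convex_set C :=
  forall t x y, 0 <= t -> t <= 1 -> C x -> C y -> C (t *: x + (1 - t) *: y).

Lemma proj_unique C x y : C y -> (forall z, C z -> dotv (x - y) (z - y) <= 0) ->
  proj_on C x = y.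
Proof.
move=> Cy hy.
have key z : C z -> sqn (x - y) + sqn (y - z) <= sqn (x - z).
  by move=> /hy; rewrite /sqn !dotE (dotvC y x) (dotvC z x) (dotvC z y); lra.
have h : [set y | C y /\ forall z, C z -> enorm (x - y) <= enorm (x - z)] y.
  split => // z Cz; rewrite ler_enorm_sqn; apply: le_trans (key _ Cz).
  by rewrite lerDl sqn_ge0.
have [Cp hp] := xgetPex 0 (ex_intro _ y h).
rewrite -/(proj_on C x) in Cp hp.
have := hp _ Cy; have := key _ Cp; rewrite ler_enorm_sqn => k1 k2.
apply/eqP; rewrite eq_sym -subr_eq0; apply/eqP; apply: sqn_eq0.
apply/eqP; rewrite eq_le sqn_ge0 andbT.
by have := le_trans k1 k2; rewrite gerDl.
Qed.

(** Minimising sequences are Cauchy by the parallelogram identity at midpoints; the angle inequality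
    is the first-order condition along the segment from the minimiser to [z]. *)
Lemma proj_convexP C x : C !=set0 -> closed C -> convex_set C ->
  C (proj_on C x) /\ forall z, C z -> dotv (x - proj_on C x) (z - proj_on C x) <= 0.
Proof.
move=> C0 Ccl Cconv.
have d0 := dist_to_ge0 x C0; set m := dist_to C x in d0.
have pick n : { y : V | C y /\ enorm (x - y) <= m + n.+1%:R^-1 }.
  by apply: cid; have [|y Cy h] := @dist_to_near C x (n.+1%:R^-1) C0; [rewrite invr_gt0|exists y].
pose y n := sval (pick n).
have Cy n : C (y n) by have [] := svalP (pick n).
have yle n : enorm (x - y n) <= m + n.+1%:R^-1 by have [] := svalP (pick n).
have i0 n : 0 < n.+1%:R^-1 :> R by rewrite invr_gt0.
have i1 n : n.+1%:R^-1 <= 1 :> R by rewrite invf_le1// ler1n.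
have sq n : sqn (x - y n) <= m ^+ 2 + (2 * m + 1) * n.+1%:R^-1.
  rewrite -enormK; apply: (@le_trans _ _ ((m + n.+1%:R^-1) ^+ 2)).
    by rewrite ler_pXn2r ?nnegrE ?enorm_ge0// addr_ge0// ltW.
  by move: (i0 n) (i1 n); move: (n.+1%:R^-1) => i; nra.
have dy n k : sqn (y k - y n) <= (2 * (2 * m + 1)) * (n.+1%:R^-1 + k.+1%:R^-1).
  have half0 : 0 <= 2^-1 :> R by rewrite invr_ge0.
  have half1 : 2^-1 <= 1 :> R by rewrite invf_le1// ler1n.
  have /(dist_to_le x) := Cconv _ _ _ half0 half1 (Cy n) (Cy k).
  rewrite -/m -(@ler_pXn2r _ 2)// ?nnegrE ?enorm_ge0// enormK.
  have -> : x - (2^-1 *: y n + (1 - 2^-1) *: y k) = 2^-1 *: ((x - y n) + (x - y k)).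
    by apply/rowP => i; rewrite !mxE; field.
  have -> : y k - y n = (x - y n) - (x - y k) by apply/rowP => i; rewrite !mxE; ring.
  move: (sq n) (sq k); move: (n.+1%:R^-1) (k.+1%:R^-1) (x - y n) (x - y k) => r s u v.
  by rewrite /sqn !dotE (dotvC v u); nra.
have [p yp] : exists p : V, y n @[n --> \oo] --> p.
  apply: enorm_cauchy_cvg => e e0.
  have m1 : 0 < 2 * m + 1 by lra.
  have e20 : 0 < e ^+ 2 / (4 * (2 * m + 1)) by rewrite divr_gt0 ?exprn_gt0// mulr_gt0.
  have [n0 hn0] := natSinv_small e20; exists n0 => n k nn nk.
  rewrite -(sqn_le _ (ltW e0)); apply: le_trans (dy _ _) _.
  have := hn0 _ nn; have := hn0 _ (leq_trans nn nk).
  rewrite !ler_pdivlMr ?mulr_gt0//.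
  by move: (n.+1%:R^-1) (k.+1%:R^-1) => r s; nra.
have Cp : C p.
  by apply: (@closed_cvg _ _ \oo _ y C); [exact: Ccl|exact: nearW|exact: yp].
have xp : enorm (x - p) <= m.
  rewrite -subr_ge0; apply: (@cvg_ge0 _ _ \oo _ (fun n => m + n.+1%:R^-1 - enorm (x - y n))).
    by near=> n; rewrite subr_ge0.
  apply: cvgB.
    by rewrite -[X in _ --> X]addr0; apply: cvgD; [exact: cvg_cst|exact: cvg_natSinv].
  apply: (cvg_comp (fun n => x - y n) (@enorm R N) _ (@enorm_continuous R N (x - p))).
  by apply: cvgB => //; exact: cvg_cst.
have hp z : C z -> dotv (x - p) (z - p) <= 0.
  move=> Cz; rewrite -oppr_ge0.
  suff : 0 <= - (2 * dotv (x - p) (z - p)) by lra.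
  apply: (@ge0_of_small _ _ (sqn (z - p))) => t t0 t1.
  rewrite -(pmulr_rge0 _ t0).
  have /(dist_to_le x) := Cconv t _ _ (ltW t0) t1 Cz Cp.
  move/(le_trans xp); rewrite ler_enorm_sqn.
  have -> : x - (t *: z + (1 - t) *: p) = (x - p) - t *: (z - p).
    by apply/rowP => i; rewrite !mxE; ring.
  move: (x - p) (z - p) => u v; rewrite /sqn !dotE (dotvC v u); nra.
by rewrite (proj_unique Cp hp).
Unshelve. all: by end_near. Qed.

Section Projection.
Variable C : set V.
Hypotheses (C0 : C !=set0) (Cconv : convex_set (closure C)).

Let cC0 : closure C !=set0.
Proof. by case: C0 => y Cy; exists y; exact: subset_closure. Qed.

Lemma proj_closureP x : closure C (proj_on (closure C) x) /\
  forall z, closure C z ->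
    dotv (x - proj_on (closure C) x) (z - proj_on (closure C) x) <= 0.
Proof. by apply: proj_convexP => //; exact: closed_closure. Qed.

Lemma proj_closure_id x : closure C x -> proj_on (closure C) x = x.
Proof. by move=> Cx; apply: proj_unique => // z _; rewrite subrr dot0v. Qed.

Lemma proj_closure_nonexp x y :
  enorm (proj_on (closure C) x - proj_on (closure C) y) <= enorm (x - y).
Proof.
have [Px hx] := proj_closureP x; have [Py hy] := proj_closureP y.
move: (hx _ Py) (hy _ Px).
move: (proj_on _ x) (proj_on _ y) => p q h1 h2.
have : sqn (p - q) <= dotv (x - y) (p - q).
  by move: h1 h2; rewrite /sqn !dotE; lra.
move=> /le_trans /(_ (dotv_le _ _)); rewrite -enormK expr2.
have [->|u0] := eqVneq (enorm (p - q)) 0; first by rewrite enorm_ge0.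
by rewrite ler_pM2r// lt0r u0 enorm_ge0.
Qed.

Lemma dist_to_proj x : dist_to C x = enorm (x - proj_on (closure C) x).
Proof.
have [Px hx] := proj_closureP x; apply/le_anti/andP; split.
  apply/ler_addgt0Pr => e e0.
  have [z Cz zp] := (closure_enormP _ _).1 Px _ e0.
  apply: le_trans (dist_to_le _ Cz) _; apply: le_trans (enormD3 _ _ (proj_on (closure C) x)) _.
  by rewrite lerD2l.
apply: lb_le_inf; first by case: (dist_has_inf x C0).
move=> _ [z Cz <-]; rewrite ler_enorm_sqn.
have := hx z (subset_closure Cz); move: (proj_on _ x) => p.
have := sqn_ge0 (z - p).
by rewrite /sqn !dotE (dotvC z x) (dotvC z p) (dotvC p x); lra.
Qed.

(** The angle at the projection is obtuse. The gain [- dist_to C x ^+ 2] is the source of the mean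
    contraction of the distance to [calD]. *)
Lemma proj_closure_pythagoras x z : closure C z ->
  sqn (proj_on (closure C) x - z) <= sqn (x - z) - dist_to C x ^+ 2.
Proof.
move=> Cz; have [_ /(_ _ Cz)] := proj_closureP x.
rewrite dist_to_proj enormK; move: (proj_on _ x) => p.
by rewrite /sqn !dotE (dotvC z x) (dotvC z p) (dotvC p x); lra.
Qed.

End Projection.
End Distance.

(** * Convexity of the closed domain; limits of resolvents for small steps *)

Section DomainClosure.
Variables (R : realType) (N : nat) (T : operator R N).
Local Notation V := 'rV[R]_N.
Hypothesis maxT : maximal_monotone T.

(** The convex hull of the domain. The resolvents converge to the projection onto its closure while
    taking their values in the domain, so the two closures coincide. *)
Let hull : set V := [set a | exists c p, mhull T a c p].

Let hull_neq0 : hull !=set0.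
Proof. by case: maxT => -[[a c] /= Tac] _ _; exists a, c, (dotv c a); exact: mhull_base. Qed.

Let hull_convex : convex_set (closure hull).
Proof.
move=> t x y t0 t1 /closure_enormP hx /closure_enormP hy; apply/closure_enormP => e e0.
have [x' [c [p hx']] xx'] := hx e e0; have [y' [c' [p' hy']] yy'] := hy e e0.
exists (t *: x' + (1 - t) *: y').
  by exists (t *: c + (1 - t) *: c'), (t * p + (1 - t) * p'); exact: mhull_mix.
have -> : t *: x + (1 - t) *: y - (t *: x' + (1 - t) *: y') = t *: (x - x') + (1 - t) *: (y - y').
  by apply/rowP => i; rewrite !mxE; ring.
apply: le_trans (enormD _ _) _; rewrite !enormZ !ger0_norm ?subr_ge0//.
by nra.
Qed.

Let hull_dom x : dom T x -> hull x.
Proof. by move=> [a Ta]; exists a, (dotv a x); exact: mhull_base. Qed.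

(** Monotonicity between the resolvent and a graph point, multiplied by [g], is affine in
    [(a, c, p)] and so extends to the hull. *)
Let hull_ineq g x a c p : 0 < g -> mhull T a c p ->
  0 <= dotv (x - resolvent g T x) (resolvent g T x - a) - g * dotv c (resolvent g T x) + g * p.
Proof.
move=> g0; elim => {a c p} [a c Tac|t a c p a' c' p' t0 t1 _ h _ h'].
  have := maximal_op_monotone maxT (yosida_in maxT g0 x) Tac.
  rewrite -(pmulr_rge0 _ g0) -dotvZl scalerBr -resolvent_sub// !dotE; lra.
by rewrite !dotE in h h' *; nra.
Qed.

Let resolvent_to_hull x e : 0 < e -> exists2 dl, 0 < dl &
  forall g, 0 < g -> g <= dl -> enorm (resolvent g T x - proj_on (closure hull) x) <= e.
Proof.
move=> e0; have [Pin Pvar] := proj_closureP hull_neq0 hull_convex x.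
set P := proj_on _ x in Pin Pvar *.
have [y0 [c0 Ty0]] := maximal_dom_neq0 maxT; pose B := enorm y0 + enorm (x - y0) + enorm c0.
have B0 : 0 <= B by rewrite /B !addr_ge0 ?enorm_ge0.
have Jb g : 0 < g -> g <= 1 -> enorm (resolvent g T x) <= B.
  move=> g0 g1; apply: le_trans (enorm_sub_ge _ y0) _; rewrite /B addrC -addrA lerD2l.
  apply: le_trans (resolvent_bound maxT g0 x Ty0) _.
  by rewrite lerD2l ler_piMl ?enorm_ge0.
have K0 : 0 < 2 * (B + enorm x + 1) by rewrite mulr_gt0// ltr_wpDl// addr_ge0 ?enorm_ge0.
have [a [c [p ha]] aP] := (closure_enormP _ _).1 Pin _ (divr_gt0 (exprn_gt0 2 e0) K0).
have M0 : 0 < 2 * (`|p| + enorm c * B + 1).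
  by rewrite mulr_gt0// ltr_wpDl// addr_ge0// mulr_ge0 ?enorm_ge0.
exists (Num.min 1 (e ^+ 2 / (2 * (`|p| + enorm c * B + 1)))).
  by rewrite lt_min ltr01/= divr_gt0 ?exprn_gt0.
move=> g g0; rewrite le_min => /andP[g1 ge].
rewrite -(sqn_le _ (ltW e0)); set J := resolvent g T x.
have JB : enorm J <= B by exact: Jb.
have Jh : closure hull J by apply/subset_closure/hull_dom/resolvent_in_dom.
have h1 := Pvar _ Jh; have h2 := hull_ineq x g0 ha; rewrite -/J in h2.
(* The obtuse angle at [P] added to the hull inequality. Of the two remaining terms one is small
   with [g], the other because the hull point [a] was chosen close to [P]; the choice of [a]
   precedes that of [g], whose bound depends on [c] and [p]. *)
have h3 : sqn (J - P) <= g * (p - dotv c J) + dotv (J - x) (a - P).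
  by move: h1 h2; rewrite /sqn !dotE ?(dotvC J x) ?(dotvC P x) ?(dotvC P J); lra.
apply: le_trans h3 _.
have -> : e ^+ 2 = e ^+ 2 / 2 + e ^+ 2 / 2 by field.
apply: lerD.
  rewrite ler_pdivlMr// in ge.
  apply: (@le_trans _ _ (g * (`|p| + enorm c * B + 1))); last by lra.
  rewrite ler_pM2l//.
  have := ler_norm p; have := dotv_normle c J; rewrite ler_norml => /andP[k1 k2] k3.
  have : enorm c * enorm J <= enorm c * B by rewrite ler_wpM2l ?enorm_ge0.
  lra.
apply: le_trans (dotv_le _ _) _; rewrite enormB in aP; rewrite ler_pdivlMr// in aP.
have : enorm (J - x) * enorm (a - P) <= (B + enorm x + 1) * enorm (a - P).
  rewrite ler_wpM2r ?enorm_ge0//; apply: le_trans (enormD _ _) _; rewrite enormN; lra.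
by move=> /le_trans; apply; lra.
Qed.

Let closure_dom_hull : closure (dom T) = closure hull.
Proof.
apply/seteqP; split; first exact: closure_subset.
move=> x hx; apply/closure_enormP => e e0.
have [dl dl0 h] := resolvent_to_hull x e0.
exists (resolvent dl T x); first exact: resolvent_in_dom.
by have := h dl dl0 (lexx _); rewrite proj_closure_id// enormB.
Qed.

Lemma closure_dom_convex : convex_set (closure (dom T)).
Proof. by rewrite closure_dom_hull. Qed.

Lemma resolvent_cvg_proj x :
  resolvent n.+1%:R^-1 T x @[n --> \oo] --> proj_on (closure (dom T)) x.
Proof.
rewrite closure_dom_hull; apply/cvg_enormP => e e0.
have [dl dl0 h] := resolvent_to_hull x e0.
have [n0 hn0] := natSinv_small dl0; exists n0 => // n /= nn.
by apply: h; [rewrite invr_gt0|exact: hn0].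
Qed.

End DomainClosure.

(** * Borel measurability and Mazur's lemma *)

Section BorelVectors.
Variables (R : realType) (N : nat).
Local Notation V := 'rV[R]_N.
Local Notation bV := (borelV R N).

Lemma measurable_ltset (d : measure_display) (X : measurableType d) (f g : X -> R) :
  measurable_fun [set: X] f -> measurable_fun [set: X] g ->
  measurable [set x | f x < g x].
Proof.
move=> mf mg; rewrite -[X in measurable X]setTI.
exact: (measurable_fun_ltr mf mg measurableT (Y := [set true])).
Qed.

Lemma measurable_leset (d : measure_display) (X : measurableType d) (f g : X -> R) :
  measurable_fun [set: X] f -> measurable_fun [set: X] g ->
  measurable [set x | f x <= g x].
Proof.
move=> mf mg; rewrite -[X in measurable X]setTI.
exact: (measurable_fun_ler mf mg measurableT (Y := [set true])).
Qed.

Lemma borelV_measurable_real (f : V -> R) : continuous f ->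
  measurable_fun [set: bV] (f : bV -> R).
Proof.
move=> /continuousP cf; apply: (measurability _ (RGenOInfty.measurableE R)) => //.
move=> _ [_ [x ->] <-]; rewrite setTI; apply: sub_sigma_algebra; apply: cf.
exact: interval_open.
Qed.

Variables (d : measure_display) (X : measurableType d).
Implicit Types f g : X -> V.

Lemma measurable_coord f i : measurable_fun [set: X] (f : X -> bV) ->
  measurable_fun [set: X] (fun x => f x 0 i).
Proof.
move=> mf; apply: (measurableT_comp (f := fun v : bV => (v : V) 0 i)) mf.
by apply: borelV_measurable_real => v; exact: coord_continuous.
Qed.

(* Every open set is a countable union of rational boxes. *)
Lemma measurable_rowV f :
  (forall i, measurable_fun [set: X] (fun x => f x 0 i)) ->
  measurable_fun [set: X] (f : X -> bV).
Proof.
move=> mf; apply: (@measurability _ _ _ bV _ _ (@open V) erefl) => //.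
move=> _ [U oU <-]; rewrite setTI.
pose box (q : 'rV[rat]_N * nat) : set V :=
  [set v | forall i, `|v 0 i - ratr (q.1 0 i)| < q.2.+1%:R^-1].
pose D := [set q | box q `<=` U].
have UE : U = \bigcup_q (if `[< D q >] then box q else set0).
  apply/seteqP; split => [v Uv|v [q _]]; last by case: asboolP => // Dq /Dq.
  have /nbhs_ballP[e /= e0 eU] : nbhs v U by rewrite nbhsE; exists U.
  have e2 : 0 < e / 4 by rewrite divr_gt0.
  have [k /(_ _ (leqnn _)) ke] := natSinv_small e2.
  have k0 : 0 < k.+1%:R^-1 :> R by rewrite invr_gt0.
  have /choice[q hq] (i : 'I_N) : exists q : rat, `|v 0 i - ratr q| < k.+1%:R^-1.
    have /rat_in_itvoo[q] : v 0 i < v 0 i + k.+1%:R^-1 by rewrite ltrDl.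
    rewrite in_itv/= => /andP[h1 h2]; exists q.
    by rewrite distrC ger0_norm ?subr_ge0 ?ltW// ltrBlDr addrC.
  exists (\row_i q i, k) => //; case: asboolP => [_ i|]; first by rewrite /= mxE.
  case=> w hw; apply: eU; rewrite -ball_normE /ball_/=.
  apply: (@le_lt_trans _ _ (e / 2)); last by rewrite ltr_pdivrMr// ltr_pMr// ltr1n.
  rewrite [leLHS]/Num.Def.normr/= mx_normrE; apply/bigmax_leP; split => [|[j i] _].
    by rewrite divr_ge0// ltW.
  rewrite /= (ord1 j) !mxE; have := hw i; rewrite /= mxE => h.
  move: ke (ltW (hq i)) (ltW h); rewrite !ler_norml; move: (k.+1%:R^-1) => r ?.
  by move=> /andP[? ?] /andP[? ?]; apply/andP; split; lra.
rewrite UE preimage_bigcup; apply: countable_bigcupT_measurable.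
  exact: countableP.
move=> q; case: asboolP => _; last by rewrite preimage_set0.
pose A i := [set x | `|f x 0 i - ratr (q.1 0 i)| < q.2.+1%:R^-1].
rewrite (_ : _ @^-1` _ = \big[setI/setT]_(i < N) A i); last first.
  apply/seteqP; split => [x /= h|x].
    by elim/big_ind : _ => // i _; exact: h.
  by move=> h i; move: h; rewrite (bigD1 i) => // -[].
apply: bigsetI_measurable => i _; apply: measurable_ltset => //.
apply: measurableT_comp => //; apply: measurable_funB => //.
Qed.

Lemma measurable_dotv f g : measurable_fun [set: X] (f : X -> bV) ->
  measurable_fun [set: X] (g : X -> bV) ->
  measurable_fun [set: X] (fun x => dotv (f x) (g x)).
Proof.
move=> mf mg; apply: measurable_sum => i.
by apply: measurable_funM; exact: measurable_coord.
Qed.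

Lemma measurable_sqn f : measurable_fun [set: X] (f : X -> bV) ->
  measurable_fun [set: X] (fun x => sqn (f x)).
Proof. by move=> mf; exact: measurable_dotv. Qed.

Lemma measurable_enorm f : measurable_fun [set: X] (f : X -> bV) ->
  measurable_fun [set: X] (fun x => enorm (f x)).
Proof.
move=> mf; apply: (measurableT_comp (f := (@enorm R N : bV -> R))) mf.
by apply: borelV_measurable_real; exact: enorm_continuous.
Qed.

Lemma measurable_vD f g : measurable_fun [set: X] (f : X -> bV) ->
  measurable_fun [set: X] (g : X -> bV) ->
  measurable_fun [set: X] ((fun x => f x + g x) : X -> bV).
Proof.
move=> mf mg; apply: measurable_rowV => i; under eq_fun do rewrite mxE.
by apply: measurable_funD; exact: measurable_coord.
Qed.

Lemma measurable_vscale (k : X -> R) f : measurable_fun [set: X] k ->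
  measurable_fun [set: X] (f : X -> bV) ->
  measurable_fun [set: X] ((fun x => k x *: f x) : X -> bV).
Proof.
move=> mk mf; apply: measurable_rowV => i; under eq_fun do rewrite mxE.
by apply: measurable_funM => //; exact: measurable_coord.
Qed.

Lemma measurable_vB f g : measurable_fun [set: X] (f : X -> bV) ->
  measurable_fun [set: X] (g : X -> bV) ->
  measurable_fun [set: X] ((fun x => f x - g x) : X -> bV).
Proof.
move=> mf mg; apply: measurable_rowV => i; under eq_fun do rewrite !mxE.
by apply: measurable_funB; exact: measurable_coord.
Qed.

Lemma measurable_vsum (I : Type) (s : seq I) (f : I -> X -> V) :
  (forall i, measurable_fun [set: X] (f i : X -> bV)) ->
  measurable_fun [set: X] ((fun x => \sum_(i <- s) f i x) : X -> bV).
Proof.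
move=> mf; elim: s => [|i s IH].
  by under eq_fun do rewrite big_nil; exact: measurable_cst.
under eq_fun do rewrite big_cons; exact: measurable_vD.
Qed.

Lemma measurable_vcvg (f : nat -> X -> V) g :
  (forall n, measurable_fun [set: X] (f n : X -> bV)) ->
  (forall x, f n x @[n --> \oo] --> g x) ->
  measurable_fun [set: X] (g : X -> bV).
Proof.
move=> mf fg; apply: measurable_rowV => i.
apply: (@measurable_fun_cvg _ _ _ _ (fun n x => f n x 0 i)).
  by move=> n; exact: measurable_coord.
move=> x _; apply: (cvg_comp (fun n => f n x) (fun u : V => u 0 i) (fg x)).
exact: coord_continuous.
Qed.

End BorelVectors.

(** * Convex combinations of tails of a sequence *)

Section ConvexWeights.
Variable R : realType.
Implicit Types (s t : seq (R * nat)) (n : nat).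

(* Finitely supported probability weights on the indices [>= n]. *)
Definition wvalid n s :=
  [/\ forall p, p \in s -> 0 <= p.1, forall p, p \in s -> (n <= p.2)%N &
      \sum_(p <- s) p.1 = 1].

Definition wcomb (E : lmodType R) s (f : nat -> E) : E :=
  \sum_(p <- s) p.1 *: f p.2.

Definition wmix s t : seq (R * nat) :=
  [seq (2^-1 * p.1, p.2) | p <- s] ++ [seq (2^-1 * p.1, p.2) | p <- t].

Lemma wmix_valid n s t : wvalid n s -> wvalid n t -> wvalid n (wmix s t).
Proof.
move=> [s1 s2 s3] [t1 t2 t3]; split.
- move=> p; rewrite mem_cat => /orP[] /mapP[q qs ->] /=.
    by rewrite mulr_ge0 ?invr_ge0 ?s1.
  by rewrite mulr_ge0 ?invr_ge0 ?t1.
- by move=> p; rewrite mem_cat => /orP[] /mapP[q qs ->] /=; [apply: s2|apply: t2].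
- rewrite big_cat/= !big_map/= -!mulr_sumr s3 t3 !mulr1.
  by field.
Qed.

Lemma wvalidS n m s : (n <= m)%N -> wvalid m s -> wvalid n s.
Proof. by move=> nm [? h ?]; split => // p /h; exact: leq_trans. Qed.

Lemma wvalid1 n : wvalid n [:: (1, n)].
Proof.
split; [by move=> p; rewrite inE => /eqP->; exact: ler01| |by rewrite big_seq1].
by move=> p; rewrite inE => /eqP->.
Qed.

Lemma wcomb_mix (E : lmodType R) s t (f : nat -> E) :
  wcomb (wmix s t) f = 2^-1 *: (wcomb s f + wcomb t f).
Proof.
rewrite /wcomb big_cat/= !big_map/= scalerDr !scaler_sumr.
by congr (_ + _); apply: eq_bigr => p _; rewrite scalerA.
Qed.

Lemma wsum_ge n s (a : nat -> R) c : wvalid n s ->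
  (forall k, (n <= k)%N -> c <= a k) -> c <= \sum_(p <- s) p.1 * a p.2.
Proof.
move=> [s1 s2 s3] h; rewrite -[c]mul1r -s3 mulr_suml.
by rewrite !big_seq; apply: ler_sum => p ps; rewrite ler_wpM2l ?s1// h// s2.
Qed.

Lemma wsum_le n s (a : nat -> R) c : wvalid n s ->
  (forall k, (n <= k)%N -> a k <= c) -> \sum_(p <- s) p.1 * a p.2 <= c.
Proof.
move=> [s1 s2 s3] h; rewrite -[c]mul1r -s3 mulr_suml.
by rewrite !big_seq; apply: ler_sum => p ps; rewrite ler_wpM2l ?s1// h// s2.
Qed.

Lemma wcomb_affine N n s (f : nat -> 'rV[R]_N) y z : wvalid n s ->
  dotv (wcomb s f - y) z = \sum_(p <- s) p.1 * dotv (f p.2 - y) z.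
Proof.
move=> [_ _ s3]; rewrite dotvDl dotv_suml dotvNl.
under [in RHS]eq_bigr do rewrite dotvDl dotvNl mulrDr.
rewrite big_split/= -mulr_suml s3 mul1r; congr (_ + _).
by apply: eq_bigr => p _; rewrite dotvZl.
Qed.

Lemma sqn_wcomb_le N n s (f : nat -> 'rV[R]_N) : wvalid n s ->
  sqn (wcomb s f) <= \sum_(p <- s) p.1 * sqn (f p.2).
Proof.
move=> sv; have [s1 s2 s3] := sv.
set c := wcomb s f.
have : 0 <= \sum_(p <- s) p.1 * sqn (f p.2 - c).
  by rewrite big_seq; apply: sumr_ge0 => p ps; rewrite mulr_ge0 ?s1 ?sqn_ge0.
have -> : \sum_(p <- s) p.1 * sqn (f p.2 - c) =
    \sum_(p <- s) p.1 * sqn (f p.2) - 2 * dotv c c + sqn c * \sum_(p <- s) p.1.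
  have -> : dotv c c = \sum_(p <- s) p.1 * dotv (f p.2) c.
    by rewrite {1}/c dotv_suml; apply: eq_bigr => p _; rewrite dotvZl.
  rewrite !mulr_sumr -sumrB -big_split/=; apply: eq_bigr => p _.
  by rewrite /sqn !dotE (dotvC c); ring.
rewrite s3 /sqn; lra.
Qed.

Lemma enorm_wcomb_le N n s (f : nat -> 'rV[R]_N) y c : wvalid n s ->
  (forall k, (n <= k)%N -> enorm (f k - y) <= c) -> enorm (wcomb s f - y) <= c.
Proof.
move=> sv h; have [s1 s2 s3] := sv.
have -> : wcomb s f - y = \sum_(p <- s) p.1 *: (f p.2 - y).
  under eq_bigr do rewrite scalerBr.
  by rewrite sumrB -scaler_suml s3 scale1r.
apply: le_trans (enorm_sum _ _ _) _.
apply: le_trans (@wsum_le _ _ (fun k => enorm (f k - y)) c sv h).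
rewrite !big_seq; apply: ler_sum => p ps.
by rewrite enormZ ger0_norm ?s1.
Qed.

End ConvexWeights.

Lemma nneseries_ge_term (R : realType) (u : nat -> \bar R) j :
  (forall k, (0 <= u k)%E) -> (u j <= \sum_(0 <= k <oo) u k)%E.
Proof.
move=> u0; apply: le_trans (nneseries_lim_ge j.+1 _); last by move=> *.
rewrite big_mkord big_ord_recr/= leeDr//.
by apply: sume_ge0 => i _; exact: u0.
Qed.

Lemma geometric_enorm_cvg (R : realType) N (u : nat -> 'rV[R]_N) (c q : R) :
  0 <= c -> 0 <= q < 1 -> (forall j, enorm (u j - u j.+1) <= c * q ^+ j) ->
  exists x : 'rV[R]_N, u n @[n --> \oo] --> x.
Proof.
move=> c0 /andP[q0 q1] hu; have q10 : 0 < 1 - q by rewrite subr_gt0.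
have tail n k : enorm (u n - u (n + k)%N) <= c * q ^+ n * ((1 - q ^+ k) / (1 - q)).
  elim: k => [|k IH]; first by rewrite addn0 subrr enorm0 expr0 subrr mul0r mulr0.
  apply: le_trans (enormD3 _ _ (u (n + k)%N)) _; rewrite addnS.
  apply: le_trans (lerD IH (hu _)) _; rewrite exprD exprS le_eqVlt.
  by apply/orP; left; apply/eqP; field; rewrite gt_eqF.
apply: enorm_cauchy_cvg => e e0.
have /cvgr0Pnorm_le/(_ _ e0)[n0 _ hn0] : c / (1 - q) * q ^+ n @[n --> \oo] --> (0 : R).
  by rewrite -[X in _ --> X](mulr0 (c / (1 - q))); apply: cvgMr; apply: cvg_expr; rewrite ger0_norm.
exists n0 => n m nn nm; rewrite enormB -(subnKC nm); apply: le_trans (tail _ _) _.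
have := hn0 n nn; rewrite /= ger0_norm; last first.
  by rewrite mulr_ge0 ?exprn_ge0// divr_ge0// ltW.
apply: le_trans; rewrite [leRHS]mulrAC -[leRHS]mulrA -mulrA ler_wpM2l//.
rewrite ler_wpM2l ?exprn_ge0// ler_pdivrMr// mulVf ?gt_eqF//.
by rewrite lerBlDr lerDl exprn_ge0.
Qed.

(** * Convex combinations of a bounded sequence of square integrable maps *)

Section Mazur.
Variables (R : realType) (N : nat) (d : measure_display) (X : measurableType d).
Variable mu : {measure set X -> \bar R}.
Local Notation V := 'rV[R]_N.
Local Notation bV := (borelV R N).
Variables (f : nat -> X -> V) (C : R).
Hypothesis mf : forall n, measurable_fun [set: X] (f n : X -> bV).
Hypothesis fC : forall n, (\int[mu]_x (sqn (f n x))%:E <= C%:E)%E.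

Let h s x : V := wcomb s (f ^~ x).

Let mh s : measurable_fun [set: X] (h s : X -> bV).
Proof.
apply: measurable_vsum => p; apply: measurable_vscale => //.
Qed.

Let msq (g : X -> V) : measurable_fun [set: X] (g : X -> bV) ->
  measurable_fun [set: X] (fun x => (sqn (g x))%:E).
Proof. by move=> mg; apply/measurable_EFinP; exact: measurable_sqn. Qed.

Let J s : R := fine (\int[mu]_x (sqn (h s x))%:E).

Let Jint s n : wvalid n s -> (\int[mu]_x (sqn (h s x))%:E = (J s)%:E)%E /\ 0 <= J s <= C.
Proof.
move=> sv; have [s1 s2 s3] := sv.
have le : (\int[mu]_x (sqn (h s x))%:E <= C%:E)%E.
  apply: (@le_trans _ _ (\int[mu]_x (\sum_(p <- s) (`|p.1| * sqn (f p.2 x))%:E))%E).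
    apply: ge0_le_integral => //.
    - by move=> x _; rewrite lee_fin sqn_ge0.
    - exact: (msq (mh s)).
    - apply: emeasurable_sum => p; apply/measurable_EFinP.
      by apply: measurable_funM => //; exact: measurable_sqn.
    - move=> x _; rewrite sumEFin lee_fin; apply: le_trans (sqn_wcomb_le _ sv) _.
      by rewrite !big_seq; apply: ler_sum => p ps; rewrite ger0_norm ?s1.
  rewrite ge0_integral_sum//; last 2 first.
  - move=> p; apply/measurable_EFinP.
    by apply: measurable_funM => //; exact: measurable_sqn.
  - by move=> p x _; rewrite lee_fin mulr_ge0 ?sqn_ge0.
  apply: (@le_trans _ _ (\sum_(p <- s) (`|p.1| * C)%:E)%E).
    apply: lee_sum => p _; under eq_integral do rewrite EFinM.
    rewrite ge0_integralZl//; last 2 first.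
    - exact: (msq (mf p.2)).
    - by move=> x _; rewrite lee_fin sqn_ge0.
    by rewrite EFinM lee_pmul// ?integral_ge0// ?lee_fin// => x _; rewrite lee_fin sqn_ge0.
  rewrite sumEFin lee_fin -mulr_suml -[leRHS]mul1r -s3.
  rewrite (_ : \sum_(p <- s) `|p.1| = \sum_(p <- s) p.1)//.
  by rewrite !big_seq; apply: eq_bigr => p ps; rewrite ger0_norm ?s1.
have ge : (0 <= \int[mu]_x (sqn (h s x))%:E)%E.
  by apply: integral_ge0 => x _; rewrite lee_fin sqn_ge0.
have fi : (\int[mu]_x (sqn (h s x))%:E)%E \is a fin_num.
  by rewrite ge0_fin_numE//; apply: le_lt_trans le _; rewrite ltry.
rewrite /J fineK//; split => //; rewrite -!lee_fin fineK//.
by rewrite ge le.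
Qed.

Let S n : set R := [set J s | s in wvalid n].
Let m n : R := inf (S n).

Let S_inf n : has_inf (S n).
Proof.
split; first by exists (J [:: (1, n)]), [:: (1, n)] => //; exact: wvalid1.
by exists 0 => _ [s sv <-]; have [_ /andP[]] := Jint sv.
Qed.

Let m_le n s : wvalid n s -> m n <= J s.
Proof. by move=> sv; apply: ge_inf; [case: (S_inf n)|exists s]. Qed.

Let m_nd n k : (n <= k)%N -> m n <= m k.
Proof.
move=> nk; apply: lb_le_inf; first by case: (S_inf k).
by move=> _ [s sv <-]; apply: m_le; exact: wvalidS sv.
Qed.

Let m_sup : has_sup (range m).
Proof.
split; first by exists (m 0%N), 0%N.
exists C => _ [n _ <-]; apply: le_trans (m_le (wvalid1 R n)) _.
by have [_ /andP[]] := Jint (wvalid1 R n).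
Qed.

Let l := sup (range m).
Let q j : R := (4 ^+ j)^-1.

Let q0 j : 0 < q j. Proof. by rewrite invr_gt0 exprn_gt0. Qed.

Let near_l j : exists n, (j <= n)%N /\ l - q j <= m n.
Proof.
have [_ [n _ <-] /ltW ln] := sup_adherent (q0 j) m_sup.
exists (maxn j n); rewrite leq_maxl; split => //.
by apply: le_trans ln _; apply: m_nd; exact: leq_maxr.
Qed.

Let par s t n : wvalid n s -> wvalid n t ->
  (\int[mu]_x (sqn (h s x - h t x))%:E <= (2 * J s + 2 * J t - 4 * m n)%:E)%E.
Proof.
move=> sv tv; have [Js _] := Jint sv; have [Jt _] := Jint tv.
have xv := wmix_valid sv tv; have [Jx _] := Jint xv; have mx := m_le xv.
pose dd x := sqn (h s x - h t x).
have md : measurable_fun [set: X] (fun x => (dd x)%:E).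
  by apply: (@msq (fun x => h s x - h t x)); apply: measurable_vB; exact: mh.
have E : (\int[mu]_x (dd x)%:E + \int[mu]_x (4 * sqn (h (wmix s t) x))%:E =
          \int[mu]_x (2 * sqn (h s x))%:E + \int[mu]_x (2 * sqn (h t x))%:E)%E.
  rewrite -!ge0_integralD//.
  - apply: eq_integral => x _; rewrite -!EFinD; congr EFin.
    rewrite /dd /h wcomb_mix sqnZ; move: (wcomb s _) (wcomb t _) => u v.
    by rewrite /sqn !dotE (dotvC v u); field.
  all: try by move=> x _; rewrite lee_fin ?mulr_ge0 ?sqn_ge0.
  all: try by under eq_fun do rewrite EFinM; apply: emeasurable_funM => //; exact: (msq (mh _)).
have Z (k : R) r : 0 <= k -> (\int[mu]_x (k * sqn (h r x))%:E = k%:E * \int[mu]_x (sqn (h r x))%:E)%E.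
  move=> k0; under eq_integral do rewrite EFinM.
  by rewrite ge0_integralZl// ?lee_fin//; [exact: (msq (mh r))|move=> x _; rewrite lee_fin sqn_ge0].
move: E; rewrite !Z// Js Jt Jx -!EFinM -EFinD.
have : (0 <= \int[mu]_x (dd x)%:E)%E by apply: integral_ge0 => x _; rewrite lee_fin sqn_ge0.
rewrite -/(dd _); case: (\int[mu]_x (dd x)%:E)%E => [r| |]//= _ [E].
by rewrite lee_fin; lra.
Qed.

(** In place of weak compactness, take in each tail a combination of nearly minimal [L^2] norm. The
    infima [m n] increase to [l], so by the parallelogram identity consecutive choices are at
    squared distance at most [8 / 4 ^ j], which is fast enough for convergence almost everywhere. *)
Lemma mazur : exists s : nat -> seq (R * nat), (forall n, wvalid n (s n)) /\
  exists g : X -> V, measurable_fun [set: X] (g : X -> bV) /\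
    {ae mu, forall x, wcomb (s n) (f ^~ x) @[n --> \oo] --> g x}.
Proof.
have /choice[n0 hn0] := near_l.
(* The running maximum makes the tails nested, so that the combination chosen at [j.+1] is also
   admissible for the tail of [j]. *)
pose n1 j := \max_(i < j.+1) n0 i.
have n1S j : (n1 j <= n1 j.+1)%N by rewrite /n1 [leqRHS]big_ord_recr/= leq_maxl.
have n01 j : (n0 j <= n1 j)%N by rewrite /n1 big_ord_recr/= leq_maxr.
have n1j j : (j <= n1 j)%N by apply: leq_trans (n01 j); have [] := hn0 j.
have ml j : l - q j <= m (n1 j).
  by have [_ /le_trans] := hn0 j; apply; exact: m_nd.
have lm j : m (n1 j) <= l by apply: ub_le_sup; [case: m_sup|exists (n1 j)].
have /choice[s hs] j : exists s, wvalid (n1 j) s /\ J s <= l + q j.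
  have [_ [s sv <-] /ltW ls] := inf_adherent (q0 j) (S_inf (n1 j)).
  by exists s; split => //; apply: le_trans ls _; rewrite lerD2r; exact: lm.
have sv j : wvalid (n1 j) (s j) by have [] := hs j.
exists s; split => [j|]; first exact: wvalidS (sv j).
pose dd j x := sqn (h (s j) x - h (s j.+1) x).
have qS j : q j.+1 <= q j.
  by rewrite /q lef_pV2 ?posrE ?exprn_gt0// exprS ler_peMl ?exprn_ge0// ler1n.
have dq j : (\int[mu]_x (dd j x)%:E <= (8 * q j)%:E)%E.
  apply: le_trans (par (sv j) (wvalidS (n1S j) (sv j.+1))) _; rewrite lee_fin.
  have [_ h1] := hs j; have [_ h2] := hs j.+1; have h3 := ml j; have h4 := qS j.
  lra.
have dd0 j x : 0 <= dd j x by exact: sqn_ge0.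
have mdd j : measurable_fun [set: X] (fun x => (dd j x)%:E).
  apply: (@msq (fun x => h (s j) x - h (s j.+1) x)).
  by apply: measurable_vB; exact: mh.
(* The weight [2 ^+ j] keeps the sum integrable against [8 / 4 ^+ j]; where [F] is finite it bounds
   the increments by a geometric sequence of ratio [sqrt (1 / 2)]. *)
pose F x := (\sum_(0 <= j <oo) (2 ^+ j * dd j x)%:E)%E.
have mF0 j : measurable_fun [set: X] (fun x => (2 ^+ j * dd j x)%:E).
  by under eq_fun do rewrite EFinM; apply: emeasurable_funM.
have F0 j x : (0 <= (2 ^+ j * dd j x)%:E)%E by rewrite lee_fin mulr_ge0 ?exprn_ge0.
have mF : measurable_fun [set: X] F by apply: ge0_emeasurable_sum.
have Ffin : (\int[mu]_x F x < +oo)%E.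
  rewrite integral_nneseries//.
  apply: (@le_lt_trans _ _ (\sum_(0 <= j <oo) (16 / (2 ^ (j + 1))%:R)%:E)%E).
    apply: lee_nneseries => j; first by move=> _ _; apply: integral_ge0 => x _.
    move=> _.
    under eq_integral do rewrite EFinM.
    rewrite ge0_integralZl//; last by move=> x _; rewrite lee_fin.
    apply: (@le_trans _ _ ((2 ^+ j)%:E * (8 * q j)%:E)%E).
      by rewrite lee_pmul2l// lte_fin exprn_gt0.
    rewrite -EFinM lee_fin natrX /q (_ : 4 = 2 * 2 :> R); last by ring.
    rewrite exprMn addn1 exprS le_eqVlt; apply/orP; left; apply/eqP.
    by field; rewrite expf_neq0.
  have e := cvg_lim (@ereal_hausdorff R) (@cvg_geometric_eseries_half R 16 0).
  by apply: (@le_lt_trans _ _ (16 / 2 ^+ 0)%:E); [rewrite -e|rewrite ltry].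
have mA : measurable [set x | (F x < +oo)%E].
  by rewrite -[X in measurable X]setTI; exact: emeasurable_fun_infty_o.
have aeF : {ae mu, forall x, (F x < +oo)%E}.
  have iF : mu.-integrable [set: X] F.
    apply/integrableP; split => //; under eq_integral => x _ do rewrite gee0_abs ?nneseries_ge0//.
    exact: Ffin.
  have := integrable_ae measurableT iF; apply: filterS => x /(_ I).
  by rewrite ge0_fin_numE// nneseries_ge0.
pose A := [set x | (F x < +oo)%E].
(* With the indicator of [A] the sequence converges everywhere, which makes its limit measurable. *)
pose h' j x := \1_A x *: h (s j) x.
have h'cvg x : exists g : V, h' j x @[j --> \oo] --> g.
  have [Ax|Ax] := pselect (A x); last first.
    have i0 : \1_A x = 0 :> R by rewrite indicE memNset.
    exists 0; rewrite /h'; under eq_fun do rewrite i0 scale0r.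
    exact: cvg_cst.
  have i1 : \1_A x = 1 :> R by rewrite indicE mem_set.
  suff [g hg] : exists g : V, h (s j) x @[j --> \oo] --> g.
    by exists g; rewrite /h'; under eq_fun do rewrite i1 scale1r.
  have Fx0 : (0 <= F x)%E by apply: nneseries_ge0.
  have [r rF] : exists r, F x = r%:E.
    by exists (fine (F x)); rewrite fineK// ge0_fin_numE.
  have r0 : 0 <= r by rewrite -lee_fin -rF.
  have step j : enorm (h (s j) x - h (s j.+1) x) <= Num.sqrt r * Num.sqrt (2^-1) ^+ j.
    rewrite -sqn_le ?mulr_ge0 ?exprn_ge0 ?sqrtr_ge0// exprMn sqr_sqrtr// -exprM mulnC exprM sqr_sqrtr ?invr_ge0//.
    rewrite exprVn ler_pdivlMr ?exprn_gt0// mulrC -lee_fin -rF.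
    exact: (nneseries_ge_term j (fun k => F0 k x)).
  apply: (geometric_enorm_cvg _ _ step); first exact: sqrtr_ge0.
  by rewrite sqrtr_ge0/= -{2}[1]sqrtr1 ltr_sqrt// invf_lt1// ltr1n.
have /choice[g hg] := h'cvg.
exists g; split.
  apply: (@measurable_vcvg _ _ _ _ h') => // j.
  by apply: measurable_vscale.
apply: filterS aeF => x Fx; have := hg x; rewrite /h'.
have i1 : \1_A x = 1 :> R by rewrite indicE mem_set.
by under eq_fun do rewrite i1 scale1r.
Qed.

End Mazur.

(** * The semiflow *)

Section DifferenceQuotient.
Variables (R : realType) (f : R -> R) (K : R).
Local Notation mu := (@lebesgue_measure R).
Hypothesis fK : forall s t, `|f t - f s| <= K * `|t - s|.

Lemma lipschitz_ge0 : 0 <= K.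
Proof. by have := le_trans (normr_ge0 _) (fK 0 1); rewrite subr0 normr1 mulr1. Qed.

Lemma lipschitz_continuous : continuous f.
Proof.
move=> x; apply/cvgrPdist_le => e e0.
have K0 := lipschitz_ge0.
have d0 : 0 < e / (K + 1) by rewrite divr_gt0// ltr_wpDl.
apply: filterS (nbhsx_ballx x _ d0) => y; rewrite /ball/= => h.
apply: le_trans (fK _ _) _; move: h; rewrite ltr_pdivlMr ?ltr_wpDl// => /ltW.
by apply: le_trans; rewrite mulrC ler_wpM2l// lerDl.
Qed.

Let fint a b : mu.-integrable `[a, b] (EFin \o f).
Proof.
apply: continuous_compact_integrable; first exact: segment_compact.
by apply: continuous_subspaceT; exact: lipschitz_continuous.
Qed.

(* Integrating the difference quotient of [f] by means of a primitive of [f]. *)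
Lemma diffquot_integral h a x : 0 < h -> a < x ->
  mu.-integrable `[a, x] (EFin \o (fun t => h^-1 * (f (t + h) - f t))) /\
  `| \int[mu]_(t in `[a, x]) (h^-1 * (f (t + h) - f t)) - (f x - f a)| <= 2 * K * h.
Proof.
move=> h0 ax; have K0 := lipschitz_ge0.
pose P y := \int[mu]_(t in `[a - 1, y]) f t.
have dP y : a - 1 < y -> is_derive y 1 P (f y).
  move=> ay; have [] := @continuous_FTC1 R f (BLeft (a - 1)) y (y + 1) _ _ _ (@lipschitz_continuous y).
  - by rewrite ltrDl.
  - exact: fint.
  - by rewrite lte_fin.
  by move=> d1 d2; apply: DeriveDef => //; rewrite -derive1E.
pose q t := h^-1 * (f (t + h) - f t).
pose G t := h^-1 * (P (t + h) - P t).
have dG y : a - 1 < y -> is_derive y 1 G (q y).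
  move=> ay.
  have dsh : is_derive y 1 (fun t => t + h) (1 + 0).
    exact: is_deriveD.
  have d1 : is_derive y 1 (P \o (fun t => t + h)) (f (y + h) * (1 + 0)).
    by apply: is_derive1_comp; apply: dP; rewrite ltr_wpDr// ltW.
  have := is_deriveZ h^-1 (is_deriveB d1 (dP y ay)).
  by rewrite addr0 mulr1.
have cq : continuous q.
  move=> y; apply: cvgMr; apply: cvgB; last exact: lipschitz_continuous.
  apply: (@cvg_comp _ _ _ (fun t => t + h) f); last exact: lipschitz_continuous.
  by apply: cvgD; [exact: cvg_id|exact: cvg_cst].
have Gc y : a - 1 < y -> {for y, continuous G}.
  by move=> ay; apply: differentiable_continuous; apply/derivable1_diffP; have [] := dG y ay.
have I : (\int[mu]_(t in `[a, x]) (q t)%:E = (G x)%:E - (G a)%:E)%E.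
  apply: continuous_FTC2 => //.
  - by apply: continuous_subspaceT; exact: cq.
  - split.
    + move=> y; rewrite in_itv/= => /andP[ay _].
      have a1y : a - 1 < y by apply: lt_trans ay; rewrite gtrBl.
      by have [] := dG y a1y.
    + by apply: cvg_at_right_filter; apply: Gc; rewrite ltrBlDr ltrDl.
    + by apply: cvg_at_left_filter; apply: Gc; rewrite ltrBlDr ltr_wpDr.
  - move=> y; rewrite in_itv/= => /andP[ay _]; rewrite derive1E.
    have a1y : a - 1 < y by apply: lt_trans ay; rewrite gtrBl.
      by have [] := dG y a1y.
split.
  apply: continuous_compact_integrable; first exact: segment_compact.
  by apply: continuous_subspaceT; exact: cq.
have near y : a <= y -> `|G y - f y| <= K * h.
  move=> ay; have yh : y < y + h by rewrite ltrDl.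
  have a1 : a - 1 < y by apply: lt_le_trans ay; rewrite gtrBl.
  have [||c] := @MVT R P f y (y + h) yh.
  - by move=> z; rewrite in_itv/= => /andP[yz _]; apply: dP; exact: lt_trans yz.
  - apply: derivable_within_continuous => z; rewrite in_itv/= => /andP[yz _].
    by have [] := dP z (lt_le_trans a1 yz).
  rewrite in_itv/= => /andP[yc cy] E.
  rewrite /G E addrAC subrr add0r mulrCA mulVf ?gt_eqF// mulr1.
  apply: le_trans (fK _ _) _; rewrite ler_wpM2l// ger0_norm; last by rewrite subr_ge0 ltW.
  by rewrite lerBlDl ltW.
rewrite /Rintegral I/=.
have := near _ (lexx a); have := near _ (ltW ax).
rewrite !ler_norml => /andP[? ?] /andP[? ?]; apply/andP; split; lra.
Qed.

End DifferenceQuotient.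

Section RealIntegrals.
Variables (R : realType) (d : measure_display) (X : measurableType d).
Variable mu : {measure set X -> \bar R}.

Lemma Rintegral_wsum (I : eqType) (D : set X) (s : seq I) (w : I -> R) (q : I -> X -> R) :
  measurable D -> (forall p, mu.-integrable D (EFin \o q p)) ->
  mu.-integrable D (EFin \o (fun t => \sum_(p <- s) w p * q p t)) /\
  \int[mu]_(t in D) (\sum_(p <- s) w p * q p t) =
  \sum_(p <- s) w p * \int[mu]_(t in D) q p t.
Proof.
move=> mD qi; elim: s => [|p s [IH1 IH2]].
  rewrite big_nil; under [X in EFin \o X]eq_fun do rewrite big_nil.
  split; first exact: integrable0.
  by rewrite /Rintegral; under eq_integral do rewrite big_nil; rewrite integral0.
have i1 : mu.-integrable D (EFin \o (fun t => w p * q p t)).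
  exact: (integrableZl mD (w p) (qi p)).
have E t : \sum_(p0 <- p :: s) w p0 * q p0 t = w p * q p t + \sum_(p0 <- s) w p0 * q p0 t.
  by rewrite big_cons.
under [X in EFin \o X]eq_fun do rewrite E.
split; first exact: (integrableD mD i1 IH1).
under eq_Rintegral do rewrite E.
by rewrite RintegralD// IH2 big_cons RintegralZl.
Qed.

End RealIntegrals.

#[global] Instance lebesgue_ae_filter (R : realType) :
  Filter (nbhs (almost_everywhere (@lebesgue_measure R))).
Proof. exact: (ae_filter_ringOfSetsType (@lebesgue_measure R)). Qed.

Section LipschitzDerivable.
Variables (R : realType) (N : nat).
Local Notation V := 'rV[R]_N.
Local Notation bV := (borelV R N).
Local Notation mu := (@lebesgue_measure R).
Variables (z : R -> V) (K : R).
Hypothesis zK : forall s t, enorm (z t - z s) <= K * `|t - s|.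

Let zi (i : 'I_N) t : R := z t 0 i.

Let ziK i s t : `|zi i t - zi i s| <= K * `|t - s|.
Proof. by apply: le_trans (zK s t); have := enorm_coord (z t - z s) i; rewrite !mxE. Qed.

Let K0 : 0 <= K.
Proof.
by have := le_trans (enorm_ge0 _) (zK 0 1); rewrite subr0 normr1 mulr1.
Qed.

Let h k : R := k.+1%:R^-1.
Let h0 k : 0 < h k. Proof. by rewrite invr_gt0. Qed.

Let mzi i : measurable_fun [set: R] (zi i).
Proof. by apply: continuous_measurable_fun; exact: lipschitz_continuous (ziK i). Qed.

Section Local.
Variable T : R.
Hypothesis T0 : 0 < T.
Let D : set R := `[- T, T]%classic.
Let mD : measurable D. Proof. exact: measurable_itv. Qed.
Let q k t : V := (h k)^-1 *: (z (t + h k) - z t).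
Let f k t : V := \1_D t *: q k t.

Let mf k : measurable_fun [set: R] (f k : R -> bV).
Proof.
apply: measurable_rowV => i; under eq_fun do rewrite !mxE.
apply: measurable_funM; first exact: (measurable_indic mD).
apply: measurable_funM => //; apply: measurable_funB; last exact: mzi.
apply: (measurableT_comp (mzi i)); exact: measurable_funD.
Qed.

Let qK k t : enorm (q k t) <= K.
Proof.
rewrite /q enormZ gtr0_norm ?invr_gt0// ler_pdivrMl//.
by apply: le_trans (zK _ _) _; rewrite addrAC subrr add0r gtr0_norm// mulrC.
Qed.

Let fK k t : enorm (f k t) <= K.
Proof.
rewrite /f enormZ indicE; case: (_ \in _); rewrite ?normr1 ?mul1r//.
by rewrite normr0 mul0r.
Qed.

Let fint k : (\int[mu]_t (sqn (f k t))%:E <= (K ^+ 2 * (T + T))%:E)%E.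
Proof.
apply: (@le_trans _ _ (\int[mu]_t ((K ^+ 2)%:E * (\1_D t)%:E))%E).
  apply: ge0_le_integral => //.
  - by move=> t _; rewrite lee_fin sqn_ge0.
  - by apply/measurable_EFinP; exact: (measurable_sqn (mf k)).
  - by apply: emeasurable_funM => //; apply/measurable_EFinP; exact: (measurable_indic mD).
  - move=> t _; rewrite lee_fin /f sqnZ -enormK indicE; case: (_ \in _).
      by rewrite expr1n mul1r mulr1 ler_pXn2r ?nnegrE ?enorm_ge0.
    by rewrite expr0n mul0r mulr0.
rewrite ge0_integralZl//; last 2 first.
- by apply/measurable_EFinP; exact: (measurable_indic mD).
- by rewrite lee_fin sqr_ge0.
rewrite integral_indic// setIT (EFinM (K ^+ 2)) lee_wpmul2l ?lee_fin ?sqr_ge0//.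
by have := @lebesgue_measure_itv R `[- T, T]; rewrite /= lte_fin gtrN// -EFinB opprK => <-.
Qed.

Let measurable_bD x : measurable (`[- T, x]%classic : set R). Proof. by []. Qed.

Let cstint x : mu.-integrable `[- T, x] (EFin \o (fun=> K)).
Proof.
apply: continuous_compact_integrable; first exact: segment_compact.
by apply: continuous_subspaceT => y; exact: cvg_cst.
Qed.

Let iD i g x : measurable_fun [set: R] (g : R -> bV) -> {ae mu, forall t, enorm (g t) <= K} ->
  mu.-integrable `[- T, x] (EFin \o (fun t => g t 0 i)).
Proof.
move=> mg gK.
have mgi : measurable_fun `[- T, x]%classic (fun t => (g t 0 i)%:E).
  by apply/measurable_EFinP; apply: measurable_funTS; exact: measurable_coord.
have [] := @dominated_convergence _ _ R mu `[- T, x]%classic (measurable_bD x)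
    (fun=> (fun t => (g t 0 i)%:E)) (fun t => (g t 0 i)%:E) (fun=> K%:E) => //.
- by apply: aeW => t _; exact: cvg_cst.
- apply: filterS gK => t gt _ _; rewrite lee_fin; apply: le_trans gt; exact: enorm_coord.
Qed.

(** Rademacher's theorem in one variable. Mazur combinations of the difference quotients converge
    almost everywhere to some [g]; only steps [h k] with [k >= n] enter the [n]-th combination, so
    the integrals converge to the increments of [z]. Hence [z] is a primitive of [g], and Lebesgue's
    differentiation theorem applies. *)
Lemma lipschitz_ae_derivable_itv :
  {ae mu, forall t, - T < t -> t < T -> derivable z t 1}.
Proof.
have [s [sv [g [mg sg]]]] := @mazur R N _ (measurableTypeR R) mu f _ mf fint.
have sE n t i : (wcomb (s n) (f ^~ t)) 0 i = \sum_(p <- s n) p.1 * f p.2 t 0 i.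
  by rewrite /wcomb summxE; apply: eq_bigr => p _; rewrite mxE.
have combK n t : enorm (wcomb (s n) (f ^~ t)) <= K.
  rewrite -[X in enorm X]subr0; apply: (enorm_wcomb_le (sv n)) => k _.
  by rewrite subr0.
have gK : {ae mu, forall t, enorm (g t) <= K}.
  apply: filterS sg => t /(cvg_comp _ _) /(_ (@enorm_continuous R N (g t))) gt.
  rewrite -subr_ge0; apply: (@cvg_ge0 _ _ \oo _ (fun n => K - enorm (wcomb (s n) (f ^~ t)))).
    by apply: nearW => n; rewrite subr_ge0.
  by apply: cvgB => //; exact: cvg_cst.
have key i x : - T < x -> x < T -> \int[mu]_(t in `[- T, x]) g t 0 i = zi i x - zi i (- T).
  move=> Tx xT.
  have mDx : measurable (`[- T, x]%classic : set R) by [].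
  have H1 n : measurable_fun `[- T, x]%classic (fun t => (wcomb (s n) (f ^~ t) 0 i)%:E).
    apply/measurable_EFinP; apply: measurable_funTS.
    apply: (@measurable_coord R N _ R (fun t => wcomb (s n) (f ^~ t))).
    by apply: measurable_vsum => p; exact: measurable_vscale.
  have H2 : measurable_fun `[- T, x]%classic (fun t => (g t 0 i)%:E).
    by apply/measurable_EFinP; apply: measurable_funTS; exact: measurable_coord.
  have H3 : {ae mu, forall t, `[- T, x]%classic t ->
      (wcomb (s n) (f ^~ t) 0 i)%:E @[n --> \oo] --> (g t 0 i)%:E}.
    apply: filterS sg => t gt _; apply: cvg_EFin; first by apply: nearW.
    apply: (cvg_comp (fun n => wcomb (s n) (f ^~ t)) (fun u : V => u 0 i) gt).
    exact: coord_continuous.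
  have H4 : {ae mu, forall t, forall n, `[- T, x]%classic t ->
      (`|(wcomb (s n) (f ^~ t) 0 i)%:E| <= K%:E)%E}.
    by apply: aeW => t n _; rewrite lee_fin; apply: le_trans (combK n t); exact: enorm_coord.
  have [_ _ cv] := @dominated_convergence _ (measurableTypeR R) R mu _ mDx _ _ _ H1 H2 H3 (cstint x) H4.
  have qi k := @diffquot_integral R (zi i) K (ziK i) (h k) _ _ (h0 k) Tx.
  have combE n : (\int[mu]_(t in `[(- T)%R, x]) (wcomb (s n) (f ^~ t) 0 i)%:E)%E =
     (\sum_(p <- s n) p.1 * \int[mu]_(t in `[- T, x]) ((h p.2)^-1 * (zi i (t + h p.2) - zi i t)))%:E.
    have [I1 I2] := @Rintegral_wsum R _ _ mu _ `[- T, x]%classic (s n) (fun p => p.1)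
      (fun p t => (h p.2)^-1 * (zi i (t + h p.2) - zi i t)) (measurable_bD x)
      (fun p => (qi p.2).1).
    rewrite -I2 /Rintegral fineK; last exact: integrable_fin_num.
    apply: eq_integral => t; rewrite inE/= in_itv/= => /andP[Tt tx]; congr EFin.
    rewrite sE; apply: eq_bigr => p _; rewrite /f /q !mxE indicE mem_set ?mul1r//.
    by rewrite /D/= in_itv/= Tt (le_trans tx (ltW xT)).
  pose I k := \int[mu]_(t in `[- T, x]) ((h k)^-1 * (zi i (t + h k) - zi i t)).
  pose c n := \sum_(p <- s n) p.1 * I p.2.
  have cc : c n @[n --> \oo] --> zi i x - zi i (- T).
    apply/cvgrPdist_le => e e0.
    have e1 : 0 < e / (2 * K + 1) by rewrite divr_gt0// ltr_wpDl// mulr_ge0.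
    have [n0 hn0] := natSinv_small e1; exists n0 => // n /= nn.
    have hk k : (n <= k)%N -> 2 * K * h k <= e.
      move=> nk; have := hn0 k (leq_trans nn nk); rewrite ler_pdivlMr; last by rewrite ltr_wpDl// mulr_ge0.
      by rewrite -/(h k); have := h0 k; have := K0; nra.
    have hc k : (n <= k)%N -> `| I k - (zi i x - zi i (- T))| <= e.
      by move=> nk; apply: le_trans (qi k).2 (hk k nk).
    rewrite distrC ler_norml lerBrDr lerBlDr; apply/andP; split.
      apply: (@wsum_ge R n (s n) I _ (sv n)) => k /hc; rewrite ler_norml => /andP[? _]; lra.
    apply: (@wsum_le R n (s n) I _ (sv n)) => k /hc; rewrite ler_norml => /andP[_ ?]; lra.
  have gi := iD i x mg gK.
  have cv2 : (c n)%:E @[n --> \oo] --> (\int[mu]_(t in `[(- T)%R, x]) (g t 0 i)%:E)%E.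
    by move: cv; apply: cvg_trans; apply: near_eq_cvg; apply: nearW => n; exact: (combE n).
  have cc' : (c n)%:E @[n --> \oo] --> (zi i x - zi i (- T))%:E.
    by apply: cvg_EFin => //; apply: nearW.
  have := cvg_unique (@ereal_hausdorff R) cv2 cc'.
  by rewrite /Rintegral => ->.
have deri i : {ae mu, forall t, - T < t -> t < T -> derivable (zi i) t 1}.
  have gi := iD i T mg gK.
  have loc := integrable_locally (measurable_itv `[- T, T]) gi.
  (* The fundamental theorem asks for integrability up to every [y], hence the extension of [g] by 0
     outside of [D]. *)
  have int2 y : mu.-integrable `[- T, y] (EFin \o ((fun t => g t 0 i) \_ D)).
    rewrite -restrict_EFin; apply/integrable_restrict => //.
    by apply: integrableS gi => //; exact: measurableI.
  have := @FTC1 R ((fun t => g t 0 i) \_ D) (BLeft (- T)) int2 loc.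
  apply: filterS => t dt Tt tT; have [|d _] := dt; first by rewrite lte_fin.
  have d2 : derivable (zi i - cst (zi i (- T))) t 1.
    apply: near_eq_derivable d; near=> y.
    have Ty : - T < y by near: y; exact: lt_nbhsr.
    have yT : y < T by near: y; exact: lt_nbhsl.
    rewrite -[RHS](key i y Ty yT); apply: eq_Rintegral => r.
    rewrite inE/= in_itv/= => /andP[Tr ry]; rewrite patchE mem_set//.
    by rewrite /D/= in_itv/= Tr (le_trans ry (ltW yT)).
  have -> : zi i = (zi i - cst (zi i (- T))) + cst (zi i (- T)) by rewrite subrK.
  exact: derivableD.
have : {ae mu, forall t, forall i, - T < t -> t < T -> derivable (zi i) t 1}.
  exact: filter_forall.
apply: filterS => t h1 tT Tt; apply/derivable_mxP => i j; rewrite (ord1 i).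
exact: h1.
Unshelve. all: by end_near. Qed.

End Local.

Lemma lipschitz_ae_derivable : {ae mu, forall t, derivable z t 1}.
Proof.
have : {ae mu, forall t, forall n : nat, - n.+1%:R < t -> t < n.+1%:R -> derivable z t 1}.
  apply/ae_foralln => n.
  by apply: lipschitz_ae_derivable_itv; rewrite ltr0n.
apply: filterS => t ht.
have tn : `|t| < (Num.bound `|t|).+1%:R.
  by apply: lt_le_trans (archi_boundP (normr_ge0 _)) _; rewrite ler_nat.
apply: (ht (Num.bound `|t|)); last by rewrite (le_lt_trans _ tn)// ler_norm.
by rewrite ltrNl (le_lt_trans _ tn)// -normrN ler_norm.
Qed.

End LipschitzDerivable.

(** * Absolutely continuous functions with nonpositive derivative *)

Section AbsolutelyContinuousDecrease.
Variables (R : realType) (phi : R -> R) (t : R).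
Local Notation mu := (@lebesgue_measure R).
Hypothesis t0 : 0 <= t.
Hypothesis ac : forall e : R, 0 < e -> exists2 dlt, 0 < dlt &
  forall (n : nat) (a b : 'I_n -> R),
    (forall i, [/\ 0 <= a i, a i <= b i & b i <= t]) ->
    (forall i j, i != j -> b i <= a j \/ b j <= a i) ->
    \sum_i (b i - a i) < dlt -> \sum_i `|phi (b i) - phi (a i)| < e.
Hypothesis good : {ae mu, forall s, 0 <= s -> exists2 L : R, L <= 0 &
  h^-1 * (phi (h + s) - phi s) @[h --> 0^'] --> L}.

Let list_sum (l : seq (R * R)) := \sum_(p <- l) (phi p.2 - phi p.1).

(** Absolute continuity restated for lists ordered from right to left, which grow by [cons] when a
    new interval is added on the right. *)
Let ac_list e dlt : (forall (n : nat) (a b : 'I_n -> R),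
    (forall i, [/\ 0 <= a i, a i <= b i & b i <= t]) ->
    (forall i j, i != j -> b i <= a j \/ b j <= a i) ->
    \sum_i (b i - a i) < dlt -> \sum_i `|phi (b i) - phi (a i)| < e) ->
  forall l : seq (R * R), (forall p, p \in l -> [/\ 0 <= p.1, p.1 <= p.2 & p.2 <= t]) ->
  pairwise (fun p q => q.2 <= p.1) l -> \sum_(p <- l) (p.2 - p.1) < dlt ->
  list_sum l <= e.
Proof.
move=> h l l1 l2 l3.
pose a (i : 'I_(size l)) := (nth (0, 0) l i).1.
pose b (i : 'I_(size l)) := (nth (0, 0) l i).2.
have S (f : R * R -> R) : \sum_(p <- l) f p = \sum_(i < size l) f (nth (0, 0) l i).
  by rewrite (big_nth (0, 0)) big_mkord.
rewrite /list_sum S; apply: le_trans (ltW (h _ a b _ _ _)).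
- by apply: ler_sum => i _; exact: ler_norm.
- by move=> i; apply: l1; rewrite mem_nth.
- move=> i j ij; have /(pairwiseP (0, 0)) pw := l2.
  move: ij; rewrite neq_ltn => /orP[] ij.
    by right; exact: (pw i j (ltn_ord i) (ltn_ord j) ij).
  by left; exact: (pw j i (ltn_ord j) (ltn_ord i) ij).
- by move: l3; rewrite S.
Qed.

(* Cousin's argument: away from a null set [phi] grows at rate at most [e],
   and the null set is covered by an open set of small measure, on which
   absolute continuity applies. *)
Lemma ac_nonincreasing : phi t <= phi 0.
Proof.
apply/ler_addgt0Pr => e e0.
pose e1 := e / (t + 1).
have e10 : 0 < e1 by rewrite divr_gt0// ltr_wpDl.
have [dlt dlt0 /ac_list acl] := ac e10.
have [E [mE E0 Ebad]] := good.
have [U [oU EU muU]] : exists U : set R, [/\ open U, E `<=` U & (mu (U `\` E) < dlt%:E)%E].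
  by apply: lebesgue_regularity_outer => //; rewrite [X in (X < _)%E]E0.
have mU : measurable U by exact: open_measurable.
have {}muU : (mu U < dlt%:E)%E.
  apply: le_lt_trans muU; rewrite -{1}(setDUK EU).
  apply: le_trans (@measureU2 _ (measurableTypeR R) R mu E (U `\` E) mE (measurableD mU mE)) _.
  by rewrite [X in (X + _)%E]E0 add0e.
pose g r := fine (mu (U `&` `[0, r]%classic)).
have mUi r : measurable (U `&` `[0, r]%classic) by exact: measurableI.
have gfin r : mu (U `&` `[0, r]%classic) \is a fin_num.
  rewrite ge0_fin_numE//; apply: le_lt_trans (lt_trans muU (ltry _)).
  by apply: le_measure; rewrite ?inE//; exact: mUi.
have gU r : g r < dlt.
  rewrite -lte_fin fineK//; apply: le_lt_trans muU.
  by apply: le_measure; rewrite ?inE//; exact: mUi.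
have g0 r : 0 <= g r by rewrite fine_ge0.
have gnd r r' : r <= r' -> g r <= g r'.
  move=> rr'; rewrite fine_le//; apply: le_measure; rewrite ?inE; [exact: mUi|exact: mUi|].
  apply: setIS => x /=; rewrite !in_itv/= => /andP[-> /le_trans]; exact.
have gadd r r' : 0 <= r -> r <= r' -> `[r, r']%classic `<=` U -> g r + (r' - r) <= g r'.
  move=> r0 rr' sU; rewrite -lee_fin EFinD !fineK//.
  have -> : (r' - r)%:E = mu `]r, r']%classic.
    have := @lebesgue_measure_itv R `]r, r']; rewrite /= lte_fin => ->.
    by case: ltP rr' => [_ _|h1 h2]; [rewrite EFinB|rewrite (le_anti (andb_true_intro (conj h1 h2))) subrr].
  rewrite -measureU//; [|exact: mUi|]; last first.
    apply/seteqP; split => // x [[_ /=]]; rewrite !in_itv/= => /andP[_ xr] /andP[rx _].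
    by have := lt_le_trans rx xr; rewrite ltxx.
  apply: le_measure; rewrite ?inE; [|exact: mUi|].
    by apply: measurableU; first exact: mUi.
  move=> x [[Ux]|] /=; rewrite !in_itv/= => /andP[h1 h2].
    by split => //; rewrite h1 (le_trans h2).
  by split; [apply: sU; rewrite /= in_itv/= (ltW h1)|rewrite h2 (le_trans r0 (ltW h1))].
(* The property propagated along [[0, t]]: outside of the listed intervals [phi] grows at rate at
   most [e1]. The intervals have been crossed inside [U], and their total length is kept below the
   measure of [U] in [[0, r]], so that absolute continuity bounds their contribution at the end. *)
pose P r := exists l : seq (R * R),
  [/\ forall p, p \in l -> [/\ 0 <= p.1, p.1 <= p.2 & p.2 <= r],
      pairwise (fun p q => q.2 <= p.1) l,
      \sum_(p <- l) (p.2 - p.1) <= g r &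
      phi r - phi 0 <= e1 * r + list_sum l].
have ext_good r r' : 0 <= r -> r <= r' -> P r -> phi r' - phi r <= e1 * (r' - r) -> P r'.
  move=> r0 rr' [l [l1 l2 l3 l4]] h; exists l; split => //.
  - by move=> p /l1[? ? ?]; split => //; exact: le_trans rr'.
  - by apply: le_trans l3 _; exact: gnd.
  - lra.
have ext_bad r r' : 0 <= r -> r <= r' -> P r -> `[r, r']%classic `<=` U -> P r'.
  move=> r0 rr' [l [l1 l2 l3 l4]] sU; exists ((r, r') :: l); split => //.
  - move=> p; rewrite inE => /predU1P[->//|/l1[? ? ?]]; split => //; exact: le_trans rr'.
  - by rewrite /= l2 andbT; apply/allP => p /l1[].
  - by rewrite big_cons/=; have := gadd _ _ r0 rr' sU; lra.
  - rewrite /list_sum big_cons/= -/(list_sum l).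
    have : e1 * r <= e1 * r' by rewrite ler_pM2l.
    lra.
have local s : 0 <= s -> exists2 dl, 0 < dl & forall r r', 0 <= r -> s - dl < r -> r <= s ->
    s <= r' -> r' < s + dl -> P r -> P r'.
  move=> s0; have [Us|nUs] := pselect (U s).
    have /nbhs_ballP[dl /= dl0 dlU] : nbhs s U by rewrite nbhsE; exists U.
    exists dl => // r r' r0 h1 h2 h3 h4 Pr; apply: (ext_bad r) => //; first exact: le_trans h3.
    move=> x /=; rewrite in_itv/= => /andP[rx xr]; apply: dlU.
    by rewrite /ball/= ltr_norml; apply/andP; split; lra.
  have : ~ E s by move=> /EU.
  move=> /(contra_not (Ebad s)) /contrapT /(_ s0)[L L0 /cvgrPdist_le /(_ _ e10)].
  rewrite /dnbhs near_withinE => /nbhs_ballP[dl /= dl0 hdl].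
  have q h : h != 0 -> `|h| < dl -> h^-1 * (phi (h + s) - phi s) <= e1.
    move=> h0 hd; have := hdl h; rewrite /ball/= sub0r normrN => /(_ hd h0).
    by rewrite ler_norml => /andP[k1 k2]; lra.
  exists dl => // r r' r0 h1 h2 h3 h4 Pr; apply: (ext_good r) => //; first exact: le_trans h3.
  have k1 : phi s - phi r <= e1 * (s - r).
    have [->|rs] := eqVneq r s; first by rewrite !subrr mulr0.
    have rs0 : 0 < s - r by rewrite subr_gt0 lt_neqAle rs.
    have := q (r - s); rewrite subrK -(opprB s r) oppr_eq0 lt0r_neq0// normrN gtr0_norm//.
    rewrite invrN mulNr -mulrN opprB ler_pdivrMl// mulrC.
    by apply => //; lra.
  have k2 : phi r' - phi s <= e1 * (r' - s).
    have [->|rs] := eqVneq r' s; first by rewrite !subrr mulr0.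
    have rs0 : 0 < r' - s by rewrite subr_gt0 lt_neqAle eq_sym rs.
    have := q (r' - s); rewrite subrK lt0r_neq0// gtr0_norm// ler_pdivrMl// mulrC.
    by apply => //; lra.
  lra.
pose S := [set r | [/\ 0 <= r, r <= t & P r]].
have S0 : S 0.
  split => //; exists [::]; split => //; first by rewrite big_nil.
  by rewrite /list_sum big_nil subrr mulr0 addr0.
have hS : has_sup S by split; [exists 0|exists t => r []].
have c0 : 0 <= sup S by apply: ub_le_sup => //; case: hS.
have ct : sup S <= t by apply: ge_sup; [exists 0|move=> r []].
(* The local step at the supremum carries [P] from a point just below it to a point above it, so the
   supremum can only be [t]. *)
have Pt : P t.
  have [dl dl0 hdl] := local _ c0.
  have [r [r0 rt Pr] hr] := sup_adherent dl0 hS.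
  have rc : r <= sup S by apply: ub_le_sup; [case: hS|].
  have [tc|tc] := leP t (sup S + dl / 2).
    by apply: (hdl r) => //; lra.
  have : S (sup S + dl / 2).
    split; [lra|exact: ltW|apply: (hdl r) => //; lra].
  move=> /(ub_le_sup (proj2 hS)); lra.
have [l [l1 l2 l3 l4]] := Pt.
have := acl l l1 l2 (le_lt_trans l3 (gU t)).
have : e1 * t + e1 = e by rewrite /e1; field; rewrite gt_eqF// ltr_wpDl.
lra.
Qed.

End AbsolutelyContinuousDecrease.

(** * Strong solutions: contraction and characterisation by inequalities *)

Section StrongSolutions.
Variables (R : realType) (N : nat) (T : operator R N).
Local Notation V := 'rV[R]_N.
Local Notation mu := (@lebesgue_measure R).

Lemma derivable_quotient (z : R -> V) s : derivable z s 1 ->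
  h^-1 *: (z (h + s) - z s) @[h --> 0^'] --> 'D_1 z s.
Proof.
move=> dz.
have -> : (fun h => h^-1 *: (z (h + s) - z s)) =
          (fun h => h^-1 *: ((z \o shift s) (h *: 1) - z s)).
  by apply/funext => h; rewrite /= /shift/= scaler1.
exact: dz.
Qed.

Lemma quotient_continuous (z : R -> V) s (l : V) :
  h^-1 *: (z (h + s) - z s) @[h --> 0^'] --> l -> z (h + s) @[h --> 0^'] --> z s.
Proof.
move=> zl; have h0 : (fun h : R => h) @ 0^' --> (0 : R) by exact: (cvg_within _).
have k : h *: (h^-1 *: (z (h + s) - z s)) @[h --> (0 : R)^'] --> (0 : R) *: l.
  exact: cvgZ.
rewrite scale0r in k.
have kc : (fun _ : R => z s) @ 0^' --> z s by exact: cvg_cst.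
have kd : h *: (h^-1 *: (z (h + s) - z s)) + z s @[h --> (0 : R)^'] --> 0 + z s.
  exact: cvgD.
rewrite add0r in kd; apply: cvg_trans kd.
apply: near_eq_cvg; near=> h; have hn0 : h != 0 by near: h; exact: nbhs_dnbhs_neq.
by rewrite /= scalerA divff// scale1r subrK.
Unshelve. all: by end_near. Qed.

Lemma sqn_quotient (u : R -> V) s (l : V) : h^-1 *: (u (h + s) - u s) @[h --> 0^'] --> l ->
  h^-1 * (sqn (u (h + s)) - sqn (u s)) @[h --> 0^'] --> 2 * dotv l (u s).
Proof.
move=> ul.
have -> : 2 * dotv l (u s) = dotv l (u s + u s) by rewrite dotvDr; ring.
have -> : (fun h => h^-1 * (sqn (u (h + s)) - sqn (u s))) =
    (fun h => dotv (h^-1 *: (u (h + s) - u s)) (u (h + s) + u s)).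
  by apply/funext => h; rewrite /sqn !dotE (dotvC (u s) (u (h + s))); ring.
apply: cvg_dotv => //; apply: cvgD; last exact: cvg_cst.
exact: quotient_continuous ul.
Qed.

Lemma abs_continuous1 (z : R -> V) t e : abs_continuous z -> 0 <= t -> 0 < e ->
  exists2 dlt, 0 < dlt & forall a b, 0 <= a -> a <= b -> b <= t -> b - a < dlt ->
    enorm (z b - z a) < e.
Proof.
move=> zac t0 e0; have [dlt dlt0 h] := zac t t0 e e0.
exists dlt => // a b a0 ab bt bad.
have := h 1%N (fun=> a) (fun=> b); rewrite !big_ord1; apply => //.
by move=> i j; rewrite (ord1 i) (ord1 j) eqxx.
Qed.

Lemma abs_continuous_bounded (z : R -> V) t : abs_continuous z -> 0 <= t ->
  exists M : R, forall s, 0 <= s -> s <= t -> enorm (z s) <= M.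
Proof.
move=> zac t0; have [dlt dlt0 h] := abs_continuous1 zac t0 ltr01.
have d2 : 0 < dlt / 2 by rewrite divr_gt0.
have step (k : nat) s : 0 <= s -> s <= t -> s <= k%:R * (dlt / 2) -> enorm (z s - z 0) <= k%:R.
  elim: k s => [|k IH] s s0 st.
    rewrite mul0r => s0'; have -> : s = 0 by apply/le_anti; rewrite s0 s0'.
    by rewrite subrr enorm0.
  rewrite -natr1 mulrDl mul1r => sk.
  have m0 : 0 <= Num.max 0 (s - dlt / 2) by rewrite le_max lexx.
  have ms : Num.max 0 (s - dlt / 2) <= s by rewrite ge_max s0; lra.
  apply: le_trans (enormD3 _ _ (z (Num.max 0 (s - dlt / 2)))) _.
  rewrite addrC; apply: lerD.
    apply: IH => //; first exact: le_trans st.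
    by rewrite ge_max (mulr_ge0 (ler0n _ _) (ltW d2)); lra.
  apply: ltW; apply: h => //.
  have : s - dlt / 2 <= Num.max 0 (s - dlt / 2) by rewrite le_max lexx orbT.
  lra.
exists (enorm (z 0) + (Num.bound (t / (dlt / 2)))%:R) => s s0 st.
apply: le_trans (enorm_sub_ge _ (z 0)) _; rewrite addrC lerD2l.
apply: step => //; apply: le_trans st _.
rewrite -ler_pdivrMr//; apply: ltW; apply: archi_boundP.
by rewrite divr_ge0// ltW.
Qed.

(** The function [sqn (z - w)] is absolutely continuous on [[0, t]], both solutions being bounded
    there, and its derivative [2 <z' - w', z - w>] is nonpositive almost everywhere by
    monotonicity. *)
Lemma solutions_contract a b z w t : monotone_op T ->
  is_solution T a z -> is_solution T b w -> 0 <= t ->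
  enorm (z t - w t) <= enorm (a - b).
Proof.
move=> mT [<- zac zT] [<- wac wT] t0.
rewrite ler_enorm_sqn.
pose phi s := sqn (z s - w s).
suff : phi t <= phi 0 by [].
have [M1 hM1] := abs_continuous_bounded zac t0.
have [M2 hM2] := abs_continuous_bounded wac t0.
pose M := 2 * (M1 + M2) + 1.
have M10 : 0 <= M1 by apply: le_trans (enorm_ge0 _) (hM1 0 _ _).
have M20 : 0 <= M2 by apply: le_trans (enorm_ge0 _) (hM2 0 _ _).
have M0 : 0 < M by rewrite /M; lra.
have dphi r s : 0 <= r -> r <= t -> 0 <= s -> s <= t ->
    `|phi r - phi s| <= (enorm (z r - z s) + enorm (w r - w s)) * M.
  move=> r0 rt s0 st.
  have -> : phi r - phi s = dotv ((z r - z s) - (w r - w s)) ((z r + z s) - (w r + w s)).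
    rewrite /phi /sqn !dotE; move: (z r) (z s) (w r) (w s) => A B C D.
    rewrite (dotvC C A) (dotvC D B) (dotvC B A) (dotvC D C) (dotvC C B) (dotvC D A); ring.
  apply: le_trans (dotv_normle _ _) _; apply: ler_pM; rewrite ?enorm_ge0//.
    by apply: le_trans (enormD _ _) _; rewrite enormN.
  apply: le_trans (enormD _ _) _; rewrite enormN.
  have := enormD (z r) (z s); have := enormD (w r) (w s).
  have := hM1 r r0 rt; have := hM1 s s0 st; have := hM2 r r0 rt; have := hM2 s s0 st.
  rewrite /M; lra.
apply: ac_nonincreasing => //.
  move=> e e0; have e1 : 0 < e / (2 * M) by rewrite divr_gt0 ?mulr_gt0.
  have [d1 d10 h1] := zac t t0 _ e1; have [d2 d20 h2] := wac t t0 _ e1.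
  exists (Num.min d1 d2); first by rewrite lt_min d10 d20.
  move=> n aa bb H1 H2; rewrite lt_min => /andP[k1 k2].
  have := h1 n aa bb H1 H2 k1; have := h2 n aa bb H1 H2 k2 => l2 l1.
  apply: (@le_lt_trans _ _ ((\sum_i enorm (z (bb i) - z (aa i)) + \sum_i enorm (w (bb i) - w (aa i))) * M)).
    rewrite -big_split/= mulr_suml; apply: ler_sum => i _.
    have [p1 p2 p3] := H1 i.
    apply: dphi => //; [exact: le_trans p2|exact: le_trans p3].
  rewrite -ltr_pdivlMr//.
  have -> : e / M = e / (2 * M) + e / (2 * M) by field; rewrite gt_eqF.
  exact: ltrD.
apply: filterS2 zT wT => s hz hw s0.
have [dz Tz] := hz s0; have [dw Tw] := hw s0.
exists (2 * dotv ('D_1 z s - 'D_1 w s) (z s - w s)).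
  have := mT _ _ _ _ Tz Tw; rewrite -opprD dotvNl oppr_ge0.
  by move=> k; rewrite pmulr_rle0.
apply: (@sqn_quotient (fun s => z s - w s)).
have -> : (fun h => h^-1 *: (z (h + s) - w (h + s) - (z s - w s))) =
   (fun h => h^-1 *: (z (h + s) - z s) - h^-1 *: (w (h + s) - w s)).
  by apply/funext => h; apply/rowP => i; rewrite !mxE; ring.
by apply: cvgB; exact: derivable_quotient.
Qed.

Lemma lipschitz_abs_continuous (z : R -> V) K :
  (forall s t, enorm (z t - z s) <= K * `|t - s|) -> abs_continuous z.
Proof.
move=> zK t t0 e e0.
have K0 : 0 <= K by have := le_trans (enorm_ge0 _) (zK 0 1); rewrite subr0 normr1 mulr1.
exists (e / (K + 1)); first by rewrite divr_gt0// ltr_wpDl.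
move=> n a b h _; rewrite ltr_pdivlMr ?ltr_wpDl// => hs.
apply: le_lt_trans hs.
apply: (@le_trans _ _ (\sum_i (b i - a i) * K)).
  apply: ler_sum => i _; have [_ ab _] := h i.
  by apply: le_trans (zK _ _) _; rewrite ger0_norm ?subr_ge0// mulrC.
rewrite -mulr_suml ler_wpM2l ?lerDl//.
by apply: sumr_ge0 => i _; have [_ ab _] := h i; rewrite subr_ge0.
Qed.

Lemma cvg_natSinv_dnbhs : n.+1%:R^-1 @[n --> \oo] --> (0 : R)^'.
Proof.
move=> A; rewrite /dnbhs /within/= => hA.
have : \forall n \near \oo, (n.+1%:R^-1 != 0 :> R -> A n.+1%:R^-1) by exact: (@cvg_natSinv R _ hA).
move=> h; suff : \forall n \near \oo, A n.+1%:R^-1 by [].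
by apply: filterS h => n; apply; rewrite invr_eq0.
Qed.

(* At a point of differentiability the inequality says that [- z'] is
   monotonically related to the graph of [T]. *)
Lemma integral_solution_strong (z : R -> V) K : maximal_monotone T ->
  (forall s t, enorm (z t - z s) <= K * `|t - s|) ->
  (forall y v, T y v -> exists C : R, forall s t, 0 <= s -> s <= t -> t <= s + 1 ->
     sqn (z t - y) - sqn (z s - y) <= 2 * (t - s) * dotv v (y - z s) + C * (t - s) ^+ 2) ->
  is_solution T (z 0) z.
Proof.
move=> maxT zK hz; split => //; first exact: lipschitz_abs_continuous zK.
have := lipschitz_ae_derivable zK; apply: filterS => t dz t0; split => //.
apply: maximal_in => // y v Tyv; have [C hC] := hz y v Tyv.
have q := cvg_comp _ _ cvg_natSinv_dnbhs (derivable_quotient dz).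
pose h n : R := n.+1%:R^-1.
have h0 n : 0 < h n by rewrite invr_gt0.
have h1 n : h n <= 1 by rewrite invf_le1// ler1n.
pose w n := (h n)^-1 *: (z (h n + t) - z t).
have {}q : w n @[n --> \oo] --> 'D_1 z t by exact: q.
have hw n : z (h n + t) - z t = h n *: w n.
  by rewrite scalerA divff ?gt_eqF// scale1r.
have ineq n : 0 <= 2 * dotv v (y - z t) + h n * C - (2 * dotv (w n) (z t - y) + h n * sqn (w n)).
  have k1 : t <= h n + t by rewrite lerDr ltW.
  have k2 : h n + t <= t + 1 by rewrite addrC lerD2l.
  have := hC t (h n + t) t0 k1 k2; rewrite addrK.
  have -> : z (h n + t) - y = h n *: w n + (z t - y).
    by rewrite -hw addrA subrK.
  rewrite -(pmulr_rge0 _ (h0 n)); move: (z t - y) (y - z t) (w n) (h n) => A B D E.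
  by rewrite /sqn !dotE (dotvC A D); nra.
have : 0 <= 2 * dotv v (y - z t) + 0 * C - (2 * dotv ('D_1 z t) (z t - y) + 0 * sqn ('D_1 z t)).
  pose F n := 2 * dotv v (y - z t) + h n * C - (2 * dotv (w n) (z t - y) + h n * sqn (w n)).
  apply: (@cvg_ge0 R nat \oo _ F); first by apply: nearW => n; exact: ineq.
  apply: cvgB; apply: cvgD.
  - exact: cvg_cst.
  - by apply: cvgM; [exact: cvg_natSinv|exact: cvg_cst].
  - by apply: cvgMr; apply: cvg_dotv => //; exact: cvg_cst.
  - by apply: cvgM; [exact: cvg_natSinv|exact: cvg_sqn].
rewrite !mul0r !addr0 -(opprB y (z t)) !dotE; lra.
Qed.

End StrongSolutions.

(** Closed balls are compact. This replaces the extraction of subsequences in the two constructions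
    of solutions below. *)
Lemma ultra_bounded_cvg (R : realType) N (I : Type) (U : set_system I)
    (f : I -> 'rV[R]_N) c : UltraFilter U ->
  (\forall i \near U, enorm (f i) <= c) -> exists l : 'rV[R]_N, f i @[i --> U] --> l.
Proof.
move=> UU hf.
pose K : set 'rV[R]_N := [set v | enorm v <= c].
have cK : compact K.
  apply: bounded_closed_compact.
    exists c; split; first exact: num_real.
    by move=> M cM v /= vc; apply: le_trans (normr_le_enorm v) _; exact: le_trans vc (ltW cM).
  move=> x /closure_enormP hx; apply/ler_addgt0Pr => e e0.
  have [y Ky yx] := hx e e0; apply: le_trans (enorm_sub_ge _ y) _.
  by rewrite addrC lerD.
have [p [_ clp]] := cK (f @ U) _ hf.
exists p => B hB.
have [//|nB] := in_ultra_setVsetC (f @^-1` B) UU.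
by have [x [nBx Bx]] := clp (~` B) B nB hB.
Qed.

(** * Existence of the flow by the implicit Euler scheme *)

Section EulerFlow.
Variables (R : realType) (N : nat) (T : operator R N).
Local Notation V := 'rV[R]_N.
Hypothesis maxT : maximal_monotone T.

Let h k : R := k.+1%:R^-1.
Let h0 k : 0 < h k. Proof. by rewrite invr_gt0. Qed.
Let E k : V -> V := resolvent (h k) T.

Let iter_nonexp k n x y : enorm (iter n (E k) x - iter n (E k) y) <= enorm (x - y).
Proof. by elim: n => //= n; apply: le_trans; exact: resolvent_nonexp. Qed.

Let iter_move k m y a : T y a -> enorm (iter m (E k) y - y) <= m%:R * h k * enorm a.
Proof.
move=> Ta; elim: m => [|m IH]; first by rewrite subrr enorm0 !mul0r.
rewrite iterSr; apply: le_trans (enormD3 _ _ (iter m (E k) y)) _.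
rewrite -natr1 !mulrDl mul1r addrC lerD//.
by apply: le_trans (iter_nonexp _ _ _ _) _; exact: resolvent_dist.
Qed.

Let iter_move2 k n m y a : T y a ->
  enorm (iter (n + m) (E k) y - iter n (E k) y) <= m%:R * h k * enorm a.
Proof.
by move=> Ta; rewrite iterD; apply: le_trans (iter_nonexp _ _ _ _) _; exact: iter_move.
Qed.

(** One backward step from [x1] to [x2] satisfies [|x2 - y|^2 - |x1 - y|^2 <= 2 h <v, y - x2>].
    Replacing [x2] by the starting point [x] costs [|v|] times the distance travelled, at most
    [m h |a|] after [m] steps; this produces the quadratic term. *)
Let iter_ineq k n m z a y v : T z a -> T y v ->
  sqn (iter (n + m) (E k) z - y) - sqn (iter n (E k) z - y) <=
  2 * (m%:R * h k) * dotv v (y - iter n (E k) z) +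
  2 * enorm v * enorm a * (m%:R * h k) ^+ 2.
Proof.
move=> Ta Tv; set x := iter n (E k) z.
elim: m => [|m IH]; first by rewrite addn0 !mul0r subrr expr0n !mulr0 mul0r addr0.
rewrite addnS iterS; set x1 := iter (n + m) (E k) z in IH *.
have d1 : enorm (E k x1 - x) <= m.+1%:R * h k * enorm a.
  by rewrite /x1 /x -iterS -addnS; exact: iter_move2.
have mono := maximal_op_monotone maxT (yosida_in maxT (h0 k) x1) Tv.
have Ex : E k x1 = resolvent (h k) T x1 by [].
rewrite -Ex in mono.
have hy : x1 = E k x1 + h k *: yosida (h k) T x1 by exact: resolventE.
move: (yosida (h k) T x1) hy mono => q hy mono.
have s1 : sqn (E k x1 - y) - sqn (x1 - y) <= 2 * h k * dotv v (y - E k x1).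
  rewrite {2}hy; have := sqn_ge0 q; have := h0 k; move: mono.
  move: (E k x1) => e; rewrite /sqn !dotE (dotvC y e) (dotvC q e) (dotvC q y).
  nra.
have s2 : dotv v (y - E k x1) <= dotv v (y - x) + enorm v * (m.+1%:R * h k * enorm a).
  have -> : y - E k x1 = (y - x) + (x - E k x1) by rewrite addrA subrK.
  rewrite dotvDr lerD2l; apply: le_trans (dotv_le _ _) _.
  by rewrite ler_wpM2l ?enorm_ge0// enormB.
have h00 := h0 k; have va : 0 <= enorm v * enorm a by rewrite mulr_ge0 ?enorm_ge0.
have s3 : 2 * h k * dotv v (y - E k x1) <=
   2 * h k * (dotv v (y - x) + enorm v * (m.+1%:R * h k * enorm a)).
  by rewrite ler_pM2l// mulr_gt0.
rewrite -!natr1 in s3 *; have m0 : 0 <= m%:R :> R by [].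
move: (sqn (E k x1 - y)) (sqn (x1 - y)) (sqn (x - y)) (dotv v (y - x)) IH s1 s3 => A B C D.
move: (dotv v (y - E k x1)) (h k) h00 (m%:R) m0 va => F H H0 M M0.
move: (enorm v) (enorm a) => v' a' va IH s1 s3.
have key : 0 <= v' * a' * H ^+ 2 * M := mulr_ge0 (mulr_ge0 va (sqr_ge0 H)) M0.
apply: (@le_trans _ _ (2 * H * (D + v' * ((M + 1) * H * a')) + (2 * (M * H) * D + 2 * v' * a' * (M * H) ^+ 2))).
  lra.
rewrite -subr_ge0 (_ : _ - _ = 2 * (v' * a' * H ^+ 2 * M)); last by ring.
by rewrite mulr_ge0.
Qed.

(** No step is made at negative times: the limit path is then Lipschitz on the whole line, as the
    differentiability theorem requires. *)
Let steps k (t : R) : nat := Num.truncn (t * k.+1%:R).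

Let steps_mono k s t : s <= t -> (steps k s <= steps k t)%N.
Proof. by move=> st; apply: le_truncn; rewrite ler_wpM2r. Qed.

Let steps_le k t : (steps k t)%:R * h k <= `|t|.
Proof.
rewrite ler_pdivrMr// /steps; have [t0|t0] := leP 0 t.
  by rewrite ger0_norm// truncn_le mulr_ge0.
have tk : t * k.+1%:R < 0 by rewrite nmulr_rlt0.
by rewrite truncn_floor (leNgt 0) tk/= mulr_ge0.
Qed.

Let steps_itv k t : 0 <= t -> t - h k <= (steps k t)%:R * h k <= t.
Proof.
move=> t0; have /truncn_itv : 0 <= t * k.+1%:R by rewrite mulr_ge0.
rewrite -/(steps k t) => /andP[h1 h2]; rewrite ler_pdivrMr// h1 andbT.
by rewrite lerBlDr -[X in _ + X]mul1r -mulrDl natr1 ler_pdivlMr// ltW.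
Qed.

Variable U : set_system nat.
Hypotheses (UU : UltraFilter U) (Uoo : \oo `<=` U).

(* Along an ultrafilter boundedness suffices for the Euler scheme to converge. *)
Definition euler_flow (x : V) (t : R) : V :=
  lim (iter (Num.truncn (t * k.+1%:R)) (resolvent k.+1%:R^-1 T) x @[k --> U]).

Let flow_cvg x t : iter (steps k t) (E k) x @[k --> U] --> euler_flow x t.
Proof.
have [y [a Ta]] := maximal_dom_neq0 maxT.
have [|l ll] := @ultra_bounded_cvg R N nat U (fun k => iter (steps k t) (E k) x)
   (enorm (x - y) + `|t| * enorm a + enorm y) UU.
  apply: nearW => k; apply: le_trans (enorm_sub_ge _ y) _; rewrite lerD2r.
  apply: le_trans (enormD3 _ _ (iter (steps k t) (E k) y)) _; rewrite lerD//.
  apply: le_trans (iter_move _ _ Ta) _; rewrite ler_wpM2r ?enorm_ge0//.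
rewrite /euler_flow; have -> : lim (iter (steps k t) (E k) x @[k --> U]) = l; last exact: ll.
exact: (cvg_lim (@norm_hausdorff R V) ll).
Qed.

Let h_cvg : h k @[k --> U] --> (0 : R).
Proof. exact: (cvg_trans (cvg_app _ Uoo) (@cvg_natSinv R)). Qed.

Let steps_cvg t : 0 <= t -> (steps k t)%:R * h k @[k --> U] --> t.
Proof.
move=> t0; apply: (@squeeze_cvgr _ _ _ _ (fun k => t - h k) (fun=> t)).
- by apply: nearW => k; exact: steps_itv.
- by rewrite -[X in _ --> X]subr0; apply: cvgB => //; exact: cvg_cst.
- exact: cvg_cst.
Qed.

Let enorm_le_lim (f : nat -> V) l c : f k @[k --> U] --> l ->
  (forall k, enorm (f k) <= c) -> enorm l <= c.
Proof.
move=> fl fc; rewrite -subr_ge0; apply: (@cvg_ge0 _ _ U _ (fun k => c - enorm (f k))).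
  by apply: nearW => k; rewrite subr_ge0.
by apply: cvgB; [exact: cvg_cst|exact: (cvg_comp _ _ fl (@enorm_continuous R N l))].
Qed.

Lemma euler_flow_nonexp x y t : enorm (euler_flow x t - euler_flow y t) <= enorm (x - y).
Proof.
apply: (@enorm_le_lim (fun k => iter (steps k t) (E k) x - iter (steps k t) (E k) y)).
  by apply: cvgB; exact: flow_cvg.
by move=> k; exact: iter_nonexp.
Qed.

Lemma euler_flow0 x : euler_flow x 0 = x.
Proof.
apply: (cvg_lim (@norm_hausdorff R V)).
have -> : (fun k => iter (Num.truncn (0 * k.+1%:R : R)) (resolvent k.+1%:R^-1 T) x) = fun=> x.
  by apply/funext => k; rewrite mul0r truncn0.
exact: cvg_cst.
Qed.

Let steps_diff k s t : s <= t -> (steps k t - steps k s)%:R * h k <= `|t - s| + h k.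
Proof.
move=> st; rewrite natrB ?steps_mono// mulrBl.
have [s0|s0] := leP 0 s.
  have /andP[h1 h2] := steps_itv k s0; have /andP[h3 h4] := steps_itv k (le_trans s0 st).
  by rewrite ger0_norm ?subr_ge0//; lra.
have p0 : 0 <= (steps k s)%:R * h k by rewrite mulr_ge0// ltW.
have h00 := h0 k; rewrite ger0_norm ?subr_ge0//.
have [t0|t0] := leP 0 t; first by have /andP[h3 h4] := steps_itv k t0; lra.
have := steps_mono k (ltW t0); rewrite {2}/steps mul0r truncn0 leqn0 => /eqP->.
by rewrite mul0r; lra.
Qed.

Lemma euler_flow_lipschitz y a s t : T y a ->
  enorm (euler_flow y t - euler_flow y s) <= enorm a * `|t - s|.
Proof.
move=> Ta; wlog st : s t / s <= t.
  move=> H; have [/H//|/ltW /H] := leP s t.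
  by rewrite enormB distrC.
rewrite -subr_ge0.
apply: (@cvg_ge0 _ _ U _ (fun k => enorm a * (`|t - s| + h k) -
   enorm (iter (steps k t) (E k) y - iter (steps k s) (E k) y))).
  apply: nearW => k; rewrite subr_ge0 -(subnKC (steps_mono k st)).
  apply: le_trans (iter_move2 _ _ _ Ta) _; rewrite mulrC ler_wpM2l ?enorm_ge0//.
  exact: steps_diff.
apply: cvgB; last first.
  have cd : iter (steps k t) (E k) y - iter (steps k s) (E k) y @[k --> U] -->
      euler_flow y t - euler_flow y s by apply: cvgB; exact: flow_cvg.
  exact: (cvg_comp _ _ cd (@enorm_continuous R N _)).
apply: cvgMr; rewrite -[X in _ --> X]addr0; apply: cvgD => //; exact: cvg_cst.
Qed.

Lemma euler_flow_ineq z a y v s t : T z a -> T y v -> 0 <= s -> s <= t ->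
  sqn (euler_flow z t - y) - sqn (euler_flow z s - y) <=
  2 * (t - s) * dotv v (y - euler_flow z s) + 2 * enorm v * enorm a * (t - s) ^+ 2.
Proof.
move=> Ta Tv s0 st; have t0 := le_trans s0 st; rewrite -subr_ge0.
pose x k := iter (steps k s) (E k) z; pose x' k := iter (steps k t) (E k) z.
pose m k := (steps k t)%:R * h k - (steps k s)%:R * h k.
have cx : x k @[k --> U] --> euler_flow z s by exact: flow_cvg.
have cx' : x' k @[k --> U] --> euler_flow z t by exact: flow_cvg.
have cm : m k @[k --> U] --> t - s by apply: cvgB; exact: steps_cvg.
apply: (@cvg_ge0 _ _ U _ (fun k => 2 * m k * dotv v (y - x k) +
   2 * enorm v * enorm a * m k ^+ 2 - (sqn (x' k - y) - sqn (x k - y)))).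
  apply: nearW => k; rewrite subr_ge0.
  have := iter_ineq k (steps k s) (steps k t - steps k s) Ta Tv.
  by rewrite subnKC ?steps_mono// natrB ?steps_mono// mulrBl.
have cst_ (c : V) : (fun _ : nat => c) k @[k --> U] --> c by exact: cvg_cst.
apply: cvgB.
  apply: cvgD; last by apply: cvgMr; rewrite !expr2; apply: cvgM.
  by apply: cvgM; [apply: cvgMr|apply: cvg_dotv => //; apply: cvgB].
by apply: cvgB; apply: cvg_sqn; apply: cvgB.
Qed.

Lemma euler_flow_closure x t : closure (dom T) x -> closure (dom T) (euler_flow x t).
Proof.
move=> cx; apply: (@closed_cvg _ _ U _ (fun k => iter (steps k t) (E k) x) (closure (dom T))).
- exact: closed_closure.
- apply: nearW => k; case: (steps k t) => //= n.
  by apply/subset_closure; exact: resolvent_in_dom.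
- exact: flow_cvg.
Qed.

Lemma euler_flow_solution z : dom T z -> is_solution T z (euler_flow z).
Proof.
move=> [a Ta]; rewrite -{1}(euler_flow0 z).
apply: (@integral_solution_strong _ _ _ _ (enorm a)) => //.
  by move=> s t; exact: euler_flow_lipschitz.
move=> y v Tv; exists (2 * enorm v * enorm a) => s t s0 st _.
exact: euler_flow_ineq.
Qed.

Lemma euler_flow_semiflow : is_semiflow T euler_flow.
Proof.
split; first exact: euler_flow_solution.
  by move=> z0 t cz _; exact: euler_flow_closure.
apply/subspace_continuousP => -[x0 t0] [/= cx0 t00].
apply/cvg_enormP => e e0; rewrite near_withinE.
have e4 : 0 < e / 4 by rewrite divr_gt0.
have [y [a Ta] xy] := (closure_enormP _ _).1 cx0 _ e4.
have a1 : 0 < enorm a + 1 by rewrite ltr_wpDl ?enorm_ge0.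
have d0 : 0 < e / (4 * (enorm a + 1)) by rewrite divr_gt0// mulr_gt0.
exists ([set x | enorm (x - x0) <= e / 4], ball t0 (e / (4 * (enorm a + 1)))).
  by split => /=; [exact: near_enorm|exact: nbhsx_ballx].
move=> [x t] /= [xx0]; rewrite /ball/= => tt0 _.
apply: le_trans (enormD3 _ _ (euler_flow x0 t)) _.
have k1 := le_trans (euler_flow_nonexp x x0 t) xx0.
have k2 : enorm (euler_flow x0 t - euler_flow x0 t0) <= e / 4 + e / 4 + e / 4.
  apply: le_trans (enormD3 _ _ (euler_flow y t)) _; rewrite -addrA; apply: lerD.
    exact: le_trans (euler_flow_nonexp _ _ _) xy.
  apply: le_trans (enormD3 _ _ (euler_flow y t0)) _; rewrite addrC; apply: lerD.
    by rewrite enormB; apply: le_trans (euler_flow_nonexp _ _ _) _.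
  apply: le_trans (euler_flow_lipschitz _ _ Ta) _; rewrite distrC.
  rewrite mulrC; apply: (@le_trans _ _ (e / (4 * (enorm a + 1)) * (enorm a + 1))).
    by apply: ler_pM; rewrite ?enorm_ge0 ?lerDl// ltW.
  by rewrite le_eqVlt; apply/orP; left; apply/eqP; field; rewrite gt_eqF.
lra.
Qed.

End EulerFlow.

(** * Identification of the semiflow *)

Section Semiflow.
Variables (R : realType) (N : nat) (T : operator R N).
Local Notation V := 'rV[R]_N.
Hypothesis maxT : maximal_monotone T.

(** The Euler flow shows that the choice in [semiflow] is made in a nonempty set. The chosen map
    agrees with the Euler flow on the domain by uniqueness of strong solutions, then on the closure
    by continuity, and so inherits its nonexpansiveness. *)
Lemma semiflow_spec : is_semiflow T (semiflow T) /\
  forall x y t, closure (dom T) x -> closure (dom T) y -> 0 <= t ->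
    enorm (semiflow T x t - semiflow T y t) <= enorm (x - y).
Proof.
have [U [UU Uoo]] := ultraFilterLemma (@eventually_filter).
have S := euler_flow_semiflow maxT UU Uoo.
have S' : is_semiflow T (semiflow T) by exact: (xgetPex _ (ex_intro _ _ S)).
suff E x t : closure (dom T) x -> 0 <= t -> semiflow T x t = euler_flow T U x t.
  by split => // x y t cx cy t0; rewrite !E//; exact: euler_flow_nonexp.
have [_ _ /subspace_continuousP cont] := S'.
move=> cx t0; apply/eqP; rewrite -subr_eq0; apply/eqP; apply: enorm_eq0.
apply/le_anti; rewrite enorm_ge0 andbT; apply/ler_addgt0Pr => e e0; rewrite add0r.
have e2 : 0 < e / 2 by rewrite divr_gt0.
have := cont (x, t) (conj cx t0).
move=> /cvg_enormP /(_ _ e2); rewrite near_withinE => -[[A B] /= [hA hB] hAB].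
have /nbhs_ballP[dl /= dl0 dlA] := hA.
have d2 : 0 < Num.min dl (e / 2) / 2 by rewrite divr_gt0// lt_min dl0.
have [y dy xy] := (closure_enormP _ _).1 cx _ d2.
have m0 : Num.min dl (e / 2) / 2 < dl.
  have : Num.min dl (e / 2) <= dl by rewrite ge_min lexx.
  lra.
have Ay : A y.
  apply: dlA; rewrite -ball_normE /ball_/=.
  by apply: le_lt_trans (normr_le_enorm _) _; exact: le_lt_trans xy m0.
have k1 := hAB (y, t) (conj Ay (nbhs_singleton hB)) (conj (subset_closure dy) t0).
have k2 : semiflow T y t = euler_flow T U y t.
  have [sol _ _] := S'.
  have := solutions_contract (maximal_op_monotone maxT) (sol y dy) (euler_flow_solution maxT UU Uoo dy) t0.
  rewrite subrr enorm0 => k; apply/eqP; rewrite -subr_eq0; apply/eqP; apply: enorm_eq0.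
  by apply/le_anti; rewrite k enorm_ge0.
apply: le_trans (enormD3 _ _ (semiflow T y t)) _; rewrite /= in k1; rewrite enormB.
have k3 := euler_flow_nonexp maxT UU y x t; rewrite k2 in k1 *.
rewrite enormB in xy.
have : Num.min dl (e / 2) <= e / 2 by rewrite ge_min lexx orbT.
lra.
Qed.

(** The path [w] may start outside of the domain, where the flow is only a continuous extension;
    both are compared with a solution started at a nearby point of the domain. *)
Lemma semiflow_unique (w : R -> V) K t :
  (forall r s, enorm (w s - w r) <= K * `|s - r|) ->
  (forall y v, T y v -> exists C : R, forall r s, 0 <= r -> r <= s -> s <= r + 1 ->
     sqn (w s - y) - sqn (w r - y) <= 2 * (s - r) * dotv v (y - w r) + C * (s - r) ^+ 2) ->
  closure (dom T) (w 0) -> 0 <= t -> semiflow T (w 0) t = w t.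
Proof.
move=> wK hw cw t0; have sol := integral_solution_strong maxT wK hw.
have [[S _ _] nexp] := semiflow_spec.
apply/eqP; rewrite -subr_eq0; apply/eqP; apply: enorm_eq0.
apply/le_anti; rewrite enorm_ge0 andbT; apply/ler_addgt0Pr => e e0; rewrite add0r.
have e2 : 0 < e / 2 by rewrite divr_gt0.
have [y dy wy] := (closure_enormP _ _).1 cw _ e2.
apply: le_trans (enormD3 _ _ (semiflow T y t)) _.
have k1 := nexp _ _ _ cw (subset_closure dy) t0.
have k2 := solutions_contract (maximal_op_monotone maxT) (S y dy) sol t0.
rewrite (enormB y) in k2; lra.
Qed.

End Semiflow.

(** * Asymptotic pseudotrajectories *)

Section Interpolation.
Variables (R : realType) (N : nat) (gam : nat -> R) (x : nat -> 'rV[R]_N).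
Local Notation V := 'rV[R]_N.
Hypothesis gam_gt0 : forall n, (0 < n)%N -> 0 < gam n.
Hypothesis tau_unbounded : forall M, exists n, M < tau gam n.
Hypothesis gam_small : forall e, 0 < e -> exists n0, forall n, (n0 <= n)%N -> gam n.+1 <= e.

Lemma tau0 : tau gam 0 = 0.
Proof. by rewrite /tau big_geq. Qed.

Lemma tauS n : tau gam n.+1 = tau gam n + gam n.+1.
Proof. by rewrite /tau big_nat_recr. Qed.

Lemma tau_le n m : (n <= m)%N -> tau gam n <= tau gam m.
Proof.
move=> /subnKC <-; elim: (m - n)%N => [|k IH]; first by rewrite addn0.
by rewrite addnS tauS; apply: le_trans IH _; rewrite lerDl ltW// gam_gt0.
Qed.

Lemma tau_lt_inv n m : tau gam n < tau gam m -> (n < m)%N.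
Proof. by move=> h; rewrite ltnNge; apply/negP => /tau_le; rewrite leNgt h. Qed.

Definition step_index (t : R) : nat :=
  xget 0%N [set n | tau gam n <= t < tau gam n.+1].

Lemma step_indexP t : 0 <= t -> tau gam (step_index t) <= t < tau gam (step_index t).+1.
Proof.
move=> t0; suff [n hn] : exists n, tau gam n <= t < tau gam n.+1.
  have h : [set n | tau gam n <= t < tau gam n.+1] n by [].
  exact: (xgetPex 0%N (ex_intro _ n h)).
have [n hn] := tau_unbounded t.
have ex : exists n, t < tau gam n by exists n.
case: (ex_minnP ex) => -[|k]; first by rewrite tau0 ltNge t0.
move=> h1 h2; exists k; rewrite h1 andbT leNgt; apply/negP => /h2.
by rewrite ltnn.
Qed.

Lemma step_index_ge n t : tau gam n <= t -> (n <= step_index t)%N.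
Proof.
move=> nt; have t0 : 0 <= t by apply: le_trans nt; rewrite -tau0 tau_le.
have /andP[_ h] := step_indexP t0; rewrite -ltnS; apply: tau_lt_inv.
exact: le_lt_trans nt h.
Qed.

Lemma step_index_le s t : 0 <= s -> s <= t -> (step_index s <= step_index t)%N.
Proof.
by move=> s0 st; apply: step_index_ge; apply: le_trans st; have /andP[] := step_indexP s0.
Qed.

Lemma step_index_large n : exists t0, 0 <= t0 /\ forall t, t0 <= t -> (n <= step_index t)%N.
Proof.
exists (tau gam n); split; first by rewrite -tau0 tau_le.
by move=> t; exact: step_index_ge.
Qed.

(** The piecewise constant path. The hypotheses below bear on indices, hence on this path, and it is
    asymptotically close to the interpolation. *)
Let xb t := x (step_index t).
Let X := interpolation gam x.

Lemma interpolation_near t : 0 <= t ->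
  enorm (X t - x (step_index t)) <= enorm (x (step_index t).+1 - x (step_index t)).
Proof.
move=> t0; have /andP[h1 h2] := step_indexP t0.
rewrite /X /interpolation -/(step_index t) addrAC subrr add0r scalerA enormZ.
rewrite ler_piMl ?enorm_ge0//.
have g0 : 0 < gam (step_index t).+1 by exact: gam_gt0.
rewrite ger0_norm; last by rewrite mulr_ge0 ?subr_ge0// invr_ge0 ltW.
by rewrite ler_pdivrMr// mul1r lerBlDl -tauS ltW.
Qed.

Section Pseudotrajectory.
Variable T : operator R N.
Hypothesis maxT : maximal_monotone T.
Variable C : R.
Hypothesis x_bounded : exists c : R, forall n, enorm (x n) <= c.
Hypothesis x_dist : forall e, 0 < e -> exists n0, forall n, (n0 <= n)%N ->
  dist_to (dom T) (x n) <= e.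
Hypothesis x_lipschitz : forall e, 0 < e -> exists n0, forall n m, (n0 <= n)%N -> (n <= m)%N ->
  enorm (x m - x n) <= C * (tau gam m - tau gam n) + e.
Hypothesis x_inclusion : forall y v, T y v -> exists K : R, forall e, 0 < e ->
  exists n0, forall n m, (n0 <= n)%N -> (n <= m)%N -> tau gam m - tau gam n <= 2 ->
  sqn (x m - y) - sqn (x n - y) <=
  2 * (tau gam m - tau gam n) * dotv v (y - x n) + K * (tau gam m - tau gam n) ^+ 2 + e.

Let C0 : 0 <= C.
Proof.
apply/ler_addgt0Pr => e e0; rewrite addrC.
have [n0 h] := x_lipschitz e0.
have [n hn] := tau_unbounded (tau gam n0 + 1).
have nn : (n0 <= n)%N by apply/ltnW/tau_lt_inv; apply: lt_trans hn; rewrite ltrDl.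
have := le_trans (enorm_ge0 _) (h n0 n (leqnn _) nn).
have d : 1 < tau gam n - tau gam n0 by lra.
move=> k; have [//|Cn] := leP 0 (e + C).
have : 0 <= (tau gam n - tau gam n0 - 1) * - C by rewrite mulr_ge0; lra.
nra.
Qed.

Let idx_gap s t : 0 <= s -> s <= t -> tau gam (step_index t) - tau gam (step_index s) <=
  (t - s) + gam (step_index s).+1.
Proof.
move=> s0 st; have /andP[_ h2] := step_indexP s0.
have /andP[h3 _] := step_indexP (le_trans s0 st).
rewrite tauS in h2; lra.
Qed.

Let xb_lipschitz e : 0 < e -> exists t0, 0 <= t0 /\ forall s t, t0 <= s -> s <= t ->
  enorm (xb t - xb s) <= C * (t - s) + e.
Proof.
move=> e0; have e2 : 0 < e / 2 by rewrite divr_gt0.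
have [n1 h1] := x_lipschitz e2.
have e3 : 0 < e / (2 * (C + 1)) by rewrite divr_gt0// mulr_gt0// ltr_wpDl.
have [n2 h2] := gam_small e3.
have [t0 [t00 ht0]] := step_index_large (maxn n1 n2); exists t0; split => // s t ts st.
have := ht0 s ts; rewrite geq_max => /andP[k1 k2].
have s0 := le_trans t00 ts.
have := h1 _ _ k1 (step_index_le s0 st) => /le_trans; apply.
have := idx_gap s0 st; have := h2 _ k2.
rewrite ler_pdivlMr ?mulr_gt0// ?ltr_wpDl// => g1 g2.
have := ler_wpM2l C0 g2; have : 0 <= gam (step_index s).+1 by rewrite ltW// gam_gt0.
nra.
Qed.

Let X_near e : 0 < e -> exists t0, 0 <= t0 /\ forall t, t0 <= t -> enorm (X t - xb t) <= e.
Proof.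
move=> e0; have e2 : 0 < e / 2 by rewrite divr_gt0.
have [n1 h1] := x_lipschitz e2.
have e3 : 0 < e / (2 * (C + 1)) by rewrite divr_gt0// mulr_gt0// ltr_wpDl.
have [n2 h2] := gam_small e3.
have [t0 [t00 ht0]] := step_index_large (maxn n1 n2); exists t0; split => // t ts.
have := ht0 t ts; rewrite geq_max => /andP[k1 k2].
apply: le_trans (interpolation_near (le_trans t00 ts)) _.
have := h1 _ _ k1 (leqnSn _) => /le_trans; apply.
rewrite tauS addrAC subrr add0r; have := h2 _ k2.
rewrite ler_pdivlMr ?mulr_gt0// ?ltr_wpDl// => g1.
have : 0 <= gam (step_index t).+1 by rewrite ltW// gam_gt0.
nra.
Qed.

Let xb_bounded : exists c : R, forall t, enorm (xb t) <= c.
Proof. by have [c hc] := x_bounded; exists c => t; exact: hc. Qed.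

Lemma interpolation_bounded : bounded_process X.
Proof.
have [c hc] := x_bounded; exists (c + (c + c)) => t t0.
apply: le_trans (enorm_sub_ge _ (x (step_index t))) _; rewrite addrC lerD//.
apply: le_trans (interpolation_near t0) _; apply: le_trans (enormD _ _) _.
by rewrite enormN lerD.
Qed.

(** * Limits of the shifted paths *)

Section UltraLimit.
Variable U : set_system R.
Hypotheses (UU : UltraFilter U) (Uoo : forall t0 : R, U [set t | t0 <= t]).

(** Frozen at negative times, so that it is Lipschitz on the whole line. *)
Let z (s : R) : V := lim (xb (t + Num.max s 0) @[t --> U]).

Let z_cvg s : 0 <= s -> xb (t + s) @[t --> U] --> z s.
Proof.
move=> s0; have [c hc] := xb_bounded.
have [|l ll] := @ultra_bounded_cvg R N R U (fun t => xb (t + s)) c UU.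
  by apply: nearW => t; exact: hc.
rewrite /z max_l//; have -> : lim (xb (t + s) @[t --> U]) = l; last exact: ll.
exact: (cvg_lim (@norm_hausdorff R V) ll).
Qed.

Let z_neg s : z s = z (Num.max s 0).
Proof.
rewrite /z; have -> // : Num.max (Num.max s 0) 0 = Num.max s 0.
by rewrite max_l// le_max lexx orbT.
Qed.

Let near_U (P : R -> Prop) : (exists t0 : R, forall t, t0 <= t -> P t) -> \forall t \near U, P t.
Proof. by move=> [t0 h]; apply: filterS (Uoo t0) => t /=; exact: h. Qed.

Let z_lipschitz0 r s : 0 <= r -> r <= s -> enorm (z s - z r) <= C * (s - r).
Proof.
move=> r0 rs; have s0 := le_trans r0 rs; apply/ler_addgt0Pr => e e0.
have [t0 [t00 ht0]] := xb_lipschitz e0.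
rewrite -subr_ge0; apply: (@cvg_ge0 _ _ U _ (fun t => C * (s - r) + e - enorm (xb (t + s) - xb (t + r)))).
  apply: near_U; exists t0 => t tt; rewrite subr_ge0.
  have := ht0 (t + r) (t + s); rewrite lerD2l => /(_ (ler_wpDr r0 tt) rs).
  by rewrite opprD addrACA subrr add0r.
apply: cvgB; first exact: cvg_cst.
have cd : xb (t + s) - xb (t + r) @[t --> U] --> z s - z r by apply: cvgB; exact: z_cvg.
exact: (cvg_comp _ _ cd (@enorm_continuous R N _)).
Qed.

Let z_lipschitz r s : enorm (z s - z r) <= C * `|s - r|.
Proof.
wlog rs : r s / r <= s.
  by move=> H; have [/H//|/ltW /H] := leP r s; rewrite enormB distrC.
rewrite (z_neg s) (z_neg r).
have m0 : 0 <= Num.max r 0 by rewrite le_max lexx orbT.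
have ms : Num.max r 0 <= Num.max s 0.
  by rewrite ge_max !le_max rs lexx orbT.
apply: le_trans (z_lipschitz0 m0 ms) _; rewrite ler_wpM2l// ger0_norm ?subr_ge0//.
by rewrite /Num.max; case: ltP => ?; case: ltP => ?; lra.
Qed.

Let z_inclusion y v : T y v -> exists K : R, forall r s, 0 <= r -> r <= s -> s <= r + 1 ->
  sqn (z s - y) - sqn (z r - y) <= 2 * (s - r) * dotv v (y - z r) + K * (s - r) ^+ 2.
Proof.
move=> Tv; have [K hK] := x_inclusion Tv; exists K => r s r0 rs sr1.
have s0 := le_trans r0 rs.
apply/ler_addgt0Pr => e e0; have [n1 h1] := hK e e0.
have [n2 h2] := gam_small (ltr01 (R := R)).
have [t0 [t00 ht0]] := step_index_large (maxn n1 n2).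
pose m t := tau gam (step_index (t + s)) - tau gam (step_index (t + r)).
have cm : m t @[t --> U] --> s - r.
  apply/cvgrPdist_le => d d0; have [n3 h3] := gam_small d0.
  have [t1 [t10 ht1]] := step_index_large n3.
  apply: near_U; exists t1 => t tt.
  have tr : t1 <= t + r by exact: ler_wpDr.
  have ts : t1 <= t + s by exact: ler_wpDr.
  have /andP[a1 a2] := step_indexP (le_trans t10 tr).
  have /andP[b1 b2] := step_indexP (le_trans t10 ts).
  have := h3 _ (ht1 _ tr); have := h3 _ (ht1 _ ts).
  rewrite !tauS in a2 b2 *; rewrite /m ler_norml => g1 g2.
  by apply/andP; split; lra.
rewrite -subr_ge0.
apply: (@cvg_ge0 _ _ U _ (fun t => 2 * m t * dotv v (y - xb (t + r)) + K * m t ^+ 2 + e -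
    (sqn (xb (t + s) - y) - sqn (xb (t + r) - y)))).
  apply: near_U; exists t0 => t tt; rewrite subr_ge0.
  have tr : t0 <= t + r by exact: ler_wpDr.
  have := ht0 _ tr; rewrite geq_max => /andP[k1 k2].
  have trs : t + r <= t + s by rewrite lerD2l.
  apply: h1 => //; first by apply: step_index_le => //; exact: le_trans tr.
  apply: le_trans (idx_gap (le_trans t00 tr) trs) _.
  have := h2 _ k2; lra.
have cst_ (c : V) : (fun _ : R => c) k @[k --> U] --> c by exact: cvg_cst.
have zr := z_cvg r0; have zs := z_cvg s0.
apply: cvgB.
  apply: cvgD; last exact: cvg_cst.
  apply: cvgD; last by apply: cvgMr; rewrite !expr2; apply: cvgM.
  by apply: cvgM; [apply: cvgMr|apply: cvg_dotv => //; apply: cvgB].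
by apply: cvgB; apply: cvg_sqn; apply: cvgB.
Qed.

Let z_closure : closure (dom T) (z 0).
Proof.
apply/closure_enormP => e e0; have e3 : 0 < e / 3 by rewrite divr_gt0.
have [n1 h1] := x_dist e3; have [t0 [_ ht0]] := step_index_large n1.
have N1 : \forall t \near U, dist_to (dom T) (xb t) <= e / 3.
  by apply: near_U; exists t0 => t /ht0 /h1.
have /cvg_enormP /(_ _ e3) N2 := z_cvg (lexx 0).
have [t [k1 k2]] := filter_ex (filterI N1 N2).
rewrite addr0 in k2.
have [y dy yx] := dist_to_near (xb t) (maximal_dom_neq0 maxT) e3.
exists y => //; apply: le_trans (enormD3 _ _ (xb t)) _; rewrite enormB; lra.
Qed.

(* Along an ultrafilter of times the shifted paths converge pointwise, and by
   [x_inclusion] their limit solves the differential inclusion. *)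
Lemma interpolation_ultra Tm e : 0 < Tm -> 0 < e ->
  \forall t \near U, forall s, 0 <= s -> s <= Tm ->
    enorm (X (t + s) - semiflow T (proj_on (closure (dom T)) (X t)) s) <= e.
Proof.
move=> T0 e0.
have cvx := closure_dom_convex maxT; have dn0 := maximal_dom_neq0 maxT.
have [_ nexp] := semiflow_spec maxT.
have zE s : 0 <= s -> semiflow T (z 0) s = z s.
  by move=> s0; apply: (semiflow_unique maxT z_lipschitz z_inclusion).
have e8 : 0 < e / 8 by rewrite divr_gt0.
have C1 : 0 < 8 * (C + 1) by rewrite mulr_gt0// ltr_wpDl.
(* Mesh of a finite grid of [[0, Tm]]: between two grid points both paths move by at most [C * dl]
   up to a small error, so pointwise convergence on the grid gives uniform closeness. *)
pose dl := e / (8 * (C + 1)); have dl0 : 0 < dl by rewrite divr_gt0.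
have Cdl : C * dl <= e / 8.
  have : dl * (8 * (C + 1)) = e by rewrite /dl mulfVK// gt_eqF.
  by nra.
pose J := (Num.bound (Tm / dl)).+1.
have grid : \forall t \near U, forall j : 'I_J, enorm (xb (t + j%:R * dl) - z (j%:R * dl)) <= e / 8.
  apply: filter_forall => j.
  have /cvg_enormP /(_ _ e8) := z_cvg (mulr_ge0 (ler0n R j) (ltW dl0)).
  exact.
have [t1 [t10 h1]] := X_near e8; have [t2 [t20 h2]] := xb_lipschitz e8.
have N1 : \forall t \near U, t1 <= t by exact: Uoo.
have N2 : \forall t \near U, t2 <= t by exact: Uoo.
apply: filterS3 grid N1 N2 => t g n1 n2 s s0 sT.
pose j := Num.truncn (s / dl).
have /truncn_itv /andP[j1 j2] : 0 <= s / dl by rewrite divr_ge0// ltW.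
rewrite -/j in j1 j2; rewrite ler_pdivlMr// in j1; rewrite ltr_pdivrMr// -natr1 mulrDl mul1r in j2.
have jJ : (j < J)%N.
  rewrite ltnS -(ler_nat R); apply: le_trans (ltW (archi_boundP _)); last by rewrite divr_ge0 ?ltW.
  rewrite ler_pdivlMr//; exact: le_trans j1 sT.
have jd0 : 0 <= j%:R * dl by rewrite mulr_ge0// ltW.
have k1 := g (Ordinal jJ); rewrite /= in k1.
have k0 := g (ord0 : 'I_J); rewrite /= mul0r addr0 in k0.
have k2 : enorm (xb (t + s) - xb (t + j%:R * dl)) <= e / 8 + e / 8.
  apply: le_trans (h2 _ _ _ _) _; [by rewrite (le_trans n2)// lerDl|by rewrite lerD2l|].
  rewrite lerD2r; apply: le_trans Cdl; rewrite ler_wpM2l//; lra.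
have k3 : enorm (z s - z (j%:R * dl)) <= e / 8.
  by apply: le_trans (z_lipschitz0 jd0 j1) _; apply: le_trans Cdl; rewrite ler_wpM2l//; lra.
have k4 : enorm (X (t + s) - xb (t + s)) <= e / 8 by apply: h1; rewrite (le_trans n1)// lerDl.
have k5 : enorm (X t - xb t) <= e / 8 by exact: h1.
have Pz := proj_closure_id z_closure.
(* The flow is started at the projection of [X t], the limit path at [z 0], which is its own
   projection; nonexpansiveness of the flow and of the projection absorbs the difference. *)
have k6 : enorm (semiflow T (z 0) s - semiflow T (proj_on (closure (dom T)) (X t)) s) <= e / 8 + e / 8.
  apply: le_trans (nexp _ _ _ z_closure _ s0) _.
    by have [] := proj_closureP dn0 cvx (X t).
  rewrite -{1}Pz; apply: le_trans (proj_closure_nonexp dn0 cvx _ _) _.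
  apply: le_trans (enormD3 _ _ (xb t)) _.
  by apply: lerD; rewrite enormB.
rewrite zE// in k6.
apply: le_trans (enormD3 _ _ (z s)) _.
have k7 : enorm (X (t + s) - z s) <= e / 8 * 5.
  apply: le_trans (enormD3 _ _ (xb (t + s))) _.
  have := enormD3 (xb (t + s)) (z s) (xb (t + j%:R * dl)).
  have := enormD3 (xb (t + j%:R * dl)) (z s) (z (j%:R * dl)).
  rewrite (enormB (z (j%:R * dl))); lra.
lra.
Qed.

End UltraLimit.

Lemma interpolation_pseudotrajectory :
  asymptotic_pseudotrajectory (semiflow T) (dom T) X.
Proof.
move=> Tm T0.
have key e : 0 < e -> exists t0 : R, forall t, t0 <= t -> forall s, 0 <= s -> s <= Tm ->
    enorm (X (t + s) - semiflow T (proj_on (closure (dom T)) (X t)) s) <= e.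
  move=> e0; apply: contrapT => nex.
  pose B := [set t | ~ forall s, 0 <= s -> s <= Tm ->
    enorm (X (t + s) - semiflow T (proj_on (closure (dom T)) (X t)) s) <= e].
  (* Neighbourhoods of infinity restricted to the bad times. It is proper if bad times are
     unbounded, and an ultrafilter above it contradicts [interpolation_ultra]. *)
  pose F : set_system R := [set A | exists t0 : R, forall t, t0 <= t -> B t -> A t].
  have FF : ProperFilter F.
    apply: Build_ProperFilter_ex.
      move=> A [t0 hA]; apply: contrapT => nA; apply: nex; exists t0 => t tt.
      apply: contrapT => Bt; apply: nA; exists t; exact: hA.
    split.
    - by exists 0.
    - move=> A A' [t0 h] [t1 h']; exists (Num.max t0 t1) => t; rewrite ge_max => /andP[a b] Bt.
      by split; [exact: h|exact: h'].
    - by move=> A A' AA' [t0 h]; exists t0 => t a b; apply: AA'; exact: h.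
  have [U [UU FU]] := ultraFilterLemma FF.
  have Uoo (t0 : R) : U [set t | t0 <= t] by apply: FU; exists t0.
  have UB : U B by apply: FU; exists 0.
  have [t [Bt ht]] := filter_ex (filterI UB (interpolation_ultra UU Uoo T0 e0)).
  exact: Bt.
pose S t := ereal_sup [set (enorm (X (t + s) - semiflow T (proj_on (closure (dom T)) (X t)) s))%:E
   | s in [set s | 0 <= s <= Tm]].
have Sle e : 0 < e -> \forall t \near +oo, (0 <= S t <= e%:E)%E.
  move=> e0; have [t0 h] := key e e0; exists t0; split; first exact: num_real.
  move=> t /ltW tt; apply/andP; split.
    apply: (@le_trans _ _ (enorm (X (t + 0) - semiflow T (proj_on (closure (dom T)) (X t)) 0))%:E).
      by rewrite lee_fin enorm_ge0.
    by apply: ereal_sup_ubound; exists 0 => //=; rewrite lexx ltW.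
  by apply: ge_ereal_sup => _ [s /= /andP[s0 sT] <-]; rewrite lee_fin; exact: h.
apply/fine_cvgP; split.
  apply: filterS (Sle 1 ltr01) => t /andP[h1 h2].
  by rewrite ge0_fin_numE//; apply: le_lt_trans h2 _; rewrite ltry.
apply/cvgr0Pnorm_le => e e0; apply: filterS (Sle e e0) => t /= /andP[h1 h2].
have fin : S t \is a fin_num by rewrite ge0_fin_numE//; apply: le_lt_trans h2 _; rewrite ltry.
by rewrite ger0_norm ?fine_ge0// -lee_fin fineK.
Qed.

End Pseudotrajectory.
End Interpolation.

(** * Random operators *)

Section Caratheodory.
Variables (R : realType) (N : nat).
Local Notation V := 'rV[R]_N.
Local Notation bV := (borelV R N).
Variables (d : measure_display) (Xi : measurableType d).

Let fl k (x : V) : 'rV[int]_N := \row_i Num.floor (x 0 i * k.+1%:R).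
Let gr k (r : 'rV[int]_N) : V := \row_i ((r 0 i)%:~R / k.+1%:R).

Let gr_cvg x : gr k (fl k x) @[k --> \oo] --> x.
Proof.
apply/cvg_enormP => e e0.
have e1 : 0 < e / (N%:R + 1) by rewrite divr_gt0// ltr_wpDl.
have [n0 h] := natSinv_small e1; exists n0 => // k /= /h hk.
apply: le_trans (enorm_le_sum _) _.
apply: (@le_trans _ _ (\sum_(i < N) (e / (N%:R + 1)))).
  apply: ler_sum => i _; apply: le_trans hk; rewrite !mxE.
  have k0 : 0 < k.+1%:R :> R by [].
  have /andP[f1 f2] := floor_itv (x 0 i * k.+1%:R).
  rewrite -(ler_pM2r k0) mulVf ?gt_eqF// -[X in _ * X](gtr0_norm k0) -normrM.
  rewrite mulrBl mulfVK ?gt_eqF// ler_norml; move: f2; rewrite intrD => f2.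
  by apply/andP; split; lra.
rewrite sumr_const card_ord -[leLHS]mulr_natl mulrA ler_pdivrMr ?ltr_wpDl// mulrC.
by rewrite ler_pM2l// lerDl.
Qed.

(** Evaluation at the grid point below [x] freezes the variable on each of countably many cells, and
    continuity gives the limit as the mesh tends to 0. *)
Lemma caratheodory_measurable (F : Xi -> V -> V) :
  (forall x, measurable_fun [set: Xi] ((fun xi => F xi x) : Xi -> bV)) ->
  (forall xi, continuous (F xi)) ->
  measurable_fun [set: Xi * bV] ((fun q => F q.1 q.2) : Xi * bV -> bV).
Proof.
move=> mF cF; apply: (@measurable_vcvg _ _ _ _ (fun k (q : Xi * bV) => F q.1 (gr k (fl k q.2)))).
  move=> k mT Y mY; rewrite setTI.
  pose B r : set bV := [set x | fl k x = r].
  pose A r : set Xi := [set xi | Y (F xi (gr k r))].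
  rewrite (_ : _ @^-1` Y = \bigcup_r (A r `*` B r)); last first.
    apply/seteqP; split => [[xi x] /= h|[xi x] [r _ [/= h e]]]; last by rewrite /= e.
    by exists (fl k x).
  apply: countable_bigcupT_measurable; first exact: countableP.
  move=> r; apply: measurableX.
    by rewrite -[A r]setTI; exact: (mF (gr k r)).
  pose Bi i : set bV := [set x | (r 0 i)%:~R <= (x : V) 0 i * k.+1%:R] `&`
     [set x | (x : V) 0 i * k.+1%:R < (r 0 i + 1)%:~R].
  rewrite (_ : B r = \big[setI/setT]_(i < N) Bi i); last first.
    apply/seteqP; split => [x /= xr|x].
      elim/big_ind : _ => // i _; have := floor_itv ((x : V) 0 i * k.+1%:R).
      have -> : Num.floor ((x : V) 0 i * k.+1%:R) = r 0 i by rewrite -xr mxE.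
      by move=> /andP[].
    move=> h; apply/rowP => i; rewrite mxE; apply/eqP; apply/eqP/floor_def.
    by move: h; rewrite (bigD1 i) => // -[[/= -> ->]].
  apply: bigsetI_measurable => i _.
  have mc : measurable_fun [set: bV] (fun x : bV => (x : V) 0 i * k.+1%:R).
    apply: measurable_funM => //; apply: borelV_measurable_real => v.
    exact: coord_continuous.
  by apply: measurableI; [exact: measurable_leset|exact: measurable_ltset].
move=> [xi x] /=; apply: (@continuous_cvg _ V V \oo _ (fun n => gr n (fl n (x : V))) (F xi) (x : V)); [exact: cF|exact: gr_cvg].
Qed.

End Caratheodory.

Section RandomOperators.
Variables (R : realType) (N : nat).
Local Notation V := 'rV[R]_N.
Local Notation bV := (borelV R N).
Variables (d : measure_display) (Xi : measurableType d).
Variable A : Xi -> operator R N.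
Hypothesis A_random : random_operator A.

Lemma random_maximal xi : maximal_monotone (A xi).
Proof. by case: A_random. Qed.

Let meas (H : set (V * V)) : <<s open >> H ->
  measurable [set xi | graph (A xi) `&` H !=set0].
Proof. by case: A_random => _; apply. Qed.

Let borel_preimage (T1 T2 : topologicalType) (f : T1 -> T2) (H : set T2) :
  continuous f -> <<s open >> H -> <<s open >> (f @^-1` H).
Proof.
move=> /continuousP cf; move: H.
apply: (@smallest_sub _ _ _ [set H | <<s open >> (f @^-1` H)]) => [|U oU]; last first.
  by apply: sub_sigma_algebra; exact: cf.
split => [|H hH|H hH] /=.
- by rewrite preimage_set0; exact: sigma_algebra0.
- by rewrite setTD preimage_setC -setTD; exact: sigma_algebraCD.
- by rewrite preimage_bigcup; exact: sigma_algebra_bigcup.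
Qed.

(** The resolvent lies in [H] exactly when the graph meets the Borel set of the pairs [(y, a)] with
    [y + g a = x] and [y] in [H]. *)
Lemma resolvent_measurable g x : 0 < g ->
  measurable_fun [set: Xi] ((fun xi => resolvent g (A xi) x) : Xi -> bV).
Proof.
move=> g0 _ H mH; rewrite setTI.
pose f (q : V * V) : V := q.1 + g *: q.2 - x.
have cf : continuous f.
  move=> q; apply: cvgB; last exact: cvg_cst.
  apply: cvgD; first exact: cvg_fst.
  by apply: cvgZr; exact: cvg_snd.
pose H' : set (V * V) := (f @^-1` [set 0]) `&` (fst @^-1` H).
have mH' : <<s open >> H'.
  apply: (@measurableI _ (g_sigma_algebraType (@open (V * V)%type))).
    apply: borel_preimage => //.
    rewrite -[[set 0]]setCK; apply: sigma_algebraC; apply: sub_sigma_algebra.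
    by apply: closed_openC; apply: accessible_closed_set1; exact: hausdorff_accessible.
  by apply: borel_preimage => // q; exact: cvg_fst.
rewrite (_ : _ @^-1` H = [set xi | graph (A xi) `&` H' !=set0]); first exact: meas.
apply/seteqP; split => [xi /= h|xi /= [[y a] [/= Tya [/= fy Hy]]]].
  exists (resolvent g (A xi) x, yosida g (A xi) x); split.
    by apply: yosida_in => //; exact: random_maximal.
  split => //=; rewrite /f/= -resolventE//; first by rewrite subrr.
suff -> : resolvent g (A xi) x = y by [].
apply: resolvent_uniq => //; first exact: random_maximal.
move/eqP: fy; rewrite /f/= subr_eq0 => /eqP <-.
by rewrite addrAC subrr add0r scalerA mulVf ?gt_eqF// scale1r.
Qed.

Lemma resolvent_continuous g xi : 0 < g -> continuous (resolvent g (A xi)).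
Proof.
move=> g0 x; apply/(@cvg_enormP R N V (nbhs x) (nbhs_filter x)) => e e0.
apply: filterS (near_enorm x e0) => y; apply: le_trans.
by apply: resolvent_nonexp => //; exact: random_maximal.
Qed.

Lemma resolvent_measurable2 g : 0 < g ->
  measurable_fun [set: Xi * bV] ((fun q => resolvent g (A q.1) q.2) : Xi * bV -> bV).
Proof.
move=> g0; apply: (@caratheodory_measurable _ _ _ _ (fun xi x => resolvent g (A xi) x)).
  by move=> x; exact: resolvent_measurable.
by move=> xi; exact: resolvent_continuous.
Qed.

Lemma yosida_measurable g x : 0 < g ->
  measurable_fun [set: Xi] ((fun xi => yosida g (A xi) x) : Xi -> bV).
Proof.
move=> g0; apply: (@measurable_vscale _ _ _ _ (fun=> g^-1)) => //.
apply: measurable_vB; first exact: measurable_cst.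
exact: resolvent_measurable.
Qed.

Lemma proj_dom_measurable x : measurable_fun [set: Xi]
  ((fun xi => proj_on (closure (dom (A xi))) x) : Xi -> bV).
Proof.
apply: (@measurable_vcvg _ _ _ _ (fun n xi => resolvent n.+1%:R^-1 (A xi) x)).
  by move=> n; apply: resolvent_measurable; rewrite invr_gt0.
by move=> xi; apply: resolvent_cvg_proj; exact: random_maximal.
Qed.

Lemma dist_dom_measurable x : measurable_fun [set: Xi] (fun xi => dist_to (dom (A xi)) x).
Proof.
have -> : (fun xi => dist_to (dom (A xi)) x) =
   (fun xi => enorm (x - proj_on (closure (dom (A xi))) x)).
  apply/funext => xi; apply: dist_to_proj.
    by apply: maximal_dom_neq0; exact: random_maximal.
  by apply: closure_dom_convex; exact: random_maximal.
apply: measurable_enorm; apply: measurable_vB; first exact: measurable_cst.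
exact: proj_dom_measurable.
Qed.

Lemma dom_measurable x : measurable [set xi | dom (A xi) x].
Proof.
have h : <<s open >> (fst @^-1` [set x] : set (V * V)).
  apply: borel_preimage; first by move=> q; exact: cvg_fst.
  rewrite -[[set x]]setCK; apply: sigma_algebraC; apply: sub_sigma_algebra.
  by apply: closed_openC; apply: accessible_closed_set1; exact: hausdorff_accessible.
rewrite (_ : [set xi | _] = [set xi | graph (A xi) `&` (fst @^-1` [set x]) !=set0]).
  exact: meas.
apply/seteqP; split => [xi [a Ta]|xi [[y a] [/= Ta <-]]]; last by exists a.
by exists (x, a).
Qed.

(** A limit of norms of Yosida values on the domain. Outside of it [least_norm_value] is the default
    value 0, hence the indicator. *)
Lemma least_norm_measurable x :
  measurable_fun [set: Xi] (fun xi => enorm (least_norm_value (A xi) x)).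
Proof.
pose D := [set xi | dom (A xi) x].
apply: (@measurable_fun_cvg _ _ _ _
  (fun n xi => \1_D xi * enorm (yosida n.+1%:R^-1 (A xi) x))).
  move=> n; apply: measurable_funM; first by apply: measurable_indic; exact: dom_measurable.
  by apply: measurable_enorm; apply: yosida_measurable; rewrite invr_gt0.
move=> xi _; have [Dx|nDx] := pselect (D xi).
  have i1 : \1_D xi = 1 :> R by rewrite indicE mem_set.
  under eq_fun do rewrite i1 mul1r.
  by apply: least_norm_value_cvg => //; exact: random_maximal.
have i0 : \1_D xi = 0 :> R by rewrite indicE memNset.
under eq_fun do rewrite i0 mul0r.
have -> : least_norm_value (A xi) x = 0.
  apply: xgetPN => y [Axy _]; apply: nDx; by exists y.
by rewrite enorm0; exact: cvg_cst.
Qed.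

End RandomOperators.

(** * Mean operators *)

Section RealIntegration.
Variables (R : realType) (d : measure_display) (X : measurableType d).
Variable mu : probability X R.
Implicit Types f g : X -> R.

Definition rintegrable f := mu.-integrable [set: X] (EFin \o f).

Lemma rintegrable_measurable f : rintegrable f -> measurable_fun [set: X] f.
Proof. by move=> /integrableP[/measurable_EFinP]. Qed.

Lemma rintegrable_cst c : rintegrable (fun=> c).
Proof. exact: (@finite_measure_integrable_cst _ _ _ mu setT c measurableT). Qed.

Lemma rintegrableD f g : rintegrable f -> rintegrable g -> rintegrable (fun x => f x + g x).
Proof. exact: (integrableD measurableT). Qed.

Lemma rintegrableB f g : rintegrable f -> rintegrable g -> rintegrable (fun x => f x - g x).
Proof. exact: (integrableB measurableT). Qed.

Lemma rintegrableZ c f : rintegrable f -> rintegrable (fun x => c * f x).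
Proof. exact: (integrableZl measurableT). Qed.

Lemma rintegrable_sum (I : Type) (s : seq I) (f : I -> X -> R) :
  (forall i, rintegrable (f i)) -> rintegrable (fun x => \sum_(i <- s) f i x).
Proof.
move=> fi; elim: s => [|i s IH].
  by under eq_fun do rewrite big_nil; exact: rintegrable_cst.
by under eq_fun do rewrite big_cons; exact: rintegrableD.
Qed.

Lemma rintegrable_le f g : measurable_fun [set: X] f -> rintegrable g ->
  {ae mu, forall x, `|f x| <= g x} -> rintegrable f.
Proof.
move=> mf ig fg; have mg := rintegrable_measurable ig.
apply/integrableP; split; first exact/measurable_EFinP.
have /integrableP[_] := ig; apply: le_lt_trans.
apply: ae_ge0_le_integral => //.
- by apply/measurable_EFinP; apply: measurableT_comp.
- by apply/measurable_EFinP; apply: measurableT_comp.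
by apply: filterS fg => x /= h _; rewrite lee_fin (le_trans h)// ler_norm.
Qed.

Lemma Rintegral_ge0_ae f : rintegrable f -> {ae mu, forall x, 0 <= f x} ->
  0 <= \int[mu]_x f x.
Proof.
move=> fi f0; have mf := rintegrable_measurable fi.
rewrite /Rintegral (@ae_eq_integral _ _ _ mu setT (fun x => (Num.max (f x) 0)%:E) (fun x => (f x)%:E))//.
- by rewrite fine_ge0// integral_ge0// => x _; rewrite lee_fin le_max lexx orbT.
- exact/measurable_EFinP.
- by apply/measurable_EFinP; apply: measurable_maxr.
- by apply: filterS f0 => x h _; rewrite max_l.
Qed.

Lemma Rintegral_le_ae f g : rintegrable f -> rintegrable g ->
  {ae mu, forall x, f x <= g x} -> \int[mu]_x f x <= \int[mu]_x g x.
Proof.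
move=> fi gi fg; rewrite -subr_ge0 -RintegralB//.
apply: Rintegral_ge0_ae; first exact: rintegrableB.
by apply: filterS fg => x; rewrite subr_ge0.
Qed.

Lemma Rintegral_cst1 c : \int[mu]_x c = c.
Proof. by rewrite Rintegral_cst// [X in fine X](@probability_setT _ _ _ mu)/= mulr1. Qed.

Lemma rintegrable_ge0 f : measurable_fun [set: X] f -> (forall x, 0 <= f x) ->
  (\int[mu]_x (f x)%:E < +oo)%E -> rintegrable f.
Proof.
move=> mf f0 h; apply/integrableP; split; first exact/measurable_EFinP.
by under eq_integral do rewrite /= ger0_norm//.
Qed.

Lemma integral_rintegrable f : rintegrable f ->
  (\int[mu]_x (f x)%:E)%E = (\int[mu]_x f x)%:E.
Proof. by move=> fi; rewrite /Rintegral fineK//; exact: integrable_fin_num. Qed.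

End RealIntegration.

(** * Integrals of vector valued maps *)

Section VectorIntegration.
Variables (R : realType) (N : nat) (d : measure_display) (X : measurableType d).
Variable mu : probability X R.
Local Notation V := 'rV[R]_N.
Local Notation bV := (borelV R N).
Implicit Types f g : X -> V.

Definition vintegrable f := measurable_fun [set: X] (f : X -> bV) /\
  rintegrable mu (fun x => enorm (f x)).

Lemma vintegrable_coord f i : vintegrable f -> rintegrable mu (fun x => f x 0 i).
Proof.
move=> [mf fi]; apply: rintegrable_le fi _; first exact: measurable_coord.
by apply: aeW => x; exact: enorm_coord.
Qed.

Lemma vintegrable_le f (g : X -> R) : measurable_fun [set: X] (f : X -> bV) ->
  rintegrable mu g -> {ae mu, forall x, enorm (f x) <= g x} -> vintegrable f.
Proof.
move=> mf gi fg; split => //; apply: rintegrable_le gi _; first exact: measurable_enorm.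
by apply: filterS fg => x; rewrite ger0_norm ?enorm_ge0.
Qed.

Lemma vintegrableD f g : vintegrable f -> vintegrable g -> vintegrable (fun x => f x + g x).
Proof.
move=> [mf fi] [mg gi].
apply: (@vintegrable_le _ (fun x => enorm (f x) + enorm (g x))).
- exact: measurable_vD.
- exact: rintegrableD.
- by apply: aeW => x; exact: enormD.
Qed.

Lemma vintegrableB f g : vintegrable f -> vintegrable g -> vintegrable (fun x => f x - g x).
Proof.
move=> [mf fi] [mg gi].
apply: (@vintegrable_le _ (fun x => enorm (f x) + enorm (g x))).
- exact: measurable_vB.
- exact: rintegrableD.
- by apply: aeW => x; apply: le_trans (enormD _ _) _; rewrite enormN.
Qed.

Lemma dotv_integrable f y : vintegrable f -> rintegrable mu (fun x => dotv (f x) y).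
Proof.
move=> fi; apply: rintegrable_sum => i; under eq_fun do rewrite mulrC.
by apply: rintegrableZ; exact: vintegrable_coord.
Qed.

Lemma dotv_vintegral f y : vintegrable f ->
  dotv (vintegral mu f) y = \int[mu]_x dotv (f x) y.
Proof.
move=> fi.
have [_ E] := @Rintegral_wsum R _ _ mu 'I_N setT (index_enum 'I_N) (fun i => y 0 i)
  (fun i x => f x 0 i) measurableT (fun i => vintegrable_coord i fi).
transitivity (\sum_i y 0 i * \int[mu]_x f x 0 i).
  by apply: eq_bigr => i _; rewrite mxE mulrC.
by rewrite -E; apply: eq_Rintegral => x _; apply: eq_bigr => i _; rewrite mulrC.
Qed.

Lemma vintegralD f g : vintegrable f -> vintegrable g ->
  vintegral mu (fun x => f x + g x) = vintegral mu f + vintegral mu g.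
Proof.
move=> fi gi; apply/rowP => i; rewrite !mxE.
under eq_Rintegral do rewrite mxE.
by rewrite RintegralD//; exact: vintegrable_coord.
Qed.

Lemma vintegralB f g : vintegrable f -> vintegrable g ->
  vintegral mu (fun x => f x - g x) = vintegral mu f - vintegral mu g.
Proof.
move=> fi gi; apply/rowP => i; rewrite !mxE.
under eq_Rintegral do rewrite !mxE.
by rewrite RintegralB//; exact: vintegrable_coord.
Qed.

(** The integral is paired with itself, Cauchy-Schwarz is applied pointwise, and its norm is divided
    out. *)
Lemma enorm_vintegral f : vintegrable f -> enorm (vintegral mu f) <= \int[mu]_x enorm (f x).
Proof.
move=> fi; set I := vintegral mu f.
have [I0|I0] := eqVneq (enorm I) 0.
  by rewrite I0; apply: Rintegral_ge0 => x _; exact: enorm_ge0.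
have Ip : 0 < enorm I by rewrite lt0r I0 enorm_ge0.
rewrite -(ler_pM2l Ip) -expr2 enormK /sqn {1}/I dotv_vintegral// -RintegralZl//; last by case: fi.
apply: Rintegral_le_ae.
- exact: dotv_integrable.
- by apply: rintegrableZ; case: fi.
- by apply: aeW => x; rewrite mulrC; exact: dotv_le.
Qed.

Lemma selections1_integrable (F : X -> set V) f : selections mu 1 F f -> vintegrable f.
Proof.
move=> [mf fi _]; split => //; apply: rintegrable_ge0.
- exact: measurable_enorm.
- by move=> x; exact: enorm_ge0.
- by move: fi; under eq_integral do rewrite powRr1 ?enorm_ge0//.
Qed.

Lemma integrable_selections1 (F : X -> set V) f : vintegrable f ->
  {ae mu, forall x, F x (f x)} -> selections mu 1 F f.
Proof.
move=> [mf fi] Ff; split => //; under eq_integral do rewrite powRr1 ?enorm_ge0//.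
by rewrite integral_rintegrable// ltry.
Qed.

Lemma vintegral_dominated (f : nat -> X -> V) g (h : X -> R) :
  (forall n, measurable_fun [set: X] (f n : X -> bV)) ->
  measurable_fun [set: X] (g : X -> bV) -> rintegrable mu h ->
  (forall n, {ae mu, forall x, enorm (f n x) <= h x}) ->
  {ae mu, forall x, f n x @[n --> \oo] --> g x} ->
  vintegrable g /\ vintegral mu (f n) @[n --> \oo] --> vintegral mu g.
Proof.
move=> mf mg hi fh fg.
have fh' : {ae mu, forall x, forall n, enorm (f n x) <= h x} by apply/ae_foralln.
have gh : {ae mu, forall x, enorm (g x) <= h x}.
  apply: filterS2 fg fh' => x fgx fhx.
  rewrite -subr_ge0; apply: (@cvg_ge0 _ _ \oo _ (fun n => h x - enorm (f n x))).
    by apply: nearW => n; rewrite subr_ge0.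
  by apply: cvgB; [exact: cvg_cst|exact: (cvg_comp _ _ fgx (@enorm_continuous R N _))].
have gi := vintegrable_le mg hi gh.
split => //.
have coord i : (\int[mu]_x f n x 0 i) @[n --> \oo] --> \int[mu]_x g x 0 i.
  have H1 n : measurable_fun [set: X] (fun x => (f n x 0 i)%:E).
    by apply/measurable_EFinP; exact: measurable_coord.
  have H2 : measurable_fun [set: X] (fun x => (g x 0 i)%:E).
    by apply/measurable_EFinP; exact: measurable_coord.
  have H3 : {ae mu, forall x, [set: X] x -> (f n x 0 i)%:E @[n --> \oo] --> (g x 0 i)%:E}.
    apply: filterS fg => x fgx _; apply: cvg_EFin; first by apply: nearW.
    apply: (cvg_comp (fun n => f n x) (fun u : V => u 0 i) fgx).
    exact: coord_continuous.
  have H4 : {ae mu, forall x, forall n, [set: X] x -> (`|(f n x 0 i)%:E| <= (h x)%:E)%E}.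
    by apply: filterS fh' => x hx n _; rewrite lee_fin; apply: le_trans (hx n); exact: enorm_coord.
  have [_ _ cv] := dominated_convergence measurableT H1 H2 H3 hi H4.
  have fi n : rintegrable mu (fun x => f n x 0 i).
    by apply: vintegrable_coord; exact: vintegrable_le (fh n).
  rewrite integral_rintegrable in cv; last exact: vintegrable_coord.
  have /fine_cvgP[_] := cv; apply: cvg_trans; apply: near_eq_cvg; apply: nearW => n /=.
  by rewrite integral_rintegrable//; exact: fi.
apply/cvg_enormP => e e0.
have e1 : 0 < e / (N%:R + 1) by rewrite divr_gt0// ltr_wpDl.
have : \forall n \near \oo, forall i : 'I_N, `|\int[mu]_x f n x 0 i - \int[mu]_x g x 0 i| <= e / (N%:R + 1).
  apply: filter_forall => i; have /cvgrPdist_le /(_ _ e1) := coord i.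
  by apply: filterS => n; rewrite distrC.
apply: filterS => n hn; apply: le_trans (enorm_le_sum _) _.
apply: (@le_trans _ _ (\sum_(i < N) (e / (N%:R + 1)))).
  by apply: ler_sum => i _; rewrite !mxE; exact: hn.
rewrite sumr_const card_ord -[leLHS]mulr_natl mulrA ler_pdivrMr ?ltr_wpDl// mulrC.
by rewrite ler_pM2l// lerDl.
Qed.

End VectorIntegration.

(** * Criteria for maximality and for belonging to a graph *)

Section MaximalityCriteria.
Variables (R : realType) (N : nat).
Local Notation V := 'rV[R]_N.
Implicit Types T S : operator R N.

(** The easy half of Minty's theorem: if [x + y = x' + v], monotonicity between [(x, y)] and
    [(x', v)] reads [|x - x'|^2 <= 0]. *)
Lemma surjective_maximal S : monotone_op S ->
  (forall w, exists x v, S x v /\ w = x + v) -> maximal_monotone S.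
Proof.
move=> mS surj; split => //.
  by have [x [v [Sxv _]]] := surj 0; exists (x, v).
move=> S' mS' SS'; apply/seteqP; split => // -[x y] /= S'xy.
have [x' [v [Sv E]]] := surj (x + y).
have S'v : S' x' v := SS' (x', v) Sv.
have := mS' _ _ _ _ S'xy S'v.
have yv : y - v = - (x - x').
  apply/eqP; rewrite -subr_eq0 opprK; apply/eqP.
  by rewrite -[RHS](subrr (x + y)) {2}E; apply/rowP => i; rewrite !mxE; ring.
rewrite yv dotvNl oppr_ge0 => le0.
have xx : x = x'.
  apply/eqP; rewrite -subr_eq0; apply/eqP; apply: sqn_eq0.
  by apply/le_anti; rewrite sqn_ge0 andbT.
move/eqP: yv; rewrite xx subrr oppr0 subr_eq0 => /eqP ->.
by rewrite /graph/=.
Qed.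

(* Graphs of maximal monotone operators are closed under strong-times-weak
   limits; here the weak limit is realised by convex combinations. *)
Lemma wcomb_maximal T (p f : nat -> V) (s : nat -> seq (R * nat)) c x g :
  maximal_monotone T -> (forall k, T (p k) (f k)) -> (forall k, enorm (f k) <= c) ->
  p k @[k --> \oo] --> x -> (forall n, wvalid n (s n)) ->
  wcomb (s n) f @[n --> \oo] --> g -> T x g.
Proof.
move=> maxT Tpf fc px sv sg; apply: maximal_in => // a b Tab.
suff : 0 <= dotv (g - b) (x - a).
  by rewrite -(opprB b) -(opprB a) dotvNl dotvNr opprK.
apply/ler_addgt0Pr => e e0.
have c0 : 0 <= c by apply: le_trans (enorm_ge0 _) (fc 0%N).
have K0 : 0 < c + enorm b + 1 by rewrite ltr_wpDl// addr_ge0 ?enorm_ge0.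
have e1 : 0 < e / (c + enorm b + 1) by rewrite divr_gt0.
have /cvg_enormP /(_ _ e1) [n0 _ hn0] := px.
apply: (@cvg_ge0 _ _ \oo _ (fun n => dotv (wcomb (s n) f - b) (x - a) + e)).
  exists n0 => // n /= nn; rewrite (wcomb_affine _ _ _ (sv n)) -lerBlDr sub0r.
  apply: (@wsum_ge R n (s n) (fun k => dotv (f k - b) (x - a)) _ (sv n)) => k nk.
  have := maximal_op_monotone maxT (Tpf k) Tab.
  have -> : p k - a = (x - a) + (p k - x) by rewrite [RHS]addrC addrA subrK.
  rewrite dotvDr => h.
  suff : dotv (f k - b) (p k - x) <= e by lra.
  apply: le_trans (dotv_le _ _) _.
  apply: (@le_trans _ _ ((c + enorm b + 1) * (e / (c + enorm b + 1)))).
    apply: ler_pM; rewrite ?enorm_ge0//; last exact: hn0 (leq_trans nn nk).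
    apply: le_trans (enormD _ _) _; rewrite enormN; have := fc k; lra.
  by rewrite mulrC mulfVK// gt_eqF.
apply: cvgD; last exact: cvg_cst.
apply: cvg_dotv; last exact: cvg_cst.
by apply: cvgB => //; exact: cvg_cst.
Qed.

End MaximalityCriteria.

(** * Maximality of the sum of the mean operators *)

Section MeanOperators.
Variables (R : realType) (N : nat) (d : measure_display) (Xi : measurableType d).
Variable mu : probability Xi R.
Local Notation V := 'rV[R]_N.
Local Notation bV := (borelV R N).

Lemma mean_op_monotone (B : Xi -> operator R N) D : (forall xi, monotone_op (B xi)) ->
  monotone_op (mean_op_on mu B D).
Proof.
move=> mB x y x' y' [_ [phi sphi <-]] [_ [psi spsi <-]].
have ip := selections1_integrable sphi; have iq := selections1_integrable spsi.
rewrite -vintegralB// dotv_vintegral; last exact: vintegrableB.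
apply: Rintegral_ge0_ae; first by apply: dotv_integrable; exact: vintegrableB.
have [_ _ ap] := sphi; have [_ _ aq] := spsi.
by apply: filterS2 ap aq => xi; exact: mB.
Qed.

Lemma op_add_monotone (T S : operator R N) : monotone_op T -> monotone_op S ->
  monotone_op (op_add T S).
Proof.
move=> mT mS x _ x' _ [y Ty [z Sz <-]] [y' Ty' [z' Sz' <-]].
by rewrite opprD addrACA dotvDl addr_ge0//; [exact: mT|exact: mS].
Qed.

Variables (A B : Xi -> operator R N) (b : Xi -> V -> V) (W : Xi -> R) (D : set V).
Hypothesis B_random : random_operator B.
Hypothesis b_sel : forall x, selections mu 1 (fun xi => B xi x) (b^~ x).
Hypothesis W_int : rintegrable mu W.
Hypothesis b_W : forall xi x, sqn (b xi x) <= W xi * (1 + enorm x) ^+ 2.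
Hypothesis maxA : maximal_monotone (mean_op_on mu A D).

Let maxB xi : maximal_monotone (B xi). Proof. exact: random_maximal. Qed.

Let lam k : R := k.+1%:R^-1.
Let lam0 k : 0 < lam k. Proof. by rewrite invr_gt0. Qed.
Let yos_b k x : {ae mu, forall xi, enorm (yosida (lam k) (B xi) x) <= enorm (b xi x)}.
Proof. by have [_ _] := b_sel x; apply: filterS => xi; exact: yosida_le. Qed.

Let bi x : vintegrable mu (b^~ x). Proof. exact: selections1_integrable (b_sel x). Qed.

Let yi k x : vintegrable mu (fun xi => yosida (lam k) (B xi) x).
Proof.
by apply: vintegrable_le (yos_b k x); [exact: yosida_measurable|case: (bi x)].
Qed.

(** Single valued, monotone and Lipschitz, so that [I + calA + L k] is onto by
    [maximal_add_lipschitz_surj]. *)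
Let L k x := vintegral mu (fun xi => yosida (lam k) (B xi) x).

Let L_monotone k x y : 0 <= dotv (L k x - L k y) (x - y).
Proof.
rewrite -vintegralB// dotv_vintegral; last exact: vintegrableB.
apply: Rintegral_ge0_ae; first by apply: dotv_integrable; exact: vintegrableB.
by apply: aeW => xi; exact: yosida_monotone.
Qed.

Let L_lipschitz k x y : enorm (L k x - L k y) <= (lam k)^-1 * enorm (x - y).
Proof.
rewrite -vintegralB//; apply: le_trans (enorm_vintegral (vintegrableB (yi k x) (yi k y))) _.
rewrite -[leRHS](Rintegral_cst1 mu); apply: Rintegral_le_ae.
- by case: (vintegrableB (yi k x) (yi k y)).
- exact: rintegrable_cst.
- by apply: aeW => xi; exact: yosida_lipschitz.
Qed.

Let L_bound k x : enorm (L k x) <= \int[mu]_xi enorm (b xi x).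
Proof.
apply: le_trans (enorm_vintegral (yi k x)) _; apply: Rintegral_le_ae => //.
- by case: (yi k x).
- by case: (bi x).
Qed.

Let W_ge0 : {ae mu, forall xi, 0 <= W xi}.
Proof.
apply: aeW => xi; have := le_trans (sqn_ge0 _) (b_W xi 0).
by rewrite enorm0 addr0 expr1n mulr1.
Qed.

Lemma mean_sum_surjective w : exists x v,
  op_add (mean_op_on mu A D) (mean_op_on mu B setT) x v /\ w = x + v.
Proof.
have /choice[xa hxa] k : exists q : V * V, mean_op_on mu A D q.1 q.2 /\ w = q.1 + q.2 + L k q.1.
  have l0 : 0 <= (lam k)^-1 by rewrite invr_ge0 ltW.
  have [x [a h]] := maximal_add_lipschitz_surj maxA w l0 (L_monotone k) (L_lipschitz k).
  by exists (x, a).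
pose x k := (xa k).1; pose a k := (xa k).2.
have Ax k : mean_op_on mu A D (x k) (a k) by have [] := hxa k.
have wE k : w = x k + a k + L k (x k) by have [] := hxa k.
have [y0 [a0 Ay0]] := maximal_dom_neq0 maxA.
pose b0 := \int[mu]_xi enorm (b xi y0).
have b00 : 0 <= b0 by apply: Rintegral_ge0 => xi _; exact: enorm_ge0.
have mA := maximal_op_monotone maxA.
(* The equation is paired with [x k - y0] for a fixed point of the graph of [calA], and the two
   monotone terms are dropped. *)
have xb0 k : enorm (x k - y0) <= enorm (w - y0 - a0) + b0.
  have h1 := mA _ _ _ _ (Ax k) Ay0; have h2 := L_monotone k (x k) y0.
  have h3 : sqn (x k - y0) <= dotv (w - y0 - a0 - L k y0) (x k - y0).
    move: h1 h2; rewrite (wE k); move: (x k) (a k) (L k (x k)) (L k y0) => X A1 L1 L0.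
    by rewrite /sqn !dotE; lra.
  have := le_trans h3 (dotv_le _ _); rewrite -enormK expr2.
  have [->|u0] := eqVneq (enorm (x k - y0)) 0.
    by move=> _; rewrite addr_ge0 ?enorm_ge0.
  rewrite ler_pM2r ?lt0r ?u0 ?enorm_ge0// => /le_trans; apply.
  by apply: le_trans (enormD _ _) _; rewrite enormN lerD2l L_bound.
pose K := enorm (w - y0 - a0) + b0 + enorm y0.
have xK k : enorm (x k) <= K by apply: le_trans (enorm_sub_ge _ y0) _; rewrite lerD2r.
have K0 : 0 <= K by apply: le_trans (enorm_ge0 _) (xK 0%N).
pose W' xi := W xi * (1 + K) ^+ 2.
have W'i : rintegrable mu W'.
  rewrite (_ : W' = fun xi => (1 + K) ^+ 2 * W xi); first exact: rintegrableZ.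
  by apply/funext => xi; rewrite /W' mulrC.
pose phi k xi := yosida (lam k) (B xi) (x k).
have phiW : {ae mu, forall xi, forall k, sqn (phi k xi) <= W' xi}.
  apply/ae_foralln => k; apply: filterS2 (yos_b k (x k)) W_ge0 => xi h W0.
  rewrite ler_enorm_sqn in h; apply: le_trans h _; apply: le_trans (b_W xi (x k)) _.
  by rewrite ler_wpM2l// ler_pXn2r ?nnegrE ?addr_ge0 ?enorm_ge0// lerD2l.
have mphi k : measurable_fun [set: Xi] (phi k : Xi -> bV) by exact: yosida_measurable.
pose IW := \int[mu]_xi W' xi.
(* Monotonicity of [B xi] holds at the resolvents and not at [x k], [x m]; the discrepancy is
   [lam k * u - lam m * v], where the squares of the Yosida values [u], [v] are bounded by [W'] for
   every [k]. *)
have cauchy k m : sqn (x k - x m) <= (lam k + lam m) * IW.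
  have h1 := mA _ _ _ _ (Ax k) (Ax m).
  have h2 : sqn (x k - x m) <= - dotv (L k (x k) - L m (x m)) (x k - x m).
    move: h1; have : dotv w (x k - x m) = dotv w (x k - x m) by [].
    rewrite {1}(wE k) (wE m); move: (x k) (x m) (a k) (a m) (L k _) (L m _) => X X' A1 A2 L1 L2.
    by rewrite /sqn !dotE (dotvC X' X); lra.
  apply: le_trans h2 _; rewrite -vintegralB// dotv_vintegral; last exact: vintegrableB.
  rewrite -mulN1r -RintegralZl//; last by apply: dotv_integrable; exact: vintegrableB.
  rewrite -RintegralZl//; apply: Rintegral_le_ae.
  - by apply: rintegrableZ; apply: dotv_integrable; exact: vintegrableB.
  - exact: rintegrableZ.
  apply: filterS phiW => xi h; rewrite mulN1r.
  have mono := maximal_op_monotone (maxB xi) (yosida_in (maxB xi) (lam0 k) (x k))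
     (yosida_in (maxB xi) (lam0 m) (x m)).
  have := h k; have := h m; rewrite /phi; move: mono.
  have -> : x k - x m = resolvent (lam k) (B xi) (x k) - resolvent (lam m) (B xi) (x m)
     + (lam k *: yosida (lam k) (B xi) (x k) - lam m *: yosida (lam m) (B xi) (x m)).
    rewrite {1}(resolventE (B xi) (lam0 k) (x k)) {1}(resolventE (B xi) (lam0 m) (x m)).
    by apply/rowP => i; rewrite !mxE; ring.
  move: (yosida _ _ (x k)) (yosida _ _ (x m)) => u v.
  rewrite [dotv _ (_ + (_ - _))]dotvDr => h1' h3 h4.
  have : (lam k + lam m) * (sqn u + sqn v) <= (lam k + lam m) * (2 * W' xi).
    by rewrite ler_pM2l ?addr_gt0//; lra.
  have := young u v; move: h1' (lam0 k) (lam0 m) (sqn_ge0 u) (sqn_ge0 v).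
  move: (lam k) (lam m) => p q mono p0 q0 u0 v0 yo.
  have yy : (p + q) * (2 * dotv u v) <= (p + q) * (sqn u + sqn v).
    by rewrite ler_pM2l ?addr_gt0.
  have : 0 <= p * sqn u by rewrite mulr_ge0// ltW.
  have : 0 <= q * sqn v by rewrite mulr_ge0// ltW.
  rewrite [dotv (u - v) (p *: u - q *: v)]dotvDl !dotvDr !dotvNr !dotvNl !dotvZr.
  rewrite (dotvC v u) -!/(sqn _).
  move: mono yy; rewrite dotvDr dotvNr.
  move: (dotv _ (resolvent p _ _)) (dotv _ (resolvent q _ _)) (dotv u v) (sqn u) (sqn v) (W' xi) => *.
  by lra.
have IW0 : 0 <= IW.
  by apply: Rintegral_ge0_ae => //; apply: filterS phiW => xi /(_ 0%N); apply: le_trans; exact: sqn_ge0.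
have [xs xxs] : exists xs : V, x k @[k --> \oo] --> xs.
  apply: enorm_cauchy_cvg => e e0.
  have e2 : 0 < e ^+ 2 / (2 * (IW + 1)) by rewrite divr_gt0 ?exprn_gt0// mulr_gt0// ltr_wpDl.
  have [n0 hn0] := natSinv_small e2; exists n0 => n m nn nm.
  rewrite -(sqn_le _ (ltW e0)); apply: le_trans (cauchy _ _) _.
  have := hn0 _ nn; have := hn0 _ (leq_trans nn nm); rewrite -/(lam n) -/(lam m).
  rewrite !ler_pdivlMr ?mulr_gt0 ?ltr_wpDl//.
  by have := lam0 n; have := lam0 m; nra.
have phiC k : (\int[mu]_xi (sqn (phi k xi))%:E <= IW%:E)%E.
  rewrite /IW -integral_rintegrable//; apply: ae_ge0_le_integral => //.
  - by move=> xi _; rewrite lee_fin sqn_ge0.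
  - by apply/measurable_EFinP; exact: measurable_sqn.
  - move=> xi _; rewrite lee_fin /W' mulr_ge0 ?sqr_ge0//.
    have := le_trans (sqn_ge0 _) (b_W xi 0).
    by rewrite enorm0 addr0 expr1n mulr1.
  - by apply/measurable_EFinP; exact: rintegrable_measurable W'i.
  - by apply: filterS phiW => xi h _; rewrite lee_fin.
have [s [sv [g [mg sg]]]] := mazur mphi phiC.
have xJ xi c : (forall k, sqn (phi k xi) <= c) ->
    resolvent (lam k) (B xi) (x k) @[k --> \oo] --> xs.
  move=> hc; have c0 : 0 <= c by apply: le_trans (sqn_ge0 _) (hc 0%N).
  have -> : (fun k => resolvent (lam k) (B xi) (x k)) = (fun k => x k - lam k *: phi k xi).
    by apply/funext => k; rewrite -resolvent_sub// opprB addrC subrK.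
  rewrite -[X in _ --> X]subr0; apply: cvgB => //.
  apply/cvg_enormP => e e0.
  have e1 : 0 < e / (c + 1) by rewrite divr_gt0// ltr_wpDl.
  have [n0 hn0] := natSinv_small e1; exists n0 => // k /= /hn0; rewrite -/(lam k).
  rewrite ler_pdivlMr ?ltr_wpDl// subr0 enormZ gtr0_norm// => /le_trans h'.
  apply: le_trans (h' _ (lexx _)); rewrite ler_pM2l//.
  have := hc k; rewrite -enormK; have := enorm_ge0 (phi k xi).
  by have := sqr_ge0 (enorm (phi k xi) - 1); rewrite !expr2; nra.
have Bg : {ae mu, forall xi, B xi xs (g xi)}.
  apply: filterS2 sg phiW => xi sgx hx.
  apply: (@wcomb_maximal R N (B xi) (fun k => resolvent (lam k) (B xi) (x k)) (phi^~ xi) s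
     (W' xi + 1) xs (g xi)) => //.
  - by move=> k; exact: yosida_in.
  - move=> k; have := hx k; rewrite -enormK; have := enorm_ge0 (phi k xi).
    by have := sqr_ge0 (enorm (phi k xi) - 1); rewrite !expr2; nra.
  - exact: xJ hx.
pose h xi := W' xi + 1.
have hi : rintegrable mu h by apply: rintegrableD => //; exact: rintegrable_cst.
have ms n : measurable_fun [set: Xi] ((fun xi => wcomb (s n) (phi^~ xi)) : Xi -> bV).
  by apply: measurable_vsum => p; exact: measurable_vscale.
have phih : {ae mu, forall xi, forall k, enorm (phi k xi) <= h xi}.
  apply: filterS phiW => xi hx k.
  have := hx k; rewrite -enormK; have := enorm_ge0 (phi k xi).
  by have := sqr_ge0 (enorm (phi k xi) - 1); rewrite /h !expr2; nra.
have sh n : {ae mu, forall xi, enorm (wcomb (s n) (phi^~ xi)) <= h xi}.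
  apply: filterS phih => xi hx; rewrite -[X in enorm X]subr0.
  by apply: (enorm_wcomb_le (sv n)) => k _; rewrite subr0.
have [gi gcv] := vintegral_dominated ms mg hi sh sg.
have vw n : vintegral mu (fun xi => wcomb (s n) (phi^~ xi)) = wcomb (s n) (fun k => L k (x k)).
  apply/rowP => i; rewrite mxE /wcomb summxE.
  have [_ E] := @Rintegral_wsum R _ _ mu _ setT (s n) (fun p => p.1)
    (fun p xi => phi p.2 xi 0 i) measurableT (fun p => vintegrable_coord i (yi p.2 (x p.2))).
  transitivity (\int[mu]_xi (\sum_(p <- s n) p.1 * phi p.2 xi 0 i)).
    by apply: eq_Rintegral => xi _; rewrite summxE; apply: eq_bigr => p _; rewrite mxE.
  by rewrite E; apply: eq_bigr => p _; rewrite !mxE.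
have xs_cv : wcomb (s n) x @[n --> \oo] --> xs.
  apply/cvg_enormP => e e0; have /cvg_enormP /(_ _ e0) [n0 _ hn0] := xxs.
  exists n0 => // n /= nn; apply: (enorm_wcomb_le (sv n)) => k nk.
  exact: hn0 (leq_trans nn nk).
have Lb k : enorm (L k (x k)) <= IW + 1.
  apply: le_trans (enorm_vintegral (yi k (x k))) _.
  rewrite -(Rintegral_cst1 mu 1) -RintegralD//; last exact: rintegrable_cst.
  apply: Rintegral_le_ae; [by case: (yi k (x k))|exact: hi|].
  by apply: filterS phih => xi; exact.
(* The weights found for the Yosida values are applied to the whole equation, so that the
   combinations of the [a k] converge although the [a k] themselves are only known to be bounded. *)
have as_cv : wcomb (s n) a @[n --> \oo] --> w - xs - vintegral mu g.
  have -> : (fun n => wcomb (s n) a) =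
      (fun n => w - wcomb (s n) x - vintegral mu (fun xi => wcomb (s n) (phi^~ xi))).
    apply/funext => n; rewrite vw; have [_ _ s1] := sv n.
    have {1}-> : w = \sum_(p <- s n) p.1 *: w by rewrite -scaler_suml s1 scale1r.
    rewrite /wcomb -!sumrB; apply: eq_bigr => p _.
    by rewrite -!scalerBr {1}(wE p.2) addrAC addrK addrC addKr.
  apply: cvgB => //; apply: cvgB => //; exact: cvg_cst.
have Aa : mean_op_on mu A D xs (w - xs - vintegral mu g).
  apply: (@wcomb_maximal R N _ x a s (enorm w + K + (IW + 1))) => //.
  move=> k; have -> : a k = w - x k - L k (x k).
    by rewrite {1}(wE k) addrAC addrK addrC addKr.
  apply: le_trans (enormD _ _) _; rewrite enormN; apply: lerD => //.
  by apply: le_trans (enormD _ _) _; rewrite enormN lerD2l.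
exists xs, (w - xs); split; last by rewrite addrC subrK.
exists (w - xs - vintegral mu g) => //; exists (vintegral mu g); last by rewrite subrK.
split => //; exists g => //; exact: integrable_selections1.
Qed.

Lemma mean_sum_maximal :
  maximal_monotone (op_add (mean_op_on mu A D) (mean_op_on mu B setT)).
Proof.
apply: surjective_maximal; last exact: mean_sum_surjective.
apply: op_add_monotone; first exact: maximal_op_monotone.
by apply: mean_op_monotone => xi; exact: maximal_op_monotone.
Qed.

End MeanOperators.

(** * Martingale estimates *)

Section Past.
Variables (R : realType) (d : measure_display) (Xi : measurableType d).
Variable mu : probability Xi R.
Variables (d' : measure_display) (Omega : measurableType d').
Variable P : probability Omega R.
Variable u : nat -> Omega -> Xi.

(** Cylinders over [u 0, ..., u n.-1]: a pi-system, on which independence from [u n] is easily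
    checked. The convention is that [u n] drives the step from [n] to [n.+1]. *)
Definition past_gen n : set (set Omega) :=
  [set A | exists2 E : nat -> set Xi, (forall i, measurable (E i)) &
     A = \big[setI/setT]_(i <- iota 0 n) (u i @^-1` E i)].

Notation Past n := (g_sigma_algebraType (past_gen n)).

Hypothesis u_iid : iid_seq mu P u.

Let u_m n : measurable_fun [set: Omega] (u n). Proof. by case: u_iid. Qed.

Let u_pre n E : measurable E -> measurable (u n @^-1` E).
Proof. by move=> mE; rewrite -[X in measurable X]setTI; exact: u_m. Qed.

Let past_gen_sub n : past_gen n `<=` measurable.
Proof.
move=> _ [E mE ->]; elim: (iota 0 n) => [|i s IH]; first by rewrite big_nil.
by rewrite big_cons; apply: measurableI => //; exact: u_pre.
Qed.

Lemma past_sub n (A : set Omega) : measurable (A : set (Past n)) -> measurable A.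
Proof. by apply: smallest_sub; [exact: sigma_algebra_measurable|exact: past_gen_sub]. Qed.

Lemma past_id_measurable n : measurable_fun [set: Omega] (id : Omega -> Past n).
Proof. by move=> _ A mA; rewrite setTI preimage_id; exact: past_sub mA. Qed.

Lemma past_measurable (dY : measure_display) (Y : measurableType dY) n (f : Omega -> Y) :
  measurable_fun [set: Past n] (f : Past n -> Y) -> measurable_fun [set: Omega] f.
Proof. by move=> mf; exact: (measurableT_comp mf (@past_id_measurable n)). Qed.

Lemma pastS_measurable n : measurable_fun [set: Past n.+1] (id : Past n.+1 -> Past n).
Proof.
move=> _ A mA; rewrite setTI preimage_id.
move: A mA; apply: smallest_sub; first exact: sigma_algebra_measurable.
move=> _ [E mE ->]; apply: sub_sigma_algebra.
exists (fun i => if (i < n)%N then E i else setT).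
  by move=> i; case: ifP.
rewrite -addn1 iotaD big_cat/= add0n big_cons big_nil setIT ltnn preimage_setT setIT.
by rewrite big_seq [RHS]big_seq; apply: eq_bigr => i; rewrite mem_iota/= => ->.
Qed.

Lemma past_u_measurable n : measurable_fun [set: Past n.+1] (u n : Past n.+1 -> Xi).
Proof.
move=> _ E mE; rewrite setTI; apply: sub_sigma_algebra.
exists (fun i => if i == n then E else setT).
  by move=> i; case: ifP.
rewrite -addn1 iotaD big_cat/= add0n big_cons big_nil setIT eqxx big1_seq ?setTI//.
move=> i /andP[_]; rewrite mem_iota/= => lin; rewrite ifN ?preimage_setT//.
by rewrite neq_ltn lin.
Qed.

(** Both sides are finite measures in [A] that agree on the cylinders. *)
Let past_indep n (A : set Omega) (E : set Xi) : measurable (A : set (Past n)) ->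
  measurable E -> P (A `&` u n @^-1` E) = (P A * mu E)%E.
Proof.
move=> mA mE; have mEu := u_pre n mE.
have muE : mu E = (fine (mu E))%:E by rewrite fineK// fin_num_measure.
have muE0 : 0 <= fine (mu E) by apply: fine_ge0.
pose m1 := [the {measure set Omega -> \bar R} of mrestr P mEu].
pose m2 := [the {measure set Omega -> \bar R} of mscale (NngNum muE0) P].
suff : m1 A = m2 A by rewrite /m1 /m2 /= /mrestr /mscale/= => ->; rewrite muE muleC.
apply: (@g_sigma_algebra_measure_unique _ _ _ (past_gen n) (@past_gen_sub n) (fun=> setT)) => //.
- by move=> _; exists (fun=> setT) => //; rewrite big1.
- by rewrite bigcup_const.
- move=> _ _ [E1 m1E ->] [E2 m2E ->]; exists (fun i => E1 i `&` E2 i).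
    by move=> i; exact: measurableI.
  by rewrite -big_split.
- move=> _ [E' mE' ->]; rewrite /m1 /m2 /= /mrestr /mscale/= -muE muleC.
  have [_ law indep] := u_iid.
  pose E2 i := if i == n then E else E' i.
  have E2m i : measurable (E2 i) by rewrite /E2; case: ifP.
  have := indep (iota 0 n.+1) E2 (iota_uniq _ _) E2m.
  rewrite -addn1 iotaD !big_cat/= add0n !big_cons !big_nil setIT mule1.
  have -> : \big[setI/setT]_(i <- iota 0 n) (u i @^-1` E2 i) =
      \big[setI/setT]_(i <- iota 0 n) (u i @^-1` E' i).
    rewrite big_seq [RHS]big_seq; apply: eq_bigr => i; rewrite mem_iota/= => lin.
    by rewrite /E2 ltn_eqF.
  have -> : (\prod_(i <- iota 0 n) P (u i @^-1` E2 i))%E =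
      (\prod_(i <- iota 0 n) P (u i @^-1` E' i))%E.
    rewrite big_seq [RHS]big_seq; apply: eq_bigr => i; rewrite mem_iota/= => lin.
    by rewrite /E2 ltn_eqF.
  rewrite -(indep (iota 0 n) E' (iota_uniq _ _) mE').
  by rewrite /E2 eqxx => ->; congr (_ * _)%E; exact: law.
- by move=> _; rewrite /m1/= /mrestr (le_lt_trans (probability_le1 _ _)) ?ltry//; apply: measurableI.
Qed.

(** The joint law of the past and of [u n] is a product, so this is Tonelli's theorem; the inner
    integral stands for the conditional expectation given the past. *)
Lemma past_integral n (f : Past n * Xi -> \bar R) :
  measurable_fun [set: Past n * Xi] f -> (forall q, 0 <= f q)%E ->
  (\int[P]_w f (w, u n w) = \int[P]_w \int[mu]_xi f (w, xi))%E.
Proof.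
move=> mf f0.
pose phi w : Past n * Xi := (w, u n w).
have mphi : measurable_fun [set: Omega] phi.
  by apply/measurable_fun_pairP; split; [exact: past_id_measurable|exact: u_m].
pose phiM : {mfun Omega >-> (Past n * Xi)%type} :=
  HB.pack phi (isMeasurableFun.Build _ _ _ _ _ mphi).
pose idM : {mfun Omega >-> Past n} :=
  HB.pack (id : Omega -> Past n) (isMeasurableFun.Build _ _ _ _ _ (@past_id_measurable n)).
pose m1 : probability (Past n) R := distribution P idM.
pose m2 : probability (Past n * Xi)%type R := distribution P phiM.
have E X : measurable X -> (m1 \x mu)%E X = m2 X.
  apply: product_measure_unique => A1 A2 mA1 mA2.
  rewrite /m2 /m1 /= /distribution /pushforward /=.
  by rewrite -(past_indep mA1 mA2); congr (P _); apply/seteqP; split.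
have H1 : (\int[m2]_q f q = \int[P]_w f (w, u n w))%E.
  by rewrite ge0_integral_pushforward// => *; exact: f0.
have H2 : (\int[m1 \x mu]_q f q = \int[m2]_q f q)%E.
  by apply: eq_measure_integral => X mX _; exact: E.
rewrite -H1 -H2 fubini_tonelli1//.
rewrite ge0_integral_pushforward//.
- exact: measurable_fun_fubini_tonelli_F.
- by move=> x _; apply: integral_ge0 => y _; exact: f0.
Qed.

End Past.

(** * Series with bounded partial sums *)

Section BoundedSums.
Variable R : realType.
Implicit Types a b : nat -> R.

Definition bounded_sums a := exists c, forall n, \sum_(0 <= k < n) a k <= c.

Lemma bounded_sums_tail a : (forall k, 0 <= a k) -> bounded_sums a ->
  forall e, 0 < e -> exists n0, forall n m, (n0 <= n)%N -> (n <= m)%N ->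
    \sum_(n <= k < m) a k <= e.
Proof.
move=> a0 [c ac] e e0; pose S := [set \sum_(0 <= k < n) a k | n in [set: nat]].
have hS : has_sup S.
  by split; [exists (\sum_(0 <= k < 0) a k), 0%N|exists c => _ [n _ <-]].
have [_ [n0 _ <-] hn0] := sup_adherent e0 hS.
exists n0 => n m nn nm.
have : \sum_(0 <= k < m) a k <= sup S by apply: ub_le_sup; [case: hS|exists m].
rewrite (big_cat_nat (leq0n n) nm)/=.
have : \sum_(0 <= k < n0) a k <= \sum_(0 <= k < n) a k.
  by rewrite [leRHS](big_cat_nat (leq0n n0) nn)/= lerDl sumr_ge0.
by move: hn0; lra.
Qed.

Lemma bounded_sums_small a : (forall k, 0 <= a k) -> bounded_sums a ->
  forall e, 0 < e -> exists n0, forall n, (n0 <= n)%N -> a n <= e.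
Proof.
move=> a0 ba e e0; have [n0 hn0] := bounded_sums_tail a0 ba e0.
by exists n0 => n nn; have := hn0 n n.+1 nn (leqnSn n); rewrite big_nat1.
Qed.

Lemma bounded_sums_le a b : (forall k, a k <= b k) -> bounded_sums b -> bounded_sums a.
Proof. by move=> ab [c bc]; exists c => n; apply: le_trans (bc n); exact: ler_sum. Qed.

Lemma bounded_sumsD a b : bounded_sums a -> bounded_sums b ->
  bounded_sums (fun k => a k + b k).
Proof. by move=> [c ac] [e be]; exists (c + e) => n; rewrite big_split lerD. Qed.

Lemma bounded_sumsZ c a : 0 <= c -> bounded_sums a -> bounded_sums (fun k => c * a k).
Proof. by move=> c0 [e ae]; exists (c * e) => n; rewrite -mulr_sumr ler_wpM2l. Qed.

Lemma bounded_sums_eventually a b n0 : (forall k, (n0 <= k)%N -> a k <= b k) ->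
  (forall k, 0 <= b k) -> bounded_sums b -> bounded_sums a.
Proof.
move=> ab b0 [c bc]; exists (\sum_(0 <= k < n0) `|a k| + c) => n.
apply: (@le_trans _ _ (\sum_(0 <= k < n) ((if (k < n0)%N then `|a k| else 0) + b k))).
  by apply: ler_sum => k _; case: ltnP => h; [rewrite ler_wpDr// ler_norm|rewrite add0r ab].
rewrite big_split lerD//=.
apply: (@le_trans _ _ (\sum_(0 <= k < n + n0) (if (k < n0)%N then `|a k| else 0))).
  by rewrite [leRHS](big_cat_nat (leq0n n) (leq_addr _ _))/= lerDl sumr_ge0// => k _; case: ifP.
rewrite (big_cat_nat (leq0n n0) (leq_addl _ _))/= [X in _ + X]big_nat_cond [X in _ + X]big1 ?addr0.
  by rewrite big_nat_cond [leRHS]big_nat_cond; apply: ler_sum => k; rewrite andbT => /andP[_ ->].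
by move=> k; rewrite andbT => /andP[h _]; rewrite ltnNge h.
Qed.

End BoundedSums.

(** * Adapted processes: drift inequalities and martingales *)

Section AdaptedProcesses.
Variables (R : realType) (d : measure_display) (Xi : measurableType d).
Variable mu : probability Xi R.
Variables (d' : measure_display) (Omega : measurableType d').
Variable P : probability Omega R.
Variable u : nat -> Omega -> Xi.
Hypothesis u_iid : iid_seq mu P u.

Notation Past n := (g_sigma_algebraType (past_gen u n)).

Definition adapted (f : nat -> Omega -> R) :=
  forall n, measurable_fun [set: Past n] (f n : Past n -> R).

Definition adapted2 (h : nat -> Omega -> Xi -> R) :=
  forall n, measurable_fun [set: Past n * Xi] (fun q : Past n * Xi => h n q.1 q.2).

Lemma adapted_measurable f n : adapted f -> measurable_fun [set: Omega] (f n).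
Proof. by move=> /(_ n); exact: (past_measurable u_iid). Qed.

Lemma adapted2_next h n : adapted2 h ->
  measurable_fun [set: Past n.+1] ((fun w => h n w (u n w)) : Past n.+1 -> R).
Proof.
move=> mh; apply: (measurableT_comp (mh n) (g := fun w : Past n.+1 => (w : Past n, u n w))).
by apply/measurable_fun_pairP; split; [exact: pastS_measurable|exact: past_u_measurable].
Qed.

Lemma adapted_adapted2 f : adapted f -> adapted2 (fun n w _ => f n w).
Proof. by move=> mf n; exact: (measurableT_comp (mf n) (@measurable_fst _ _ _ _)). Qed.

Lemma adapted_sum f : adapted f -> adapted (fun n w => \sum_(0 <= k < n.+1) f k w).
Proof.
move=> mf; elim=> [|n IH].
  by under eq_fun do rewrite big_nat1; exact: mf.
under eq_fun do rewrite big_nat_recr//=.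
by apply: measurable_funD => //; exact: (measurableT_comp IH (@pastS_measurable _ _ _ _ u n)).
Qed.

Lemma adapted2_section h n w : adapted2 h -> measurable_fun [set: Xi] (h n w).
Proof.
by move=> mh; exact: (measurableT_comp (mh n) (@measurable_pair1 _ _ (Past n) Xi w)).
Qed.

Lemma expectation_next (h : nat -> Omega -> Xi -> R) n : adapted2 h ->
  (forall w xi, 0 <= h n w xi) ->
  (\int[P]_w (h n w (u n w))%:E = \int[P]_w \int[mu]_xi (h n w xi)%:E)%E.
Proof.
move=> mh h0.
have mf : measurable_fun [set: Past n * Xi] (fun q : Past n * Xi => (h n q.1 q.2)%:E).
  by apply/measurable_EFinP; exact: mh.
by apply: (past_integral u_iid mf) => q; rewrite lee_fin.
Qed.

(** The drift inequality is integrated and telescoped. All terms are nonnegative extended reals, so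
    no integrability has to be known beforehand. *)
Lemma drift_expectation (U W be : nat -> Omega -> R) (h : nat -> Omega -> Xi -> R) c0 :
  adapted U -> adapted W -> adapted be -> adapted2 h ->
  (forall k w, 0 <= U k w) -> (forall k w, 0 <= W k w) -> (forall k w, 0 <= be k w) ->
  (forall k w xi, 0 <= h k w xi) ->
  (forall w, U 0%N w <= c0) -> (forall k w, U k.+1 w <= h k w (u k w)) ->
  (forall k w, (\int[mu]_xi (h k w xi)%:E + (W k w)%:E <= (U k w + be k w)%:E)%E) ->
  forall n, (\sum_(0 <= k < n) \int[P]_w (W k w)%:E + \int[P]_w (U n w)%:E <=
    c0%:E + \sum_(0 <= k < n) \int[P]_w (be k w)%:E)%E.
Proof.
move=> aU aW ab ah U0 W0 b0 h0 Uc Uh drift.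
have m_ f n : adapted f -> measurable_fun [set: Omega] (fun w => (f n w)%:E).
  by move=> af; apply/measurable_EFinP; exact: adapted_measurable.
elim=> [|n IH].
  rewrite !big_nil add0e adde0.
  have -> : c0%:E = (\int[P]_w (cst c0%:E w))%E.
    by rewrite integral_cst// [X in (_ * X)%E](@probability_setT _ _ _ P) mule1.
  by apply: ge0_le_integral => //; [move=> w _; rewrite lee_fin|exact: m_|move=> w _; rewrite lee_fin].
have recr (f : nat -> \bar R) :
    (\sum_(0 <= k < n.+1) f k = \sum_(0 <= k < n) f k + f n)%E by rewrite big_nat_recr.
rewrite !recr -addeA.
apply: (@le_trans _ _ (\sum_(0 <= k < n) \int[P]_w (W k w)%:E +
    (\int[P]_w (U n w)%:E + \int[P]_w (be n w)%:E))%E); last first.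
  by rewrite [leLHS]addeA [leRHS]addeA; apply: leeD2r; exact: IH.
rewrite leeD2l// -[leRHS]ge0_integralD//; [|by move=> w _; rewrite lee_fin|exact: m_|by move=> w _; rewrite lee_fin|exact: m_].
have mI : measurable_fun [set: Omega] (fun w => \int[mu]_xi (h n w xi)%:E)%E.
  apply: (@past_measurable _ _ _ mu _ _ P u u_iid _ _ n).
  apply: (@measurable_fun_fubini_tonelli_F _ _ _ _ _ mu (fun q : Past n * Xi => (h n q.1 q.2)%:E)).
    by apply/measurable_EFinP; exact: ah.
  by move=> q; rewrite lee_fin.
apply: (@le_trans _ _ (\int[P]_w ((W n w)%:E + \int[mu]_xi (h n w xi)%:E))%E); last first.
  apply: ge0_le_integral => //.
  - by move=> w _; rewrite adde_ge0 ?lee_fin// integral_ge0// => xi _; rewrite lee_fin.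
  - by apply: emeasurable_funD => //; exact: m_.
  - by apply: emeasurable_funD; exact: m_.
  - by move=> w _; rewrite addeC; exact: drift.
have IW : (\int[P]_w ((W n w)%:E + \int[mu]_xi (h n w xi)%:E) =
    \int[P]_w (W n w)%:E + \int[P]_w \int[mu]_xi (h n w xi)%:E)%E.
  apply: ge0_integralD => //; first by move=> w _; rewrite lee_fin.
    exact: m_.
  by move=> w _; rewrite integral_ge0// => xi _; rewrite lee_fin.
rewrite IW leeD2l// -(expectation_next ah)//.
apply: ge0_le_integral => //.
- by move=> w _; rewrite lee_fin.
- exact: m_.
- apply/measurable_EFinP.
  exact: (@past_measurable _ _ _ mu _ _ P u u_iid _ _ n.+1 _ (adapted2_next ah)).
- by move=> w _; rewrite lee_fin.
Qed.

(** A stopping time written as a 0-1 factor. The current term is included in the sum, which is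
    allowed because [be k] is known before [u k] is drawn; the gated sums of [be] thus never exceed
    [K]. *)
Definition gate (be : nat -> Omega -> R) (K : R) k w : R :=
  ((\sum_(0 <= j < k.+1) be j w <= K)%R)%:R.

Lemma gate_adapted be K : adapted be -> adapted (gate be K).
Proof.
move=> ab k.
have mB : measurable_fun [set: Past k] (fun w : Past k => \sum_(0 <= j < k.+1) be j w <= K).
  by apply: measurable_fun_ler; [exact: adapted_sum|exact: measurable_cst].
have -> : (gate be K k : Past k -> R) =
    (fun w : Past k => if \sum_(0 <= j < k.+1) be j w <= K then 1 else 0).
  by apply/funext => w; rewrite /gate; case: ifP.
by apply: measurable_fun_ifT => //; exact: measurable_cst.
Qed.

Lemma gate01 be K k w : gate be K k w = 0 \/ gate be K k w = 1.
Proof. by rewrite /gate; case: (_ <= _); [right|left]. Qed.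

Lemma gate_ge0 be K k w : 0 <= gate be K k w.
Proof. exact: ler0n. Qed.

Lemma gate_decr be K k w : (forall k w, 0 <= be k w) -> gate be K k.+1 w <= gate be K k w.
Proof.
move=> b0; rewrite /gate ler_nat; case: (leP _ K) => //= h.
suff -> : \sum_(0 <= j < k.+1) be j w <= K by [].
by apply: le_trans h; rewrite [leRHS]big_nat_recr//= lerDl.
Qed.

Lemma gate_sum_le be K n w : (forall k w, 0 <= be k w) -> 0 <= K ->
  \sum_(0 <= k < n) gate be K k w * be k w <= K.
Proof.
move=> b0 K0; elim: n => [|n IH]; first by rewrite big_nil.
have [g0|g1] := gate01 be K n w; first by rewrite big_nat_recr//= g0 mul0r addr0.
apply: (@le_trans _ _ (\sum_(0 <= k < n.+1) be k w)).
  by apply: ler_sum => k _; have [->|->] := gate01 be K k w; rewrite ?mul0r ?mul1r.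
by move: g1; rewrite /gate; case: (leP _ K) => // _ /esym /eqP; rewrite oner_eq0.
Qed.

Lemma gate_open be K w : (forall n, \sum_(0 <= k < n) be k w <= K) ->
  forall k, gate be K k w = 1.
Proof. by move=> h k; rewrite /gate h. Qed.

Lemma gate_expectation be K n : adapted be -> (forall k w, 0 <= be k w) -> 0 <= K ->
  (\sum_(0 <= k < n) \int[P]_w (gate be K k w * be k w)%:E <= K%:E)%E.
Proof.
move=> ab b0 K0.
have mg k : measurable_fun [set: Omega] (fun w => (gate be K k w * be k w)%:E).
  apply/measurable_EFinP; apply: measurable_funM.
    by apply: adapted_measurable; exact: gate_adapted.
  exact: adapted_measurable.
have g0 k w : [set: Omega] w -> (0 <= (gate be K k w * be k w)%:E)%E.
  by move=> _; rewrite lee_fin mulr_ge0 ?gate_ge0.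
rewrite -ge0_integral_sum//.
have -> : K%:E = (\int[P]_w (cst K%:E w))%E.
  by rewrite integral_cst// [X in (_ * X)%E](@probability_setT _ _ _ P) mule1.
apply: ge0_le_integral => //.
- by move=> w _; apply: sume_ge0 => k _; exact: g0.
- by apply: emeasurable_sum => k; exact: mg.
- by move=> w _; rewrite sumEFin lee_fin; exact: gate_sum_le.
Qed.

(* Robbins and Siegmund: stopping when the sum of the [be k] exceeds [K] makes
   the drift summable in expectation. *)
Lemma bounded_sums_drift (U W be : nat -> Omega -> R) (h : nat -> Omega -> Xi -> R) c0 :
  adapted U -> adapted W -> adapted be -> adapted2 h ->
  (forall k w, 0 <= U k w) -> (forall k w, 0 <= W k w) -> (forall k w, 0 <= be k w) ->
  (forall k w xi, 0 <= h k w xi) ->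
  (forall w, U 0%N w <= c0) -> (forall k w, U k.+1 w <= h k w (u k w)) ->
  (forall k w, (\int[mu]_xi (h k w xi)%:E + (W k w)%:E <= (U k w + be k w)%:E)%E) ->
  {ae P, forall w, bounded_sums (be^~ w)} -> {ae P, forall w, bounded_sums (W^~ w)}.
Proof.
move=> aU aW ab ah U0 W0 b0 h0 Uc Uh drift sb.
(* The level is a natural number, so that there are only countably many exceptional sets. *)
have key K : {ae P, forall w, (forall n, \sum_(0 <= k < n) be k w <= K%:R) ->
    bounded_sums (W^~ w)}.
  pose g := gate be K%:R.
  have ag : adapted g by exact: gate_adapted.
  have gp k w : 0 <= g k w by exact: gate_ge0.
  have aM f : adapted f -> adapted (fun k w => g k w * f k w).
    by move=> af k; apply: measurable_funM; [exact: ag|exact: af].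
  have c00 : 0 <= c0 by apply: le_trans (Uc point).
  have := @drift_expectation (fun k w => g k w * U k w) (fun k w => g k w * W k w)
    (fun k w => g k w * be k w) (fun k w xi => g k w * h k w xi) c0 (aM _ aU) (aM _ aW) (aM _ ab).
  have ah' : adapted2 (fun k w xi => g k w * h k w xi).
    by move=> k; apply: measurable_funM; [exact: adapted_adapted2|exact: ah].
  have p1 k w : 0 <= g k w * U k w by rewrite mulr_ge0.
  have p2 k w : 0 <= g k w * W k w by rewrite mulr_ge0.
  have p3 k w : 0 <= g k w * be k w by rewrite mulr_ge0.
  have p4 k w xi : 0 <= g k w * h k w xi by rewrite mulr_ge0.
  have p5 w : g 0%N w * U 0%N w <= c0.
    by rewrite /g; have [->|->] := gate01 be K%:R 0 w; rewrite ?mul0r ?mul1r.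
  have p6 k w : g k.+1 w * U k.+1 w <= g k w * h k w (u k w).
    by apply: ler_pM => //; exact: gate_decr.
  have p7 k w : (\int[mu]_xi (g k w * h k w xi)%:E + (g k w * W k w)%:E <=
      (g k w * U k w + g k w * be k w)%:E)%E.
    rewrite /g; have [->|->] := gate01 be K%:R k w.
      by rewrite integral0_eq ?add0e ?lee_fin ?mul0r ?addr0// => xi _; rewrite mul0r.
    by rewrite !mul1r; under eq_integral do rewrite mul1r; exact: drift.
  move=> /(_ ah' p1 p2 p3 p4 p5 p6 p7) bnd.
  have mW k : measurable_fun [set: Omega] (fun w => (g k w * W k w)%:E).
    by apply/measurable_EFinP; exact: (adapted_measurable k (aM _ aW)).
  have W0' k w : [set: Omega] w -> (0 <= (g k w * W k w)%:E)%E by rewrite lee_fin.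
  have fin : (\int[P]_w (\sum_(0 <= k <oo) (g k w * W k w)%:E) <= (c0 + K%:R)%:E)%E.
    rewrite integral_nneseries//; apply: lime_le.
      by apply: is_cvg_nneseries => k _ _; apply: integral_ge0 => w _; rewrite lee_fin.
    apply: nearW => n; have := bnd n.
    have := @gate_expectation be K%:R n ab b0 (ler0n _ _) => h1 h2.
    rewrite EFinD; apply: (@le_trans _ _ (c0%:E + \sum_(0 <= k < n) \int[P]_w (g k w * be k w)%:E)%E).
      by apply: le_trans h2; rewrite leeDl// integral_ge0// => w _; rewrite lee_fin.
    by rewrite leeD2l.
  have S0 w : (0 <= \sum_(0 <= k <oo) (g k w * W k w)%:E)%E.
    by apply: nneseries_ge0 => k _ _; rewrite lee_fin.
  have : P.-integrable setT (fun w => \sum_(0 <= k <oo) (g k w * W k w)%:E)%E.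
    apply/integrableP; split.
      by apply: ge0_emeasurable_sum => // k w _ _; rewrite lee_fin.
    by under eq_integral do rewrite gee0_abs//; rewrite (le_lt_trans fin)// ltry.
  move=> /(integrable_ae measurableT); apply: filterS => w /(_ I) fw hK.
  exists (fine (\sum_(0 <= k <oo) (g k w * W k w)%:E)%E) => n.
  rewrite -lee_fin fineK// -sumEFin.
  have -> : (\sum_(0 <= k < n) (W k w)%:E = \sum_(0 <= k < n) (g k w * W k w)%:E)%E.
    by apply: eq_bigr => k _; rewrite /g gate_open// mul1r.
  by apply: nneseries_lim_ge => k _ _; rewrite lee_fin.
have /ae_foralln := key; apply: filterS2 sb => w [c hc] hw.
have [K cK] : exists K : nat, c <= K%:R.
  by exists (Num.truncn c).+1; apply: ltW; exact: truncnS_gt.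
by apply: (hw K) => n; exact: le_trans (hc n) cK.
Qed.

(** The shifted sequence [f k.-1] is taken both for [U] and for the decrease [W]: the drift
    inequality then reduces to the bound on the conditional mean of [f k]. *)
Lemma bounded_sums_next (f : nat -> Omega -> Xi -> R) (be : nat -> Omega -> R) :
  adapted2 f -> adapted be -> (forall k w xi, 0 <= f k w xi) -> (forall k w, 0 <= be k w) ->
  (forall k w, (\int[mu]_xi (f k w xi)%:E <= (be k w)%:E)%E) ->
  {ae P, forall w, bounded_sums (be^~ w)} ->
  {ae P, forall w, bounded_sums (fun k => f k w (u k w))}.
Proof.
move=> af ab f0 b0 fb sb.
pose U k w := if k is k'.+1 then f k' w (u k' w) else 0.
have aU : adapted U.
  by case=> [|k]; [exact: measurable_cst|exact: adapted2_next].
have U0 k w : 0 <= U k w by case: k => //=.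
have sU : {ae P, forall w, bounded_sums (U^~ w)}.
  apply: (@bounded_sums_drift U U be f 0) => // k w.
  by rewrite addeC EFinD leeD2l.
apply: filterS sU => w [c hc]; exists c => n.
by have := hc n.+1; rewrite big_nat_recl//= add0r.
Qed.

Lemma adapted_Rintegral z : adapted2 z -> adapted (fun k w => \int[mu]_xi z k w xi).
Proof.
move=> az k.
have mz : measurable_fun [set: Past k * Xi] (fun q : Past k * Xi => (z k q.1 q.2)%:E).
  by apply/measurable_EFinP; exact: az.
apply: (measurableT_comp (@fine_measurable R setT measurableT) (g := fun w : Past k => \int[mu]_xi (z k w xi)%:E)%E).
under eq_fun do rewrite integralE.
have H1 := @measurable_fun_fubini_tonelli_F _ _ _ _ _ mu _ (measurable_funepos mz)
  (funepos_ge0 _).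
have H2 := @measurable_fun_fubini_tonelli_F _ _ _ _ _ mu _ (measurable_funeneg mz)
  (funeneg_ge0 _).
apply: emeasurable_funB.
- apply: eq_measurable_fun H1 => w _; rewrite /fubini_F; apply: eq_integral => x _.
  by rewrite !funeposE.
- apply: eq_measurable_fun H2 => w _; rewrite /fubini_F; apply: eq_integral => x _.
  by rewrite !funenegE.
Qed.

Lemma sqr_rintegrable (f : Xi -> R) (c : R) : measurable_fun [set: Xi] f ->
  (\int[mu]_xi (f xi ^+ 2)%:E <= c%:E)%E ->
  [/\ rintegrable mu f, rintegrable mu (fun xi => f xi ^+ 2) & \int[mu]_xi f xi ^+ 2 <= c].
Proof.
move=> mf fc.
have i2 : rintegrable mu (fun xi => f xi ^+ 2).
  apply: rintegrable_ge0; [exact: measurable_funX|by move=> x; exact: sqr_ge0|].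
  exact: le_lt_trans fc (ltry _).
split=> //; last by rewrite -lee_fin -integral_rintegrable.
apply: (rintegrable_le mf (rintegrableD (rintegrable_cst mu 1) i2)).
apply: aeW => x; rewrite -[f x ^+ 2]real_normK ?num_real//.
by have := sqr_ge0 (`|f x| - 1); have := normr_ge0 (f x); nra.
Qed.

(** * Kolmogorov's maximal inequality *)

Section MaximalInequality.
Variables (eta : nat -> Omega -> Xi -> R) (v : nat -> Omega -> R) (K eps : R) (n : nat).
Hypothesis a_eta : adapted2 eta.
Hypothesis a_v : adapted v.
Hypothesis v0 : forall k w, 0 <= v k w.
Hypothesis eta0 : forall k w, \int[mu]_xi eta k w xi = 0.
Hypothesis eta_v : forall k w, (\int[mu]_xi (eta k w xi ^+ 2)%:E <= (v k w)%:E)%E.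
Hypothesis eps0 : 0 < eps.

(* Freezing the sum once it leaves the interval of radius [eps] reduces the
   maximal inequality to a second moment bound at a single time. *)
Fixpoint stopped_sum k w : R :=
  if k is j.+1 then stopped_sum j w +
    (n <= j)%:R * (`|stopped_sum j w| < eps)%R%:R * gate v K j w * eta j w (u j w)
  else 0.

Let a k w := (n <= k)%:R * (`|stopped_sum k w| < eps)%R%:R * gate v K k w.

Let a_step k : measurable_fun [set: Past k] (stopped_sum k : Past k -> R) ->
  measurable_fun [set: Past k] (a k : Past k -> R).
Proof.
move=> mT; apply: measurable_funM; last exact: gate_adapted.
apply: measurable_funM; first exact: measurable_cst.
have mB : measurable_fun [set: Past k] (fun w : Past k => `|stopped_sum k w| < eps).
  apply: measurable_fun_ltr; last exact: measurable_cst.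
  exact: (measurableT_comp (@normr_measurable R setT) mT).
have -> : (fun w : Past k => (`|stopped_sum k w| < eps)%R%:R) =
   (fun w : Past k => if `|stopped_sum k w| < eps then 1 else 0 :> R).
  by apply/funext => w; case: ifP.
by apply: measurable_fun_ifT => //; exact: measurable_cst.
Qed.

Let aT : adapted stopped_sum.
Proof.
elim=> [|k IH]; first exact: measurable_cst.
apply: measurable_funD.
  exact: (measurableT_comp IH (@pastS_measurable _ _ _ _ u k)).
apply: measurable_funM; last exact: adapted2_next.
exact: (measurableT_comp (a_step IH) (@pastS_measurable _ _ _ _ u k)).
Qed.

Let be k w := (n <= k)%:R * (gate v K k w * v k w).

Let a_be k w : a k w ^+ 2 * v k w <= be k w.
Proof.
rewrite /a /be; have [->|->] := gate01 v K k w; first by rewrite mulr0 expr0n/= !mul0r mulr0.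
rewrite mulr1 mul1r; case: (n <= k)%N; rewrite ?mul0r ?mul1r ?expr0n/= ?mul0r//.
by case: (_ < _); rewrite ?expr1n ?mul1r// expr0n/= mul0r.
Qed.

Let drift k w : (\int[mu]_xi ((stopped_sum k w + a k w * eta k w xi) ^+ 2)%:E + 0%:E <=
  (stopped_sum k w ^+ 2 + be k w)%:E)%E.
Proof.
have me := adapted2_section k w a_eta : measurable_fun [set: Xi] (eta k w).
have [i1 i2 le2] := sqr_rintegrable me (eta_v k w).
move: (stopped_sum k w) (a k w) (a_be k w) => T b bb; rewrite adde0.
have E xi : (T + b * eta k w xi) ^+ 2 =
   T ^+ 2 + (2 * T * b * eta k w xi + b ^+ 2 * eta k w xi ^+ 2) by ring.
under eq_integral do rewrite E.
have j1 : rintegrable mu (fun xi => 2 * T * b * eta k w xi) by exact: rintegrableZ.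
have j2 : rintegrable mu (fun xi => b ^+ 2 * eta k w xi ^+ 2) by exact: rintegrableZ.
rewrite integral_rintegrable; last first.
  by apply: rintegrableD; [exact: rintegrable_cst|exact: rintegrableD].
rewrite lee_fin RintegralD//; [|exact: rintegrable_cst|exact: rintegrableD].
rewrite Rintegral_cst1 RintegralD// !RintegralZl// eta0 mulr0 add0r lerD2l.
by apply: le_trans bb; rewrite ler_wpM2l ?sqr_ge0.
Qed.

Let F m := [set w | eps <= `|stopped_sum m w|].

Let mF m : measurable (F m).
Proof.
apply: measurable_leset; first exact: measurable_cst.
exact: (measurableT_comp (@normr_measurable R setT) (adapted_measurable m aT)).
Qed.

Lemma stopped_sum_measurable : measurable (\bigcup_m F m).
Proof. by apply: bigcup_measurable => m _; exact: mF. Qed.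

Let F_incr m : F m `<=` F m.+1.
Proof.
by move=> w; rewrite /F /= => h; rewrite ltNge h mulr0 !mul0r addr0.
Qed.

(** Chebyshev's inequality for the stopped sum at time [m]. The events [F m] increase because the
    sum no longer moves once it has left the interval, so the bound passes to their union. *)
Lemma stopped_sum_prob c :
  (forall m, (\sum_(0 <= k < m) \int[P]_w (be k w)%:E <= c%:E)%E) ->
  ((eps ^+ 2)%:E * P (\bigcup_m F m) <= c%:E)%E.
Proof.
move=> hc.
have hF m : ((eps ^+ 2)%:E * P (F m) <= c%:E)%E.
  have ab : adapted be.
    move=> k; apply: measurable_funM; first exact: measurable_cst.
    by apply: measurable_funM; [exact: gate_adapted|exact: a_v].
  have aU : adapted (fun k w => stopped_sum k w ^+ 2) by move=> k; exact: measurable_funX.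
  have ah : adapted2 (fun k w xi => (stopped_sum k w + a k w * eta k w xi) ^+ 2).
    move=> k; apply: measurable_funX; apply: measurable_funD; first exact: adapted_adapted2.
    apply: measurable_funM; last exact: a_eta.
    have aa : adapted a by move=> j; apply: a_step; exact: aT.
    exact: (adapted_adapted2 aa).
  have := @drift_expectation (fun k w => stopped_sum k w ^+ 2) (fun _ _ => 0) be
    (fun k w xi => (stopped_sum k w + a k w * eta k w xi) ^+ 2) 0 aU
    (fun k => @measurable_cst _ _ _ _ _ _) ab ah.
  have b0 k w : 0 <= be k w by rewrite /be !mulr_ge0 ?gate_ge0.
  have U00 w : stopped_sum 0 w ^+ 2 <= 0 by rewrite expr0n.
  move=> /(_ (fun k w => sqr_ge0 _) (fun k w => lexx _) b0 (fun k w xi => sqr_ge0 _) U00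
    (fun k w => lexx _) drift m).
  rewrite big1 ?add0e; last by move=> k _; rewrite integral0_eq.
  move=> h; apply: le_trans (hc m); apply: le_trans h.
  rewrite -[P (F m)]/(P (F m)) -(setIT (F m)) -integral_indic// -ge0_integralZl//.
  apply: ge0_le_integral => //.
  - by move=> w _; rewrite -EFinM lee_fin mulr_ge0 ?sqr_ge0.
  - by apply: emeasurable_funM => //; apply/measurable_EFinP; exact: measurable_indic.
  - by apply/measurable_EFinP; exact: (adapted_measurable m aU).
  - move=> w _; rewrite -EFinM lee_fin indicE; case: (boolP (w \in F m)) => hw; last first.
      by rewrite mulr0 sqr_ge0.
    rewrite mulr1 -[stopped_sum m w ^+ 2]real_normK ?num_real//.
    by move: hw; rewrite inE /F/= => hw; rewrite ler_pXn2r ?nnegrE// ltW.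
  - by apply/measurable_EFinP; exact: measurable_indic.
  - by rewrite lee_fin sqr_ge0.
have mU := stopped_sum_measurable.
have nd : {homo F : n m / (n <= m)%N >-> (n <= m)%O}.
  by apply: homo_leq => [A|B A C|m]; [exact: lexx|exact: le_trans|apply/subsetPset; exact: F_incr].
have cv := nondecreasing_cvg_mu (mu := P) mF mU nd.
have e20 : 0 < eps ^+ 2 by rewrite exprn_gt0.
rewrite muleC -lee_pdivlMr// -(cvg_lim _ cv)//; apply: lime_le.
  by apply/cvg_ex; exists (P (\bigcup_m F m)).
by apply: nearW => m; rewrite lee_pdivlMr// muleC; exact: hF.
Qed.

Lemma stopped_sum_open w : (forall k, gate v K k w = 1) ->
  ~ (\bigcup_m F m) w -> forall m, (n <= m)%N ->
  `|\sum_(n <= k < m) eta k w (u k w)| < eps.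
Proof.
move=> g1 nF m nm.
have Tlt k : `|stopped_sum k w| < eps.
  by rewrite ltNge; apply/negP => h; apply: nF; exists k.
suff <- : stopped_sum m w = \sum_(n <= k < m) eta k w (u k w) by [].
have T0 k : (k <= n)%N -> stopped_sum k w = 0.
  by elim: k => [//|k IH] kn /=; rewrite leqNgt kn/= IH ?(ltnW kn)// !mul0r addr0.
elim: m nm => [|m IH]; first by rewrite leqn0 => /eqP ->; rewrite big_geq// T0.
rewrite leq_eqVlt => /orP[/eqP <-|]; first by rewrite big_geq// T0.
rewrite ltnS => nm; rewrite big_nat_recr//= -IH// Tlt g1 nm.
by rewrite !mul1r.
Qed.

End MaximalInequality.

(** Gating by [v] makes the expected variances summable. The probability of a deviation by [eps]
    after time [n] is then at most a tail of a convergent series divided by [eps ^ 2], and almost no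
    path deviates after every [n]. *)
Lemma martingale_cauchy (z : nat -> Omega -> Xi -> R) (v : nat -> Omega -> R) :
  adapted2 z -> adapted v -> (forall k w, 0 <= v k w) ->
  (forall k w, (\int[mu]_xi (z k w xi ^+ 2)%:E <= (v k w)%:E)%E) ->
  {ae P, forall w, bounded_sums (v^~ w)} ->
  {ae P, forall w, forall e, 0 < e -> exists n0, forall n m, (n0 <= n)%N -> (n <= m)%N ->
    `|\sum_(n <= k < m) (z k w (u k w) - \int[mu]_xi z k w xi)| <= e}.
Proof.
move=> az av v0 zv sv.
pose eta k w xi := z k w xi - \int[mu]_xi z k w xi.
have mz k w : measurable_fun [set: Xi] (z k w) by exact: adapted2_section.
have zi k w := sqr_rintegrable (mz k w) (zv k w).
have a_eta : adapted2 eta.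
  move=> k; apply: measurable_funB; first exact: az.
  exact: (adapted_adapted2 (adapted_Rintegral az)).
have eta0 k w : \int[mu]_xi eta k w xi = 0.
  have [i1 _ _] := zi k w.
  by rewrite RintegralB//; [rewrite Rintegral_cst1 subrr|exact: rintegrable_cst].
have eta_v k w : (\int[mu]_xi (eta k w xi ^+ 2)%:E <= (v k w)%:E)%E.
  have [i1 i2 le2] := zi k w; rewrite /eta; set c := \int[mu]_xi z k w xi.
  have E xi : (z k w xi - c) ^+ 2 = (z k w xi ^+ 2 - 2 * c * z k w xi) + c ^+ 2 by ring.
  under eq_integral do rewrite E.
  have j1 : rintegrable mu (fun xi => 2 * c * z k w xi) by exact: rintegrableZ.
  have j2 := rintegrableB i2 j1.
  rewrite integral_rintegrable; last by apply: rintegrableD => //; exact: rintegrable_cst.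
  rewrite lee_fin RintegralD//; last exact: rintegrable_cst.
  rewrite RintegralB// RintegralZl// Rintegral_cst1 -/c.
  by have := sqr_ge0 c; rewrite expr2; lra.
have key (K j : nat) : {ae P, forall w, (forall n, \sum_(0 <= k < n) v k w <= K%:R) ->
    exists n, forall m, (n <= m)%N -> `|\sum_(n <= k < m) eta k w (u k w)| < j.+1%:R^-1}.
  pose eps : R := j.+1%:R^-1; have eps0 : 0 < eps by rewrite invr_gt0.
  pose D n := \bigcup_m [set w | eps <= `|stopped_sum eta v K%:R eps n m w|].
  pose A k := (\int[P]_w (gate v K%:R k w * v k w)%:E)%E.
  have A0 k : (0 <= A k)%E by apply: integral_ge0 => w _; rewrite lee_fin mulr_ge0 ?gate_ge0.
  have AK m : (\sum_(0 <= k < m) A k <= K%:R%:E)%E by exact: gate_expectation.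
  have Afin k : A k \is a fin_num.
    rewrite ge0_fin_numE//; apply: le_lt_trans (ltry K%:R); apply: le_trans (AK k.+1).
    have -> : (\sum_(0 <= k0 < k.+1) A k0 = \sum_(0 <= k0 < k) A k0 + A k)%E by rewrite big_nat_recr.
    by rewrite leeDr// sume_ge0.
  have bA : bounded_sums (fun k => fine (A k)).
    exists K%:R => m; rewrite -lee_fin -sumEFin; apply: le_trans (AK m).
    by apply: lee_sum => k _; rewrite fineK.
  have mD n : measurable (D n) by exact: stopped_sum_measurable.
  have PD n c : (forall m, (n <= m)%N -> \sum_(n <= k < m) fine (A k) <= c) ->
      ((eps ^+ 2)%:E * P (D n) <= c%:E)%E.
    move=> hc; apply: stopped_sum_prob => // m.
    have E k : (\int[P]_w ((n <= k)%:R * (gate v K%:R k w * v k w))%:E)%E =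
        (if (n <= k)%N then fine (A k) else 0)%:E.
      case: (n <= k)%N; last by rewrite integral0_eq// => w _; rewrite mul0r.
      by rewrite fineK//; apply: eq_integral => w _; rewrite mul1r.
    under eq_bigr do rewrite E.
    rewrite sumEFin lee_fin.
    have z0 j1 : (j1 <= n)%N -> \sum_(0 <= k < j1) (if (n <= k)%N then fine (A k) else 0) = 0.
      move=> jn; rewrite big_nat_cond big1// => k; rewrite andbT => /andP[_ kj].
      by rewrite leqNgt (leq_trans kj jn).
    have [mn|nm] := leqP m n.
      by rewrite z0//; have := hc n (leqnn n); rewrite big_geq.
    rewrite (big_cat_nat (leq0n n) (ltnW nm))/= z0// add0r.
    rewrite (_ : \sum_(n <= k < m) _ = \sum_(n <= k < m) fine (A k)); first exact/hc/ltnW.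
    by rewrite big_nat_cond [RHS]big_nat_cond; apply: eq_bigr => k /andP[/andP[-> _] _].
  have mDD : measurable (\bigcap_n D n) by exact: bigcap_measurable.
  have ND : P.-negligible (\bigcap_n D n).
    apply/negligibleP => //; apply/eqP; rewrite -measure_le0.
    apply/lee_addgt0Pr => del del0; rewrite add0e.
    have e20 : 0 < eps ^+ 2 by rewrite exprn_gt0.
    have [|n0 hn0] := bounded_sums_tail (fun k => fine_ge0 (A0 k)) bA (e := eps ^+ 2 * del).
      exact: mulr_gt0.
    have := PD n0 (eps ^+ 2 * del) (fun m nm => hn0 _ _ (leqnn n0) nm).
    rewrite (EFinM (eps ^+ 2) del) lee_pmul2l ?lte_fin//; apply: le_trans.
    by apply: le_measure; rewrite ?inE//; exact: bigcap_inf.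
  case: ND => X [mX X0 DX]; exists X; split => // w hw; apply: DX => n _.
  apply: contra_notP hw => nD hK; exists n => m nm.
  by apply: (stopped_sum_open (K := K%:R) (v := v)) => //; exact: gate_open.
have key' : {ae P, forall w, forall K j : nat, (forall n, \sum_(0 <= k < n) v k w <= K%:R) ->
    exists n, forall m, (n <= m)%N -> `|\sum_(n <= k < m) eta k w (u k w)| < j.+1%:R^-1}.
  by apply/ae_foralln => K; apply/ae_foralln => j; exact: key.
apply: filterS2 sv key' => w [c hc] hw e e0.
have [K cK] : exists K : nat, c <= K%:R.
  by exists (Num.truncn c).+1; apply: ltW; exact: truncnS_gt.
have e20 : 0 < e / 2 by rewrite divr_gt0.
have [j hj] := natSinv_small e20.
have [n0 hn0] := hw K j (fun n => le_trans (hc n) cK).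
exists n0 => n m nn nm; rewrite -/(eta _ _ _).
have h1 := hn0 n nn; have := hn0 m (leq_trans nn nm).
rewrite (big_cat_nat nn nm)/= => h2.
have -> : \sum_(n <= k < m) (z k w (u k w) - \int[mu]_xi z k w xi) =
  (\sum_(n0 <= k < n) eta k w (u k w) + \sum_(n <= k < m) eta k w (u k w)) -
  \sum_(n0 <= k < n) eta k w (u k w) by rewrite addrAC subrr add0r.
apply: le_trans (ler_normB _ _) _.
have := hj j (leqnn j); move: h1 h2; move: (j.+1%:R^-1) => r h1 h2 h3.
by have := ltW h1; have := ltW h2; lra.
Qed.

End AdaptedProcesses.

(** * One step of the algorithm *)

Section ForwardBackward.
Variables (R : realType) (N : nat) (T : operator R N).
Local Notation V := 'rV[R]_N.
Hypothesis maxT : maximal_monotone T.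
Variables (g : R) (x w : V).
Hypothesis g0 : 0 < g.

Let xp := resolvent g T (x - g *: w).

Lemma forward_backward_in : T xp (g^-1 *: (x - xp) - w).
Proof.
have := yosida_in maxT g0 (x - g *: w); rewrite /yosida -/xp.
suff -> : g^-1 *: (x - g *: w - xp) = g^-1 *: (x - xp) - w by [].
rewrite addrAC scalerBr [X in _ - X]scalerA mulVf ?scale1r//; exact: lt0r_neq0.
Qed.

(** With [h = x - xp] and [k = x - xs], monotonicity of [T] reads [0 <= <h - g (w + p), k - h>].
    Young's inequality spends half of [|h|^2] on [2 g <h, p + w>]: this is the origin of [2^-1] and
    of [2 * g ^+ 2]. *)
Lemma forward_backward_fejer xs p q : T xs p -> 0 <= dotv (w - q) (x - xs) ->
  sqn (xp - xs) + 2^-1 * sqn (x - xp) <=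
  sqn (x - xs) - 2 * g * dotv (p + q) (x - xs) + 2 * g ^+ 2 * sqn (p + w).
Proof.
move=> Tp mq; have mp := maximal_op_monotone maxT forward_backward_in Tp.
pose h := x - xp; pose k := x - xs.
have hE : xp - xs = k - h by apply/rowP => i; rewrite !mxE; ring.
have gn : g != 0 by exact: lt0r_neq0.
have m1 : 0 <= dotv (h - g *: (w + p)) (k - h).
  have -> : h - g *: (w + p) = g *: (g^-1 *: (x - xp) - w - p).
    by apply/rowP => i; rewrite !mxE; field.
  by rewrite dotvZl -hE mulr_ge0// ltW.
have y1 : 2 * dotv h (2 *: (g *: (p + w))) <= sqn h + sqn (2 *: (g *: (p + w))) by exact: young.
have gq : 0 <= g * dotv (w - q) k by rewrite mulr_ge0// ltW.
rewrite hE -/h -/k; clearbody h k; move: m1 y1 gq; rewrite !sqnZ /sqn !dotE.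
rewrite (dotvC k h) (dotvC w p) (dotvC h p) (dotvC h w).
by lra.
Qed.

Lemma forward_backward_resolvent : enorm (xp - resolvent g T x) <= g * enorm w.
Proof.
apply: le_trans (resolvent_nonexp maxT g0 _ _) _.
by rewrite addrAC subrr add0r enormN enormZ gtr0_norm.
Qed.

(** The point [y] of the domain serves as a relay near [x], which need not belong to the domain. *)
Lemma forward_backward_move y a : T y a ->
  enorm (xp - x) <= g * enorm w + 2 * enorm (x - y) + g * enorm a.
Proof.
move=> Ta; apply: le_trans (enormD3 _ _ (resolvent g T x)) _.
have h1 := forward_backward_resolvent.
have h2 := resolvent_bound maxT g0 x Ta.
have := enormD3 (resolvent g T x) x y; rewrite (enormB y x); lra.
Qed.

End ForwardBackward.

(** * The essential domain and the random domains *)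

Section EssentialDomain.
Variables (R : realType) (N : nat) (d : measure_display) (Xi : measurableType d).
Variable mu : probability Xi R.
Variable A : Xi -> operator R N.
Hypothesis A_random : random_operator A.
Local Notation V := 'rV[R]_N.
Local Notation calD := (essential_dom mu A).

Lemma essential_domP x : calD x -> {ae mu, forall xi, dom (A xi) x}.
Proof.
move=> Dx; have mD := dom_measurable A_random x.
exists (~` [set xi | dom (A xi) x]); split => //; first exact: measurableC.
by rewrite probability_setC// Dx subee.
Qed.

Lemma essential_dom_closure x : closure calD x ->
  {ae mu, forall xi, closure (dom (A xi)) x}.
Proof.
move=> /closure_enormP Dx.
have /choice[y hy] : forall n : nat, exists y, calD y /\ enorm (x - y) <= n.+1%:R^-1.
  by move=> n; have [|y Dy xy] := Dx n.+1%:R^-1; [rewrite invr_gt0|exists y].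
have : {ae mu, forall xi, forall n, dom (A xi) (y n)}.
  by apply/ae_foralln => n; apply: essential_domP; case: (hy n).
apply: filterS => xi hxi; apply/closure_enormP => e e0.
have [n hn] := natSinv_small e0; exists (y n) => //.
by have [_ /le_trans] := hy n; apply; exact: hn.
Qed.

End EssentialDomain.

Lemma integral_le_ae (R : realType) (d : measure_display) (X : measurableType d)
    (mu : probability X R) (f F : X -> R) c : measurable_fun [set: X] f ->
  (forall x, 0 <= f x) -> rintegrable mu F -> {ae mu, forall x, f x <= F x} ->
  \int[mu]_x F x <= c -> (\int[mu]_x (f x)%:E <= c%:E)%E.
Proof.
move=> mf f0 iF fF Fc.
have fi : rintegrable mu f.
  by apply: (rintegrable_le mf iF); apply: filterS fF => x; rewrite ger0_norm.
by rewrite integral_rintegrable// lee_fin (le_trans _ Fc)// Rintegral_le_ae.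
Qed.

Section OneStep.
Variables (R : realType) (N : nat) (d : measure_display) (Xi : measurableType d).
Variable mu : probability Xi R.
Local Notation V := 'rV[R]_N.
Local Notation bV := (borelV R N).
Variables (A : Xi -> operator R N) (b : Xi -> V -> V).
Hypothesis A_random : random_operator A.
Hypothesis b_measurable : measurable_fun [set: Xi * bV] (fun q : Xi * bV => b q.1 q.2 : bV).

Let maxA xi : maximal_monotone (A xi). Proof. exact: random_maximal. Qed.

Definition forward_backward g x xi := resolvent g (A xi) (x - g *: b xi x).
Local Notation fb := forward_backward.

Lemma forward_backward_measurable2 g : 0 < g ->
  measurable_fun [set: bV * Xi] (fun q : bV * Xi => fb g q.1 q.2 : bV).
Proof.
move=> g0.
have mx : measurable_fun [set: bV * Xi] (fun q : bV * Xi => q.1 : bV) := @measurable_fst _ _ _ _.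
have mxi : measurable_fun [set: bV * Xi] (fun q : bV * Xi => q.2) := @measurable_snd _ _ _ _.
have mb : measurable_fun [set: bV * Xi] (fun q : bV * Xi => b q.2 q.1 : bV).
  apply: (measurableT_comp b_measurable (g := fun q : bV * Xi => (q.2, q.1))).
  by apply/measurable_fun_pairP.
have mp : measurable_fun [set: bV * Xi] (fun q : bV * Xi => (q.2, (q.1 - g *: b q.2 q.1 : bV))).
  apply/measurable_fun_pairP; split => //=.
  apply: measurable_vB => //; apply: measurable_vscale => //; exact: measurable_cst.
exact: (measurableT_comp (resolvent_measurable2 A_random g0) mp).
Qed.

Lemma forward_backward_measurable g x : 0 < g ->
  measurable_fun [set: Xi] (fun xi => fb g x xi : bV).
Proof.
move=> g0; exact: (measurableT_comp (forward_backward_measurable2 g0)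
  (@measurable_pair1 _ _ bV Xi x)).
Qed.

Lemma b_section_measurable x : measurable_fun [set: Xi] (fun xi => b xi x : bV).
Proof. exact: (measurableT_comp b_measurable (@measurable_pair2 _ _ Xi bV x)). Qed.

(** * Mean contraction of the distance to the domain *)

Section DistanceDecay.
Local Notation calD := (essential_dom mu A).
Hypothesis D0 : calD !=set0.
Hypothesis Dconv : convex_set (closure calD).
Variables (p : nat) (Cd Cj Cb : R).
Hypotheses (Cd0 : 0 < Cd) (Cj0 : 0 < Cj) (Cb0 : 0 < Cb).
Hypothesis dist_item : forall x, ((Cd * dist_to calD x ^+ 2)%:E <=
  \int[mu]_xi (dist_to (dom (A xi)) x ^+ 2)%:E)%E.
Hypothesis J_item : forall x (g : R), 0 < g ->
  ((g ^- 4)%:E * \int[mu]_xi (enorm (resolvent g (A xi) x - proj_on (closure (dom (A xi))) x) ^+ 4)%:E <=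
    (Cj * (1 + enorm x ^+ (2 * p)))%:E)%E.
Hypothesis b_item : forall x, (\int[mu]_xi (enorm (b xi x) ^+ 4)%:E <=
  (Cb * (1 + enorm x ^+ (2 * p)))%:E)%E.

Let pr x xi := proj_on (closure (dom (A xi))) x.
Let m (x : V) := 1 + enorm x ^+ (2 * p).
Let m1 x : 1 <= m x. Proof. by rewrite lerDl exprn_ge0// enorm_ge0. Qed.

(** Bounds the distance from the new iterate to the projection of [x] onto the random domain; the
    growth hypotheses on [b] and [J] make its fourth moment [O(g ^ 4)]. *)
Let e4 g x xi := g * enorm (b xi x) + enorm (resolvent g (A xi) x - pr x xi).

Let fb_pr g x xi : 0 < g -> enorm (fb g x xi - pr x xi) <= e4 g x xi.
Proof.
move=> g0; apply: le_trans (enormD3 _ _ (resolvent g (A xi) x)) _; rewrite lerD2r.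
exact: forward_backward_resolvent.
Qed.

Let e4_measurable g x : 0 < g -> measurable_fun [set: Xi] (e4 g x).
Proof.
move=> g0; apply: measurable_funD.
  apply: measurable_funM; first exact: measurable_cst.
  by apply: measurable_enorm; exact: b_section_measurable.
apply: measurable_enorm; apply: measurable_vB; first exact: resolvent_measurable.
exact: proj_dom_measurable.
Qed.

Let e4_ge0 g x xi : 0 < g -> 0 <= e4 g x xi.
Proof. by move=> g0; rewrite addr_ge0 ?mulr_ge0 ?enorm_ge0// ltW. Qed.

Let C4 := 8 * (Cb + Cj).

Let e4_int g x : 0 < g -> rintegrable mu (fun xi => e4 g x xi ^+ 4) /\
  \int[mu]_xi e4 g x xi ^+ 4 <= g ^+ 4 * (C4 * m x).
Proof.
move=> g0.
pose f1 xi := enorm (b xi x); pose f2 xi := enorm (resolvent g (A xi) x - pr x xi).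
have mf1 : measurable_fun [set: Xi] f1 by apply: measurable_enorm; exact: b_section_measurable.
have mf2 : measurable_fun [set: Xi] f2.
  apply: measurable_enorm; apply: measurable_vB; first exact: resolvent_measurable.
  exact: proj_dom_measurable.
have f10 xi : 0 <= f1 xi by exact: enorm_ge0.
have f20 xi : 0 <= f2 xi by exact: enorm_ge0.
have i1 : rintegrable mu (fun xi => f1 xi ^+ 4).
  apply: rintegrable_ge0; [exact: measurable_funX|by move=> xi; rewrite exprn_ge0|].
  exact: le_lt_trans (b_item x) (ltry _).
have g40 : 0 < g ^+ 4 by rewrite exprn_gt0.
have le2 : (\int[mu]_xi (f2 xi ^+ 4)%:E <= (Cj * m x * g ^+ 4)%:E)%E.
  by have := J_item x g0; rewrite muleC lee_pdivrMr.
have i2 : rintegrable mu (fun xi => f2 xi ^+ 4).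
  apply: rintegrable_ge0; [exact: measurable_funX|by move=> xi; rewrite exprn_ge0|].
  exact: le_lt_trans le2 (ltry _).
pose F xi := 8 * g ^+ 4 * f1 xi ^+ 4 + 8 * f2 xi ^+ 4.
have iF : rintegrable mu F by apply: rintegrableD; exact: rintegrableZ.
have eF xi : e4 g x xi ^+ 4 <= F xi.
  rewrite /e4 /F -/(f1 xi) -/(f2 xi) -mulrA -exprMn.
  have h1 : 0 <= g * f1 xi by rewrite mulr_ge0// ltW.
  move: (g * f1 xi) (f2 xi) h1 (f20 xi) => s t s0 t0.
  have q2 (a c : R) : (a + c) ^+ 2 <= 2 * a ^+ 2 + 2 * c ^+ 2 by have := sqr_ge0 (a - c); lra.
  have q4 (a : R) : a ^+ 4 = (a ^+ 2) ^+ 2 by rewrite -exprM.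
  rewrite !q4; apply: (@le_trans _ _ ((2 * s ^+ 2 + 2 * t ^+ 2) ^+ 2)).
    by rewrite ler_pXn2r ?nnegrE ?sqr_ge0// addr_ge0// mulr_ge0// sqr_ge0.
  by apply: le_trans (q2 _ _) _; rewrite !exprMn; lra.
have ie : rintegrable mu (fun xi => e4 g x xi ^+ 4).
  apply: rintegrable_le iF _; first by apply: measurable_funX; exact: e4_measurable.
  by apply: aeW => xi; rewrite ger0_norm// exprn_ge0// e4_ge0.
split => //; apply: (@le_trans _ _ (\int[mu]_xi F xi)).
  by apply: Rintegral_le_ae => //; exact: aeW.
have h1 : \int[mu]_xi f1 xi ^+ 4 <= Cb * m x by rewrite -lee_fin -integral_rintegrable//; exact: b_item.
have h2 : \int[mu]_xi f2 xi ^+ 4 <= Cj * m x * g ^+ 4 by rewrite -lee_fin -integral_rintegrable.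
rewrite /F RintegralD//; [|exact: rintegrableZ|exact: rintegrableZ].
rewrite !RintegralZl// /C4; move: (\int[mu]_xi f1 xi ^+ 4) (\int[mu]_xi f2 xi ^+ 4) (g ^+ 4) g40 h1 h2.
by move=> I1 I2 G G0 h1 h2; nra.
Qed.

Let e2_int g x : 0 < g -> rintegrable mu (fun xi => e4 g x xi ^+ 2) /\
  \int[mu]_xi e4 g x xi ^+ 2 <= g ^+ 2 * ((C4 + 1) * m x).
Proof.
move=> g0; have [i4 l4] := e4_int x g0.
have g20 : 0 < g ^+ 2 by rewrite exprn_gt0.
(* Young's inequality with weight [g ^ 2], which draws the right power of [g] from the fourth
   moment. *)
pose F xi := g ^+ 2 + g ^- 2 * e4 g x xi ^+ 4.
have iF : rintegrable mu F by apply: rintegrableD; [exact: rintegrable_cst|exact: rintegrableZ].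
have eF xi : e4 g x xi ^+ 2 <= F xi.
  rewrite /F -[e4 g x xi ^+ 4]/(e4 g x xi ^+ (2 * 2)) exprM.
  rewrite -(ler_pM2l g20) mulrDr [X in _ <= _ + X]mulrA mulfV ?mul1r ?gt_eqF//.
  by have := sqr_ge0 (e4 g x xi ^+ 2 - g ^+ 2); have := sqr_ge0 (e4 g x xi ^+ 2 + g ^+ 2); lra.
have ie : rintegrable mu (fun xi => e4 g x xi ^+ 2).
  apply: rintegrable_le iF _; first by apply: measurable_funX; exact: e4_measurable.
  by apply: aeW => xi; rewrite ger0_norm// exprn_ge0// e4_ge0.
split => //; apply: (@le_trans _ _ (\int[mu]_xi F xi)).
  by apply: Rintegral_le_ae => //; exact: aeW.
rewrite /F RintegralD//; [|exact: rintegrable_cst|exact: rintegrableZ].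
rewrite Rintegral_cst1 RintegralZl//.
apply: (@le_trans _ _ (g ^+ 2 + g ^- 2 * (g ^+ 4 * (C4 * m x)))).
  by rewrite lerD2l ler_pM2l// invr_gt0.
have -> : g ^- 2 * (g ^+ 4 * (C4 * m x)) = g ^+ 2 * (C4 * m x).
  by field; exact: lt0r_neq0.
by rewrite (mulrDl C4) mul1r [leRHS]mulrDr addrC lerD2l ler_peMr// ltW.
Qed.

(** The minimum keeps [1 - c0] positive. With [eta = c0 / 8] the factor [(1 + eta) ^ 3] lost in
    splitting squares leaves the contraction [rho = 1 - c0 / 2]. *)
Let c0 := Num.min Cd (2^-1).
Let c00 : 0 < c0. Proof. by rewrite lt_min Cd0 invr_gt0 ltr0n. Qed.
Let c01 : c0 <= 2^-1. Proof. by rewrite ge_min lexx orbT. Qed.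
Let eta := c0 / 8.
Let kap := 1 + eta^-1.
Let rho := 1 - c0 / 2.

Let sum2 (s t : R) : (s + t) ^+ 2 <= (1 + eta) * s ^+ 2 + kap * t ^+ 2.
Proof.
have e0 : 0 < eta by rewrite divr_gt0.
rewrite -subr_ge0; have -> : (1 + eta) * s ^+ 2 + kap * t ^+ 2 - (s + t) ^+ 2 =
  eta^-1 * (eta * s - t) ^+ 2 by rewrite /kap; field; exact: lt0r_neq0.
by rewrite mulr_ge0 ?sqr_ge0// invr_ge0 ltW.
Qed.

Let eta_rho : (1 + eta) ^+ 3 * (1 - c0) <= rho.
Proof.
rewrite /rho /eta; move: c00 c01; move: c0 => c h1 h2.
have -> : (1 + c / 8) ^+ 3 = 1 + 3 / 8 * c + 3 / 64 * c ^+ 2 + c ^+ 3 / 512 by field.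
have h3 : c ^+ 2 <= c by rewrite expr2; nra.
have h4 : c ^+ 3 <= c by rewrite exprS; nra.
have : 1 + 3 / 8 * c + 3 / 64 * c ^+ 2 + c ^+ 3 / 512 <= 1 + c / 2 by lra.
move=> h5; apply: (@le_trans _ _ ((1 + c / 2) * (1 - c))); last by nra.
by rewrite ler_wpM2r//; lra.
Qed.

Local Notation dD := (dist_to calD).

(** Let [z] be the projection of [x] onto the closure of [calD]; it lies in almost every closed
    random domain. By Pythagoras, projecting [x] onto the random domain brings it closer to [z], by
    [d(xi, x) ^ 2] on the squared distance, and the lower bound on the mean of [d(xi, x) ^ 2] turns
    this gain into a factor smaller than 1. *)
Lemma forward_backward_dist : exists r C : R, [/\ 0 <= r, r < 1, 0 <= C &
  forall g x, 0 < g ->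
   (\int[mu]_xi (dD (fb g x xi) ^+ 2)%:E <=
      (r * dD x ^+ 2 + C * g ^+ 2 * (1 + enorm x ^+ (2 * p)))%:E)%E /\
   (\int[mu]_xi (dD (fb g x xi) ^+ 4)%:E <=
      (r * dD x ^+ 4 + C * g ^+ 4 * (1 + enorm x ^+ (2 * p)))%:E)%E].
Proof.
have eta0 : 0 < eta by rewrite divr_gt0.
have kap0 : 0 < kap by rewrite addr_gt0// invr_gt0.
have kap1 : 1 <= kap by rewrite lerDl invr_ge0 ltW.
have C40 : 0 < C4 by rewrite mulr_gt0// addr_gt0.
exists rho, (kap ^+ 3 * (C4 + 1)); split.
- by rewrite /rho; move: c00 c01; move: c0 => c h1 h2; lra.
- by rewrite /rho; move: c00 c01; move: c0 => c h1 h2; lra.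
- by rewrite mulr_ge0 ?exprn_ge0 ?(ltW kap0)// addr_ge0// ltW.
move=> g x g0; rewrite -/(m x).
pose z := proj_on (closure calD) x.
have [Dz _] := proj_closureP D0 Dconv x.
have dz : dD x = enorm (x - z) by exact: dist_to_proj.
pose de xi := dist_to (dom (A xi)) x.
pose Pt xi := dD x ^+ 2 - de xi ^+ 2.
have PtP : {ae mu, forall xi, sqn (pr x xi - z) <= Pt xi}.
  apply: filterS (essential_dom_closure A_random Dz) => xi hz.
  rewrite /Pt dz enormK; apply: proj_closure_pythagoras => //.
  - exact: maximal_dom_neq0.
  - exact: closure_dom_convex.
have Pt0 : {ae mu, forall xi, 0 <= Pt xi}.
  by apply: filterS PtP => xi; apply: le_trans; exact: sqn_ge0.
have PtD xi : Pt xi <= dD x ^+ 2 by rewrite gerBl sqr_ge0.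
have mde : measurable_fun [set: Xi] de by exact: dist_dom_measurable.
have ide : rintegrable mu (fun xi => de xi ^+ 2).
  apply: rintegrable_le (rintegrable_cst mu (dD x ^+ 2)) _; first exact: measurable_funX.
  by apply: filterS Pt0 => xi; rewrite subr_ge0 ger0_norm ?sqr_ge0.
have iPt : rintegrable mu Pt by apply: rintegrableB => //; exact: rintegrable_cst.
have IPt : \int[mu]_xi Pt xi <= (1 - c0) * dD x ^+ 2.
  rewrite RintegralB//; last exact: rintegrable_cst.
  rewrite Rintegral_cst1 mulrBl mul1r lerD2l lerN2.
  apply: (@le_trans _ _ (Cd * dD x ^+ 2)); first by rewrite ler_wpM2r ?sqr_ge0// ge_min lexx.
  by rewrite -lee_fin -integral_rintegrable.
have [i2 l2] := e2_int x g0; have [i4 l4] := e4_int x g0.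
have e40 xi : 0 <= e4 g x xi by exact: e4_ge0.
have dle : {ae mu, forall xi, dD (fb g x xi) ^+ 2 <= (1 + eta) * Pt xi + kap * e4 g x xi ^+ 2}.
  apply: filterS PtP => xi hP.
  apply: (@le_trans _ _ ((enorm (pr x xi - z) + e4 g x xi) ^+ 2)).
    rewrite ler_pXn2r ?nnegrE ?dist_to_ge0 ?(addr_ge0 (enorm_ge0 _) (e40 _))//.
    apply: le_trans (dist_to_lipschitz _ (pr x xi) D0) _; apply: lerD; last exact: fb_pr.
    apply/ler_addgt0Pr => ep ep0.
    have /closure_enormP /(_ _ ep0) [y Dy zy] := Dz.
    apply: le_trans (dist_to_le (pr x xi) Dy) _.
    by apply: le_trans (enormD3 _ _ z) _; rewrite lerD2l.
  apply: le_trans (sum2 _ _) _; rewrite lerD2r ler_pM2l ?enormK//.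
  by rewrite addr_gt0.
have mfb : measurable_fun [set: Xi] (fun xi => dD (fb g x xi)).
  apply: (measurableT_comp (borelV_measurable_real (dist_to_continuous D0))).
  exact: forward_backward_measurable.
have r0 : 0 < 1 + eta by rewrite addr_gt0.
have kk : kap <= kap ^+ 3 by rewrite exprS ler_peMr ?(ltW kap0)// exprn_ege1.
have r1 : 1 <= 1 + eta by rewrite lerDl ltW.
have rr : 1 + eta <= (1 + eta) ^+ 3 by rewrite [leRHS]exprS ler_peMr ?(ltW r0)// exprn_ege1.
have c10 : 0 <= 1 - c0 by move: c00 c01; move: c0 => c h1 h2; lra.
have m0 : 0 <= m x by apply: le_trans (m1 x).
split.
  apply: (@integral_le_ae _ _ _ _ _ (fun xi => (1 + eta) * Pt xi + kap * e4 g x xi ^+ 2)) => //.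
  - exact: measurable_funX.
  - by move=> xi; exact: sqr_ge0.
  - by apply: rintegrableD; exact: rintegrableZ.
  rewrite RintegralD//; [|exact: rintegrableZ|exact: rintegrableZ].
  rewrite !RintegralZl//; apply: lerD.
    apply: (@le_trans _ _ ((1 + eta) ^+ 3 * (1 - c0) * dD x ^+ 2)).
      rewrite -mulrA; apply: (@le_trans _ _ ((1 + eta) * ((1 - c0) * dD x ^+ 2))).
        by rewrite ler_pM2l.
      by rewrite ler_wpM2r// mulr_ge0// sqr_ge0.
    by rewrite ler_wpM2r ?sqr_ge0.
  apply: (@le_trans _ _ (kap * (g ^+ 2 * ((C4 + 1) * m x)))); first by rewrite ler_pM2l.
  rewrite [leRHS](_ : _ = kap ^+ 3 * (g ^+ 2 * ((C4 + 1) * m x))); last by ring.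
  apply: ler_wpM2r => //; apply: mulr_ge0; first exact: sqr_ge0.
  by apply: mulr_ge0 => //; rewrite addr_ge0// ltW.
(* For the fourth power the bound is squared, and [Pt ^ 2 <= d ^ 2 * Pt] leads back to the mean of
   [Pt]. *)
apply: (@integral_le_ae _ _ _ _ _
  (fun xi => (1 + eta) ^+ 3 * (dD x ^+ 2 * Pt xi) + kap ^+ 3 * e4 g x xi ^+ 4)) => //.
- exact: measurable_funX.
- by move=> xi; rewrite -[_ ^+ 4]/(_ ^+ (2 * 2)) exprM sqr_ge0.
- by apply: rintegrableD; apply: rintegrableZ => //; exact: rintegrableZ.
- apply: filterS2 dle Pt0 => xi hd hP.
  rewrite -[dD (fb g x xi) ^+ 4]/(dD (fb g x xi) ^+ (2 * 2)) exprM.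
  rewrite -[e4 g x xi ^+ 4]/(e4 g x xi ^+ (2 * 2)) exprM.
  have e0 : 0 <= e4 g x xi ^+ 2 by exact: sqr_ge0.
  have hD := PtD xi.
  apply: (@le_trans _ _ (((1 + eta) * Pt xi + kap * e4 g x xi ^+ 2) ^+ 2)).
    rewrite ler_pXn2r ?nnegrE ?sqr_ge0//.
    by apply: addr_ge0; apply: mulr_ge0 => //; exact: ltW.
  apply: le_trans (sum2 _ _) _; rewrite !exprMn.
  move: hP hD; move: (Pt xi) (e4 g x xi ^+ 2) (dD x ^+ 2) => P E D P0 PD.
  rewrite [X in _ <= X + _](_ : _ = (1 + eta) * ((1 + eta) ^+ 2 * (D * P))); last by ring.
  rewrite [X in _ <= _ + X](_ : _ = kap * (kap ^+ 2 * E ^+ 2)); last by ring.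
  rewrite lerD2r ler_pM2l// ler_pM2l ?exprn_gt0// expr2.
  exact: ler_wpM2r.
rewrite RintegralD//; [|by apply: rintegrableZ; exact: rintegrableZ|exact: rintegrableZ].
rewrite !RintegralZl//; last exact: rintegrableZ.
apply: lerD.
  apply: (@le_trans _ _ ((1 + eta) ^+ 3 * (1 - c0) * dD x ^+ 4)).
    rewrite -mulrA ler_pM2l ?exprn_gt0//.
    rewrite -[dD x ^+ 4]/(dD x ^+ (2 + 2)) exprD mulrCA ler_wpM2l ?sqr_ge0//.
  by rewrite ler_wpM2r// -[_ ^+ 4]/(_ ^+ (2 * 2)) exprM sqr_ge0.
apply: (@le_trans _ _ (kap ^+ 3 * (g ^+ 4 * (C4 * m x)))); first by rewrite ler_pM2l ?exprn_gt0.
rewrite [leRHS](_ : _ = kap ^+ 3 * (g ^+ 4 * ((C4 + 1) * m x))); last by ring.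
by rewrite !ler_pM2l ?exprn_gt0// ler_wpM2r// lerDl.
Qed.

End DistanceDecay.

End OneStep.

(** * Almost sure estimates *)

Section AlmostSureEstimates.
Variables (R : realType) (N : nat) (d : measure_display) (Xi : measurableType d).
Variable mu : probability Xi R.
Local Notation V := 'rV[R]_N.
Local Notation bV := (borelV R N).
Variables (A B : Xi -> operator R N) (b : Xi -> V -> V).
Hypothesis A_random : random_operator A.
Hypothesis B_monotone : forall xi, monotone_op (B xi).
Hypothesis b_measurable : measurable_fun [set: Xi * bV] (fun q : Xi * bV => b q.1 q.2 : bV).
Hypothesis b_sel : forall x, {ae mu, forall xi, B xi x (b xi x)}.
Variables (d' : measure_display) (Omega : measurableType d').
Variable P : probability Omega R.
Variable u : nat -> Omega -> Xi.
Hypothesis u_iid : iid_seq mu P u.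
Variable g : nat -> R.
Hypothesis g0 : forall n, 0 < g n.
Hypothesis g2 : bounded_sums (fun n => g n ^+ 2).
Variables (X : nat -> Omega -> V) (x0 : V).
Hypothesis X0 : forall w, X 0 w = x0.
Hypothesis XS : forall n w, X n.+1 w = forward_backward A b (g n) (X n w) (u n w).

Let g_ge0 n : 0 <= g n. Proof. exact: ltW. Qed.

Local Notation fb := (forward_backward A b).
Notation Past n := (g_sigma_algebraType (past_gen u n)).

Let X_adapted n : measurable_fun [set: Past n] (X n : Past n -> bV).
Proof.
elim: n => [|n IH].
  by rewrite (_ : X 0 = fun=> x0); [exact: measurable_cst|apply/funext => w; rewrite X0].
rewrite (_ : X n.+1 = fun w => fb (g n) (X n w) (u n w)); last by apply/funext => w; rewrite XS.
have mp : measurable_fun [set: Past n.+1] (fun w : Past n.+1 => (X n w : bV, u n w)).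
  apply/measurable_fun_pairP; split; last exact: past_u_measurable.
  exact: (measurableT_comp IH (@pastS_measurable _ _ _ _ u n)).
exact: (measurableT_comp (forward_backward_measurable2 A_random b_measurable (g0 n)) mp).
Qed.

Let adaptedX (f : nat -> V -> R) : (forall n, measurable_fun [set: bV] (f n : bV -> R)) ->
  adapted u (fun n w => f n (X n w)).
Proof. by move=> mf n; exact: (measurableT_comp (mf n) (@X_adapted n)). Qed.

Let adapted2X (f : nat -> V -> Xi -> R) :
  (forall n, measurable_fun [set: bV * Xi] (fun q : bV * Xi => f n q.1 q.2)) ->
  adapted2 u (fun n w xi => f n (X n w) xi).
Proof.
move=> mf n.
have mp : measurable_fun [set: Past n * Xi] (fun q : Past n * Xi => (X n q.1 : bV, q.2)).
  apply/measurable_fun_pairP; split; last exact: measurable_snd.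
  exact: (measurableT_comp (@X_adapted n) (@measurable_fst _ _ _ _)).
exact: (measurableT_comp (mf n) mp).
Qed.

Let mx : measurable_fun [set: bV * Xi] (fun q : bV * Xi => q.1 : bV).
Proof. exact: measurable_fst. Qed.

Let mfb n : measurable_fun [set: bV * Xi] (fun q : bV * Xi => fb (g n) q.1 q.2 : bV).
Proof. exact: forward_backward_measurable2. Qed.

Let mfbx n x : measurable_fun [set: Xi] (fun xi => fb (g n) x xi : bV).
Proof. exact: forward_backward_measurable. Qed.

(** * Boundedness of the iterates *)

Section Boundedness.
Variables (W : Xi -> R) (xs : V) (phi psi : Xi -> V).
Hypothesis W_int : rintegrable mu W.
Hypothesis b_W : forall xi x, sqn (b xi x) <= W xi * (1 + enorm x) ^+ 2.
Hypothesis phi_m : measurable_fun [set: Xi] (phi : Xi -> bV).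
Hypothesis psi_m : measurable_fun [set: Xi] (psi : Xi -> bV).
Hypothesis phi2 : rintegrable mu (fun xi => sqn (phi xi)).
Hypothesis psi2 : rintegrable mu (fun xi => sqn (psi xi)).
Hypothesis phiA : {ae mu, forall xi, A xi xs (phi xi)}.
Hypothesis psiB : {ae mu, forall xi, B xi xs (psi xi)}.
Hypothesis sum0 : vintegral mu phi + vintegral mu psi = 0.

Let vintegrable_sqn f : measurable_fun [set: Xi] (f : Xi -> bV) ->
  rintegrable mu (fun xi => sqn (f xi)) -> vintegrable mu f.
Proof.
move=> mf f2.
apply: (vintegrable_le mf (rintegrableD (rintegrable_cst mu 1) f2)); apply: aeW => xi.
by rewrite -enormK; have := sqr_ge0 (enorm (f xi) - 1); have := enorm_ge0 (f xi); nra.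
Qed.

Let sV := fun x => sqn (x - xs).

Let msV : measurable_fun [set: bV] (sV : bV -> R).
Proof. by apply: measurable_sqn; apply: measurable_vB => //; exact: measurable_cst. Qed.

Let C := 2 * (\int[mu]_xi sqn (phi xi)) + 4 * (\int[mu]_xi W xi) * (1 + enorm xs) ^+ 2 +
  4 * (\int[mu]_xi W xi).

Let W0 xi : 0 <= W xi.
Proof.
have := le_trans (sqn_ge0 _) (b_W xi 0).
by rewrite enorm0 addr0 expr1n mulr1.
Qed.

Let IW0 : 0 <= \int[mu]_xi W xi. Proof. by apply: Rintegral_ge0 => xi _; exact: W0. Qed.

Let C0 : 0 <= C.
Proof.
have h : 0 <= \int[mu]_xi sqn (phi xi) by apply: Rintegral_ge0 => xi _; exact: sqn_ge0.
have k : 0 <= 4 * (\int[mu]_xi W xi) by rewrite mulr_ge0.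
apply: addr_ge0 => //; apply: addr_ge0; first by rewrite mulr_ge0.
by apply: mulr_ge0 => //; exact: sqr_ge0.
Qed.

Let mpb x : measurable_fun [set: Xi] (fun xi => sqn (phi xi + b xi x)).
Proof.
by apply: measurable_sqn; apply: measurable_vD => //; exact: (b_section_measurable b_measurable).
Qed.

Let pb x : rintegrable mu (fun xi => sqn (phi xi + b xi x)) /\
  \int[mu]_xi sqn (phi xi + b xi x) <= C * (1 + sV x).
Proof.
pose F xi := 2 * sqn (phi xi) + (4 * (1 + enorm xs) ^+ 2 + 4 * sV x) * W xi.
have iF : rintegrable mu F by apply: rintegrableD; exact: rintegrableZ.
have le xi : sqn (phi xi + b xi x) <= F xi.
  apply: le_trans (sqnD_le _ _) _; rewrite lerD2l.
  apply: (@le_trans _ _ (2 * (W xi * (1 + enorm x) ^+ 2))); first by rewrite ler_pM2l.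
  rewrite mulrCA mulrC ler_wpM2r// /sV -enormK.
  have := enorm_sub_ge x xs; have := enorm_ge0 x; have := enorm_ge0 xs; have := enorm_ge0 (x - xs).
  move: (enorm x) (enorm xs) (enorm (x - xs)) => p q r r0 q0 p0 pqr.
  have : (1 + p) ^+ 2 <= (1 + q + r) ^+ 2 by rewrite ler_pXn2r ?nnegrE//; lra.
  by have := sqr_ge0 (1 + q - r); lra.
split.
  by apply: (rintegrable_le (mpb x) iF); apply: aeW => xi; rewrite ger0_norm ?sqn_ge0.
have ip : rintegrable mu (fun xi => sqn (phi xi + b xi x)).
  by apply: (rintegrable_le (mpb x) iF); apply: aeW => xi; rewrite ger0_norm ?sqn_ge0.
apply: (@le_trans _ _ (\int[mu]_xi F xi)); first by apply: Rintegral_le_ae => //; exact: aeW.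
rewrite /F RintegralD//; [|exact: rintegrableZ|exact: rintegrableZ].
rewrite !RintegralZl// /C.
have s0 : 0 <= \int[mu]_xi sqn (phi xi) by apply: Rintegral_ge0 => xi _; exact: sqn_ge0.
have v0 : 0 <= sV x by exact: sqn_ge0.
have q0 := sqr_ge0 (1 + enorm xs).
move: s0 v0 q0 IW0; move: (\int[mu]_xi sqn (phi xi)) (sV x) ((1 + enorm xs) ^+ 2) (\int[mu]_xi W xi).
move=> s v q w s0 v0 q0 w0.
have : 0 <= s * v by exact: mulr_ge0.
have : 0 <= w * q * v by rewrite !mulr_ge0.
lra.
Qed.

(** The linear term of the Fejer inequality; its mean vanishes because [phi] and [psi] represent 0
    at [xs]. *)
Let lin x xi := dotv (phi xi + psi xi) (x - xs).

Let vphi := vintegrable_sqn phi_m phi2.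
Let vpsi := vintegrable_sqn psi_m psi2.

Let lin_int x : rintegrable mu (lin x) /\ \int[mu]_xi lin x xi = 0.
Proof.
split; first by apply: dotv_integrable; exact: vintegrableD.
rewrite -(@dotv_vintegral _ _ _ _ mu (fun xi => phi xi + psi xi)); last exact: vintegrableD.
by rewrite vintegralD// sum0 dot0v.
Qed.

Let fejer n x : {ae mu, forall xi, sV (fb (g n) x xi) + 2^-1 * sqn (x - fb (g n) x xi) <=
  sV x - 2 * g n * lin x xi + 2 * g n ^+ 2 * sqn (phi xi + b xi x)}.
Proof.
apply: filterS3 phiA psiB (b_sel x) => xi hp hq hb.
exact: (forward_backward_fejer (random_maximal A_random xi) (g0 n) hp (B_monotone hb hq)).
Qed.

Let moves n x := \int[mu]_xi sqn (x - fb (g n) x xi).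

Let fejer_int n x : [/\ rintegrable mu (fun xi => sqn (x - fb (g n) x xi)),
  rintegrable mu (fun xi => sV (fb (g n) x xi)) &
  \int[mu]_xi sV (fb (g n) x xi) + 2^-1 * moves n x <=
  sV x + 2 * g n ^+ 2 * (C * (1 + sV x))].
Proof.
have [li l0] := lin_int x; have [bi bC] := pb x.
pose F xi := sV x - 2 * g n * lin x xi + 2 * g n ^+ 2 * sqn (phi xi + b xi x).
have i1 : rintegrable mu (fun xi => sV x - 2 * g n * lin x xi).
  by apply: rintegrableB; [exact: rintegrable_cst|exact: rintegrableZ].
have iF : rintegrable mu F by apply: rintegrableD => //; exact: rintegrableZ.
have m1 : measurable_fun [set: Xi] (fun xi => sqn (x - fb (g n) x xi)).
  by apply: measurable_sqn; apply: measurable_vB => //; exact: measurable_cst.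
have m2 : measurable_fun [set: Xi] (fun xi => sV (fb (g n) x xi)).
  by apply: measurable_sqn; apply: measurable_vB => //; exact: measurable_cst.
have j1 : rintegrable mu (fun xi => sqn (x - fb (g n) x xi)).
  apply: (rintegrable_le m1 (rintegrableZ 2 iF)); apply: filterS (fejer n x) => xi h.
  by rewrite ger0_norm ?sqn_ge0// /F; have : 0 <= sV (fb (g n) x xi) := sqn_ge0 _; lra.
have j2 : rintegrable mu (fun xi => sV (fb (g n) x xi)).
  apply: (rintegrable_le m2 iF); apply: filterS (fejer n x) => xi h.
  by rewrite ger0_norm ?sqn_ge0// /F; have := sqn_ge0 (x - fb (g n) x xi); lra.
split => //; rewrite /moves -RintegralZl// -RintegralD//; last exact: rintegrableZ.
apply: (@le_trans _ _ (\int[mu]_xi F xi)).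
  by apply: Rintegral_le_ae => //; apply: rintegrableD => //; exact: rintegrableZ.
rewrite /F RintegralD//; last exact: rintegrableZ.
rewrite RintegralB//; [|exact: rintegrable_cst|exact: rintegrableZ].
rewrite Rintegral_cst1 !RintegralZl// l0 mulr0 subr0 lerD2l ler_wpM2l//.
by rewrite mulr_ge0 ?sqr_ge0.
Qed.

Let mmove n : measurable_fun [set: bV * Xi]
  (fun q : bV * Xi => sqn ((q.1 : V) - fb (g n) q.1 q.2)).
Proof. by apply: measurable_sqn; exact: measurable_vB. Qed.

Let moves_adapted : adapted u (fun k w => moves k (X k w)).
Proof.
exact: (adapted_Rintegral mu (adapted2X (f := fun n x xi => sqn (x - fb (g n) x xi)) mmove)).
Qed.

Let moves_ge0 k x : 0 <= moves k x.
Proof. by apply: Rintegral_ge0 => xi _; exact: sqn_ge0. Qed.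

(* The weights [expR (- (2 * C + 1) * S k)], [S k] the sum of the squared
   steps, turn the growth factor [1 + 2 * C * g k ^+ 2] into a decrease. *)
Lemma summable_moves : {ae P, forall w, bounded_sums (fun k => g k ^+ 2 * sqn (X k w - xs))} /\
  {ae P, forall w, bounded_sums (fun k => \int[mu]_xi sqn (X k w - fb (g k) (X k w) xi))}.
Proof.
have [S hS] := g2.
(* [2 * C] compensates the growth factor; the extra 1 leaves [g k ^ 2 * sV] in the decrease [W']. *)
pose K0 := 2 * C + 1; pose s k := \sum_(0 <= j < k) g j ^+ 2.
have K00 : 0 < K0 by rewrite /K0 ltr_wpDl// mulr_ge0.
pose c k := expR (- (K0 * s k)).
have c_gt0 k : 0 < c k by exact: expR_gt0.
have c_step k : c k.+1 * (1 + K0 * g k ^+ 2) <= c k.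
  have -> : c k = c k.+1 * expR (K0 * g k ^+ 2).
    rewrite /c -expRD; congr expR; rewrite /s big_nat_recr//=; ring.
  by rewrite ler_pM2l// expR_ge1Dx.
have c_low k : expR (- (K0 * S)) <= c k.
  by rewrite ler_expR lerN2 ler_pM2l// hS.
pose U k w := c k * sV (X k w).
pose W' k w := c k.+1 * (g k ^+ 2 * sV (X k w) + 2^-1 * moves k (X k w)).
pose be k (w : Omega) := c k.+1 * (2 * C * g k ^+ 2).
pose h k w xi := c k.+1 * sV (fb (g k) (X k w) xi).
have sW : {ae P, forall w, bounded_sums (W'^~ w)}.
  apply: (@bounded_sums_drift R d Xi mu d' Omega P u u_iid U W' be h (c 0%N * sV x0)).
  - apply: (adaptedX (f := fun k x => c k * sV x)) => k.
    by apply: measurable_funM => //; exact: measurable_cst.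
  - move=> k; apply: measurable_funM; first exact: measurable_cst.
    apply: measurable_funD; apply: measurable_funM; try exact: measurable_cst.
      exact: (adaptedX (f := fun _ => sV)).
    exact: moves_adapted.
  - by move=> k; exact: measurable_cst.
  - apply: (adapted2X (f := fun k x xi => c k.+1 * sV (fb (g k) x xi))) => k.
    apply: measurable_funM; first exact: measurable_cst.
    by apply: measurable_sqn; apply: measurable_vB => //; exact: measurable_cst.
  - by move=> k w; rewrite mulr_ge0 ?sqn_ge0// ltW.
  - move=> k w; rewrite mulr_ge0 ?(ltW (c_gt0 _))// addr_ge0 ?mulr_ge0 ?sqr_ge0 ?sqn_ge0//.
  - by move=> k w; rewrite mulr_ge0 ?(ltW (c_gt0 _))// !mulr_ge0.
  - by move=> k w xi; rewrite mulr_ge0 ?sqn_ge0// ltW.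
  - by move=> w; rewrite /U X0.
  - by move=> k w; rewrite /U /h XS.
  - move=> k w; have [_ j2 le] := fejer_int k (X k w).
    rewrite integral_rintegrable; last exact: rintegrableZ.
    rewrite lee_fin RintegralZl// /W' /U /be.
    have v0 : 0 <= sV (X k w) by exact: sqn_ge0.
    have h1 : c k.+1 * (1 + K0 * g k ^+ 2) * sV (X k w) <= c k * sV (X k w).
      by rewrite ler_wpM2r.
    have h2 : c k.+1 * (\int[mu]_xi sV (fb (g k) (X k w) xi) + 2^-1 * moves k (X k w)) <=
        c k.+1 * (sV (X k w) + 2 * g k ^+ 2 * (C * (1 + sV (X k w)))) by rewrite ler_pM2l.
    move: h1 h2; rewrite /K0; lra.
  - apply: aeW => w; apply: (@bounded_sums_le _ _ (fun k => 2 * C * g k ^+ 2)).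
      move=> k; rewrite /be ler_piMl ?mulr_ge0 ?sqr_ge0// -expR0 ler_expR oppr_le0.
      by rewrite mulr_ge0 ?(ltW K00)// sumr_ge0// => j _; exact: sqr_ge0.
    by apply: bounded_sumsZ => //; rewrite mulr_ge0.
pose l := expR (- (K0 * S)); have l0 : 0 < l by exact: expR_gt0.
have low k w : l * (g k ^+ 2 * sV (X k w) + 2^-1 * moves k (X k w)) <= W' k w.
  rewrite ler_wpM2r// addr_ge0// mulr_ge0 ?sqr_ge0//; exact: sqn_ge0.
split; apply: filterS sW => w bW.
  apply: (@bounded_sums_le _ _ (fun k => l^-1 * W' k w)) => [k|]; last first.
    by apply: bounded_sumsZ => //; rewrite invr_ge0 ltW.
  rewrite ler_pdivlMl//; apply: le_trans (low k w); rewrite ler_pM2l// lerDl.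
  by rewrite mulr_ge0.
apply: (@bounded_sums_le _ _ (fun k => 2 * l^-1 * W' k w)) => [k|]; last first.
  by apply: bounded_sumsZ => //; rewrite mulr_ge0// invr_ge0 ltW.
rewrite -mulrA mulrCA ler_pdivlMl//; apply: (@le_trans _ _ (2 * (l * (g k ^+ 2 * sV (X k w) + 2^-1 * moves k (X k w))))).
  have : 0 <= l * (g k ^+ 2 * sV (X k w)) by rewrite mulr_ge0 ?(ltW l0)// mulr_ge0 ?sqr_ge0//; exact: sqn_ge0.
  by rewrite -/(moves k (X k w)); lra.
by rewrite ler_pM2l.
Qed.

(** The Fejer inequality is summed along the path: [g k * lin] is a martingale increment with
    summable conditional variances by [summable_moves], and [f], the positive part of the rest, has
    summable conditional means. *)
Lemma iterates_bounded : {ae P, forall w, exists c, forall n, enorm (X n w) <= c}.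
Proof.
have [sV2 _] := summable_moves.
pose Q := \int[mu]_xi sqn (phi xi + psi xi).
have iQ : rintegrable mu (fun xi => sqn (phi xi + psi xi)).
  apply: (rintegrable_le _ (rintegrableD (rintegrableZ 2 phi2) (rintegrableZ 2 psi2))).
    by apply: measurable_sqn; exact: measurable_vD.
  by apply: aeW => xi; rewrite ger0_norm ?sqn_ge0// sqnD_le.
have Q0 : 0 <= Q by apply: Rintegral_ge0 => xi _; exact: sqn_ge0.
pose z k w xi := g k * lin (X k w) xi.
have mz : adapted2 u z.
  apply: (adapted2X (f := fun k x xi => g k * lin x xi)) => k.
  apply: measurable_funM; first exact: measurable_cst.
  apply: measurable_dotv; last by apply: measurable_vB => //; exact: measurable_cst.
  by apply: measurable_vD; exact: (measurableT_comp _ (@measurable_snd _ _ bV Xi)).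
have mart := @martingale_cauchy R d Xi mu d' Omega P u u_iid z
  (fun k w => Q * (g k ^+ 2 * sV (X k w))) mz.
have {}mart : {ae P, forall w, forall e, 0 < e -> exists n0, forall n m, (n0 <= n)%N -> (n <= m)%N ->
    `|\sum_(n <= k < m) z k w (u k w)| <= e}.
  have z0 k w : \int[mu]_xi z k w xi = 0.
    by have [li l0] := lin_int (X k w); rewrite RintegralZl// l0 mulr0.
  have E w n m : \sum_(n <= k < m) (z k w (u k w) - \int[mu]_xi z k w xi) =
      \sum_(n <= k < m) z k w (u k w) by apply: eq_bigr => k _; rewrite z0 subr0.
  suff : {ae P, forall w, forall e, 0 < e -> exists n0, forall n m, (n0 <= n)%N -> (n <= m)%N ->
     `|\sum_(n <= k < m) (z k w (u k w) - \int[mu]_xi z k w xi)| <= e}.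
    by apply: filterS => w H e /H [n0 hn0]; exists n0 => n m a1 a2; rewrite -E; exact: hn0.
  apply: mart.
  - apply: (adaptedX (f := fun k x => Q * (g k ^+ 2 * sV x))) => k.
    by apply: measurable_funM; [exact: measurable_cst|apply: measurable_funM => //; exact: measurable_cst].
  - by move=> k w; rewrite !mulr_ge0 ?sqr_ge0//; exact: sqn_ge0.
  - move=> k w; apply: (@integral_le_ae _ _ _ _ _
      (fun xi => (g k ^+ 2 * sV (X k w)) * sqn (phi xi + psi xi))).
    + by apply: measurable_funX; exact: (adapted2_section k w mz).
    + by move=> xi; exact: sqr_ge0.
    + exact: rintegrableZ.
    + apply: aeW => xi; rewrite exprMn -mulrA ler_wpM2l ?sqr_ge0// mulrC.
      by rewrite /lin dotv_sqr_le.
    + by rewrite RintegralZl// mulrC.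
  - by apply: filterS sV2 => w bw; exact: bounded_sumsZ.
pose f k w xi := Num.max 0 (sV (fb (g k) (X k w) xi) - sV (X k w) + 2 * z k w xi).
have mf : adapted2 u f.
  move=> k; apply: measurable_maxr; first exact: measurable_cst.
  apply: measurable_funD; last by apply: measurable_funM; [exact: measurable_cst|exact: mz].
  apply: (adapted2X (f := fun k x xi => sV (fb (g k) x xi) - sV x)) => j.
  apply: measurable_funB; last exact: (measurableT_comp msV (@measurable_fst _ _ bV Xi)).
  by apply: measurable_sqn; apply: measurable_vB => //; exact: measurable_cst.
have sf : {ae P, forall w, bounded_sums (fun k => f k w (u k w))}.
  apply: (@bounded_sums_next R d Xi mu d' Omega P u u_iid f
    (fun k w => 2 * g k ^+ 2 * (C * (1 + sV (X k w)))) mf).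
  - apply: (adaptedX (f := fun k x => 2 * g k ^+ 2 * (C * (1 + sV x)))) => k.
    apply: measurable_funM; first exact: measurable_cst.
    apply: measurable_funM; first exact: measurable_cst.
    by apply: measurable_funD => //; exact: measurable_cst.
  - by move=> k w xi; rewrite le_max lexx.
  - move=> k w; rewrite !mulr_ge0 ?sqr_ge0// addr_ge0//; exact: sqn_ge0.
  - move=> k w; have [bi bC] := pb (X k w).
    apply: (@integral_le_ae _ _ _ _ _ (fun xi => 2 * g k ^+ 2 * sqn (phi xi + b xi (X k w)))).
    + exact: (adapted2_section k w mf).
    + by move=> xi; rewrite le_max lexx.
    + exact: rintegrableZ.
    + apply: filterS (fejer k (X k w)) => xi h; rewrite ge_max mulr_ge0 ?sqn_ge0 ?mulr_ge0 ?sqr_ge0//=.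
      by move: h; rewrite /z; have := sqn_ge0 (X k w - fb (g k) (X k w) xi); lra.
    + by rewrite RintegralZl// ler_wpM2l// mulr_ge0 ?sqr_ge0.
  - apply: filterS sV2 => w bw.
    apply: (@bounded_sums_le _ _ (fun k => 2 * C * (g k ^+ 2 + g k ^+ 2 * sV (X k w)))).
      by move=> k; rewrite le_eqVlt; apply/orP; left; apply/eqP; ring.
    by apply: bounded_sumsZ; [rewrite mulr_ge0|exact: bounded_sumsD].
apply: filterS2 mart sf => w hm [cf hf].
have [n0 hn0] := hm 1 ltr01.
have step n : sV (X n w) <= sV x0 + \sum_(0 <= k < n) f k w (u k w) -
    2 * \sum_(0 <= k < n) z k w (u k w).
  elim: n => [|n IH]; first by rewrite !big_geq// X0 mulr0 subr0 addr0.
  rewrite !big_nat_recr//= -/(sV _) XS.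
  have : sV (fb (g n) (X n w) (u n w)) - sV (X n w) + 2 * z n w (u n w) <= f n w (u n w).
    by rewrite le_max lexx orbT.
  by move: IH; lra.
pose M := \sum_(0 <= k < n0) `|z k w (u k w)|.
have zb n : - (M + 1) <= \sum_(0 <= k < n) z k w (u k w).
  have [nn|nn] := leqP n0 n.
    rewrite (big_cat_nat (leq0n n0) nn)/=.
    have := hn0 n0 n (leqnn _) nn; rewrite ler_norml => /andP[h _].
    have : `|\sum_(0 <= k < n0) z k w (u k w)| <= M by exact: ler_norm_sum.
    by rewrite ler_norml => /andP[h' _]; lra.
  have : `|\sum_(0 <= k < n) z k w (u k w)| <= M.
    apply: le_trans (ler_norm_sum _ _ _) _.
    by rewrite /M (big_cat_nat (leq0n n) (ltnW nn))/= lerDl sumr_ge0.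
  by rewrite ler_norml => /andP[h' _]; lra.
pose K := sV x0 + cf + 2 * (M + 1).
have VK n : sV (X n w) <= K by have := step n; have := hf n; have := zb n; rewrite /K; lra.
have K0 : 0 <= K by apply: le_trans (VK 0%N); exact: sqn_ge0.
exists (K + 1 + enorm xs) => n; apply: le_trans (enorm_sub_ge _ xs) _; rewrite lerD2r.
have K1 : 0 <= K + 1 by rewrite addr_ge0.
rewrite -(sqn_le _ K1).
apply: le_trans (VK n) _; rewrite -subr_ge0.
have -> : (K + 1) ^+ 2 - K = K ^+ 2 + K + 1 by ring.
by apply: addr_ge0 => //; apply: addr_ge0 => //; exact: sqr_ge0.
Qed.

Lemma moves_integrable n x : rintegrable mu (fun xi => sqn (x - fb (g n) x xi)).
Proof. by case: (fejer_int n x). Qed.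

End Boundedness.

(** Each coordinate of a step minus its conditional mean is a martingale increment, whose
    conditional variance is bounded by the mean squared move. From here on a path is driven by its
    mean moves. *)
Lemma increments_cauchy :
  (forall n x, rintegrable mu (fun xi => sqn (x - fb (g n) x xi))) ->
  {ae P, forall w, bounded_sums (fun k => \int[mu]_xi sqn (X k w - fb (g k) (X k w) xi))} ->
  {ae P, forall w, forall e, 0 < e -> exists n0, forall n m, (n0 <= n)%N -> (n <= m)%N ->
    enorm (X m w - X n w -
      \sum_(n <= k < m) vintegral mu (fun xi => fb (g k) (X k w) xi - X k w)) <= e}.
Proof.
move=> mi sm.
pose z i k w xi := (fb (g k) (X k w) xi - X k w) 0 i.
have mz i : adapted2 u (z i).
  apply: (adapted2X (f := fun k x xi => (fb (g k) x xi - x) 0 i)) => k.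
  by apply: measurable_coord; exact: measurable_vB.
have av : adapted u (fun k w => \int[mu]_xi sqn (X k w - fb (g k) (X k w) xi)).
  apply: (adapted_Rintegral mu (adapted2X (f := fun n x xi => sqn (x - fb (g n) x xi)) _)) => n.
  by apply: measurable_sqn; exact: measurable_vB.
have key i : {ae P, forall w, forall e, 0 < e -> exists n0, forall n m, (n0 <= n)%N -> (n <= m)%N ->
    `|\sum_(n <= k < m) (z i k w (u k w) - \int[mu]_xi z i k w xi)| <= e}.
  apply: (@martingale_cauchy R d Xi mu d' Omega P u u_iid (z i) _ (mz i) av) => //.
    by move=> k w; apply: Rintegral_ge0 => xi _; exact: sqn_ge0.
  move=> k w; apply: (@integral_le_ae _ _ _ _ _ (fun xi => sqn (X k w - fb (g k) (X k w) xi))) => //.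
  - by apply: measurable_funX; exact: (adapted2_section k w (mz i)).
  - by move=> xi; exact: sqr_ge0.
  - apply: aeW => xi; rewrite sqnB -enormK -[z i k w xi ^+ 2]real_normK ?num_real//.
    by rewrite ler_pXn2r ?nnegrE ?enorm_ge0//; exact: enorm_coord.
have key' : {ae P, forall w, forall i, forall e, 0 < e -> exists n0, forall n m, (n0 <= n)%N -> (n <= m)%N ->
    `|\sum_(n <= k < m) (z i k w (u k w) - \int[mu]_xi z i k w xi)| <= e}.
  exact: filter_forall key.
apply: filterS key' => w hw e e0.
have e1 : 0 < e / (N%:R + 1) by rewrite divr_gt0// ltr_wpDl.
have /choice[n0 hn0] i := hw i _ e1.
exists (\max_i n0 i)%N => n m nn nm.
have -> : X m w - X n w = \sum_(n <= k < m) (X k.+1 w - X k w) by rewrite telescope_sumr.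
rewrite -sumrB; apply: le_trans (enorm_le_sum _) _.
apply: (@le_trans _ _ (\sum_(i < N) (e / (N%:R + 1)))).
  apply: ler_sum => i _; have := hn0 i n m (leq_trans (leq_bigmax i) nn) nm.
  rewrite summxE; congr (`|_| <= _); apply: eq_bigr => k _.
  by rewrite /z !mxE XS.
rewrite sumr_const card_ord -[leLHS]mulr_natl mulrA ler_pdivrMr ?ltr_wpDl// mulrC.
by rewrite ler_pM2l// lerDl.
Qed.

(** * Sums of powers of the distance to the domain *)

Section DistanceToDomain.
Local Notation dD := (dist_to (essential_dom mu A)).
Variables (r C : R) (q : nat).
Hypothesis D0 : essential_dom mu A !=set0.
Hypotheses (r0 : 0 <= r) (r1 : r < 1) (C0 : 0 <= C).
Hypothesis dist2 : forall k x, (\int[mu]_xi (dD (fb (g k) x xi) ^+ 2)%:E <=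
  (r * dD x ^+ 2 + C * g k ^+ 2 * (1 + enorm x ^+ q))%:E)%E.
Hypothesis dist4 : forall k x, (\int[mu]_xi (dD (fb (g k) x xi) ^+ 4)%:E <=
  (r * dD x ^+ 4 + C * g k ^+ 4 * (1 + enorm x ^+ q))%:E)%E.
Hypothesis g_ratio : forall t, 1 < t -> exists n0, forall k, (n0 <= k)%N -> g k <= t * g k.+1.
Hypothesis X_bounded : {ae P, forall w, exists c, forall n, enorm (X n w) <= c}.

Let mdD : measurable_fun [set: bV] (dD : bV -> R).
Proof. exact: borelV_measurable_real (dist_to_continuous D0). Qed.

Let mdfb n : measurable_fun [set: bV * Xi] (fun q : bV * Xi => dD (fb (g n) q.1 q.2)).
Proof. exact: (measurableT_comp mdD (@mfb n)). Qed.

Let mm : measurable_fun [set: bV] (fun x : bV => 1 + enorm (x : V) ^+ q).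
Proof.
by apply: measurable_funD; [exact: measurable_cst|apply: measurable_funX; exact: measurable_enorm].
Qed.

Let m0 (x : V) : 0 <= 1 + enorm x ^+ q. Proof. by rewrite addr_ge0 ?exprn_ge0 ?enorm_ge0. Qed.

Let summable_mass : {ae P, forall w, bounded_sums (fun k => g k ^+ 2 * (1 + enorm (X k w) ^+ q))}.
Proof.
apply: filterS X_bounded => w [c hc].
have c0 : 0 <= c by apply: le_trans (hc 0%N); exact: enorm_ge0.
apply: (@bounded_sums_le _ _ (fun k => (1 + c ^+ q) * g k ^+ 2)).
  by move=> k; rewrite mulrC ler_wpM2r ?sqr_ge0// lerD2l lerXn2r ?nnegrE ?enorm_ge0.
by apply: bounded_sumsZ => //; rewrite addr_ge0 ?exprn_ge0.
Qed.

(** Since [g k / g k.+1] tends to 1, the mean contraction of [d ^ 4] survives the division by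
    [g ^ 2], with an error [O(g ^ 2)]. The result controls the conditional variances in the sums of
    [d ^ 2 / g]. *)
Lemma summable_dist4 : {ae P, forall w, bounded_sums (fun k => dD (X k w) ^+ 4 / g k ^+ 2)}.
Proof.
(* [s] is such that [r * (1 + s) ^ 2 <= r * (1 + 3 * s) <= rr < 1]. *)
pose rr : R := (1 + r) / 2; pose s : R := (1 - r) / 6.
have [a0 a1] := (r0, r1).
have s0 : 0 < s by rewrite /s; lra.
have [n0 hn0] := g_ratio (t := 1 + s) ltac:(by rewrite ltrDl).
pose rho k := (g k / g k.+1) ^+ 2.
have rho0 k : 0 <= rho k by exact: sqr_ge0.
have rhoP k : (n0 <= k)%N -> rho k <= 2 /\ r * rho k <= rr.
  move=> /hn0 h; have h1 : rho k <= (1 + s) ^+ 2.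
    rewrite /rho lerXn2r ?nnegrE ?divr_ge0 ?addr_ge0 ?(ltW s0)//.
    by rewrite ler_pdivrMr.
  have s1 : s <= 1 by rewrite /s; lra.
  have h2 : (1 + s) ^+ 2 <= 1 + 3 * s.
    have : s * s <= s by rewrite ler_piMr// ltW.
    by lra.
  split; first by apply: le_trans h1 (le_trans h2 _); rewrite /s; lra.
  apply: (@le_trans _ _ (r * (1 + 3 * s))); first by rewrite ler_wpM2l// (le_trans h1).
  by rewrite /s /rr; nra.
pose U k w := dD (X k w) ^+ 4 / g k ^+ 2.
pose W' k w := (1 - rr) * U k w.
pose mass k w := g k ^+ 2 * (1 + enorm (X k w) ^+ q).
(* Before [n0] the ratio of the steps is not controlled: these finitely many terms are counted as
   errors. *)
pose be k w := C * rho k * mass k w + (if (k < n0)%N then r * rho k else 0) * U k w.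
pose h k w xi := dD (fb (g k) (X k w) xi) ^+ 4 / g k.+1 ^+ 2.
have d40 x : 0 <= dD x ^+ 4 by rewrite -[_ ^+ 4]/(_ ^+ (2 * 2)) exprM sqr_ge0.
have U0 k w : 0 <= U k w by rewrite divr_ge0 ?sqr_ge0.
have rr1 : 0 < 1 - rr by rewrite /rr; lra.
have rr0 : 0 <= rr by rewrite /rr; lra.
have mU k : measurable_fun [set: bV] (fun x : bV => dD x ^+ 4 / g k ^+ 2).
  by apply: measurable_funM; [exact: measurable_funX|exact: measurable_cst].
have aU : adapted u U by exact: (adaptedX mU).
have mass0 k w : 0 <= mass k w by rewrite mulr_ge0 ?sqr_ge0.
have i0 k : 0 <= (if (k < n0)%N then r * rho k else 0) by case: ifP => // _; rewrite mulr_ge0.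
have sW : {ae P, forall w, bounded_sums (W'^~ w)}.
  apply: (@bounded_sums_drift R d Xi mu d' Omega P u u_iid U W' be h (dD x0 ^+ 4 / g 0%N ^+ 2)) => //.
  - by move=> k; apply: measurable_funM; [exact: measurable_cst|exact: aU].
  - move=> k; apply: measurable_funD; last first.
      by apply: measurable_funM; [exact: measurable_cst|exact: aU].
    apply: measurable_funM; first exact: measurable_cst.
    apply: (adaptedX (f := fun k x => g k ^+ 2 * (1 + enorm x ^+ q))) => j.
    by apply: measurable_funM => //; exact: measurable_cst.
  - apply: (adapted2X (f := fun k x xi => dD (fb (g k) x xi) ^+ 4 / g k.+1 ^+ 2)) => k.
    by apply: measurable_funM; [exact: measurable_funX|exact: measurable_cst].
  - by move=> k w; rewrite mulr_ge0// ltW.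
  - by move=> k w; rewrite addr_ge0// mulr_ge0// mulr_ge0.
  - by move=> k w xi; rewrite divr_ge0 ?sqr_ge0.
  - by move=> w; rewrite /U X0.
  - by move=> k w; rewrite /U /h XS.
  - move=> k w; have := dist4 k (X k w).
    have mf : measurable_fun [set: Xi] (fun xi => dD (fb (g k) (X k w) xi) ^+ 4).
      by apply: measurable_funX; exact: (measurableT_comp mdD (mfbx k (X k w))).
    move=> le4; have i4 : rintegrable mu (fun xi => dD (fb (g k) (X k w) xi) ^+ 4).
      by apply: rintegrable_ge0 => //; exact: le_lt_trans le4 (ltry _).
    rewrite integral_rintegrable// lee_fin in le4.
    have E : h k w = (fun xi => g k.+1 ^- 2 * dD (fb (g k) (X k w) xi) ^+ 4).
      by apply/funext => xi; rewrite /h mulrC.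
    rewrite E integral_rintegrable; last exact: rintegrableZ.
    rewrite lee_fin RintegralZl//.
    have gk := g0 k; have gk1 := g0 k.+1.
    have h1 : g k.+1 ^- 2 * \int[mu]_xi dD (fb (g k) (X k w) xi) ^+ 4 <=
        r * rho k * U k w + C * rho k * mass k w.
      rewrite [leRHS](_ : _ = g k.+1 ^- 2 * (r * dD (X k w) ^+ 4 + C * g k ^+ 4 * (1 + enorm (X k w) ^+ q))).
        by rewrite ler_pM2l// invr_gt0 exprn_gt0.
      by rewrite /rho /U /mass; field; rewrite !gt_eqF.
    have U0k := U0 k w; rewrite /W' /be; case: (ltnP k n0) => hk.
      have : 0 <= rr * U k w by rewrite mulr_ge0.
      by move: h1; lra.
    have [_ hr] := rhoP k hk.
    have : r * rho k * U k w <= rr * U k w by rewrite ler_wpM2r.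
    by move: h1; lra.
  - apply: filterS summable_mass => w bm.
    apply: (@bounded_sums_eventually _ _ (fun k => 2 * C * mass k w) n0).
    + move=> k nk; rewrite /be ltnNge nk mul0r addr0 ler_wpM2r// mulrC ler_wpM2r//.
      by have [] := rhoP k nk.
    + by move=> k; rewrite mulr_ge0// mulr_ge0.
    + by apply: bounded_sumsZ => //; rewrite mulr_ge0.
apply: filterS sW => w bW.
apply: (@bounded_sums_le _ _ (fun k => (1 - rr)^-1 * W' k w)) => [k|]; last first.
  by apply: bounded_sumsZ => //; rewrite invr_ge0 ltW.
by rewrite /W' mulrA mulVf ?mul1r// gt_eqF.
Qed.

(** The sum is replaced by that of its conditional means, up to a convergent martingale whose
    conditional second moments are at most [v]. *)
Lemma dist2_cauchy : {ae P, forall w, forall e, 0 < e -> exists n0, forall n m, (n0 <= n)%N -> (n <= m)%N ->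
  \sum_(n <= k < m) dD (X k.+1 w) ^+ 2 / g k <=
  r * (\sum_(n <= k < m) dD (X k w) ^+ 2 / g k) +
    C * (\sum_(n <= k < m) g k * (1 + enorm (X k w) ^+ q)) + e}.
Proof.
pose z k w xi := dD (fb (g k) (X k w) xi) ^+ 2 / g k.
pose v k w := r * (dD (X k w) ^+ 4 / g k ^+ 2) + C * (g k ^+ 2 * (1 + enorm (X k w) ^+ q)).
have mz : adapted2 u z.
  apply: (adapted2X (f := fun k x xi => dD (fb (g k) x xi) ^+ 2 / g k)) => k.
  by apply: measurable_funM; [exact: measurable_funX|exact: measurable_cst].
have d40 x : 0 <= dD x ^+ 4 by rewrite -[_ ^+ 4]/(_ ^+ (2 * 2)) exprM sqr_ge0.
have av : adapted u v.
  apply: (adaptedX (f := fun k x => r * (dD x ^+ 4 / g k ^+ 2) + C * (g k ^+ 2 * (1 + enorm x ^+ q)))) => k.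
  apply: measurable_funD; apply: measurable_funM; try exact: measurable_cst.
    by apply: measurable_funM; [exact: measurable_funX|exact: measurable_cst].
  by apply: measurable_funM => //; exact: measurable_cst.
have mf n k w : measurable_fun [set: Xi] (fun xi => dD (fb (g k) (X k w) xi) ^+ n).
  by apply: measurable_funX; exact: (measurableT_comp mdD (mfbx k (X k w))).
have := @martingale_cauchy R d Xi mu d' Omega P u u_iid z v mz av.
have p1 k w : 0 <= v k w.
  by rewrite addr_ge0// mulr_ge0// ?divr_ge0 ?sqr_ge0// mulr_ge0 ?sqr_ge0.
have p2 k w : (\int[mu]_xi (z k w xi ^+ 2)%:E <= (v k w)%:E)%E.
  have le4 := dist4 k (X k w).
  have i4 : rintegrable mu (fun xi => dD (fb (g k) (X k w) xi) ^+ 4).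
    by apply: rintegrable_ge0 => //; exact: le_lt_trans le4 (ltry _).
  rewrite integral_rintegrable// lee_fin in le4.
  have E : (fun xi => z k w xi ^+ 2) = (fun xi => g k ^- 2 * dD (fb (g k) (X k w) xi) ^+ 4).
    by apply/funext => xi; rewrite /z expr_div_n mulrC -exprM.
  rewrite (eq_integral (fun xi => (g k ^- 2 * dD (fb (g k) (X k w) xi) ^+ 4)%:E)); last first.
    by move=> xi _; rewrite -[in RHS](congr1 (fun f => f xi) E).
  rewrite integral_rintegrable; last exact: rintegrableZ.
  rewrite lee_fin RintegralZl//.
  rewrite [leRHS](_ : _ = g k ^- 2 * (r * dD (X k w) ^+ 4 + C * g k ^+ 4 * (1 + enorm (X k w) ^+ q))).
    by rewrite ler_pM2l// invr_gt0 exprn_gt0.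
  by rewrite /v; field; rewrite gt_eqF.
have p3 : {ae P, forall w, bounded_sums (v^~ w)}.
  apply: filterS2 summable_dist4 summable_mass => w b1 b2.
  by apply: bounded_sumsD; exact: bounded_sumsZ.
move=> /(_ p1 p2 p3); apply: filterS => w hw e /hw [n0 hn0].
exists n0 => n m nn nm; have := hn0 n m nn nm; rewrite ler_norml => /andP[_].
rewrite sumrB lerBlDl => h.
have -> : \sum_(n <= k < m) dD (X k.+1 w) ^+ 2 / g k = \sum_(n <= k < m) z k w (u k w).
  by apply: eq_bigr => k _; rewrite /z XS.
apply: le_trans h _; rewrite lerD2r !mulr_sumr -big_split/=; apply: ler_sum => k _.
have le2 := dist2 k (X k w).
have i2 : rintegrable mu (fun xi => dD (fb (g k) (X k w) xi) ^+ 2).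
  apply: rintegrable_ge0 => //; first by move=> xi; exact: sqr_ge0.
  exact: le_lt_trans le2 (ltry _).
rewrite integral_rintegrable// lee_fin in le2.
have -> : \int[mu]_xi z k w xi = (g k)^-1 * \int[mu]_xi dD (fb (g k) (X k w) xi) ^+ 2.
  by rewrite -RintegralZl//; apply: eq_Rintegral => xi _; rewrite /z mulrC.
rewrite [leRHS](_ : _ = (g k)^-1 * (r * dD (X k w) ^+ 2 + C * g k ^+ 2 * (1 + enorm (X k w) ^+ q))).
  by rewrite ler_pM2l// invr_gt0.
by field; rewrite gt_eqF.
Qed.

End DistanceToDomain.

End AlmostSureEstimates.

(** Beyond the threshold [c], the [eps]-th root of [1 / del], the factor [del * t ^ eps] is at least
    1. This converts the moments of order [1 + eps] into uniform integrability. *)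
Lemma powR_young (R : realType) (eps del : R) : 0 < eps -> 0 < del ->
  exists2 c, 0 <= c & forall t, 0 <= t -> t <= del * t `^ (1 + eps) + c.
Proof.
move=> e0 d0; exists (del^-1 `^ eps^-1) => [|t t0]; first exact: powR_ge0.
have [h|h] := leP t (del^-1 `^ eps^-1).
  by rewrite ler_wpDl// mulr_ge0 ?powR_ge0// ltW.
apply: ler_wpDr; first exact: powR_ge0.
have tp : 0 < t by apply: le_lt_trans h; exact: powR_ge0.
rewrite powRD; last by rewrite (gt_eqF tp) implybT.
rewrite powRr1// mulrCA ler_peMr// -ler_pdivrMl// mulr1.
have -> : del^-1 = (del^-1 `^ eps^-1) `^ eps.
  by rewrite -powRrM mulVf ?gt_eqF// powRr1// invr_ge0 ltW.
by apply: ge0_ler_powR; rewrite ?nnegrE ?powR_ge0 ?(ltW e0)// ltW.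
Qed.

Lemma integrable_tail (R : realType) (d : measure_display) (X : measurableType d)
    (mu : probability X R) (f : X -> R) e : rintegrable mu f -> (forall x, 0 <= f x) -> 0 < e ->
  exists2 K : R, 1 <= K & \int[mu]_x (if K < f x then f x else 0) <= e.
Proof.
move=> fi f0 e0; have mf := rintegrable_measurable fi.
pose h (n : nat) x := if n.+1%:R < f x then f x else 0.
have mh n : measurable_fun [set: X] (h n).
  by apply: measurable_fun_ifT => //; exact: measurable_fun_ltr.
have h0 n x : 0 <= h n x by rewrite /h; case: ifP.
have hf n x : h n x <= f x by rewrite /h; case: ifP.
have hi n : rintegrable mu (h n).
  by apply: (rintegrable_le (mh n) fi); apply: aeW => x; rewrite ger0_norm.
have H1 n : measurable_fun [set: X] (EFin \o h n) by exact/measurable_EFinP.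
have H2 : measurable_fun [set: X] (fun _ : X => (0 : \bar R)%E) by exact: measurable_cst.
have H3 : {ae mu, forall x, [set: X] x -> (EFin \o h n) x @[n --> \oo] --> (0 : \bar R)%E}.
  apply: aeW => x _; apply: cvg_near_cst.
  exists (Num.truncn (f x)) => // n /= hn; rewrite /h ifN//.
  rewrite -leNgt; apply: ltW; apply: lt_le_trans (truncnS_gt (f x)) _.
  by rewrite ler_nat.
have H4 : {ae mu, forall x, forall n, [set: X] x -> (`|(EFin \o h n) x| <= (EFin \o f) x)%E}.
  by apply: aeW => x n _; rewrite /= lee_fin ger0_norm.
have [_ _ cv] := dominated_convergence measurableT H1 H2 H3 fi H4.
rewrite integral0 in cv.
have cv' : \int[mu]_x h n x @[n --> \oo] --> (0 : R).
  have /fine_cvgP[_] := cv; apply: cvg_trans; apply: near_eq_cvg; apply: nearW => n /=.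
  by rewrite -/(Rintegral _ _ _).
have /cvgrPdist_le /(_ _ e0) [n _ hn] := cv'.
exists n.+1%:R; first by rewrite ler1n.
have := hn n (leqnn n); rewrite /= sub0r normrN ger0_norm//.
by apply: Rintegral_ge0 => x _; exact: h0.
Qed.

(* On [enorm p <= K] monotonicity of [A] is used, elsewhere only the size of
   the increment [h]. *)
Lemma increment_dotv_le (R : realType) (N : nat) (h w p q x y : 'rV[R]_N) (g K D a dx : R) :
  0 < g -> 0 <= K -> enorm (x - y) <= D -> enorm h <= g * enorm w + 2 * (dx + g) + g * a ->
  0 <= dotv (g^-1 *: (x - (h + x)) - w - p) (h + x - y) -> 0 <= dotv (w - q) (x - y) ->
  dotv h (x - y) <= g * (dotv (p + q) (y - x) + K * enorm h + enorm w * enorm h +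
    D * (if K < enorm p then enorm p + 2 * enorm w + 2 + 2 * (dx / g) + a else 0)).
Proof.
move=> g0 K0 xyD hle; set z := x - y => mA mB.
have zE : y - x = - z by rewrite opprB.
have hE : h + x - y = h + z by rewrite addrA.
have gn : g != 0 by exact: lt0r_neq0.
have m1 : 0 <= - (sqn h + dotv h z) - g * (dotv w h + dotv w z) - g * (dotv p h + dotv p z).
  have := mulr_ge0 (ltW g0) mA; rewrite hE.
  have -> : x - (h + x) = - h by rewrite opprD addrCA subrr addr0.
  rewrite -dotvZl !scalerBr scalerA mulfV// scale1r /sqn !dotE; lra.
have m2 : g * dotv q z <= g * dotv w z.
  by rewrite ler_pM2l//; move: mB; rewrite !dotE; lra.
have wh : g * - dotv w h <= g * (enorm w * enorm h).
  by rewrite ler_pM2l// -dotvNl; apply: le_trans (dotv_le _ _) _; rewrite enormN.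
have D0 : 0 <= D by apply: le_trans xyD; exact: enorm_ge0.
rewrite zE dotvNr dotvDl.
case: ltP => hK; last first.
  have ph : g * - dotv p h <= g * (K * enorm h).
    rewrite ler_pM2l// -dotvNl; apply: le_trans (dotv_le _ _) _; rewrite enormN.
    by rewrite ler_wpM2r ?enorm_ge0.
  by have := sqn_ge0 h; lra.
have hz : dotv h z <= enorm h * D.
  by apply: le_trans (dotv_le _ _) _; rewrite ler_wpM2l ?enorm_ge0.
have wz : g * dotv w z <= g * (enorm w * D).
  by rewrite ler_pM2l//; apply: le_trans (dotv_le _ _) _; rewrite ler_wpM2l ?enorm_ge0.
have pz : g * dotv p z <= g * (enorm p * D).
  by rewrite ler_pM2l//; apply: le_trans (dotv_le _ _) _; rewrite ler_wpM2l ?enorm_ge0.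
have hD : enorm h * D <= (g * enorm w + 2 * (dx + g) + g * a) * D by rewrite ler_wpM2r.
have gd : g * (dx / g) = dx by rewrite mulrC mulfVK.
have gdD : g * (D * (2 * (dx / g))) = 2 * dx * D by rewrite -{2}gd; ring.
have p1 : 0 <= g * (K * enorm h) by rewrite !mulr_ge0 ?enorm_ge0// ltW.
have p2 : 0 <= g * (enorm w * enorm h) by rewrite !mulr_ge0 ?enorm_ge0// ltW.
move: hz wz pz hD gdD p1 p2 m2.
move: (dotv h z) (dotv w z) (dotv p z) (dotv q z) => t1 t2 t3 t4.
move: (dx / g) => rr *.
lra.
Qed.

(** * Deterministic estimates along one path *)

Section PathwiseEstimates.
Variables (R : realType) (N : nat) (d : measure_display) (Xi : measurableType d).
Variable mu : probability Xi R.
Local Notation V := 'rV[R]_N.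
Local Notation bV := (borelV R N).
Variables (A B : Xi -> operator R N) (b : Xi -> V -> V) (W : Xi -> R).
Local Notation calD := (essential_dom mu A).
Local Notation dD := (dist_to calD).
Local Notation fb := (forward_backward A b).
Hypothesis A_random : random_operator A.
Hypothesis B_monotone : forall xi, monotone_op (B xi).
Hypothesis b_measurable : measurable_fun [set: Xi * bV] (fun q : Xi * bV => b q.1 q.2 : bV).
Hypothesis b_sel : forall x, {ae mu, forall xi, B xi x (b xi x)}.
Hypothesis W_int : rintegrable mu W.
Hypothesis b_W : forall xi x, sqn (b xi x) <= W xi * (1 + enorm x) ^+ 2.
Hypothesis D0 : calD !=set0.

Variables (g : nat -> R) (x : nat -> V) (c r C : R) (q : nat).
Hypothesis g0 : forall n, 0 < g n.
Hypothesis g2 : bounded_sums (fun n => g n ^+ 2).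
Hypothesis g_ratio : forall t, 1 < t -> exists n0, forall k, (n0 <= k)%N -> g k <= t * g k.+1.
Hypothesis x_bounded : forall n, enorm (x n) <= c.
Hypothesis moves_int : forall n x, rintegrable mu (fun xi => sqn (x - fb (g n) x xi)).
Hypothesis moves_sum : bounded_sums (fun k => \int[mu]_xi sqn (x k - fb (g k) (x k) xi)).
Hypothesis increments : forall e, 0 < e -> exists n0, forall n m, (n0 <= n)%N -> (n <= m)%N ->
    enorm (x m - x n -
      \sum_(n <= k < m) vintegral mu (fun xi => fb (g k) (x k) xi - x k)) <= e.
Hypotheses (r0 : 0 <= r) (r1 : r < 1) (C0 : 0 <= C).
Hypothesis dist4_sum : bounded_sums (fun k => dD (x k) ^+ 4 / g k ^+ 2).
Hypothesis dist2_sum : forall e, 0 < e -> exists n0, forall n m, (n0 <= n)%N -> (n <= m)%N ->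
  \sum_(n <= k < m) dD (x k.+1) ^+ 2 / g k <=
  r * (\sum_(n <= k < m) dD (x k) ^+ 2 / g k) +
    C * (\sum_(n <= k < m) g k * (1 + enorm (x k) ^+ q)) + e.

Let S n m := \sum_(n <= k < m) g k.
Let S0 n m : 0 <= S n m. Proof. by apply: sumr_ge0 => k _; exact: ltW. Qed.
Let c0 : 0 <= c. Proof. exact: le_trans (enorm_ge0 _) (x_bounded 0). Qed.
Let d0 y : 0 <= dD y. Proof. exact: dist_to_ge0. Qed.

Let ratio_small e : 0 < e -> exists n0, forall k, (n0 <= k)%N -> dD (x k) ^+ 2 / g k <= e.
Proof.
move=> e0; have e20 : 0 < e ^+ 2 by rewrite exprn_gt0.
have p4 k : 0 <= dD (x k) ^+ 4 / g k ^+ 2.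
  by rewrite divr_ge0 ?sqr_ge0// exprn_ge0.
have [n0 hn0] := bounded_sums_small p4 dist4_sum e20; exists n0 => k /hn0.
have -> : dD (x k) ^+ 4 / g k ^+ 2 = (dD (x k) ^+ 2 / g k) ^+ 2.
  by rewrite expr_div_n -exprM.
by rewrite ler_pXn2r ?nnegrE ?(ltW e0)// divr_ge0 ?sqr_ge0// ltW.
Qed.

Let g_small e : 0 < e -> exists n0, forall k, (n0 <= k)%N -> g k <= e.
Proof.
move=> e0; have e20 : 0 < e ^+ 2 by rewrite exprn_gt0.
have [n0 hn0] := bounded_sums_small (fun k => sqr_ge0 (g k)) g2 e20; exists n0 => k /hn0.
by rewrite ler_pXn2r ?nnegrE ?(ltW e0) ?(ltW (g0 k)).
Qed.

Lemma iterates_dist e : 0 < e -> exists n0, forall k, (n0 <= k)%N -> dD (x k) <= e.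
Proof.
move=> e0; have e20 : 0 < e ^+ 2 by rewrite exprn_gt0.
have [n1 h1] := ratio_small e20; have [n2 h2] := g_small ltr01.
exists (maxn n1 n2) => k; rewrite geq_max => /andP[/h1 k1 /h2 k2].
rewrite -(ler_pXn2r (n := 2))// ?nnegrE ?(ltW e0)//.
rewrite ler_pdivrMr// in k1; apply: le_trans k1 _.
by rewrite ler_piMr// ltW.
Qed.

(** The hypothesis bounds the shifted sum by [r] times the sum itself. Undoing the shift costs the
    ratio of consecutive steps, at most [1 + s], and the first term, which tends to 0; as
    [(1 + s) * r <= rr < 1], the sum is absorbed on the left. *)
Lemma dist_sum_bound : exists2 C1, 0 <= C1 & forall e, 0 < e ->
  exists n0, forall n m, (n0 <= n)%N -> (n <= m)%N ->
  \sum_(n <= k < m) dD (x k) ^+ 2 / g k <= C1 * S n m + e.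
Proof.
have [a0 a1] := (r0, r1).
pose rr : R := (1 + r) / 2; pose s : R := (1 - r) / 2.
have s0 : 0 < s by rewrite /s; lra.
have rr1 : 0 < 1 - rr by rewrite /rr; lra.
pose mc := 1 + c ^+ q; have mc0 : 0 <= mc by rewrite addr_ge0 ?exprn_ge0.
have s2 : 0 <= 1 + s by rewrite addr_ge0// ltW.
exists ((1 - rr)^-1 * ((1 + s) * (C * mc))).
  by rewrite mulr_ge0 ?invr_ge0 ?(ltW rr1)// !mulr_ge0.
move=> e e0.
(* Spent once on the first term and [1 + s] times on the error of [dist2_sum]. *)
pose e1 := (1 - rr) * e / (2 + s).
have s20 : 0 < 2 + s by rewrite addr_gt0.
have e10 : 0 < e1 by rewrite divr_gt0// mulr_gt0.
have [n1 h1] := g_ratio (t := 1 + s) ltac:(by rewrite ltrDl).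
have [n2 h2] := dist2_sum e10; have [n3 h3] := ratio_small e10.
exists (maxn n1 (maxn n2 n3)) => n m; rewrite !geq_max => /andP[k1 /andP[k2 k3]] nm.
pose a k := dD (x k) ^+ 2 / g k.
have a_ge0 k : 0 <= a k by rewrite divr_ge0 ?sqr_ge0// ltW.
pose Sa := \sum_(n <= k < m) a k.
have Sa0 : 0 <= Sa by apply: sumr_ge0.
have b1 : Sa <= a n + \sum_(n <= k < m) a k.+1.
  have : \sum_(n <= k < m) (a k.+1 - a k) = a m - a n by rewrite telescope_sumr.
  by rewrite sumrB -/Sa; have := a_ge0 m; lra.
have b2 : \sum_(n <= k < m) a k.+1 <= (1 + s) * (\sum_(n <= k < m) dD (x k.+1) ^+ 2 / g k).
  rewrite mulr_sumr big_nat_cond [leRHS]big_nat_cond; apply: ler_sum => k.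
  rewrite andbT => /andP[nk _]; have hk := h1 k (leq_trans k1 nk).
  rewrite /a ler_pdivrMr//.
  have -> : (1 + s) * (dD (x k.+1) ^+ 2 / g k) * g k.+1 =
    dD (x k.+1) ^+ 2 * ((1 + s) * g k.+1 / g k) by ring.
  by rewrite ler_peMr ?sqr_ge0// ler_pdivlMr// mul1r.
have b3 : \sum_(n <= k < m) g k * (1 + enorm (x k) ^+ q) <= mc * S n m.
  rewrite mulr_sumr; apply: ler_sum => k _; rewrite mulrC ler_wpM2r ?(ltW (g0 k))//.
  by rewrite lerD2l lerXn2r ?nnegrE ?enorm_ge0.
have b4 := h2 n m k2 nm; have b5 := h3 n k3; rewrite -/(a n) -/Sa in b4 b5.
have b6 : (1 + s) * r <= rr by rewrite /s /rr; nra.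
have b7 : (1 + s) * (\sum_(n <= k < m) dD (x k.+1) ^+ 2 / g k) <=
    (1 + s) * (r * Sa + C * (mc * S n m) + e1).
  have hC := ler_wpM2l C0 b3.
  by rewrite ler_wpM2l//; apply: le_trans b4 _; lra.
have b8 : (1 + s) * r * Sa <= rr * Sa by rewrite ler_wpM2r.
have e1E : (2 + s) * e1 = (1 - rr) * e by rewrite /e1 mulrC mulfVK// gt_eqF.
rewrite -/Sa -(ler_pM2l rr1).
have -> : (1 - rr) * ((1 - rr)^-1 * ((1 + s) * (C * mc)) * S n m + e) =
    (1 + s) * (C * (mc * S n m)) + (1 - rr) * e by field; exact: lt0r_neq0.
by move: b1 b2 b5 b7 b8 e1E; lra.
Qed.

Section NearProjection.
(** Substitutes for the projections of the iterates, which lie only in the closure of [calD], where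
    [A] may have no value; the slack [g k] has the order of the step. *)
Variables (pi : nat -> V) (eps CA : R).
Hypothesis eps0 : 0 < eps.
Hypothesis piD : forall k, calD (pi k).
Hypothesis pi_near : forall k, enorm (x k - pi k) <= dD (x k) + g k.
Let al0 k xi := enorm (least_norm_value (A xi) (pi k)).
Hypothesis al0_int : forall k, (\int[mu]_xi (al0 k xi `^ (1 + eps))%:E <= CA%:E)%E.

Let h k xi := fb (g k) (x k) xi - x k.
Let nb k xi := enorm (b xi (x k)).

Let W0 xi : 0 <= W xi.
Proof.
have := le_trans (sqn_ge0 _) (b_W xi 0).
by rewrite enorm0 addr0 expr1n mulr1.
Qed.

Let Wc := (1 + c) ^+ 2 * \int[mu]_xi W xi.
Let Wc0 : 0 <= Wc.
Proof. by rewrite mulr_ge0 ?sqr_ge0//; apply: Rintegral_ge0 => xi _; exact: W0. Qed.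

Let CA0 : 0 <= CA.
Proof.
rewrite -lee_fin; apply: le_trans (al0_int 0); apply: integral_ge0 => xi _.
by rewrite lee_fin powR_ge0.
Qed.

Let mal0 k : measurable_fun [set: Xi] (al0 k). Proof. exact: least_norm_measurable. Qed.

Let al0_powR k : rintegrable mu (fun xi => al0 k xi `^ (1 + eps)) /\
  \int[mu]_xi al0 k xi `^ (1 + eps) <= CA.
Proof.
have i : rintegrable mu (fun xi => al0 k xi `^ (1 + eps)).
  apply: rintegrable_ge0; [exact: (measurableT_comp (measurable_powR (1 + eps)) (mal0 k))|by move=> xi; exact: powR_ge0|].
  exact: le_lt_trans (al0_int k) (ltry _).
by split => //; rewrite -lee_fin -integral_rintegrable.
Qed.

Let mnb k : measurable_fun [set: Xi] (nb k).
Proof. by apply: measurable_enorm; exact: (b_section_measurable b_measurable). Qed.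

Let nb0 k xi : 0 <= nb k xi. Proof. exact: enorm_ge0. Qed.

Let nb2 k : rintegrable mu (fun xi => nb k xi ^+ 2) /\ \int[mu]_xi nb k xi ^+ 2 <= Wc.
Proof.
have iW : rintegrable mu (fun xi => (1 + c) ^+ 2 * W xi) by exact: rintegrableZ.
have le xi : nb k xi ^+ 2 <= (1 + c) ^+ 2 * W xi.
  rewrite enormK; apply: le_trans (b_W _ _) _; rewrite mulrC ler_wpM2r//.
  by rewrite ler_pXn2r ?nnegrE ?addr_ge0 ?enorm_ge0// lerD2l.
have i : rintegrable mu (fun xi => nb k xi ^+ 2).
  apply: (rintegrable_le _ iW); first exact: measurable_funX.
  by apply: aeW => xi; rewrite ger0_norm ?sqr_ge0.
by split => //; rewrite /Wc -RintegralZl//; apply: Rintegral_le_ae => //; exact: aeW.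
Qed.

Let h_vint k : vintegrable mu (h k).
Proof.
have mh : measurable_fun [set: Xi] (h k : Xi -> bV).
  apply: measurable_vB; last exact: measurable_cst.
  exact: (forward_backward_measurable A_random b_measurable).
apply: (vintegrable_le mh (rintegrableD (rintegrable_cst mu 1) (moves_int k (x k)))).
apply: aeW => xi; rewrite sqnB -/(h k xi) -enormK.
by have := sqr_ge0 (enorm (h k xi) - 1); have := enorm_ge0 (h k xi); nra.
Qed.

Let move_bound k : {ae mu, forall xi,
  enorm (h k xi) <= g k * nb k xi + 2 * (dD (x k) + g k) + g k * al0 k xi}.
Proof.
apply: filterS (essential_domP A_random (piD k)) => xi hxi.
have [Aa _] := least_norm_valueP (random_maximal A_random xi) hxi.
have := forward_backward_move (random_maximal A_random xi) (x k) (b xi (x k)) (g0 k) Aa.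
by move=> /le_trans; apply; rewrite lerD2r lerD2l ler_pM2l.
Qed.

(** Trades the excess move outside of the domain for the quantity whose sums are under control. *)
Let two_d k : 2 * dD (x k) <= g k + dD (x k) ^+ 2 / g k.
Proof.
rewrite -(ler_pM2l (g0 k)) mulrDr mulrCA [X in _ <= _ + X]mulrC mulfVK ?gt_eqF//.
by have := sqr_ge0 (dD (x k) - g k); lra.
Qed.

Lemma move_integral_sum : exists2 C2, 0 <= C2 & forall e, 0 < e ->
  exists n0, forall n m, (n0 <= n)%N -> (n <= m)%N ->
  \sum_(n <= k < m) \int[mu]_xi enorm (h k xi) <= C2 * S n m + e.
Proof.
have [c1 c10 hc1] := powR_young eps0 ltr01.
have [C1 C10 hC1] := dist_sum_bound.
pose K := (1 + Wc) + 3 + (CA + c1).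
have K0 : 0 <= K by rewrite /K !addr_ge0.
have le k : \int[mu]_xi enorm (h k xi) <= K * g k + dD (x k) ^+ 2 / g k.
  have [ia la] := al0_powR k; have [ib lb] := nb2 k.
  pose F xi := g k * (1 + nb k xi ^+ 2) + 2 * (dD (x k) + g k) +
    g k * (al0 k xi `^ (1 + eps) + c1).
  have i1 : rintegrable mu (fun xi => 1 + nb k xi ^+ 2).
    by apply: rintegrableD => //; exact: rintegrable_cst.
  have i2 : rintegrable mu (fun xi => al0 k xi `^ (1 + eps) + c1).
    by apply: rintegrableD => //; exact: rintegrable_cst.
  have i3 : rintegrable mu (fun xi => g k * (1 + nb k xi ^+ 2) + 2 * (dD (x k) + g k)).
    by apply: rintegrableD; [exact: rintegrableZ|exact: rintegrable_cst].
  have iF : rintegrable mu F by apply: rintegrableD => //; exact: rintegrableZ.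
  apply: (@le_trans _ _ (\int[mu]_xi F xi)).
    apply: Rintegral_le_ae => //; first by case: (h_vint k).
    apply: filterS (move_bound k) => xi /le_trans; apply; rewrite /F.
    have a1 : g k * nb k xi <= g k * (1 + nb k xi ^+ 2).
      rewrite ler_pM2l//; have := sqr_ge0 (nb k xi - 1); have := nb0 k xi; nra.
    have a2 : g k * al0 k xi <= g k * (al0 k xi `^ (1 + eps) + c1).
      by rewrite ler_pM2l//; have := hc1 _ (enorm_ge0 (least_norm_value (A xi) (pi k))); rewrite mul1r.
    by lra.
  rewrite /F RintegralD//; last exact: rintegrableZ.
  rewrite RintegralD//; [|exact: rintegrableZ|exact: rintegrable_cst].
  rewrite RintegralZl// [X in _ + X <= _]RintegralZl// Rintegral_cst1.
  rewrite RintegralD//; last exact: rintegrable_cst.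
  rewrite [X in _ + g k * X <= _]RintegralD//; last exact: rintegrable_cst.
  rewrite !Rintegral_cst1.
  have b1 : g k * (1 + \int[mu]_xi nb k xi ^+ 2) <= g k * (1 + Wc) by rewrite ler_pM2l// lerD2l.
  have b2 : g k * (\int[mu]_xi al0 k xi `^ (1 + eps) + c1) <= g k * (CA + c1).
    by rewrite ler_pM2l// lerD2r.
  by have := two_d k; rewrite /K; lra.
exists (K + C1) => [|e e0]; first exact: addr_ge0.
have [n0 hn0] := hC1 e e0; exists n0 => n m nn nm.
apply: (@le_trans _ _ (\sum_(n <= k < m) (K * g k + dD (x k) ^+ 2 / g k))).
  by apply: ler_sum => k _.
by rewrite big_split/= -mulr_sumr -/(S n m); have := hn0 n m nn nm; lra.
Qed.

(** The middle bound makes the path asymptotically Lipschitz in the time [tau]; the last one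
    replaces increments by mean moves. *)
Lemma increment_bound : exists2 C2, 0 <= C2 & forall e, 0 < e ->
  exists n0, forall n m, (n0 <= n)%N -> (n <= m)%N ->
  [/\ \sum_(n <= k < m) \int[mu]_xi enorm (h k xi) <= C2 * S n m + e,
      enorm (x m - x n) <= C2 * S n m + e &
      enorm (x m - x n - \sum_(n <= k < m) vintegral mu (h k)) <= e].
Proof.
have [C2 C20 hC2] := move_integral_sum; exists C2 => // e e0.
have e20 : 0 < e / 2 by rewrite divr_gt0.
have [n1 h1] := hC2 _ e20; have [n2 h2] := increments e20.
exists (maxn n1 n2) => n m; rewrite geq_max => /andP[k1 k2] nm.
have a1 := h1 n m k1 nm; have a2 := h2 n m k2 nm.
have s0 := S0 n m; split; [lra| |by apply: le_trans a2 _; lra].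
apply: le_trans (enorm_sub_ge _ (\sum_(n <= k < m) vintegral mu (h k))) _.
have : enorm (\sum_(n <= k < m) vintegral mu (h k)) <= \sum_(n <= k < m) \int[mu]_xi enorm (h k xi).
  by apply: le_trans (enorm_sum _ _ _) _; apply: ler_sum => k _; exact: enorm_vintegral.
by move: a1 a2; rewrite -/(h _); lra.
Qed.

(** * The differential inclusion in integrated form *)

Section Inclusion.
Variables (y : V) (al be : Xi -> V).
Hypotheses (al_int : vintegrable mu al) (be_int : vintegrable mu be).
Hypothesis alA : {ae mu, forall xi, A xi y (al xi)}.
Hypothesis beB : {ae mu, forall xi, B xi y (be xi)}.

Let v := vintegral mu al + vintegral mu be.
Let Dy := c + enorm y.
Let Dy0 : 0 <= Dy. Proof. by rewrite addr_ge0 ?enorm_ge0. Qed.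
Let xy_le k : enorm (x k - y) <= Dy.
Proof. by apply: le_trans (enormD _ _) _; rewrite enormN lerD2r. Qed.

Let tail K xi := if K < enorm (al xi) then enorm (al xi) else 0.

Let pointwise k K : 1 <= K -> {ae mu, forall xi, dotv (h k xi) (x k - y) <=
  g k * (dotv (al xi + be xi) (y - x k) + K * enorm (h k xi) + nb k xi * enorm (h k xi) +
    Dy * (if K < enorm (al xi)
          then enorm (al xi) + 2 * nb k xi + 2 + 2 * (dD (x k) / g k) + al0 k xi else 0))}.
Proof.
move=> K1; apply: filterS3 (filterI (move_bound k) alA) beB (b_sel (x k)) => xi [hm hal] hbe hb.
have gk := g0 k.
have inA := forward_backward_in (random_maximal A_random xi) (x k) (b xi (x k)) gk.
have mB := B_monotone hb hbe.
have mA := maximal_op_monotone (random_maximal A_random xi) inA hal.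
have xpE : fb (g k) (x k) xi = h k xi + x k by rewrite subrK.
apply: increment_dotv_le => //; [exact: le_trans K1|by rewrite -xpE].
Qed.

Let mal : measurable_fun [set: Xi] (fun xi => enorm (al xi)).
Proof. by apply: measurable_enorm; case: al_int. Qed.

Let tail_int K : rintegrable mu (tail K).
Proof.
have [_ ia] := al_int.
have mt : measurable_fun [set: Xi] (tail K).
  by apply: measurable_fun_ifT => //; exact: measurable_fun_ltr.
apply: (rintegrable_le mt ia); apply: aeW => xi.
by rewrite /tail; case: ifP; rewrite ?normr0 ?enorm_ge0// ger0_norm ?enorm_ge0.
Qed.

Let tail_ge0 K xi : 0 <= tail K xi.
Proof. by rewrite /tail; case: ifP => // _; exact: enorm_ge0. Qed.

Let mv k := \int[mu]_xi sqn (x k - fb (g k) (x k) xi).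

(** [s] weighs the products of a move with [K] or [|b|] in Young's inequality, [del] the moments of
    [|b|] and of [A_0]. Where [|al| > K >= 1] every remaining constant is at most itself times
    [|al|], so [Q] multiplies the tail integral. *)
Let step_integral k K s del cd : 1 <= K -> 0 < s -> 0 < del -> 0 <= cd ->
  (forall t, 0 <= t -> t <= del * t `^ (1 + eps) + cd) ->
  dotv (vintegral mu (h k)) (x k - y) <=
  g k * (dotv v (y - x k) + (K * s + s * Wc + (K + 1) / s * mv k) +
    Dy * (del * (Wc + CA) + (4 + del^-1 + cd + (dD (x k) / g k) ^+ 2) * \int[mu]_xi tail K xi)).
Proof.
move=> K1 s0 del0 cd0 hcd.
have [ia la] := al0_powR k; have [ib lb] := nb2 k.
have im := moves_int k (x k); have it := tail_int K.
pose Q := 4 + del^-1 + cd + (dD (x k) / g k) ^+ 2.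
have Q0 : 0 <= Q by rewrite /Q !addr_ge0 ?sqr_ge0// invr_ge0 ltW.
pose F1 xi := dotv (al xi + be xi) (y - x k).
pose F2 xi := s * nb k xi ^+ 2 + (K + 1) / s * sqn (x k - fb (g k) (x k) xi).
pose F3 xi := del * nb k xi ^+ 2 + del * al0 k xi `^ (1 + eps).
pose F xi := g k * (F1 xi + (K * s + F2 xi) + Dy * (F3 xi + Q * tail K xi)).
have i1 : rintegrable mu F1 by apply: dotv_integrable; exact: vintegrableD.
have i2 : rintegrable mu F2 by apply: rintegrableD; exact: rintegrableZ.
have i3 : rintegrable mu F3 by apply: rintegrableD; exact: rintegrableZ.
have i4 : rintegrable mu (fun xi => F3 xi + Q * tail K xi).
  by apply: rintegrableD => //; exact: rintegrableZ.
have i2' : rintegrable mu (fun xi => K * s + F2 xi).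
  by apply: rintegrableD => //; exact: rintegrable_cst.
have i5 : rintegrable mu (fun xi => F1 xi + (K * s + F2 xi)) by exact: rintegrableD.
have i6 : rintegrable mu (fun xi => F1 xi + (K * s + F2 xi) + Dy * (F3 xi + Q * tail K xi)).
  by apply: rintegrableD => //; exact: rintegrableZ.
rewrite dotv_vintegral//; apply: (@le_trans _ _ (\int[mu]_xi F xi)).
  apply: Rintegral_le_ae; [exact: dotv_integrable|exact: rintegrableZ|].
  apply: filterS (pointwise k K1) => xi /le_trans; apply.
  rewrite /F ler_pM2l//.
  have e1 : K * enorm (h k xi) + nb k xi * enorm (h k xi) <= K * s + F2 xi.
    rewrite /F2 sqnB -/(h k xi) -enormK.
    have yg t p : p * t <= s * p ^+ 2 + t ^+ 2 / s.
      rewrite -(ler_pM2l s0) mulrDr [X in _ <= _ + X]mulrC mulfVK ?gt_eqF//.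
      by have := sqr_ge0 (s * p - t); have := sqr_ge0 (s * p); have := sqr_ge0 t; rewrite !expr2; lra.
    have y1 := yg (enorm (h k xi)) (nb k xi).
    have y2 := yg (enorm (h k xi)) 1; rewrite mul1r expr1n mulr1 in y2.
    have y3 : K * enorm (h k xi) <= K * (s + enorm (h k xi) ^+ 2 / s).
      by rewrite ler_wpM2l// (le_trans ler01).
    have -> : (K + 1) / s * enorm (h k xi) ^+ 2 = K * (enorm (h k xi) ^+ 2 / s) + enorm (h k xi) ^+ 2 / s.
      by ring.
    by lra.
  rewrite -(addrA (dotv _ _)); apply: lerD; first by rewrite lerD2l.
  rewrite ler_wpM2l// /F3 /tail; case: ltP => hK; last first.
    by rewrite mulr0 addr0 addr_ge0// mulr_ge0 ?(ltW del0)// ?sqr_ge0 ?powR_ge0.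
  have a1 : 1 <= enorm (al xi) by rewrite ltW// (le_lt_trans K1).
  have a2 := hcd _ (enorm_ge0 (least_norm_value (A xi) (pi k))); rewrite -/(al0 k xi) in a2.
  have a3 : 2 * nb k xi <= del * nb k xi ^+ 2 + del^-1.
    rewrite -(ler_pM2l del0) mulrDr mulfV ?gt_eqF//.
    by have := sqr_ge0 (del * nb k xi - 1); lra.
  have a4 : 2 * (dD (x k) / g k) <= 1 + (dD (x k) / g k) ^+ 2.
    by have := sqr_ge0 (dD (x k) / g k - 1); lra.
  have a5 : (3 + del^-1 + cd + (dD (x k) / g k) ^+ 2) * 1 <=
      (3 + del^-1 + cd + (dD (x k) / g k) ^+ 2) * enorm (al xi).
    by rewrite ler_wpM2l// !addr_ge0 ?sqr_ge0// invr_ge0 ltW.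
  by move: a2 a3 a4 a5; rewrite /Q; lra.
have I2 : \int[mu]_xi F2 xi = s * (\int[mu]_xi nb k xi ^+ 2) + (K + 1) / s * mv k.
  by rewrite RintegralD//; [rewrite !RintegralZl//|exact: rintegrableZ|exact: rintegrableZ].
have I3 : \int[mu]_xi F3 xi = del * (\int[mu]_xi nb k xi ^+ 2) +
    del * (\int[mu]_xi al0 k xi `^ (1 + eps)).
  by rewrite RintegralD//; [rewrite !RintegralZl//|exact: rintegrableZ|exact: rintegrableZ].
have I2' : \int[mu]_xi (K * s + F2 xi) = K * s + \int[mu]_xi F2 xi.
  by rewrite RintegralD//; [rewrite Rintegral_cst1|exact: rintegrable_cst].
have I4 : \int[mu]_xi (F3 xi + Q * tail K xi) = \int[mu]_xi F3 xi + Q * \int[mu]_xi tail K xi.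
  by rewrite RintegralD//; [rewrite RintegralZl//|exact: rintegrableZ].
rewrite /F RintegralZl// ler_pM2l// RintegralD//; last exact: rintegrableZ.
rewrite RintegralD// I2' RintegralZl// I4 I2 I3.
have -> : \int[mu]_xi F1 xi = dotv v (y - x k).
  by rewrite /v -vintegralD// dotv_vintegral//; exact: vintegrableD.
apply: lerD.
  rewrite lerD2l -addrA lerD2l lerD2r.
  by rewrite ler_wpM2l// ltW.
rewrite ler_wpM2l// lerD2r mulrDr; apply: lerD; by rewrite ler_wpM2l// ltW.
Qed.

Lemma inclusion_sum e : 0 < e -> exists n0, forall n m, (n0 <= n)%N -> (n <= m)%N -> S n m <= 2 ->
  \sum_(n <= k < m) dotv (vintegral mu (h k)) (x k - y) <=
  \sum_(n <= k < m) g k * dotv v (y - x k) + e.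
Proof.
move=> e0; have [C1 C10 hC1] := dist_sum_bound.
(* Four errors [e1] per unit of time over a time at most 2, and one more for the tail against
   [d ^ 2 / g]: 9 in all. *)
pose e1 := e / 10; have e10 : 0 < e1 by rewrite divr_gt0.
have small K : 0 <= K -> exists2 s, 0 < s & K * s <= e1.
  move=> K0; have K10 : 0 < K + 1 by rewrite ltr_wpDl.
  exists (e1 / (K + 1)); first exact: divr_gt0.
  by rewrite mulrCA ler_piMr ?(ltW e10)// ler_pdivrMr// mul1r lerDl.
(* Order of the choices: [del], then the level [K] through [eta], then [s], which depends on [K],
   and last the index after which the mean squared moves [mv] are small compared with
   [s / (K + 1)]. *)
have [del del0 hdel] := small (Dy * (Wc + CA)) ltac:(by rewrite mulr_ge0// addr_ge0).
have [cd cd0 hcd] := powR_young eps0 del0.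
have q0 : 0 <= 4 + del^-1 + cd by rewrite !addr_ge0// invr_ge0 ltW.
have z0 : 0 <= 2 * C1 + 1 by rewrite addr_ge0// mulr_ge0.
have [eta eta0 heta] := small (Dy * (4 + del^-1 + cd) + Dy * (2 * C1 + 1))
  ltac:(by rewrite addr_ge0// mulr_ge0).
have [_ ia] := al_int.
have [K K1 hK] := integrable_tail ia (fun xi => enorm_ge0 (al xi)) eta0.
pose tK := \int[mu]_xi tail K xi.
have tK0 : 0 <= tK by apply: Rintegral_ge0 => xi _; exact: tail_ge0.
have K0 : 0 <= K by apply: le_trans K1.
have [s s0 hs] := small (K + Wc) ltac:(exact: addr_ge0).
have mv0 k : 0 <= mv k by apply: Rintegral_ge0 => xi _; exact: sqn_ge0.
have e20 : 0 < e1 / ((K + 1) / s) by rewrite divr_gt0// divr_gt0// ltr_wpDl.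
have [n1 hn1] := bounded_sums_small mv0 moves_sum e20.
have [n2 hn2] := hC1 1 ltr01.
exists (maxn n1 n2) => n m; rewrite geq_max => /andP[k1 k2] nm S2.
have step k : (n <= k)%N -> dotv (vintegral mu (h k)) (x k - y) <=
    g k * dotv v (y - x k) + 4 * e1 * g k + Dy * tK * (dD (x k) ^+ 2 / g k).
  move=> nk; apply: le_trans (step_integral k K1 s0 del0 cd0 hcd) _.
  have m1 : (K + 1) / s * mv k <= e1.
    by rewrite mulrC -ler_pdivlMr ?divr_gt0 ?ltr_wpDl//; apply: hn1; exact: leq_trans nk.
  have t1 : Dy * (4 + del^-1 + cd) * tK <= e1.
    apply: (@le_trans _ _ ((Dy * (4 + del^-1 + cd) + Dy * (2 * C1 + 1)) * eta)) => //.
    by apply: ler_pM => //; rewrite ?mulr_ge0// lerDl mulr_ge0.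
  rewrite [leRHS](_ : _ = g k * (dotv v (y - x k) + 4 * e1 + Dy * tK * (dD (x k) / g k) ^+ 2)); last first.
    by field; rewrite gt_eqF.
  rewrite ler_pM2l// -/tK; move: m1 t1 hdel hs.
  by move: (mv k) => M; lra.
apply: (@le_trans _ _ (\sum_(n <= k < m) (g k * dotv v (y - x k) + 4 * e1 * g k +
    Dy * tK * (dD (x k) ^+ 2 / g k)))).
  rewrite big_nat_cond [leRHS]big_nat_cond; apply: ler_sum => k; rewrite andbT => /andP[nk _].
  exact: step.
rewrite !big_split/= -!mulr_sumr -addrA lerD2l.
have u1 : 4 * e1 * S n m <= 8 * e1.
  by rewrite [leRHS](_ : _ = 4 * e1 * 2); [rewrite ler_pM2l// mulr_gt0|ring].
have u2 : Dy * tK * (\sum_(n <= k < m) dD (x k) ^+ 2 / g k) <= Dy * tK * (2 * C1 + 1).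
  rewrite ler_wpM2l ?mulr_ge0//; apply: le_trans (hn2 n m k2 nm) _.
  by rewrite lerD2r mulrC ler_wpM2r.
have u3 : Dy * tK * (2 * C1 + 1) <= e1.
  apply: (@le_trans _ _ ((Dy * (4 + del^-1 + cd) + Dy * (2 * C1 + 1)) * eta)) => //.
  rewrite mulrAC; apply: ler_pM => //; rewrite ?mulr_ge0// lerDr mulr_ge0//.
have : 10 * e1 = e by rewrite /e1 mulrC mulfVK.
by move: u1 u2 u3; rewrite -/(S n m); lra.
Qed.

(** The square is expanded at [x n] and the increment replaced by the sum of the mean moves.
    Exchanging [x n] and [x k] inside the sums costs the oscillation [L = C2 * S n m + e1]. *)
Lemma inclusion_bound : exists K : R, forall e, 0 < e ->
  exists n0, forall n m, (n0 <= n)%N -> (n <= m)%N -> S n m <= 2 ->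
  sqn (x m - y) - sqn (x n - y) <=
  2 * S n m * dotv v (y - x n) + K * S n m ^+ 2 + e.
Proof.
have [C2 C20 hC2] := increment_bound.
(* The first term comes from freezing [x k] at [x n] in [<v, y - x k>]; the second from [L ^ 2],
   once for the square of the increment and twice for the exchange in the doubled pairing. *)
exists (2 * enorm v * C2 + 3 * C2 ^+ 2) => e e0.
pose Q := 4 * enorm v + 3 * (4 * C2 + 1) + 2 + 2 * Dy.
have Q0 : 0 <= Q.
  by rewrite /Q; apply: addr_ge0; rewrite ?mulr_ge0// !addr_ge0// ?mulr_ge0 ?enorm_ge0// addr_ge0// mulr_ge0.
have Q10 : 0 < Q + 1 by rewrite ltr_wpDl.
pose e1 := Num.min 1 (e / (Q + 1)).
have e10 : 0 < e1 by rewrite lt_min ltr01 divr_gt0.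
have e11 : e1 <= 1 by rewrite ge_min lexx.
have Qe : Q * e1 <= e.
  apply: (@le_trans _ _ ((Q + 1) * e1)); first by rewrite ler_pM2r// lerDl.
  by rewrite mulrC -ler_pdivlMr// ge_min lexx orbT.
have [n1 h1] := hC2 _ e10; have [n2 h2] := inclusion_sum e10.
exists (maxn n1 n2) => n m; rewrite geq_max => /andP[k1 k2] nm S2.
have [a1 a2 a3] := h1 n m k1 nm; have a4 := h2 n m k2 nm S2.
have s0 := S0 n m.
pose L := C2 * S n m + e1.
have L0 : 0 <= L by rewrite addr_ge0 ?mulr_ge0// ltW.
have near k : (n <= k)%N -> (k < m)%N -> enorm (x k - x n) <= L.
  move=> nk km; have [_ + _] := h1 n k k1 nk; move=> /le_trans; apply.
  rewrite lerD2r ler_wpM2l// /S [leRHS](big_cat_nat nk (ltnW km))/= lerDl.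
  exact: S0.
have d1 : dotv (x m - x n) (x n - y) <=
    \sum_(n <= k < m) dotv (vintegral mu (h k)) (x n - y) + e1 * Dy.
  rewrite -dotv_suml -lerBlDl -dotvNl -dotvDl.
  apply: le_trans (dotv_le _ _) _; apply: ler_pM; rewrite ?enorm_ge0//; exact: xy_le.
have d2 : \sum_(n <= k < m) dotv (vintegral mu (h k)) (x n - y) <=
    \sum_(n <= k < m) dotv (vintegral mu (h k)) (x k - y) + L * L.
  apply: (@le_trans _ _ (\sum_(n <= k < m) (dotv (vintegral mu (h k)) (x k - y) +
     L * \int[mu]_xi enorm (h k xi)))).
    rewrite big_nat_cond [leRHS]big_nat_cond; apply: ler_sum => k; rewrite andbT => /andP[nk km].
    have -> : x n - y = (x k - y) + (x n - x k) by apply/rowP => i; rewrite !mxE; ring.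
    rewrite dotvDr lerD2l; apply: le_trans (dotv_le _ _) _; rewrite mulrC enormB.
    by apply: ler_pM; rewrite ?enorm_ge0 ?near//; exact: enorm_vintegral.
  by rewrite big_split/= -mulr_sumr lerD2l ler_wpM2l.
have d3 : \sum_(n <= k < m) g k * dotv v (y - x k) <= S n m * (dotv v (y - x n) + enorm v * L).
  rewrite mulr_suml big_nat_cond [leRHS]big_nat_cond; apply: ler_sum => k; rewrite andbT => /andP[nk km].
  rewrite ler_pM2l//; have -> : y - x k = (y - x n) - (x k - x n) by apply/rowP => i; rewrite !mxE; ring.
  rewrite dotvDr lerD2l; apply: le_trans (dotv_le _ _) _; rewrite enormN.
  by rewrite ler_wpM2l ?enorm_ge0// near.
have E : sqn (x m - y) - sqn (x n - y) = 2 * dotv (x m - x n) (x n - y) + sqn (x m - x n).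
  have -> : x m - y = (x m - x n) + (x n - y) by rewrite addrA subrK.
  by move: (x m - x n) (x n - y) => p z; rewrite /sqn !dotE (dotvC z p); lra.
have d4 : sqn (x m - x n) <= L ^+ 2 by rewrite sqn_le.
have vS : enorm v * e1 * S n m <= enorm v * e1 * 2.
  by rewrite ler_wpM2l// mulr_ge0 ?enorm_ge0// ltW.
have LL : L ^+ 2 <= C2 ^+ 2 * S n m ^+ 2 + (4 * C2 + 1) * e1.
  have b1 : C2 * e1 * S n m <= C2 * e1 * 2 by rewrite ler_wpM2l// mulr_ge0// ltW.
  have b2 : e1 * e1 <= e1 * 1 by rewrite ler_pM2l.
  have -> : L ^+ 2 = C2 ^+ 2 * S n m ^+ 2 + 2 * (C2 * e1 * S n m) + e1 * e1 by rewrite /L; ring.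
  by lra.
have LE : S n m * (enorm v * L) = enorm v * C2 * S n m ^+ 2 + enorm v * e1 * S n m by rewrite /L; ring.
move: Qe; rewrite /Q E; move: d1 d2 d3 d4 a4 vS LL LE; rewrite -[L * L]/(L ^+ 2).
move: (L ^+ 2) (\sum_(n <= k < m) dotv (vintegral mu (h k)) (x n - y)).
move: (\sum_(n <= k < m) dotv (vintegral mu (h k)) (x k - y)) => *.
by lra.
Qed.

End Inclusion.

End NearProjection.

End PathwiseEstimates.

(** * Conclusion *)

Section StepSizes.
Variables (R : realType) (gam : nat -> R).
Hypothesis gam_gt0 : forall n, (0 < n)%N -> 0 < gam n.

Lemma cvg_series_bounded (a : nat -> R) : (forall k, 0 <= a k) -> cvgn (series a) ->
  bounded_sums a.
Proof.
move=> a0 ca; exists (limn (series a)) => n.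
apply: (@nondecreasing_cvgn_le _ (series a)) => //.
apply/nondecreasing_seqP => k.
by rewrite /series/= big_nat_recr//= lerDl.
Qed.

Lemma bounded_sums_cvg (a : nat -> R) : (forall k, 0 <= a k) -> bounded_sums a ->
  cvgn (series a).
Proof.
move=> a0 [c hc]; apply: nondecreasing_is_cvgn.
  by apply/nondecreasing_seqP => k; rewrite /series/= big_nat_recr//= lerDl.
by exists c => _ [n _ <-]; exact: hc.
Qed.

Lemma tau_sub n m : (n <= m)%N -> tau gam m - tau gam n = \sum_(n <= k < m) gam k.+1.
Proof.
move=> nm; rewrite /tau !big_add1/= (big_cat_nat (leq0n n) nm)/=.
by rewrite addrAC subrr add0r.
Qed.

Lemma tau_unbounded : ~ cvgn (series (fun n => gam n.+1)) -> forall M, exists n, M < tau gam n.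
Proof.
move=> ncv M; apply/not_existsP => h; apply: ncv; apply: bounded_sums_cvg.
  by move=> k; apply: ltW; exact: gam_gt0.
exists M => n; rewrite leNgt; apply/negP => lt; apply: (h n).
by move: lt; rewrite /tau big_add1.
Qed.

Lemma steps_ratio : gam n.+1 / gam n @[n --> \oo] --> (1 : R) ->
  forall t, 1 < t -> exists n0, forall k, (n0 <= k)%N -> gam k.+1 <= t * gam k.+2.
Proof.
move=> cv t t1; have t0 : 0 < t by apply: lt_trans t1.
have ti : t^-1 < 1 by rewrite invf_lt1.
have [n0 _ hn0] := cvgr_gt 1 cv _ ti.
exists n0 => k nk; have /ltW := hn0 k.+1 (leqW nk).
by rewrite ler_pdivlMr ?gam_gt0// ler_pdivrMl ?gam_gt0.
Qed.

End StepSizes.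

Section Moments.
Variables (R : realType) (N : nat) (d : measure_display) (X : measurableType d).
Variable mu : probability X R.
Local Notation V := 'rV[R]_N.

Lemma sqr_le_expr (t : R) p : 0 <= t -> (0 < p)%N -> t ^+ 2 <= 1 + t ^+ (2 * p).
Proof.
move=> t0 p0; have [t1|t1] := leP t 1.
  by apply: (@le_trans _ _ 1); [rewrite expr_le1|rewrite lerDl exprn_ge0].
apply: (@le_trans _ _ (t ^+ (2 * p))); last by rewrite lerDr.
by apply: ler_weXn2l; [exact: ltW|rewrite leq_pmulr].
Qed.

Lemma selections_sqn (F : X -> set V) phi p : (0 < p)%N ->
  selections mu (2 * p)%:R F phi -> rintegrable mu (fun x => sqn (phi x)).
Proof.
move=> p0 [mphi fin _].
have ip : rintegrable mu (fun x => enorm (phi x) ^+ (2 * p)).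
  apply: rintegrable_ge0.
  - by apply: measurable_funX; exact: measurable_enorm.
  - by move=> x; rewrite exprn_ge0 ?enorm_ge0.
  - rewrite (eq_integral (fun x => (enorm (phi x) `^ (2 * p)%:R)%:E))// => x _.
    by rewrite powR_mulrn ?enorm_ge0.
apply: (rintegrable_le (measurable_sqn mphi) (rintegrableD (rintegrable_cst mu 1) ip)).
by apply: aeW => x; rewrite ger0_norm ?sqn_ge0// -enormK sqr_le_expr ?enorm_ge0.
Qed.

End Moments.

(** A compact set containing the Euclidean ball of radius [rad], to which the local moment
    hypothesis on [A_0] is applied. *)
Lemma cube_compact (R : realType) (N : nat) (rad : R) :
  compact [set v : 'rV[R]_N | forall i, `|v 0 i| <= rad].
Proof.
have -> : [set v : 'rV[R]_N | forall i, `|v 0 i| <= rad] =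
    [set v : 'rV[R]_N | forall i : 'I_N, `[(- rad), rad]%classic (v ord0 i)].
  by apply/seteqP; split => v /= h i; have := h i; rewrite in_itv/= ler_norml.
have c (i : 'I_N) : compact (`[(- rad), rad]%classic : set R) by exact: segment_compact.
exact: (rV_compact c).
Qed.

Theorem theorem3p1 (R : realType) (N : nat)
    (d : measure_display) (Xi : measurableType d) (mu : probability Xi R)
    (mu_complete : measure_is_complete mu)
    (A : Xi -> operator R N)
    (A_random : random_operator A)
    (domA_neq0 : essential_dom mu A !=set0)
    (A_integrable : forall x, essential_dom mu A x ->
       sv_integrable mu (fun xi => A xi x))
    (B : Xi -> operator R N)
    (B_random : random_operator B)
    (B_dom : {ae mu, forall xi, dom (B xi) = setT})
    (B_integrable : forall x, sv_integrable mu (fun xi => B xi x))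
    (b : Xi -> 'rV[R]_N -> 'rV[R]_N)
    (b_measurable : measurable_fun [set: Xi * borelV R N]
       (fun q : Xi * borelV R N => b q.1 q.2 : borelV R N))
    (b_selection : forall x, selections mu 1 (fun xi => B xi x) (b^~ x))
    (d' : measure_display) (Omega : measurableType d')
    (P : probability Omega R)
    (u : nat -> Omega -> Xi)
    (u_iid : iid_seq mu P (fun n => u n.+1))
    (gam : nat -> R)
    (gam_gt0 : forall n, (0 < n)%N -> 0 < gam n)
    (gam_l2 : cvgn (series (fun n => gam n.+1 ^+ 2)))
    (gam_notl1 : ~ cvgn (series (fun n => gam n.+1)))
    (x0 : 'rV[R]_N) :
  let calD := essential_dom mu A in
  let calA := mean_op_on mu A calD in
  let calB := mean_op_on mu B setT in
  let A0 := fun xi x => least_norm_value (A xi) x in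
  let J := fun g xi x => resolvent g (A xi) x in
  let proj := fun xi x => proj_on (closure (dom (A xi))) x in
  let xt := fun w =>
    interpolation gam (iterates A b gam (fun n => u n w) x0) in
  forall (p : nat), (0 < p)%N ->
  maximal_monotone calA ->
  (exists2 xstar, zeros (op_add calA calB) xstar &
     representations mu A B (2 * p)%:R xstar !=set0) ->
  (forall K : set 'rV[R]_N, compact K -> exists eps : R,
     [/\ 0 < eps <= 1,
         (ereal_sup
           [set \int[mu]_xi (enorm (A0 xi x) `^ (1 + eps))%:E
           | x in K `&` calD] < +oo)%E &
         exists2 y0, calD y0 &
           (\int[mu]_xi (enorm (A0 xi y0) `^ (1 + eps^-1))%:E < +oo)%E]) ->
  (exists2 C : R, 0 < C & forall x,
     ((C * dist_to calD x ^+ 2)%:E <=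
      \int[mu]_xi (dist_to (dom (A xi)) x ^+ 2)%:E)%E) ->
  (gam n.+1 / gam n @[n --> \oo] --> (1 : R)) ->
  (exists2 C : R, 0 < C & forall x (g : R), 0 < g ->
     ((g ^- 4)%:E * \int[mu]_xi (enorm (J g xi x - proj xi x) ^+ 4)%:E <=
      (C * (1 + enorm x ^+ (2 * p)))%:E)%E) ->
  (exists M : Xi -> R,
     [/\ forall xi, 0 <= M xi,
         mu.-integrable [set: Xi] (EFin \o (fun xi => M xi ^+ (2 * p))) &
         forall xi x, enorm (b xi x) <= M xi * (1 + enorm x)]) ->
  (exists2 C : R, 0 < C & forall x,
     (\int[mu]_xi (enorm (b xi x) ^+ 4)%:E <=
      (C * (1 + enorm x ^+ (2 * p)))%:E)%E) ->
  maximal_monotone (op_add calA calB) /\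
  {ae P, forall w,
     bounded_process (xt w) /\
     asymptotic_pseudotrajectory (semiflow (op_add calA calB)) calD (xt w)}.
Proof.
move=> calD calA calB A0 J proj xt p p0 maxA [xs _ [[phi psi] [/= sphi spsi sum0]]].
move=> item3 [Cd Cd0 item4] ratio [Cj Cj0 item5] [M [M0 Mint bM]] [Cb Cb0 item6].
pose W xi := 1 + M xi ^+ (2 * p).
have W_int : rintegrable mu W by apply: rintegrableD => //; exact: rintegrable_cst.
have b_W xi x : sqn (b xi x) <= W xi * (1 + enorm x) ^+ 2.
  have e1 : 0 <= 1 + enorm x by rewrite addr_ge0 ?enorm_ge0.
  apply: (@le_trans _ _ ((M xi * (1 + enorm x)) ^+ 2)).
    by rewrite -enormK ler_pXn2r ?nnegrE ?enorm_ge0 ?mulr_ge0.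
  by rewrite exprMn ler_wpM2r ?sqr_ge0// sqr_le_expr.
have maxAB : maximal_monotone (op_add calA calB).
  exact: (mean_sum_maximal B_random b_selection W_int b_W maxA).
split => //.
have maxB xi : maximal_monotone (B xi) by exact: random_maximal.
have B_monotone xi : monotone_op (B xi) by exact: maximal_op_monotone.
have b_sel x : {ae mu, forall xi, B xi x (b xi x)} by case: (b_selection x).
have domA : dom calA = calD.
  apply/seteqP; split => [x [y [Dx _]] //|x Dx].
  by have [f sf] := A_integrable x Dx; exists (vintegral mu f); split => //; exists f.
have domAB : dom (op_add calA calB) = calD.
  rewrite -domA; apply/seteqP; split => x; first by move=> [_ [y Ay _]]; exists y.
  move=> [y Ay]; exists (y + vintegral mu (b^~ x)); exists y => //.
  by exists (vintegral mu (b^~ x)) => //; split => //; exists (b^~ x).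
have Dconv : convex_set (closure calD) by rewrite -domA; exact: closure_dom_convex.
have [r [C [r0 r1 C0 fbd]]] := forward_backward_dist A_random b_measurable domA_neq0 Dconv
  Cd0 Cj0 Cb0 item4 item5 item6.
(* The step from [n] to [n.+1] uses [gam n.+1] and [u n.+1]; the shifted sequences [g] and [v] match
   the indexing of the estimates above. *)
pose g n := gam n.+1.
have g0 n : 0 < g n by exact: gam_gt0.
have g2 : bounded_sums (fun n => g n ^+ 2).
  by apply: cvg_series_bounded => // k; exact: sqr_ge0.
have g_ratio := steps_ratio gam_gt0 ratio.
pose v n := u n.+1.
pose X n w := iterates A b gam (fun n => u n w) x0 n.
have X0 w : X 0%N w = x0 by [].
have XS n w : X n.+1 w = forward_backward A b (g n) (X n w) (v n w) by [].
have [phi_m _ phiA] := sphi; have [psi_m _ psiB] := spsi.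
have phi2 := selections_sqn p0 sphi; have psi2 := selections_sqn p0 spsi.
have bounded := iterates_bounded A_random B_monotone b_measurable b_sel u_iid g0 g2 X0 XS
  W_int b_W phi_m psi_m phi2 psi2 phiA psiB sum0.
have [_ moves] := summable_moves A_random B_monotone b_measurable b_sel u_iid g0 g2 X0 XS
  W_int b_W phi_m psi_m phi2 psi2 phiA psiB sum0.
have moves_int := moves_integrable A_random B_monotone b_measurable b_sel g0
  W_int b_W phi_m psi_m phi2 psi2 phiA psiB sum0.
have incr := increments_cauchy A_random b_measurable u_iid g0 X0 XS moves_int moves.
have fb2 k x := (fbd (g k) x (g0 k)).1; have fb4 k x := (fbd (g k) x (g0 k)).2.
have d4 := summable_dist4 A_random b_measurable u_iid g0 g2 X0 XS domA_neq0 r0 r1 C0 fb4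
  g_ratio bounded.
have d2 := dist2_cauchy A_random b_measurable u_iid g0 g2 X0 XS domA_neq0 r0 r1 C0 fb2 fb4
  g_ratio bounded.
have A0_int (rad : R) : exists eps CA : R, 0 < eps /\ forall y, calD y -> enorm y <= rad ->
    (\int[mu]_xi (enorm (least_norm_value (A xi) y) `^ (1 + eps))%:E <= CA%:E)%E.
  have [eps [/andP[eps0 _] + _]] := item3 _ (@cube_compact R N rad).
  set sp := ereal_sup _ => spoo; exists eps, (fine sp); split => // y Dy ye.
  have le : (\int[mu]_xi (enorm (least_norm_value (A xi) y) `^ (1 + eps))%:E <= sp)%E.
    apply: ereal_sup_ubound; exists y => //; split => // i.
    exact: le_trans (enorm_coord y i) ye.
  rewrite fineK// fin_numElt spoo andbT; apply: lt_le_trans le.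
  apply: (@lt_le_trans _ _ 0%E) => //; apply: integral_ge0 => xi _.
  by rewrite lee_fin powR_ge0.
have [G hG] := g2.
have gG k : g k <= 1 + G.
  have : g k ^+ 2 <= G.
    by apply: le_trans (hG k.+1); rewrite big_nat_recr//= lerDr sumr_ge0// => j _; exact: sqr_ge0.
  by have := sqr_ge0 (g k - 1); have := g0 k; nra.
have tauE n m (nm : (n <= m)%N) : tau gam m - tau gam n = \sum_(n <= k < m) g k.
  exact: tau_sub.
have tau_u := tau_unbounded gam_gt0 gam_notl1.
have g_small e : 0 < e -> exists n0, forall n, (n0 <= n)%N -> gam n.+1 <= e.
  move=> e0; have e20 : 0 < e ^+ 2 by rewrite exprn_gt0.
  have [n0 hn0] := bounded_sums_small (fun k => sqr_ge0 (g k)) g2 e20; exists n0 => k /hn0.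
  by rewrite ler_pXn2r ?nnegrE ?(ltW e0) ?(ltW (g0 k)).
have [y0 Dy0] := domA_neq0.
apply: filterS3 (filterI bounded moves) (filterI incr d4) d2 => w [[c hc] mw] [iw d4w] d2w.
pose x n := X n w.
have xw : xt w = interpolation gam x by [].
(* The choice is made for the fixed path, hence without any measurability in [w]. *)
have /choice[pi hpi] k : exists y, calD y /\ enorm (x k - y) <= dist_to calD (x k) + g k.
  by have [y Dy le] := dist_to_near (x k) domA_neq0 (g0 k); exists y.
have piD k : calD (pi k) by case: (hpi k).
have pi_near k : enorm (x k - pi k) <= dist_to calD (x k) + g k by case: (hpi k).
(* [|pi k| <= |x k| + d (x k) + g k], where [d (x k) <= c + |y0|] and [g k <= 1 + G]. *)
pose rad := c + (c + enorm y0) + (1 + G) + c.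
have pi_rad k : enorm (pi k) <= rad.
  have l1 := enorm_sub_ge (pi k) (x k); rewrite enormB in l1.
  have l2 := dist_to_le (x k) Dy0; have l3 := enormD (x k) (- y0); rewrite enormN in l3.
  have l4 := hc k; have l5 := gG k; have l6 := pi_near k; have l7 : 0 <= c by apply: le_trans l4; exact: enorm_ge0.
  rewrite /rad; rewrite -/(x k) in l4; lra.
(* The exponent depends on the bound of the path; this is why the estimates involving [A_0] are made
   along a fixed path. *)
have [eps [CA [eps0 hCA]]] := A0_int rad.
have al0_int k := hCA (pi k) (piD k) (pi_rad k).
have [C2 C20 incl] := increment_bound A_random b_measurable W_int b_W domA_neq0 g0 g_ratio hc
  moves_int iw r0 r1 C0 d4w d2w eps0 piD pi_near al0_int.
have x_dist e : 0 < e -> exists n0, forall k, (n0 <= k)%N -> dist_to calD (x k) <= e.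
  exact: (iterates_dist domA_neq0 g0 g2 d4w).
have xb : exists c, forall n, enorm (x n) <= c by exists c.
rewrite xw; split; first exact: interpolation_bounded.
rewrite -domAB.
apply: (@interpolation_pseudotrajectory _ _ _ _ gam_gt0 tau_u g_small _ maxAB C2) => //.
- by rewrite domAB.
- move=> e /incl [n0 hn0]; exists n0 => n m nn nm.
  by rewrite tauE//; case: (hn0 n m nn nm).
move=> y _ [_ [_ [al sal <-]] [_ [_ [be sbe <-]] <-]].
have [K hK] := inclusion_bound A_random B_monotone b_measurable b_sel W_int b_W domA_neq0 g0
  g_ratio hc moves_int mw iw r0 r1 C0 d4w d2w eps0 piD pi_near al0_int
  (selections1_integrable sal) (selections1_integrable sbe) (let: And3 _ _ h := sal in h)
  (let: And3 _ _ h := sbe in h).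
exists K => e /hK [n0 hn0]; exists n0 => n m nn nm; rewrite tauE// => S2.
exact: hn0.
Qed.
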